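(* Let $A$ be a real $d\times d$ matrix, $s\ge\frac12$, and let $a\in\Gamma_s^\infty(\mathbf R^{2d})$. Then $\operatorname{Op}_A(a)$ is continuous on $\mathcal S_s(\mathbf R^d)$ and on $\mathcal S_s'(\mathbf R^d)$.
   Context: $f\lesssim g$ means $f\le Cg$ with a constant $C>0$ independent of the variables and of the multi-indices involved. **Gelfand-Shilov spaces.** For $s,h>0$ let $\|f\|_{s,h}=\sup_{\alpha,\beta\in\mathbf N^n}\sup_x|x^\beta\partial^\alpha f(x)|/(h^{|\alpha+\beta|}(\alpha!\beta!)^s)$. $\mathcal S_s(\mathbf R^n)$ consists of all $f\in C^\infty(\mathbf R^n)$ with $\|f\|_{s,h}<\infty$ for some $h>0$, with the inductive limit topology over $h>0$; $\mathcal S_s'$ is its dual. For $s\ge\frac12$: $\mathcal S_{1/2}\subseteq\mathcal S_s\subseteq\mathcal S_s'\subseteq\mathcal S_{1/2}'$. **Symbol class.** $\Gamma_s^\infty(\mathbf R^{2d})$ consists of all $a\in C^\infty(\mathbf R^{2d})$ for which there is $\varepsilon>0$ such that for every $h>0$: $|\partial^\alpha a(X)|\lesssim\varepsilon^{|\alpha|}(\alpha!)^se^{h|X|^{1/s}}$ for all $\alpha\in\mathbf N^{2d}$, $X\in\mathbf R^{2d}$. (It is contained in $\mathcal S_{1/2}'(\mathbf R^{2d})$.) **Pseudo-differential operators.** For $a\in\mathcal S_{1/2}(\mathbf R^{2d})$, $$(\operatorname{Op}_A(a)f)(x)=(2\pi)^{-d}\iint a(x-A(x-y),\xi)f(y)e^{i\langle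 x-y,\xi\rangle}\,dy\,d\xi,\quad f\in\mathcal S_{1/2}(\mathbf R^d).$$ For $a\in\mathcal S_{1/2}'(\mathbf R^{2d})$, $\operatorname{Op}_A(a)$ is the continuous operator from $\mathcal S_{1/2}(\mathbf R^d)$ to $\mathcal S_{1/2}'(\mathbf R^d)$ with distribution kernel $K_{A,a}(x,y)=(2\pi)^{-d/2}(\mathscr F_2^{-1}a)(x-A(x-y),x-y)$, where $\mathscr F_2$ is the partial Fourier transform in the second $\mathbf R^d$-variable and $\mathscr Ff(\xi)=(2\pi)^{-d/2}\int f(x)e^{-i\langle x,\xi\rangle}dx$. ''Continuous on $\mathcal X$'' means that $\operatorname{Op}_A(a)$, initially defined from $\mathcal S_{1/2}(\mathbf R^d)$ to $\mathcal S_{1/2}'(\mathbf R^d)$, extends uniquely to a continuous map from $\mathcal X$ to $\mathcal X$. *)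

(* Defs.v *)
From HB Require Import structures.
From mathcomp Require Import all_boot all_order all_algebra.
From mathcomp Require Import all_classical all_reals all_analysis.
From mathcomp Require Import complex.

Set Implicit Arguments.
Unset Strict Implicit.
Unset Printing Implicit Defensive.

Import Order.TTheory GRing.Theory Num.Theory.
Import numFieldNormedType.Exports.

Local Open Scope classical_set_scope.
Local Open Scope ring_scope.
Local Open Scope complex_scope.

(* Points of R^n are row vectors, and (x, xi) in R^d x R^d is row_mx x xi.
   gs n s is S_s(R^n), with the locally convex inductive limit topology, and
   gs_dual n s is S_s'(R^n), with the strong dual topology. *)

Section Calculus.
Context {R : realType}.

Definition cabs (z : R[i]) : R := ComplexField.Normc.normc z.

Definition cis (t : R) : R[i] := cos t +i* sin t.

Definition dotp n (x y : 'rV[R]_n) : R := \sum_i x 0 i * y 0 i.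

(* the norm of the library on 'rV[R]_n is the max norm *)
Definition enorm n (x : 'rV[R]_n) : R := Num.sqrt (dotp x x).

Definition partial n (i : 'I_n) (f : 'rV[R]_n -> R[i]) : 'rV[R]_n -> R[i] :=
  fun x => 'D_(delta_mx 0 i) (fun y => complex.Re (f y)) x
        +i* 'D_(delta_mx 0 i) (fun y => complex.Im (f y)) x.

Definition partials n (l : seq 'I_n) (f : 'rV[R]_n -> R[i]) :=
  foldr (@partial n) f l.

Definition cderivable n (i : 'I_n) (f : 'rV[R]_n -> R[i]) := forall x,
  derivable (fun y => complex.Re (f y)) x (delta_mx 0 i) /\
  derivable (fun y => complex.Im (f y)) x (delta_mx 0 i).

Definition ccontinuous n (f : 'rV[R]_n -> R[i]) :=
  continuous (fun y => complex.Re (f y)) /\ continuous (fun y => complex.Im (f y)).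

(* C^infty: all iterated partial derivatives exist and are continuous *)
Definition smooth n (f : 'rV[R]_n -> R[i]) := forall l : seq 'I_n,
  ccontinuous (partials l f) /\ forall i, cderivable i (partials l f).

Definition mseq n (al : 'I_n -> nat) : seq 'I_n :=
  flatten [seq nseq (al i) i | i <- enum 'I_n].

Definition mderiv n (al : 'I_n -> nat) (f : 'rV[R]_n -> R[i]) :=
  partials (mseq al) f.

Definition msize n (al : 'I_n -> nat) : nat := (\sum_i al i)%N.
Definition mfact n (al : 'I_n -> nat) : nat := (\prod_i (al i)`!)%N.
Definition mpow n (x : 'rV[R]_n) (be : 'I_n -> nat) : R :=
  \prod_i x 0 i ^+ be i.

(* Lebesgue integral over R^n, as an n-fold iterated integral (Fubini) *)
Fixpoint rint n : ('rV[R]_n -> R) -> R :=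
  match n with
  | 0 => fun f => f 0
  | m.+1 => fun f =>
      \int[lebesgue_measure]_(t in [set: R])
        @rint m (fun y : 'rV[R]_m => f (row_mx (t%:M : 'rV[R]_1) y))
  end.

Definition cint n (f : 'rV[R]_n -> R[i]) : R[i] :=
  rint (fun x => complex.Re (f x)) +i* rint (fun x => complex.Im (f x)).

End Calculus.

Section GelfandShilov.
Context {R : realType}.
Implicit Types (s h : R) (n : nat).

Definition gs_norm n s h (f : 'rV[R]_n -> R[i]) : \bar R :=
  ereal_sup [set e | exists (al be : 'I_n -> nat) (x : 'rV[R]_n),
    e = (cabs ((mpow x be)%:C * mderiv al f x)
         / (h ^+ (msize al + msize be)
            * (mfact al * mfact be)%:R `^ s))%:E].

Definition in_gs n s (f : 'rV[R]_n -> R[i]) : Prop :=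
  smooth f /\ exists2 h, 0 < h & (gs_norm s h f < +oo)%E.

(* R[i]^o is R[i] as a normed space over itself. *)
Definition gs_pred n s : {pred 'rV[R]_n -> R[i]^o} := fun f => `[< in_gs s f >].
Arguments gs_pred : clear implicits.

Lemma cabsE (z : R[i]) : (cabs z)%:C = `|z|.
Proof. by []. Qed.

Lemma cabs_ge0 (z : R[i]) : 0 <= cabs z.
Proof. by case: z => a b; exact: sqrtr_ge0. Qed.

Lemma cabsM (z w : R[i]) : cabs (z * w) = cabs z * cabs w.
Proof. exact: ComplexField.Normc.normcM. Qed.

Lemma cabsD (z w : R[i]) : cabs (z + w) <= cabs z + cabs w.
Proof. exact: (@le_normcD R). Qed.

Lemma is_derive_lin3 n (a b : R) (p q r : 'rV[R]_n -> R) (x v : 'rV[R]_n) :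
  derivable p x v -> derivable q x v -> derivable r x v ->
  is_derive x v (fun y => a * p y + b * q y + r y)
    (a * 'D_v p x + b * 'D_v q x + 'D_v r x).
Proof.
move=> /derivableP dp /derivableP dq /derivableP dr.
exact: (is_deriveD (is_deriveD (is_deriveZ a dp) (is_deriveZ b dq)) dr).
Qed.

Lemma cderivable_lin n i (k : R[i]) (f g : 'rV[R]_n -> R[i]) :
  cderivable i f -> cderivable i g ->
  cderivable i (fun x => k * f x + g x) /\
  partial i (fun x => k * f x + g x) =
    (fun x => k * partial i f x + partial i g x).
Proof.
case: k => a b df dg; set v : 'rV[R]_n := delta_mx 0 i.
have reE : (fun y => complex.Re ((a +i* b) * f y + g y)) =
  (fun y => a * complex.Re (f y) + (- b) * complex.Im (f y) + complex.Re (g y)).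
  by apply/funext => y; case: (f y) (g y) => [c e] [p q] /=; rewrite mulNr.
have imE : (fun y => complex.Im ((a +i* b) * f y + g y)) =
  (fun y => a * complex.Im (f y) + b * complex.Re (f y) + complex.Im (g y)).
  by apply/funext => y; case: (f y) (g y) => [c e] [p q].
have dR x := is_derive_lin3 a (- b) (df x).1 (df x).2 (dg x).1.
have dI x := is_derive_lin3 a b (df x).2 (df x).1 (dg x).2.
split=> [x|]; last apply/funext => x.
  rewrite reE imE; split.
    exact: (@ex_derive _ _ _ _ _ _ _ (dR x)).
  exact: (@ex_derive _ _ _ _ _ _ _ (dI x)).
rewrite /partial reE imE (@derive_val _ _ _ _ _ _ _ (dR x)).
by rewrite (@derive_val _ _ _ _ _ _ _ (dI x)) mulNr.
Qed.

Lemma ccontinuous_lin n (k : R[i]) (f g : 'rV[R]_n -> R[i]) :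
  ccontinuous f -> ccontinuous g -> ccontinuous (fun x => k * f x + g x).
Proof.
move=> [rf jf] [rg jg]; case: k => a b.
have reE : (fun y => complex.Re ((a +i* b) * f y + g y)) =
  (fun y => a * complex.Re (f y) - b * complex.Im (f y) + complex.Re (g y)).
  by apply/funext => y; case: (f y) (g y) => [c e] [].
have imE : (fun y => complex.Im ((a +i* b) * f y + g y)) =
  (fun y => a * complex.Im (f y) + b * complex.Re (f y) + complex.Im (g y)).
  by apply/funext => y; case: (f y) (g y) => [c e] [].
split=> x; rewrite ?reE ?imE.
  exact: (cvgD (cvgB (cvgM (cvg_cst a) (rf x)) (cvgM (cvg_cst b) (jf x))) (rg x)).
exact: (cvgD (cvgD (cvgM (cvg_cst a) (jf x)) (cvgM (cvg_cst b) (rf x))) (jg x)).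
Qed.

Lemma partials_lin n (l : seq 'I_n) (k : R[i]) (f g : 'rV[R]_n -> R[i]) :
  smooth f -> smooth g ->
  partials l (fun x => k * f x + g x) =
  (fun x => k * partials l f x + partials l g x).
Proof.
move=> sf sg; elim: l => // i l /= ->.
by have [_ ->] := cderivable_lin k ((sf l).2 i) ((sg l).2 i).
Qed.

Lemma smooth_lin n (k : R[i]) (f g : 'rV[R]_n -> R[i]) :
  smooth f -> smooth g -> smooth (fun x => k * f x + g x).
Proof.
move=> sf sg l; rewrite partials_lin //; split.
  by apply: ccontinuous_lin; [exact: (sf l).1|exact: (sg l).1].
by move=> i; have [] := cderivable_lin k ((sf l).2 i) ((sg l).2 i).
Qed.

Lemma partials0 n (l : seq 'I_n) :
  partials l (fun=> 0 : R[i]) = (fun=> 0).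
Proof.
elim: l => // i l /= ->; apply/funext => x.
by rewrite /partial !(@derive_cst _ _ R^o).
Qed.

Lemma smooth0 n : smooth (fun _ : 'rV[R]_n => 0 : R[i]).
Proof.
move=> l; rewrite partials0; split; first by split; exact: (@cst_continuous _ R 0).
move=> i x; by split; exact: (@derivable_cst R _ R^o 0 x (delta_mx 0 i)).
Qed.

Lemma gs_den_gt0 n s h (al be : 'I_n -> nat) : 0 < h ->
  0 < h ^+ (msize al + msize be) * (mfact al * mfact be)%:R `^ s.
Proof.
move=> h0; rewrite mulr_gt0 ?exprn_gt0 // powR_gt0 // ltr0n muln_gt0.
by rewrite !prodn_gt0 // => i; rewrite fact_gt0.
Qed.

Lemma gs_norm_leP n s h (f : 'rV[R]_n -> R[i]) (M : R) : 0 < h ->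
  (gs_norm s h f <= M%:E)%E <->
  (forall al be x, cabs ((mpow x be)%:C * mderiv al f x) <=
     M * (h ^+ (msize al + msize be) * (mfact al * mfact be)%:R `^ s)).
Proof.
move=> h0; split=> [H al be x|H].
  rewrite -ler_pdivrMr ?gs_den_gt0 // -lee_fin; apply: le_trans H.
  by apply: ereal_sup_ubound; exists al, be, x.
apply: ge_ereal_sup => _ [al [be [x ->]]].
by rewrite lee_fin ler_pdivrMr ?gs_den_gt0.
Qed.

Lemma gs_norm_ltyP n s h (f : 'rV[R]_n -> R[i]) :
  (gs_norm s h f < +oo)%E <-> exists M : R, (gs_norm s h f <= M%:E)%E.
Proof.
split=> [|[M H]]; last exact: le_lt_trans H (ltry _).
have : (gs_norm s h f > -oo)%E.
  apply: lt_le_trans (ltNyr _) _.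
  by apply: ereal_sup_ubound; exists (fun=> 0%N), (fun=> 0%N), 0.
by case: gs_norm => // r _ _; exists r.
Qed.

Lemma gs_submod n s : submod_closed (gs_pred n s).
Proof.
split=> [|k f g /asboolP[sf [h h0 /gs_norm_ltyP[M Mf]]]
           /asboolP[sg [h' h'0 /gs_norm_ltyP[M' Mg]]]]; apply/asboolP.
  split; first exact: smooth0.
  exists 1 => //; apply/gs_norm_ltyP; exists 0.
  apply/(gs_norm_leP _ _ _ ltr01) => al be x.
  by rewrite /mderiv partials0 mulr0 mul0r /cabs ComplexField.Normc.normc0.
split; first exact: smooth_lin.
have m0 : 0 < Num.max h h' by rewrite lt_max h0.
exists (Num.max h h') => //; apply/gs_norm_ltyP.
exists (cabs k * `|M| + `|M'|).
apply/gs_norm_leP => // al be x.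
rewrite /mderiv partials_lin // mulrDr mulrCA.
apply: le_trans (cabsD _ _) _; rewrite [cabs (k * _)]cabsM mulrDl -mulrA.
have step (M0 h0' : R) (p : 'rV[R]_n -> R[i]) : 0 < h0' ->
    h0' <= Num.max h h' -> (gs_norm s h0' p <= M0%:E)%E ->
    cabs ((mpow x be)%:C * mderiv al p x) <= `|M0| *
    (Num.max h h' ^+ (msize al + msize be) * (mfact al * mfact be)%:R `^ s).
  move=> p0 ple /(gs_norm_leP _ _ _ p0)/(_ al be x) H; apply: le_trans H _.
  apply: (@le_trans _ _ (`|M0| *
      (h0' ^+ (msize al + msize be) * (mfact al * mfact be)%:R `^ s))).
    by rewrite ler_wpM2r ?ler_norm // ltW // gs_den_gt0.
  by rewrite ler_wpM2l // ler_wpM2r ?powR_ge0 // lerXn2r // nnegrE ltW.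
apply: lerD; last by apply: (step _ h') => //; rewrite le_max lexx orbT.
by rewrite ler_wpM2l ?cabs_ge0 //; apply: (step _ h) => //; rewrite le_max lexx.
Qed.


HB.instance Definition _ n s :=
  GRing.isSubmodClosed.Build R[i] ('rV[R]_n -> R[i]^o) (gs_pred n s)
    (gs_submod n s).

Record gs n s := GS {
  gs_fun :> 'rV[R]_n -> R[i]^o;
  gs_funP : gs_fun \in gs_pred n s }.

HB.instance Definition _ n s := [isSub for @gs_fun n s].
HB.instance Definition _ n s := [Choice of gs n s by <:].
HB.instance Definition _ n s := [SubChoice_isSubLmodule of gs n s by <:].

Definition disk (V : lmodType R[i]) (D : set V) : Prop :=
  forall (k l : R[i]) (f g : V), `|k| + `|l| <= 1 ->
    D f -> D g -> D (k *: f + l *: g).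

(* 0-neighbourhood base of the locally convex inductive limit of the normed
   spaces S_{s,h}, h > 0: the absolutely convex sets whose trace on every
   S_{s,h} contains a ball *)
Definition gs_base n s (D : set (gs n s)) : Prop :=
  disk D /\
  forall h, 0 < h ->
    exists2 r : R, 0 < r &
      forall f : gs n s, (gs_norm s h f <= r%:E)%E -> D f.

Definition gs_open n s (O : set (gs n s)) : Prop :=
  forall f, O f -> exists2 D, gs_base D & forall g, D (g - f) -> O g.

Lemma gs_openT n s : gs_open [set: gs n s].
Proof.
move=> f _; exists setT => //; split=> // h h0.
by exists 1.
Qed.

Lemma gs_openI n s : setI_closed (@gs_open n s).
Proof.
move=> A B oA oB f [/oA[D [dD bD] DA] /oB[E [dE bE] EB]].
exists (D `&` E); last by move=> g [/DA ? /EB].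
split=> [k l u v kl [Du Eu] [Dv Ev]|h h0]; first by split; [exact: dD|exact: dE].
have [r r0 Hr] := bD h h0; have [t t0 Ht] := bE h h0.
exists (Num.min r t); first by rewrite lt_min r0.
move=> u Hu; split.
  by apply: Hr; apply: le_trans Hu _; rewrite lee_fin ge_min lexx.
by apply: Ht; apply: le_trans Hu _; rewrite lee_fin ge_min lexx orbT.
Qed.

Lemma gs_open_bigcup n s (I : Type) (F : I -> set (gs n s)) :
  (forall i, gs_open (F i)) -> gs_open (\bigcup_i F i).
Proof.
move=> oF f [i _ /oF[D bD DF]]; exists D => // g /DF Fg.
by exists i.
Qed.

HB.instance Definition _ n s := isOpenTopological.Build (gs n s)
  (@gs_openT n s) (@gs_openI n s) (@gs_open_bigcup n s).

Lemma gs_norm_scale n s h (k : R[i]) (f : gs n s) (r : R) : 0 < h ->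
  (gs_norm s h f <= r%:E)%E -> (gs_norm s h (k *: f : gs n s) <= (cabs k * r)%:E)%E.
Proof.
move=> h0 /(gs_norm_leP _ _ _ h0) H; apply/gs_norm_leP => // al be x.
have [sf _] := asboolW (gs_funP f).
have -> : gs_fun (k *: f) = (fun x => k * f x + (fun=> 0) x).
  by apply/funext => y; rewrite addr0.
rewrite /mderiv partials_lin //; last exact: smooth0.
rewrite partials0 addr0 mulrCA cabsM -mulrA ler_wpM2l ?cabs_ge0 //.
exact: H.
Qed.

Lemma cabs_gt0 (z : R[i]) : z != 0 -> 0 < cabs z.
Proof.
move=> z0; rewrite lt_def cabs_ge0 andbT; apply: contra_neq z0.
exact: ComplexField.Normc.eq0_normc.
Qed.

Lemma gs_base_double n s (D : set (gs n s)) :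
  gs_base D -> gs_base [set f | D (2 *: f)].
Proof.
move=> [dD bD]; have c0 : 0 < cabs (2 : R[i]) by rewrite cabs_gt0 // pnatr_eq0.
split=> [k l f g kl Df Dg|h h0].
  by rewrite /= scalerDr !scalerA !(mulrC 2) -!scalerA; exact: dD.
have [r r0 Hr] := bD h h0; exists (r / cabs 2); first by rewrite divr_gt0.
move=> f /(gs_norm_scale 2 h0); rewrite mulrC divfK ?gt_eqF //.
exact: Hr.
Qed.

Lemma gs_base0 n s (D : set (gs n s)) : gs_base D -> D 0.
Proof.
move=> [_ bD]; have [r r0] := bD 1 ltr01; apply.
apply/gs_norm_leP => // al be x; rewrite /mderiv partials0 mulr0.
rewrite /cabs ComplexField.Normc.normc0 mulr_ge0 // ?(ltW r0) // ltW //.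
Qed.

Lemma gs_nbhsP n s (f : gs n s) (V : set (gs n s)) :
  nbhs f V <->
  exists2 D : set (gs n s), gs_base D & forall g, D (g - f) -> V g.
Proof.
rewrite nbhsE; split=> [ [W [Oop Of] WV] | [D bD DV]].
  by have [D bD DW] := Oop f Of; exists D => // g /DW /WV.
exists [set g | exists2 E : set (gs n s), gs_base E &
                  forall g', E (g' - g) -> V g'].
  split; last by exists D.
  move=> g [E bE EV]; exists [set g' | E (2 *: g')]; first exact: gs_base_double.
  move=> g' Eg'; exists [set w | E (2 *: w)]; first exact: gs_base_double.
  move=> w Ew; apply: EV.
  have -> : w - g = 2^-1 *: (2 *: (w - g')) + 2^-1 *: (2 *: (g' - g)).
    by rewrite !scalerA mulVf ?pnatr_eq0 // !scale1r addrA subrK.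
  apply: bE.1 => //.
  by rewrite ger0_norm ?invr_ge0 // [leRHS](splitr 1) !mul1r.
by move=> g [E bE EV]; apply: EV; rewrite subrr; exact: gs_base0.
Qed.

(* von Neumann boundedness *)
Definition vn_bounded (E : preTopologicalLmodType R[i]) (B : set E) : Prop :=
  forall V, nbhs (0 : E) V ->
    \forall k \near (0 : R[i]^o), forall f, B f -> V (k *: f).

Definition gs_dual_pred n s : {pred gs n s -> R[i]^o} := fun u =>
  `[< linear u /\ continuous u >].

Lemma gs_dual_submod n s : submod_closed (@gs_dual_pred n s).
Proof.
split=> [|k u v /asboolP[lu cu] /asboolP[lv cv]]; apply/asboolP; split.
- by move=> a f g /=; rewrite scaler0 addr0.
- exact: (@cst_continuous _ R[i]^o 0).
- move=> a f g; rewrite !fctE lu lv !scalerDr !scalerA.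
  by rewrite addrACA (mulrC k a).
- by move=> x; exact: (cvgD (cvgZr (k := k) (cu x)) (cv x)).
Qed.

HB.instance Definition _ n s :=
  GRing.isSubmodClosed.Build R[i] (gs n s -> R[i]^o) (@gs_dual_pred n s)
    (@gs_dual_submod n s).

Record gs_dual n s := GSDual {
  gs_dual_fun :> gs n s -> R[i]^o;
  gs_dual_funP : gs_dual_fun \in @gs_dual_pred n s }.

HB.instance Definition _ n s := [isSub for @gs_dual_fun n s].
HB.instance Definition _ n s := [Choice of gs_dual n s by <:].
HB.instance Definition _ n s := [SubChoice_isSubLmodule of gs_dual n s by <:].

(* strong topology: uniform convergence on the bounded subsets of S_s *)
HB.instance Definition _ n s := Uniform.copy (gs_dual n s)
  (initial_topology (@gs_dual_fun n s :
     gs_dual n s -> {family @vn_bounded (gs n s), gs n s -> R[i]^o})).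

Lemma in_gs_le n s s' (f : 'rV[R]_n -> R[i]) : s <= s' ->
  in_gs s f -> in_gs s' f.
Proof.
move=> ss' [sf [h h0 /gs_norm_ltyP[M Mf]]]; split=> //; exists h => //.
apply/gs_norm_ltyP; exists `|M|; apply/gs_norm_leP => // al be x.
have /(_ al be x) H := (gs_norm_leP s f M h0).1 Mf; apply: le_trans H _.
apply: (@le_trans _ _ (`|M| *
    (h ^+ (msize al + msize be) * (mfact al * mfact be)%:R `^ s))).
  by rewrite ler_wpM2r ?ler_norm // ltW // gs_den_gt0.
rewrite ler_wpM2l // ler_wpM2l ?exprn_ge0 ?(ltW h0) // ler_powR //.
by rewrite ler1n muln_gt0 !prodn_gt0 // => i; rewrite fact_gt0.
Qed.

Definition gs_incl n s s' (ss' : s <= s') (f : gs n s) : gs n s' :=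
  GS (asboolT (in_gs_le ss' (asboolW (gs_funP f)))).

End GelfandShilov.

Arguments gs {R} n s.
Arguments gs_dual {R} n s.

Section Pseudodifferential.
Context {R : realType}.

Definition Gamma_infty n (s : R) (a : 'rV[R]_n -> R[i]) : Prop :=
  smooth a /\
  exists2 eps : R, 0 < eps & forall h : R, 0 < h ->
    exists2 C : R, 0 < C & forall (al : 'I_n -> nat) (x : 'rV[R]_n),
      cabs (mderiv al a x) <=
      C * (eps ^+ msize al * (mfact al)%:R `^ s * expR (h * enorm x `^ s^-1)).

(* An ultradistribution in S_{1/2}' enters the definition of Op_A as a
   functional on functions, of which only the values on S_{1/2} matter. *)
Definition functional n := ('rV[R]_n -> R[i]) -> R[i].

Definition of_fun n (a : 'rV[R]_n -> R[i]) : functional n :=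
  fun phi => cint (fun x => a x * phi x).

Definition twopi_pow (d : nat) : R[i] := ((2 * pi) `^ (- (d%:R / 2)) : R)%:C.

(* F_2^{-1}, as F has kernel (2 pi)^{-d/2} e^{-i<x,xi>}; it is symmetric for
   the bilinear pairing, hence F2inv_dual *)
Definition F2inv d (Psi : 'rV[R]_(d + d) -> R[i]) : 'rV[R]_(d + d) -> R[i] :=
  fun z => twopi_pow d *
    cint (fun v : 'rV[R]_d => Psi (row_mx (lsubmx z) v)
                              * cis (dotp v (rsubmx z))).

Definition F2inv_dual d (u : functional (d + d)) : functional (d + d) :=
  fun Psi => u (F2inv Psi).

(* the distribution u o (z |-> z *m M), for M invertible *)
Definition comp_lin n (u : functional n) (M : 'M[R]_n) : functional n :=
  fun Phi => (`|\det M|^-1)%:C * u (fun z => Phi (z *m invmx M)).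

Definition kernel_mx d (A : 'M[R]_d) : 'M[R]_(d + d) :=
  block_mx (1%:M - A^T) 1%:M A^T (- 1%:M).

(* A acts on row vectors by v |-> v *m A^T *)
Lemma kernel_mxE d (A : 'M[R]_d) (x y : 'rV[R]_d) :
  row_mx x y *m kernel_mx A = row_mx (x - (x - y) *m A^T) (x - y).
Proof.
rewrite mul_row_block mulmxBr !mulmx1 mulmxN mulmx1 mulmxBl opprB.
by rewrite -addrA [- _ + _]addrC.
Qed.

Lemma kernel_mx_unit d (A : 'M[R]_d) : kernel_mx A \in unitmx.
Proof.
have /mulmx1_unit[] // : kernel_mx A *m
    block_mx 1%:M 1%:M A^T (A^T - 1%:M) = 1%:M.
rewrite mulmx_block !mulmx1 !mul1mx !mulNmx !mul1mx subrK subrr.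
have -> : 1%:M - A^T + (A^T - 1%:M) = 0 by rewrite addrA subrK subrr.
have -> : A^T - (A^T - 1%:M) = 1%:M by rewrite opprB addrC subrK.
by rewrite -scalar_mx_block.
Qed.

(* K_{A,a}, paired below with g (x) f *)
Definition op_kernel d (A : 'M[R]_d) (a : functional (d + d)) :
    functional (d + d) :=
  fun Phi => twopi_pow d * comp_lin (F2inv_dual a) (kernel_mx A) Phi.

Definition tensor d (g f : 'rV[R]_d -> R[i]) : 'rV[R]_(d + d) -> R[i] :=
  fun z => g (lsubmx z) * f (rsubmx z).

Definition Op d (A : 'M[R]_d) (a : functional (d + d)) (f : 'rV[R]_d -> R[i]) :
    functional d :=
  fun g => op_kernel A a (tensor g f).

(* In the next definitions P f, for f in S_{1/2}, is an element of S_{1/2}',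
   and the embeddings S_s, S_s' -> S_{1/2}' are of_fun and restriction. *)
Definition extends_gs d (s : R) (hs : 2^-1 <= s)
    (P : ('rV[R]_d -> R[i]) -> functional d) (T : gs d s -> gs d s) : Prop :=
  forall f g : gs d 2^-1, of_fun (T (gs_incl hs f)) g = P f g.

Definition continuous_on_gs d (s : R) (hs : 2^-1 <= s)
    (P : ('rV[R]_d -> R[i]) -> functional d) : Prop :=
  exists T : {linear gs d s -> gs d s},
    [/\ continuous T, extends_gs hs P T &
        forall T' : gs d s -> gs d s,
          continuous T' -> extends_gs hs P T' -> T' =1 T].

Definition extends_gs_dual d (s : R) (hs : 2^-1 <= s)
    (P : ('rV[R]_d -> R[i]) -> functional d)
    (T : gs_dual d s -> gs_dual d s) : Prop :=
  forall (f : gs d 2^-1) (u : gs_dual d s),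
    (forall phi : gs d s, u phi = of_fun f phi) ->
    forall g : gs d 2^-1, T u (gs_incl hs g) = P f g.

Definition continuous_on_gs_dual d (s : R) (hs : 2^-1 <= s)
    (P : ('rV[R]_d -> R[i]) -> functional d) : Prop :=
  exists T : {linear gs_dual d s -> gs_dual d s},
    [/\ continuous T, extends_gs_dual hs P T &
        forall T' : gs_dual d s -> gs_dual d s,
          continuous T' -> extends_gs_dual hs P T' -> T' =1 T].

End Pseudodifferential.

(* Main.v *)
Require Import Defs.
From HB Require Import structures.
From mathcomp Require Import all_boot all_order all_algebra.
From mathcomp Require Import all_classical all_reals all_analysis.
From mathcomp Require Import measurable_realfun complex ring lra.

Set Implicit Arguments.
Unset Strict Implicit.
Unset Printing Implicit Defensive.
Import Order.TTheory GRing.Theory Num.Theory.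
Import numFieldNormedType.Exports.
Local Open Scope classical_set_scope.
Local Open Scope ring_scope.
Local Open Scope complex_scope.

(* Write p = 1/s and measure decay by weights exp(c |x_j|^p).  A family of smooth
   functions is of class [cls s I] if its derivatives obey uniform Gevrey bounds
   h^k k!^s, decay like exp(-c |x_j|^p) in the coordinates j in I, and grow less
   than every exp(d |x_j|^p) in the others: for I empty this contains Gamma_s^infty,
   for I full it describes the bounded subsets of the Banach spaces S_{s,h}.  These
   classes are stable under products, linear substitutions and partial Fourier
   transforms in coordinates of I, because such a transform exchanges derivatives
   and multiplications.  Writing Op_A(a)f(x) as the composition of
   (x, xi, y) |-> a(x - A(x-y), xi) f(y), a Fourier transform in y, a restriction to
   the diagonal, a Fourier transform in xi and another restriction, one sees that
   Op_A(a) maps each S_{s,h} boundedly into some S_{s,h'}, hence is continuous.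

   By Fubini and linear changes of variables this operator has the prescribed kernel,
   and its transpose is Op_{1-A}(a(x,-xi)), so transposition gives the operator on S_s'.

   Uniqueness needs S_{1/2} to be dense in S_s and in S_s'.  Both follow from a
   uniform approximation of the identity on bounded sets by operators
   sum_k P_k (x) Q_k with P_k, Q_k in S_{1/2}: regularise by a Gaussian convolution
   followed by a Gaussian cut-off, whose kernel is
   exp(-(b+e)|x|^2 - b|t|^2) exp(2b <x,t>), and expand the last factor into its
   Taylor series, whose remainders are still of Gaussian type. *)

(** * Real and complex differential calculus *)

(** Two obstacles shape the proof. When the symbol grows, the integral over (y, xi) does not in
    general converge absolutely: the transform in y must come first, since it turns smoothness in y
    into decay in xi. Hence decay is recorded coordinate by coordinate, and Fubini is used only for
    variables in which there is decay. Secondly, S_{1/2} has no compactly supported element but 0,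
    so density cannot come from cut-offs of compact support; Gaussians have to serve instead.
    Finite-rank operators settle both density statements at once: sum_k P_k (x) Q_k maps f in S_s to
    sum_k <Q_k, f> P_k and, by transposition, u in S_s' to sum_k u(P_k) Q_k.

    All estimates are made for families with an arbitrary index type. A point of a ball of S_{s,h},
    a regularisation parameter and the order of a Taylor remainder can then be indices, so that one
    estimate yields membership, boundedness of operators and rates of approximation. The assumption
    s >= 1/2 enters as 1/s <= 2, for comparison with Gaussians, and in commutators of x_i with
    derivatives, whose factor m is absorbed by k!^s. *)

Section RealCalculus.
Context {R : realType}.

Lemma is_derive_line n (f : 'rV[R]_n -> R) (x v : 'rV[R]_n) (t : R) :
  derivable f (x + t *: v) v ->
  is_derive t 1 (fun r : R => f (x + r *: v)) ('D_v f (x + t *: v)).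
Proof.
have E : (fun h : R => h^-1 *: (f (x + (h *: 1 + t) *: v) - f (x + t *: v)))
  = (fun h : R => h^-1 *: (f (h *: v + (x + t *: v)) - f (x + t *: v))).
  apply/funext => h; congr (_ *: (f _ - _)).
  by rewrite scalerDl addrCA /GRing.scale/= mulr1.
move=> df; split; first by rewrite /derivable E.
by rewrite /derive E.
Qed.

Lemma mvt_line n (f : 'rV[R]_n -> R) (x v : 'rV[R]_n) (c : R) :
  (forall y, derivable f y v) ->
  exists2 t : R, `|t| <= `|c| & f (x + c *: v) - f x = c * 'D_v f (x + t *: v).
Proof.
move=> df; pose g (r : R) := f (x + r *: v).
have dg (r : R) : is_derive r 1 g ('D_v f (x + r *: v)) by exact: is_derive_line.
have cg a b : {within `[a, b], continuous g}.
  apply: continuous_subspaceT => r; apply/differentiable_continuous.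
  by apply/derivable1_diffP; have [] := dg r.
have g0 : g 0 = f x by rewrite /g scale0r addr0.
have [c0|c0] := leP 0 c.
  have [t tc E] := @MVT_segment R g (fun r => 'D_v f (x + r *: v)) 0 c c0
    (fun r _ => dg r) (cg _ _).
  exists t; first by move: tc; rewrite in_itv/= => /andP[t0 tc]; rewrite !ger0_norm.
  by rewrite -g0 -/(g c) E subr0 mulrC.
have [t tc E] := @MVT_segment R g (fun r => 'D_v f (x + r *: v)) c 0 (ltW c0)
    (fun r _ => dg r) (cg _ _).
exists t.
  move: tc; rewrite in_itv/= => /andP[tc t0].
  by rewrite !ler0_norm ?lerN2 // ltW.
by rewrite -g0 -/(g c) -opprB E sub0r mulrN opprK mulrC.
Qed.


Lemma rV_norm_le n (x : 'rV[R]_n) (e : R) : 0 <= e ->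
  (`|x| <= e) <-> (forall i, `|x 0 i| <= e).
Proof.
move=> e0; rewrite [X in X <= e](mx_normrE x); split=> [H i|H].
  apply: le_trans H.
  exact: (@le_bigmax _ _ _ 0 (fun ij : 'I_1 * 'I_n => `|x ij.1 ij.2|) (0, i)).
by apply: bigmax_le => // -[a b] _ /=; rewrite (ord1 a).
Qed.

Lemma rV_norm_coord n (x : 'rV[R]_n) i : `|x 0 i| <= `|x|.
Proof. by move: i; apply: (rV_norm_le x (normr_ge0 x)).1. Qed.

(** The segment from x to x + w is replaced by a path along the axes, [tr k] being w cut after its
    first k entries; the one-dimensional mean value theorem on each edge gives a telescoping sum. In
    the max norm the edges stay within [|w|] of x. *)
Lemma mvt_rV n (f : 'rV[R]_n -> R) (x w : 'rV[R]_n) :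
  (forall i y, derivable f y (delta_mx 0 i)) ->
  exists2 z : 'I_n -> 'rV[R]_n, (forall k, `|z k - x| <= `|w|) &
    f (x + w) - f x = \sum_k w 0 k * 'D_(delta_mx 0 k) f (z k).
Proof.
move=> df; pose tr k : 'rV[R]_n := \row_j (if (j < k)%N then w 0 j else 0).
have trS (k : 'I_n) : tr k.+1 = tr k + w 0 k *: delta_mx 0 k.
  apply/rowP => j; rewrite !mxE eqxx /= ltnS leq_eqVlt.
  case: (ltngtP j k) => [jk|jk|/val_inj ->] /=.
  - by rewrite (_ : j == k = false) ?mulr0 ?addr0 // -val_eqE /= ltn_eqF.
  - by rewrite (_ : j == k = false) ?mulr0 ?addr0 // -val_eqE /= gtn_eqF.
  - by rewrite eqxx mulr1 add0r.
have H (k : 'I_n) : exists z : 'rV[R]_n, `|z - x| <= `|w| /\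
    f (x + tr k.+1) - f (x + tr k) = w 0 k * 'D_(delta_mx 0 k) f z.
  have [t tw E] := @mvt_line n f (x + tr k) (delta_mx 0 k) (w 0 k) (df k).
  exists (x + tr k + t *: delta_mx 0 k); split; last by rewrite trS addrA.
  rewrite addrAC (addrC x) addrK; apply: (rV_norm_le _ (normr_ge0 _)).2 => j.
  rewrite !mxE eqxx /=; case: (ltngtP j k) => [jk|jk|/val_inj ->].
  - rewrite (_ : j == k = false) ?mulr0 ?addr0 ?rV_norm_coord //.
    by rewrite -val_eqE /= ltn_eqF.
  - rewrite (_ : j == k = false) ?mulr0 ?addr0 ?normr0 //.
    by rewrite -val_eqE /= gtn_eqF.
  - by rewrite eqxx mulr1 add0r (le_trans tw) ?rV_norm_coord.
have [z Hz] := fin_all_exists H; exists z => [k|]; first exact: (Hz k).1.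
under eq_bigr do rewrite -(Hz _).2.
rewrite -(big_mkord xpredT (fun k => f (x + tr k.+1) - f (x + tr k))).
rewrite telescope_sumr //; congr (f _ - f _).
  by congr (_ + _); apply/rowP => j; rewrite mxE ltn_ord.
by rewrite -[LHS]addr0; congr (_ + _); apply/rowP => j; rewrite !mxE ltn0.
Qed.

(** By [mvt_rV] the difference quotient is a combination of partial derivatives at points tending to
    x, so their continuity suffices. *)
Lemma is_derive_C1 n (f : 'rV[R]_n -> R) (x v : 'rV[R]_n) :
  (forall i y, derivable f y (delta_mx 0 i)) ->
  (forall i, continuous (fun y => 'D_(delta_mx 0 i) f y)) ->
  is_derive x v f (\sum_i v 0 i * 'D_(delta_mx 0 i) f x).
Proof.
move=> df cf; set l := \sum_i _.
suff H : h^-1 *: (f (h *: v + x) - f x) @[h --> (0 : R)^'] --> (l : R).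
  by split; [apply/cvg_ex; exists l|apply/cvg_lim].
apply/cvgrPdist_le => /= e e0.
pose M := \sum_i `|v 0 i|; have M0 : 0 <= M by exact: sumr_ge0.
have e'0 : 0 < e / (M + 1) by rewrite divr_gt0 // ltr_wpDl.
have : \forall y \near x, forall i,
    `|'D_(delta_mx 0 i) f x - 'D_(delta_mx 0 i) f y| <= e / (M + 1).
  apply: (@filter_forall _ _ (fun i y => `|'D_(delta_mx 0 i) f x - 'D_(delta_mx 0 i) f y|
    <= e / (M + 1)) (nbhs x)) => i.
  by have /cvgrPdist_le/(_ _ e'0) := cf i x.
move=> /nbhs_ballP[r /= r0 Hr].
have v0 : 0 < `|v| + 1 by rewrite ltr_wpDl.
near=> h.
have hN0 : h != 0 by near: h; exact: nbhs_dnbhs_neq.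
have [z zx E] := @mvt_rV n f x (h *: v) df.
rewrite (addrC (h *: v)) E scaler_sumr /l -sumrB.
apply: (le_trans (ler_norm_sum _ _ _)).
apply: (@le_trans _ _ (\sum_i `|v 0 i| * (e / (M + 1)))).
  apply: ler_sum => i _; rewrite mxE /GRing.scale/= -mulrA mulKf // -mulrBr normrM.
  rewrite ler_wpM2l //; apply: Hr.
  rewrite -ball_normE /= distrC (le_lt_trans (zx i)) // normrZ.
  apply: (@le_lt_trans _ _ (`|h| * (`|v| + 1))); first by rewrite ler_wpM2l // lerDl.
  rewrite -ltr_pdivlMr //; near: h; apply: dnbhs0_lt; exact: divr_gt0.
rewrite -mulr_suml -/M mulrCA ler_piMr ?(ltW e0) // ler_pdivrMr ?mul1r ?lerDl //.
by rewrite ltr_wpDl.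
Unshelve. all: by end_near. Qed.

(** The mean value theorem in direction i, applied to the increment [g] in direction j, leaves an
    increment of D_i f, to which it is applied in direction j. *)
Lemma schwarz_pt n (f : 'rV[R]_n -> R) (x : 'rV[R]_n) (i j : 'I_n) (h : R) :
  (forall y, derivable f y (delta_mx 0 i)) ->
  (forall y, derivable (fun z => 'D_(delta_mx 0 i) f z) y (delta_mx 0 j)) ->
  exists2 z, `|z - x| <= `|h| + `|h| &
  f (x + h *: delta_mx 0 i + h *: delta_mx 0 j) - f (x + h *: delta_mx 0 i)
   - (f (x + h *: delta_mx 0 j) - f x) =
  h * (h * 'D_(delta_mx 0 j) (fun z => 'D_(delta_mx 0 i) f z) z).
Proof.
move=> di dij; set ei : 'rV[R]_n := delta_mx 0 i; set ej : 'rV[R]_n := delta_mx 0 j.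
pose g y := f (y + h *: ej) - f y.
have dsh y : derivable (fun z => f (z + h *: ej)) y ei /\
    'D_ei (fun z => f (z + h *: ej)) y = 'D_ei f (y + h *: ej).
  have E : (fun k : R => k^-1 *: (f (k *: ei + y + h *: ej) - f (y + h *: ej)))
     = (fun k : R => k^-1 *: (f (k *: ei + (y + h *: ej)) - f (y + h *: ej))).
    by apply/funext => k; rewrite addrA.
  by split; [rewrite /derivable E; exact: di|rewrite /derive E].
have dg y : derivable g y ei.
  by apply: derivableB; [exact: (dsh y).1|exact: di].
have [t th E] := @mvt_line n g x ei h dg.
rewrite deriveB in E; [|exact: (dsh _).1|exact: di].
rewrite (dsh _).2 in E.
have [t' t'h E'] := @mvt_line n (fun z => 'D_ei f z) (x + t *: ei) ej h dij.
have ne k (s : R) : `|s *: (delta_mx 0 k : 'rV[R]_n)| <= `|s|.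
  apply: (rV_norm_le _ (normr_ge0 _)).2 => m; rewrite !mxE eqxx /=.
  by case: eqP => _; rewrite ?mulr1 ?mulr0 ?normr0.
exists (x + t *: ei + t' *: ej).
  rewrite addrAC (addrC x) addrK (le_trans (ler_normD _ _)) // lerD //.
    by rewrite (le_trans (ne _ _)).
  by rewrite (le_trans (ne _ _)).
by rewrite -E' -E.
Qed.

(** The second difference of [schwarz_pt] is symmetric in i and j, so one mixed derivative at a
    point near x equals the other at another point near x; continuity does the rest. *)
Lemma schwarz n (f : 'rV[R]_n -> R) (i j : 'I_n) (x : 'rV[R]_n) :
  let D k (f : 'rV[R]_n -> R) := fun z => 'D_(delta_mx 0 k) f z in
  (forall k y, derivable f y (delta_mx 0 k)) ->
  (forall k l y, derivable (D k f) y (delta_mx 0 l)) ->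
  (forall k l, continuous (D l (D k f))) ->
  D j (D i f) x = D i (D j f) x.
Proof.
have third (m : R) : 0 < m -> m / 3 + m / 3 < m by clear; move=> m0; lra.
have tri (a b c e : R) : `|a - c| <= e / 2 -> `|b - c| <= e / 2 -> `|a - b| <= e.
  move=> ac bc; rewrite (_ : a - b = (a - c) - (b - c)); last by ring.
  by apply: (le_trans (ler_normB _ _)); rewrite [leRHS]splitr; apply: lerD.
have cross (a b c e : R) : a - b - (c - e) = a - c - (b - e) by clear; ring.
move=> D d1 d2 c2; apply/eqP; rewrite -subr_eq0 -normr_le0.
apply/ler_addgt0Pr => e e0; rewrite add0r.
have e2 : 0 < e / 2 by rewrite divr_gt0.
have /cvgrPdist_le/(_ _ e2)/nbhs_ballP[r /= r0 Hr] := c2 i j x.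
have /cvgrPdist_le/(_ _ e2)/nbhs_ballP[r' /= r'0 Hr'] := c2 j i x.
pose h := Num.min r r' / 3.
have h0 : 0 < h by rewrite divr_gt0 // lt_min r0.
have [z zx E] := @schwarz_pt n f x i j h (d1 i) (d2 i j).
have [z' z'x E'] := @schwarz_pt n f x j i h (d1 j) (d2 j i).
have hh : `|h| + `|h| < Num.min r r'.
  by rewrite ger0_norm ?(ltW h0) // third // lt_min r0.
have B : ball x r z.
  rewrite -ball_normE /= distrC (le_lt_trans zx) // (lt_le_trans hh) //.
  by rewrite ge_min lexx.
have B' : ball x r' z'.
  rewrite -ball_normE /= distrC (le_lt_trans z'x) // (lt_le_trans hh) //.
  by rewrite ge_min lexx orbT.
have EE : D j (D i f) z = D i (D j f) z'.
  have hN0 : h != 0 by rewrite gt_eqF.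
  apply: (mulfI hN0); apply: (mulfI hN0).
  apply: (etrans (esym E)); apply: etrans E'; rewrite (addrAC x).
  exact: cross.
have H2 : `|D j (D i f) x - D j (D i f) z| <= e / 2 := Hr _ B.
have H1 : `|D i (D j f) x - D j (D i f) z| <= e / 2.
  by rewrite EE; exact: Hr' _ B'.
exact: (tri _ _ _ _ H2 H1).
Qed.

End RealCalculus.

(** * Complex-valued smooth functions: closure properties and symmetry of derivatives *)

Section ComplexCalculus.
Context {R : realType}.
Local Notation C := R[i].

Definition cder (V : normedModType R) (f : V -> C) (x v : V) (d : C) : Prop :=
  is_derive x v (fun y => complex.Re (f y) : R) (complex.Re d) /\
  is_derive x v (fun y => complex.Im (f y) : R) (complex.Im d).

Lemma cderD (V : normedModType R) (f g : V -> C) x v a b :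
  cder f x v a -> cder g x v b -> cder (fun y => f y + g y) x v (a + b).
Proof.
move=> [fr fi] [gr gi]; split.
  have -> : (fun y => complex.Re (f y + g y)) =
    (fun y => complex.Re (f y)) + (fun y => complex.Re (g y)).
    by apply/funext => y; rewrite fctE; case: (f y) (g y) => [? ?] [].
  have -> : complex.Re (a + b) = complex.Re a + complex.Re b by case: (a) (b) => [? ?] [].
  exact: is_deriveD.
have -> : (fun y => complex.Im (f y + g y)) =
  (fun y => complex.Im (f y)) + (fun y => complex.Im (g y)).
  by apply/funext => y; rewrite fctE; case: (f y) (g y) => [? ?] [].
have -> : complex.Im (a + b) = complex.Im a + complex.Im b by case: (a) (b) => [? ?] [].
exact: is_deriveD.
Qed.

Lemma cderM (V : normedModType R) (f g : V -> C) x v a b :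
  cder f x v a -> cder g x v b -> cder (fun y => f y * g y) x v (a * g x + f x * b).
Proof.
move=> [fr fi] [gr gi]; split.
  have -> : (fun y => complex.Re (f y * g y)) =
    (fun y => complex.Re (f y)) * (fun y => complex.Re (g y)) -
    (fun y => complex.Im (f y)) * (fun y => complex.Im (g y)).
    by apply/funext => y; rewrite !fctE; case: (f y) (g y) => [? ?] [].
  have H := is_deriveB (is_deriveM fr gr) (is_deriveM fi gi).
  apply: is_derive_eq; rewrite /GRing.scale /=.
  case: (a) (b) (f x) (g x) => [a1 a2] [b1 b2] [c1 c2] [d1 d2] /=; ring.
have -> : (fun y => complex.Im (f y * g y)) =
  (fun y => complex.Re (f y)) * (fun y => complex.Im (g y)) +
  (fun y => complex.Im (f y)) * (fun y => complex.Re (g y)).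
  by apply/funext => y; rewrite !fctE; case: (f y) (g y) => [? ?] [].
have H := is_deriveD (is_deriveM fr gi) (is_deriveM fi gr).
apply: is_derive_eq; rewrite /GRing.scale /=.
case: (a) (b) (f x) (g x) => [a1 a2] [b1 b2] [c1 c2] [d1 d2] /=; ring.
Qed.

Lemma cder_cst (V : normedModType R) (c : C) (x v : V) : cder (fun _ => c) x v 0.
Proof. by split; exact: is_derive_cst. Qed.

Lemma cder_unique (V : normedModType R) (f : V -> C) x v a b :
  cder f x v a -> cder f x v b -> a = b.
Proof.
move=> [[_ r1] [_ i1]] [[_ r2] [_ i2]].
by apply/eqP; rewrite eq_complex -r1 -r2 -i1 -i2 !eqxx.
Qed.

Lemma cder_sum (V : normedModType R) (I : Type) (r : seq I) (f : I -> V -> C) x v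
    (d : I -> C) : (forall i, cder (f i) x v (d i)) ->
  cder (fun y => \sum_(i <- r) f i y) x v (\sum_(i <- r) d i).
Proof.
move=> H; elim: r => [|i r IH].
  rewrite big_nil; have -> : (fun y => \sum_(i <- [::]) f i y) = (fun=> 0).
    by apply/funext => y; rewrite big_nil.
  exact: cder_cst.
rewrite big_cons; have -> : (fun y => \sum_(j <- i :: r) f j y) =
    (fun y => f i y + \sum_(j <- r) f j y).
  by apply/funext => y; rewrite big_cons.
exact: cderD.
Qed.

Lemma cderivableP n (i : 'I_n) (f : 'rV[R]_n -> C) :
  cderivable i f <-> forall x, cder f x (delta_mx 0 i) (partial i f x).
Proof.
split=> H x; last by have [[? _] [? _]] := H x.
by split; apply: derivableP; have [] := H x.
Qed.

Lemma partialE n (i : 'I_n) (f : 'rV[R]_n -> C) x d :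
  cder f x (delta_mx 0 i) d -> partial i f x = d.
Proof.
move=> [[_ r] [_ j]]; rewrite /partial r j.
by case: d {r j}.
Qed.

Lemma cderivable_partial n (i : 'I_n) (f df : 'rV[R]_n -> C) :
  (forall x, cder f x (delta_mx 0 i) (df x)) -> cderivable i f /\ partial i f = df.
Proof.
move=> H; have E : partial i f = df by apply/funext => x; exact: partialE (H x).
by split=> //; apply/cderivableP; rewrite E.
Qed.

Lemma partials_rcons n (l : seq 'I_n) i (f : 'rV[R]_n -> C) :
  partials (rcons l i) f = partials l (partial i f).
Proof. by rewrite /partials foldr_rcons. Qed.

Lemma partials_cat n (l l' : seq 'I_n) (f : 'rV[R]_n -> C) :
  partials (l ++ l') f = partials l (partials l' f).
Proof. by rewrite /partials foldr_cat. Qed.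

Lemma smooth_partials n (l : seq 'I_n) (f : 'rV[R]_n -> C) :
  smooth f -> smooth (partials l f).
Proof. by move=> sf l'; rewrite -partials_cat; exact: sf. Qed.

Lemma smooth_partial n (i : 'I_n) (f : 'rV[R]_n -> C) :
  smooth f -> smooth (partial i f).
Proof. exact: (@smooth_partials n [:: i]). Qed.

Lemma smooth_cont n (f : 'rV[R]_n -> C) : smooth f -> ccontinuous f.
Proof. by move=> /(_ [::]) []. Qed.

Lemma smooth_cder n i (f : 'rV[R]_n -> C) x :
  smooth f -> cder f x (delta_mx 0 i) (partial i f x).
Proof. by move=> /(_ [::]) [_ /(_ i)] /cderivableP. Qed.

(** Smoothness quantifies over all iterated derivatives. Exhibiting a set of functions that is
    stable under partial derivatives avoids any formula for the higher ones. *)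
Lemma smooth_coind n (S : set ('rV[R]_n -> C)) :
  (forall g, S g -> ccontinuous g /\ forall i, cderivable i g /\ S (partial i g)) ->
  forall f, S f -> smooth f.
Proof.
move=> H f Sf; have SS l : S (partials l f).
  by elim: l => // i l /H[_ /(_ i)[]].
by move=> l; have [? K] := H _ (SS l); split=> // i; have [] := K i.
Qed.

Lemma smoothD n (f g : 'rV[R]_n -> C) :
  smooth f -> smooth g -> smooth (fun x => f x + g x).
Proof.
move=> sf sg; have -> : (fun x => f x + g x) = (fun x => 1 * f x + g x).
  by apply/funext => x; rewrite mul1r.
exact: smooth_lin.
Qed.

Lemma smoothZ n (k : C) (f : 'rV[R]_n -> C) :
  smooth f -> smooth (fun x => k * f x).
Proof.
move=> sf; have -> : (fun x => k * f x) = (fun x => k * f x + 0).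
  by apply/funext => x; rewrite addr0.
exact: (smooth_lin k sf (@smooth0 R n)).
Qed.

Lemma partialsD n (l : seq 'I_n) (f g : 'rV[R]_n -> C) :
  smooth f -> smooth g ->
  partials l (fun x => f x + g x) = (fun x => partials l f x + partials l g x).
Proof.
move=> sf sg; have -> : (fun x => f x + g x) = (fun x => 1 * f x + g x).
  by apply/funext => x; rewrite mul1r.
by rewrite partials_lin //; apply/funext => x; rewrite mul1r.
Qed.

Lemma partialsZ n (l : seq 'I_n) (k : C) (f : 'rV[R]_n -> C) :
  smooth f -> partials l (fun x => k * f x) = (fun x => k * partials l f x).
Proof.
move=> sf; have -> : (fun x => k * f x) = (fun x => k * f x + 0).
  by apply/funext => x; rewrite addr0.
rewrite (partials_lin l k sf (@smooth0 R n)).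
by rewrite partials0; apply/funext => x; rewrite addr0.
Qed.

Lemma smooth_sum n (I : Type) (r : seq I) (f : I -> 'rV[R]_n -> C) :
  (forall i, smooth (f i)) -> smooth (fun x => \sum_(i <- r) f i x).
Proof.
move=> H; elim: r => [|i r IH].
  have -> : (fun y => \sum_(i <- [::]) f i y) = (fun=> 0).
    by apply/funext => y; rewrite big_nil.
  exact: smooth0.
have -> : (fun y => \sum_(j <- i :: r) f j y) =
    (fun y => f i y + \sum_(j <- r) f j y).
  by apply/funext => y; rewrite big_cons.
exact: (smoothD (H i) IH).
Qed.

Lemma partials_sum n (l : seq 'I_n) (I : Type) (r : seq I) (f : I -> 'rV[R]_n -> C) :
  (forall i, smooth (f i)) -> partials l (fun x => \sum_(i <- r) f i x) =
  (fun x => \sum_(i <- r) partials l (f i) x).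
Proof.
move=> H; elim: r => [|i r IH].
  have -> : (fun y => \sum_(i <- [::]) f i y) = (fun=> 0).
    by apply/funext => y; rewrite big_nil.
  by rewrite partials0; apply/funext => y; rewrite big_nil.
have -> : (fun y => \sum_(j <- i :: r) f j y) =
    (fun y => f i y + \sum_(j <- r) f j y).
  by apply/funext => y; rewrite big_cons.
rewrite (partialsD l (H i) (smooth_sum r H)) IH.
by apply/funext => y; rewrite big_cons.
Qed.

Lemma ccontinuousM n (f g : 'rV[R]_n -> C) :
  ccontinuous f -> ccontinuous g -> ccontinuous (fun x => f x * g x).
Proof.
move=> [fr fi] [gr gi]; split.
  have -> : (fun y => complex.Re (f y * g y)) =
    (fun y => complex.Re (f y) * complex.Re (g y) - complex.Im (f y) * complex.Im (g y)).
    by apply/funext => y; case: (f y) (g y) => [? ?] [].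
  by move=> x; exact: (cvgB (cvgM (fr x) (gr x)) (cvgM (fi x) (gi x))).
have -> : (fun y => complex.Im (f y * g y)) =
  (fun y => complex.Re (f y) * complex.Im (g y) + complex.Im (f y) * complex.Re (g y)).
  by apply/funext => y; case: (f y) (g y) => [? ?] [].
by move=> x; exact: (cvgD (cvgM (fr x) (gi x)) (cvgM (fi x) (gr x))).
Qed.

Lemma partialM n i (F G : 'rV[R]_n -> C) : smooth F -> smooth G ->
  cderivable i (fun x => F x * G x) /\
  partial i (fun x => F x * G x) = (fun x => partial i F x * G x + F x * partial i G x).
Proof.
move=> sF sG; apply: cderivable_partial => x.
by apply: cderM; exact: smooth_cder.
Qed.

(** Products alone are not stable under differentiation; sums of products are, by the Leibniz rule,
    which makes them an invariant set for [smooth_coind]. *)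
Inductive sum_of_products n : ('rV[R]_n -> C) -> Prop :=
| product_of F G : smooth F -> smooth G -> sum_of_products (fun x => F x * G x)
| sum_of f g : sum_of_products f -> sum_of_products g ->
    sum_of_products (fun x => f x + g x).

Lemma smoothM n (F G : 'rV[R]_n -> C) :
  smooth F -> smooth G -> smooth (fun x => F x * G x).
Proof.
move=> sF sG; apply: (@smooth_coind n (@sum_of_products n)); last exact: product_of.
move=> g; elim=> {g} [f g sf sg|f g sf [cf df] sg [cg dg]].
  split; first by apply: ccontinuousM; exact: smooth_cont.
  move=> i; have [d ->] := partialM i sf sg; split=> //.
  exact: (sum_of (product_of (smooth_partial i sf) sg) (product_of sf (smooth_partial i sg))).
have E : (fun x => f x + g x) = (fun x => 1 * f x + g x).
  by apply/funext => x; rewrite mul1r.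
split; first by rewrite E; exact: ccontinuous_lin.
move=> i; have [df1 df2] := df i; have [dg1 dg2] := dg i.
have [fg pfg] := cderivable_lin 1 df1 dg1; rewrite E; split=> //.
rewrite pfg; have -> : (fun x => 1 * partial i f x + partial i g x) =
   (fun x => partial i f x + partial i g x) by apply/funext => x; rewrite mul1r.
exact: (sum_of df2 dg2).
Qed.

Lemma continuous_mulmx m n (L : 'M[R]_(m, n)) :
  continuous (fun x : 'rV[R]_m => x *m L).
Proof.
move=> x; apply/(@cvgrPdist_le R 'rV[R]_n _ (nbhs (x : 'rV[R]_m)) (nbhs_filter (x : 'rV[R]_m))) => e e0.
pose M := \sum_k \sum_j `|L k j|.
have M0 : 0 <= M by apply: sumr_ge0 => k _; exact: sumr_ge0.
have M1 : 0 < M + 1 by rewrite ltr_wpDl.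
apply/nbhs_ballP; exists (e / (M + 1)) => [|y]; first exact: divr_gt0.
rewrite -ball_normE /= => /ltW xy.
rewrite -mulmxBl; apply: (rV_norm_le _ (ltW e0)).2 => j; rewrite mxE.
apply: (le_trans (ler_norm_sum _ _ _)).
apply: (@le_trans _ _ (\sum_k (e / (M + 1) * `|L k j|))).
  apply: ler_sum => k _; rewrite normrM ler_wpM2r //.
  exact: le_trans (rV_norm_coord _ _) xy.
rewrite -mulr_sumr -mulrA ler_piMr ?(ltW e0) // mulrC ler_pdivrMr // mul1r.
rewrite ler_wpDr // ler_sum // => k _.
by rewrite (bigD1 j) //= lerDl sumr_ge0.
Qed.

Lemma ccontinuous_comp m n (g : 'rV[R]_m -> 'rV[R]_n) (F : 'rV[R]_n -> C) :
  continuous g -> ccontinuous F -> ccontinuous (fun x => F (g x)).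
Proof.
move=> cg [cr ci]; split=> x.
  by apply: (@continuous_comp _ _ _ g (fun y => complex.Re (F y))); [exact: cg|exact: cr].
by apply: (@continuous_comp _ _ _ g (fun y => complex.Im (F y))); [exact: cg|exact: ci].
Qed.

Lemma cder_dir n (F : 'rV[R]_n -> C) x v : smooth F ->
  cder F x v (\sum_j (v 0 j)%:C * partial j F x).
Proof.
move=> sF.
have dF i := ((sF [::]).2 i); have cF i := ((sF [:: i]).1).
have -> : \sum_j (v 0 j)%:C * partial j F x =
  (\sum_j v 0 j * complex.Re (partial j F x)) +i*
  (\sum_j v 0 j * complex.Im (partial j F x)).
  apply/eqP; rewrite eq_complex !raddf_sum /=; apply/andP; split; apply/eqP;
  by apply: eq_bigr => j _; rewrite /= mul0r ?subr0 ?addr0.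
split; apply: is_derive_C1.
- by move=> i y; exact: (dF i y).1.
- by move=> i; exact: (cF i).1.
- by move=> i y; exact: (dF i y).2.
- by move=> i; exact: (cF i).2.
Qed.

Lemma cder_comp_lin m n (L : 'M[R]_(m, n)) (F : 'rV[R]_n -> C) x v d :
  cder F (x *m L) (v *m L) d -> cder (fun y => F (y *m L)) x v d.
Proof.
have E (f : 'rV[R]_n -> R) : (fun h : R => h^-1 *: (f ((h *: v + x) *m L) - f (x *m L)))
  = (fun h : R => h^-1 *: (f (h *: (v *m L) + x *m L) - f (x *m L))).
  by apply/funext => h; rewrite mulmxDl -scalemxAl.
have H (f : 'rV[R]_n -> R) (c : R) : is_derive (x *m L) (v *m L) f c ->
    is_derive x v (fun y => f (y *m L)) c.
  move=> [d1 d2]; split; first by rewrite /derivable E.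
  by rewrite -d2 /derive E.
by move=> [dr di]; split; [exact: (H (fun y => complex.Re (F y)))|
                           exact: (H (fun y => complex.Im (F y)))].
Qed.

Lemma partial_comp m n (L : 'M[R]_(m, n)) (F : 'rV[R]_n -> C) i : smooth F ->
  cderivable i (fun x => F (x *m L)) /\
  partial i (fun x => F (x *m L)) =
    (fun x => \sum_j (L i j)%:C * partial j F (x *m L)).
Proof.
move=> sF; apply: cderivable_partial => x; apply: cder_comp_lin.
have := cder_dir (x *m L) (delta_mx 0 i *m L) sF.
by under eq_bigr do rewrite -rowE mxE.
Qed.

(** The analogous invariant set for substitutions: the chain rule turns a pullback into a
    combination of pullbacks by the same matrix. *)
Inductive sum_of_pullbacks m n (L : 'M[R]_(m, n)) : ('rV[R]_m -> C) -> Prop :=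
| pullback_of F : smooth F -> sum_of_pullbacks L (fun x => F (x *m L))
| comb_of k f g : sum_of_pullbacks L f -> sum_of_pullbacks L g ->
    sum_of_pullbacks L (fun x => k * f x + g x).

Lemma sum_of_pullbacks0 m n (L : 'M[R]_(m, n)) :
  sum_of_pullbacks L (fun _ : 'rV[R]_m => 0 : C).
Proof. exact: (@pullback_of m n L _ (@smooth0 R n)). Qed.

Lemma sum_of_pullbacks_sum m n (L : 'M[R]_(m, n)) (r : seq 'I_n) (c : 'I_n -> C)
    (f : 'I_n -> 'rV[R]_n -> C) : (forall j, smooth (f j)) ->
  sum_of_pullbacks L (fun x => \sum_(j <- r) c j * f j (x *m L)).
Proof.
move=> sf; elim: r => [|j r IH].
  under eq_fun do rewrite big_nil.
  exact: sum_of_pullbacks0.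
under eq_fun do rewrite big_cons.
exact: (comb_of (c j) (pullback_of L (sf j)) IH).
Qed.

Lemma smooth_comp m n (L : 'M[R]_(m, n)) (F : 'rV[R]_n -> C) :
  smooth F -> smooth (fun x => F (x *m L)).
Proof.
move=> sF; apply: (@smooth_coind m (@sum_of_pullbacks m n L)); last exact: pullback_of.
move=> g; elim=> {g} [f sf|k f g _ [cf df] _ [cg dg]].
  split; first by apply: ccontinuous_comp; [exact: continuous_mulmx|exact: smooth_cont].
  move=> i; have [d ->] := partial_comp L i sf; split=> //.
  apply: (@sum_of_pullbacks_sum m n L _ (fun j => (L i j)%:C) (fun j => partial j f)).
  by move=> j; exact: smooth_partial.
split; first exact: ccontinuous_lin.
move=> i; have [df1 df2] := df i; have [dg1 dg2] := dg i.
have [fg pfg] := cderivable_lin k df1 dg1; split=> //.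
by rewrite pfg; exact: comb_of.
Qed.

Lemma partialC n (i j : 'I_n) (f : 'rV[R]_n -> C) : smooth f ->
  partial i (partial j f) = partial j (partial i f).
Proof.
move=> sf; have d1 k := (sf [::]).2 k; have d2 k l := (sf [:: k]).2 l.
have c2 k l := (sf [:: l; k]).1.
apply/funext => x.
have HR := @schwarz R n (fun y => complex.Re (f y)) j i x
  (fun k y => (d1 k y).1) (fun k l y => (d2 k l y).1) (fun k l => (c2 k l).1).
have HI := @schwarz R n (fun y => complex.Im (f y)) j i x
  (fun k y => (d1 k y).2) (fun k l y => (d2 k l y).2) (fun k l => (c2 k l).2).
exact: (f_equal2 (@Complex R) HR HI).
Qed.

Lemma partials_perm n (l l' : seq 'I_n) (f : 'rV[R]_n -> C) : smooth f ->
  perm_eq l l' -> partials l f = partials l' f.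
Proof.
move=> sf; have move_front a i b : partials (a ++ i :: b) f = partial i (partials (a ++ b) f).
  elim: a => [|j a IH]; first exact: erefl.
  have -> : partials ((j :: a) ++ i :: b) f = partial j (partials (a ++ i :: b) f) by exact: erefl.
  by rewrite IH (partialC j i (smooth_partials _ sf)).
elim: l l' => [|i l IH] l'; first by rewrite perm_sym => /perm_nilP ->.
move=> p; have il' : i \in l' by rewrite -(perm_mem p) mem_head.
move: p; case/splitPr: il' => a b.
rewrite perm_sym (perm_catCA a [:: i] b) /= perm_cons perm_sym => /IH E.
rewrite move_front -E; exact: erefl.
Qed.

Lemma size_mseq n (al : 'I_n -> nat) : size (mseq al) = msize al.
Proof.
rewrite /mseq size_flatten /shape -map_comp sumnE big_map /msize big_enum /=.
by apply: eq_bigr => i _; rewrite size_nseq.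
Qed.

Lemma perm_mseq n (l : seq 'I_n) : perm_eq l (mseq (fun i => count_mem i l)).
Proof.
apply/allP => x _ /=; apply/eqP.
rewrite /mseq count_flatten -map_comp sumnE big_map big_enum /= (bigD1 x) //=.
rewrite count_nseq /= eqxx mul1n big1 ?addn0 // => i ix.
by rewrite count_nseq /= (negbTE ix).
Qed.

(** Lists of directions suit inductions on the order of a derivative, while multi-indices occur in
    the norms; symmetry of derivatives passes from one to the other. *)
Lemma partials_mderiv n (l : seq 'I_n) (f : 'rV[R]_n -> C) : smooth f ->
  partials l f = mderiv (fun i => count_mem i l) f.
Proof. by move=> sf; apply: partials_perm => //; exact: perm_mseq. Qed.

End ComplexCalculus.

(** * Gevrey constants and weights *)

Section Weights.
Context {R : realType}.
Local Notation C := R[i].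

Definition fs (s : R) (m : nat) : R := (m`!)%:R `^ s.

Lemma fs_gt0 s m : 0 < fs s m.
Proof. by rewrite powR_gt0 // ltr0n fact_gt0. Qed.

Lemma fs_ge0 s m : 0 <= fs s m. Proof. exact/ltW/fs_gt0. Qed.

Lemma fs0 s : fs s 0 = 1. Proof. by rewrite /fs fact0 powR1. Qed.

Lemma le_fs s (m n : nat) : 0 <= s -> (m <= n)%N -> fs s m <= fs s n.
Proof.
move=> s0 mn; rewrite /fs ge0_ler_powR ?nnegrE ?ler0n // ler_nat.
by rewrite leq_fact.
Qed.

Lemma fs_mul s (m n : nat) : 0 <= s -> fs s m * fs s n <= fs s (m + n).
Proof.
move=> s0; rewrite /fs -powRM ?ler0n // -natrM ge0_ler_powR ?nnegrE ?ler0n // ler_nat.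
rewrite -(@bin_fact (m + n) m) ?leq_addr // addKn.
by rewrite leq_pmull // bin_gt0 leq_addr.
Qed.

(** The binomial coefficient of m + n over m is at most 2^(m+n). *)
Lemma fs_add s (m n : nat) : 0 <= s ->
  fs s (m + n) <= (2 `^ s) ^+ (m + n) * (fs s m * fs s n).
Proof.
move=> s0; rewrite /fs -powRM ?ler0n // -natrM -powR_mulrn ?powR_ge0 //.
rewrite powRAC powR_mulrn // -powRM ?exprn_ge0 // -natrX -natrM.
rewrite ge0_ler_powR ?nnegrE ?ler0n // ler_nat.
rewrite -(@bin_fact (m + n) m) ?leq_addr // addKn leq_mul2r; apply/orP; right.
rewrite -[2%N]/(1 + 1)%N expnDn.
have mn : (m < (m + n).+1)%N by rewrite ltnS leq_addr.
rewrite (bigD1 (Ordinal mn)) //= !exp1n !muln1; exact: leq_addr.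
Qed.

(** Here s >= 1/2 pays for commutators: differentiating x^m costs a factor m while one power and one
    derivative disappear, and m <= (m m)^(1/2) <= ((N+1)(N+2))^s for m >= 1. *)
Lemma fs_step s (m N : nat) : 2^-1 <= s -> (m <= N.+1)%N ->
  m%:R * fs s N <= fs s N.+2.
Proof.
move=> hs mN; have s0 : 0 <= s by apply: le_trans hs; rewrite invr_ge0.
rewrite /fs !factS !natrM mulrA powRM ?mulr_ge0 ?ler0n // ler_wpM2r ?powR_ge0 //.
have [->|m0] := posnP m; first by rewrite powR_ge0.
have m1 : 1 <= m%:R :> R by rewrite ler1n.
apply: (@le_trans _ _ ((m%:R * m%:R) `^ s)); last first.
  rewrite ge0_ler_powR ?nnegrE ?mulr_ge0 ?ler0n // ler_pM // ler_nat //.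
  exact: leq_trans mN (leqnSn _).
apply: (@le_trans _ _ ((m%:R * m%:R) `^ 2^-1)).
  by rewrite powR12_sqrt ?mulr_ge0 // -expr2 sqrtr_sqr ger0_norm.
by rewrite ler_powR // -natrM ler1n muln_gt0 m0.
Qed.

Section ExpPow.
Variables (s : R) (s0 : 0 < s).
Local Notation p := s^-1.

(* [kap K] is the rate for which exp(kap K t^(1/s)) is comparable with
   sup_k t^k / (K^k k!^s). *)
Definition kap (K : R) := s * K `^ (- p).

Lemma kap_gt0 (K : R) : 0 < K -> 0 < kap K.
Proof. by move=> K0; rewrite mulr_gt0 // powR_gt0. Qed.

Lemma kap_surj (k : R) : 0 < k -> exists2 K, 0 < K & kap K = k.
Proof.
move=> k0; exists ((k / s) `^ (- s)); first by rewrite powR_gt0 // divr_gt0.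
rewrite /kap -powRrM mulrNN mulfV ?gt_eqF // powRr1 ?divr_ge0 ?ltW //.
by rewrite mulrC divfK // gt_eqF.
Qed.

Lemma kapE (K t : R) : 0 < K -> 0 <= t -> kap K * t `^ p = s * (t / K) `^ p.
Proof.
move=> K0 t0; rewrite /kap -mulrA powRM ?invr_ge0 ?(ltW K0) //.
by rewrite -(powR_inv1 (ltW K0)) -powRrM mulN1r (mulrC (K `^ _)).
Qed.

Lemma pow_fact_le_expR (y : R) k : 0 <= y -> y ^+ k / k`!%:R <= expR y.
Proof.
move=> y0; case: k => [|k]; first by rewrite expr0 fact0 divr1 -expR0 ler_expR.
by apply: le_trans (expR_ge1Dxn k y0); rewrite lerDr.
Qed.

Lemma pow_s (y : R) k : 0 <= y -> (y ^+ k / k`!%:R) `^ s = (y `^ s) ^+ k / fs s k.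
Proof.
move=> y0; rewrite powRM ?exprn_ge0 ?invr_ge0 ?ler0n //.
rewrite -powR_inv1 ?ler0n // -powRrM mulN1r powRN -/(fs s k); congr (_ / _).
by rewrite -powR_mulrn // powRAC powR_mulrn ?powR_ge0.
Qed.

Lemma expR_s (y : R) : expR y `^ s = expR (s * y).
Proof. by rewrite -expRM mulrC. Qed.

Lemma div_pow (t K : R) : 0 <= t -> 0 < K -> ((t / K) `^ p) `^ s = t / K.
Proof.
move=> t0 K0; rewrite -powRrM mulVf ?gt_eqF // powRr1 ?divr_ge0 ?(ltW K0) //.
Qed.

(** This is the s-th power of y^k / k! <= exp y, with y = (t / K)^(1/s). *)
Lemma pow_le_exp (K t : R) k : 0 < K -> 0 <= t ->
  t ^+ k <= K ^+ k * fs s k * expR (kap K * t `^ p).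
Proof.
move=> K0 t0; rewrite kapE //; set y := _ `^ p.
have y0 : 0 <= y by exact: powR_ge0.
have := pow_fact_le_expR k y0.
move=> /(@ge0_ler_powR _ s (ltW s0)).
rewrite !nnegrE expR_ge0 divr_ge0 ?exprn_ge0 ?ler0n // => /(_ isT isT).
rewrite pow_s // expR_s div_pow // => H.
have -> : t ^+ k = K ^+ k * fs s k * ((t / K) ^+ k / fs s k).
  rewrite mulrACA (mulrC (K ^+ k)) -exprMn divfK ?gt_eqF //.
  by rewrite mulfV ?mulr1 // gt_eqF ?fs_gt0.
by rewrite ler_wpM2l // mulr_ge0 ?fs_ge0 // exprn_ge0 // ltW.
Qed.

(** For k the integer part of y, exp y <= e e^k, while k! <= k^k <= y^k. *)
Lemma expR_trunc (y : R) : 0 <= y ->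
  exists k, expR y <= expR 1 * ((expR 1 * y) ^+ k / k`!%:R).
Proof.
move=> y0; pose k := Num.truncn y; exists k.
have /andP[ky yk] := truncn_itv y0; rewrite -/k in ky yk.
have e1 : expR y <= expR 1 * expR 1 ^+ k.
  rewrite -exprS -expRM_natl mulr1 ler_expR; exact: ltW.
apply: (le_trans e1); rewrite ler_wpM2l ?expR_ge0 // exprMn -mulrA.
rewrite ler_peMr ?exprn_ge0 ?expR_ge0 // ler_pdivlMr ?ltr0n ?fact_gt0 // mul1r.
apply: (@le_trans _ _ (k%:R ^+ k)); last by rewrite lerXn2r ?nnegrE ?ler0n.
rewrite -natrX ler_nat {e1 ky yk}; elim: k => // k IH.
rewrite factS expnS leq_mul2l /= (leq_trans IH) //.
by case: k {IH} => // k; rewrite leq_exp2r.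
Qed.

(** A converse of [pow_le_exp], with an exponent k depending on t: exponential decay can therefore
    be proved by bounding all monomials. The price is a factor e^s per power of t. *)
Lemma exp_le_pow (K t : R) : 0 < K -> 0 <= t -> exists k,
  expR (kap K * t `^ p) * (K ^+ k * fs s k) <= expR s * (expR s * t) ^+ k.
Proof.
move=> K0 t0; rewrite kapE //; set y := _ `^ p.
have y0 : 0 <= y by exact: powR_ge0.
have [k H] := expR_trunc y0; exists k; move: H.
have e0 : 0 <= expR 1 :> R by exact: expR_ge0.
move=> /(@ge0_ler_powR _ s (ltW s0)).
rewrite !nnegrE expR_ge0 mulr_ge0 ?divr_ge0 ?exprn_ge0 ?mulr_ge0 ?ler0n //.
move=> /(_ isT isT); rewrite expR_s powRM ?divr_ge0 ?exprn_ge0 ?mulr_ge0 //.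
rewrite expR_s mulr1 pow_s ?mulr_ge0 // powRM // expR_s mulr1 div_pow // => H.
rewrite -ler_pdivlMr ?mulr_gt0 ?exprn_gt0 ?fs_gt0 //; apply: le_trans H _.
by rewrite [K ^+ k * _]mulrC invfM -!mulrA ler_wpM2l ?expR_ge0 // mulrA exprMn exprMn exprVn
  -!mulrA [_ / fs s k]mulrC.
Qed.

End ExpPow.

Section RowWeights.
Variables (s : R) (hs : 2^-1 <= s).
Local Notation p := s^-1.

Lemma s_gt0 : 0 < s. Proof. by apply: lt_le_trans hs; rewrite invr_gt0. Qed.
Let s0 := s_gt0.
Let p_ge0 : 0 <= p. Proof. by rewrite invr_ge0 ltW. Qed.
Let p_gt0 : 0 < p. Proof. by rewrite invr_gt0. Qed.
Let p_le2 : p <= 2. Proof. by rewrite -[2]invrK lef_pV2 // posrE ?invr_gt0. Qed.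

(** The larger of |a| and |b| is at least half of |a + b|, and 4 = 2^2 bounds 2^(1/s) because 1/s <=
    2. *)
Lemma powR_leD (a b : R) : `|a + b| `^ p <= 4 * (`|a| `^ p + `|b| `^ p).
Proof.
wlog ab : a b / `|a| <= `|b|.
  move=> H; have [|/ltW] := leP `|a| `|b|; first exact: H.
  by move=> /H; rewrite (addrC b) (addrC (_ `^ p)).
apply: (@le_trans _ _ ((2 * `|b|) `^ p)).
  rewrite ge0_ler_powR ?nnegrE ?mulr_ge0 // (le_trans (ler_normD _ _)) //.
  by rewrite mulr2n mulrDl mul1r lerD2r.
rewrite powRM //; apply: (@le_trans _ _ (4 * `|b| `^ p)).
  rewrite ler_wpM2r ?powR_ge0 //; apply: (@le_trans _ _ (2 `^ 2%:R)).
    by rewrite ler_powR // ler1n.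
  by rewrite powR_mulrn // -natrX.
by rewrite ler_wpM2l // lerDr powR_ge0.
Qed.

Definition Sp n (x : 'rV[R]_n) : R := \sum_j `|x 0 j| `^ p.

Lemma Sp_ge0 n (x : 'rV[R]_n) : 0 <= Sp x.
Proof. by apply: sumr_ge0 => j _; exact: powR_ge0. Qed.

Lemma norm_Sp n (x : 'rV[R]_n) : `|x| `^ p <= Sp x.
Proof.
have [->|/mx_norm_neq0[[a j] E]] := eqVneq `|x| 0.
  by rewrite powR0 ?Sp_ge0 // gt_eqF.
rewrite [X in X `^ _](_ : _ = `|x 0 j|); last by rewrite [LHS]E (ord1 a).
by rewrite /Sp (bigD1 j) //= lerDl sumr_ge0 // => k _; exact: powR_ge0.
Qed.

Lemma Sp_mulmx m n (L : 'M[R]_(m, n)) (B : R) (x : 'rV[R]_m) : 0 <= B ->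
  (forall i j, `|L i j| <= B) -> Sp (x *m L) <= n%:R * (m%:R * B) `^ p * Sp x.
Proof.
move=> B0 LB; apply: (@le_trans _ _ (\sum_(j < n) (m%:R * B) `^ p * Sp x)).
  apply: ler_sum => j _.
  apply: (@le_trans _ _ ((m%:R * B * `|x|) `^ p)).
    rewrite ge0_ler_powR ?nnegrE ?mulr_ge0 // mxE (le_trans (ler_norm_sum _ _ _)) //.
    apply: (@le_trans _ _ (\sum_(i < m) B * `|x|)).
      apply: ler_sum => i _; rewrite normrM mulrC ler_pM // rV_norm_coord //.
    by rewrite sumr_const card_ord -[leLHS]mulr_natl mulrA.
  by rewrite powRM ?mulr_ge0 // ler_wpM2l ?powR_ge0 // norm_Sp.
by rewrite sumr_const card_ord -[leLHS]mulr_natl mulrA.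
Qed.

(* The product of exp((d - c) |x_j|^(1/s)) over j in I and exp(d |x_j|^(1/s)) over
   the other coordinates. *)
Definition W n (I : {set 'I_n}) (c d : R) (x : 'rV[R]_n) : R :=
  expR (\sum_j (d - c * (j \in I)%:R) * `|x 0 j| `^ p).

Lemma W_ge0 n (I : {set 'I_n}) c d x : 0 <= W I c d x.
Proof. exact: expR_ge0. Qed.

Lemma le_W n (I J : {set 'I_n}) c c' d d' x :
  (forall j, d - c * (j \in I)%:R <= d' - c' * (j \in J)%:R) ->
  W I c d x <= W J c' d' x.
Proof.
by move=> H; rewrite ler_expR; apply: ler_sum => j _; rewrite ler_wpM2r ?powR_ge0.
Qed.

End RowWeights.
End Weights.

(** * Symbol classes with decay in some coordinates *)

Section Classes.
Context {R : realType}.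
Local Notation C := R[i].

Lemma eqW (a b : R) : a = b -> a <= b. Proof. by move=> ->. Qed.

(** The bound is pointwise, so that A may carry a weight evaluated at x. *)
Definition bnd n (h s A : R) (F : 'rV[R]_n -> C) (x : 'rV[R]_n) : Prop :=
  forall l, cabs (partials l F x) <= A * (h ^+ size l * fs s (size l)).

Lemma bnd_le n (h h' s A A' : R) (F : 'rV[R]_n -> C) x : 0 <= h -> h <= h' ->
  0 <= A -> A <= A' -> bnd h s A F x -> bnd h' s A' F x.
Proof.
move=> h0 hh A0 AA H l; apply: le_trans (H l) _.
have hn : h ^+ size l <= h' ^+ size l by rewrite lerXn2r ?nnegrE // (le_trans h0).
by rewrite ler_pM ?mulr_ge0 ?exprn_ge0 ?fs_ge0 // ler_wpM2r ?fs_ge0.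
Qed.

Lemma bnd_mul n (h s A B : R) (F G : 'rV[R]_n -> C) x :
  0 <= s -> 0 <= h -> 0 <= A -> 0 <= B -> smooth F -> smooth G ->
  bnd h s A F x -> bnd h s B G x -> bnd (2 * h) s (A * B) (fun y => F y * G y) x.
Proof.
move=> s0 h0 A0 B0 sF sG bF bG.
(* Generalised to products of derivatives: by Leibniz each derivative doubles the number of terms,
   which costs 2^|l|, that is, 2 h in place of h. *)
suff H l l1 l2 : cabs (partials l (fun y => partials l1 F y * partials l2 G y) x) <=
    A * B * 2 ^+ size l * (h ^+ (size l + size l1 + size l2)
      * fs s (size l + size l1 + size l2)).
  by move=> l; have := H l [::] [::]; rewrite !addn0 exprMn -!mulrA.
elim/last_ind: l l1 l2 => [|l i IH] l1 l2.
  rewrite expr0 mulr1 /= add0n cabsM.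
  apply: (le_trans (ler_pM (cabs_ge0 _) (cabs_ge0 _) (bF l1) (bG l2))).
  rewrite mulrACA ler_wpM2l ?mulr_ge0 // mulrACA -exprD ler_wpM2l ?exprn_ge0 //.
  exact: fs_mul.
rewrite partials_rcons.
have [_ ->] := partialM i (smooth_partials l1 sF) (smooth_partials l2 sG).
have s1 := smoothM (smooth_partials (i :: l1) sF) (smooth_partials l2 sG).
have s2 := smoothM (smooth_partials l1 sF) (smooth_partials (i :: l2) sG).
have -> := partialsD l s1 s2.
apply: (le_trans (cabsD _ _)).
apply: (le_trans (lerD (IH (i :: l1) l2) (IH l1 (i :: l2)))).
rewrite size_rcons /= !addSn !addnS -mulr2n -[X in X <= _]mulr_natl exprS.
rewrite !addSn; move: (h ^+ _) (fs s _) (2 ^+ _) => a b c; apply: eqW; ring.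
Qed.

Lemma bnd_comp m n (h s A K : R) (L : 'M[R]_(m, n)) (F : 'rV[R]_n -> C) x :
  0 <= s -> 0 <= h -> 0 <= A -> 0 <= K -> (forall i, \sum_j `|L i j| <= K) ->
  smooth F -> bnd h s A F (x *m L) -> bnd (K * h) s A (fun y => F (y *m L)) x.
Proof.
move=> s0 h0 A0 K0 LK sF bF.
(* Derivatives of F are carried along since the chain rule creates them; each one multiplies the
   bound by a row sum of |L|, hence by at most K. *)
suff H l l1 : cabs (partials l (fun y => partials l1 F (y *m L)) x) <=
    A * K ^+ size l * (h ^+ (size l + size l1) * fs s (size l + size l1)).
  by move=> l; have := H l [::]; rewrite !addn0 exprMn -!mulrA.
elim/last_ind: l l1 => [|l i IH] l1; first by rewrite expr0 mulr1 /= add0n.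
rewrite partials_rcons.
have [_ ->] := partial_comp L i (smooth_partials l1 sF).
have sj j : smooth (fun x => (L i j)%:C * partials (j :: l1) F (x *m L)).
  by apply: smoothZ; apply: smooth_comp; exact: smooth_partials.
have -> := partials_sum l (index_enum _) sj.
set Q := A * K ^+ size l * (h ^+ (size l + size l1).+1 * fs s (size l + size l1).+1).
have Q0 : 0 <= Q by rewrite !mulr_ge0 ?exprn_ge0 ?fs_ge0.
apply: (@le_trans _ _ (\sum_j `|L i j| * Q)).
  elim/big_rec2: _ => [|j a z _ H]; first by rewrite /cabs ComplexField.Normc.normc0.
  apply: (le_trans (cabsD _ _)); apply: lerD => //.
  have -> := partialsZ l (L i j)%:C (smooth_comp L (smooth_partials (j :: l1) sF)).
  rewrite cabsM ler_pM ?cabs_ge0 //.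
    by rewrite /cabs /= expr0n addr0 sqrtr_sqr.
  by rewrite /Q -addnS; exact: IH.
rewrite -mulr_suml size_rcons !addSn.
apply: (@le_trans _ _ (K * Q)); first by rewrite ler_wpM2r.
by rewrite /Q (exprS K) !mulrA (mulrC K A).
Qed.

Variables (s : R) (hs : 2^-1 <= s).
Let s0 : 0 < s := s_gt0 hs.
Let s_ge0 : 0 <= s := ltW s0.

(* One h and one c must serve all d > 0; the constant A may depend on d. *)
Definition cls n (I : {set 'I_n}) (T : Type) (F : T -> 'rV[R]_n -> C) : Prop :=
  (forall t, smooth (F t)) /\
  exists h c : R, [/\ 0 < h, 0 < c & forall d : R, 0 < d ->
    exists2 A : R, 0 <= A & forall t x, bnd h s (A * W s I c d x) (F t) x].

Lemma cls_smooth n I T (F : T -> 'rV[R]_n -> C) t : cls I F -> smooth (F t).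
Proof. by case. Qed.

Lemma cls_sub n (I : {set 'I_n}) T T' (u : T' -> T) (F : T -> 'rV[R]_n -> C) :
  cls I F -> cls I (fun t => F (u t)).
Proof.
move=> [sF [h [c [h0 c0 H]]]]; split=> //; exists h, c; split=> // d d0.
by have [A A0 HA] := H d d0; exists A.
Qed.

Lemma cls_mono n (I J : {set 'I_n}) T (F : T -> 'rV[R]_n -> C) :
  I \subset J -> cls J F -> cls I F.
Proof.
move=> IJ [sF [h [c [h0 c0 H]]]]; split=> //; exists h, c; split=> // d d0.
have [A A0 HA] := H d d0; exists A => // t x.
apply: bnd_le (HA t x); rewrite ?(ltW h0) ?mulr_ge0 ?W_ge0 // ler_wpM2l //.
apply: le_W => j; rewrite lerB // ler_wpM2l ?(ltW c0) // ler_nat.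
by have := fintype.subsetP IJ j; case: (j \in I) => // ->.
Qed.

Lemma clsM n (I J : {set 'I_n}) T (F G : T -> 'rV[R]_n -> C) :
  cls I F -> cls J G -> cls (I :|: J) (fun t x => F t x * G t x).
Proof.
move=> [sF [h [c [h0 c0 H]]]] [sG [k [e [k0 e0 K]]]].
split=> [t|]; first exact: smoothM.
exists (2 * Num.max h k), (Num.min c e); split.
- by rewrite mulr_gt0 // lt_max h0.
- by rewrite lt_min c0.
(* Half of the allowed growth d goes to each factor. *)
- move=> d d0; have d2 : 0 < d / 2 by rewrite divr_gt0.
  have [A A0 HA] := H _ d2; have [B B0 HB] := K _ d2.
  exists (A * B); first by rewrite mulr_ge0.
  move=> t x.
  have bF : bnd (Num.max h k) s (A * W s I c (d / 2) x) (F t) x.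
    by apply: bnd_le (HA t x); rewrite ?(ltW h0) ?mulr_ge0 ?W_ge0 // le_max lexx.
  have bG : bnd (Num.max h k) s (B * W s J e (d / 2) x) (G t) x.
    by apply: bnd_le (HB t x); rewrite ?(ltW k0) ?mulr_ge0 ?W_ge0 // le_max lexx orbT.
  have m0 : 0 <= Num.max h k by rewrite le_max (ltW h0).
  have := bnd_mul s_ge0 m0 _ _ (sF t) (sG t) bF bG.
  rewrite !mulr_ge0 ?W_ge0 // => /(_ isT isT).
  apply: bnd_le; rewrite ?mulr_ge0 ?W_ge0 //.
  rewrite mulrACA ler_wpM2l ?mulr_ge0 // /W -expRD -big_split /= ler_expR.
  apply: ler_sum => j _; rewrite -mulrDl ler_wpM2r ?powR_ge0 //.
  rewrite addrACA -splitr -opprD lerB // inE.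
  have me : Num.min c e <= c by rewrite ge_min lexx.
  have me' : Num.min c e <= e by rewrite ge_min lexx orbT.
  case: (j \in I) (j \in J) => [] []; rewrite ?mulr1 ?mulr0 ?addr0 ?add0r //.
  by rewrite (le_trans me) // lerDl ltW.
Qed.

Lemma clsM0 n (I : {set 'I_n}) T (F G : T -> 'rV[R]_n -> C) :
  cls finset.set0 F -> cls I G -> cls I (fun t x => F t x * G t x).
Proof. by move=> cF cG; have := clsM cF cG; rewrite finset.set0U. Qed.

Lemma clsD n (I : {set 'I_n}) T (F G : T -> 'rV[R]_n -> C) :
  cls I F -> cls I G -> cls I (fun t x => F t x + G t x).
Proof.
move=> [sF [h [c [h0 c0 H]]]] [sG [k [e [k0 e0 K]]]].
split=> [t|]; first exact: smoothD.
exists (Num.max h k), (Num.min c e); split.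
- by rewrite lt_max h0.
- by rewrite lt_min c0.
- move=> d d0; have [A A0 HA] := H _ d0; have [B B0 HB] := K _ d0.
  exists (A + B); first by rewrite addr_ge0.
  have me : Num.min c e <= c by rewrite ge_min lexx.
  have me' : Num.min c e <= e by rewrite ge_min lexx orbT.
  move=> t x l.
  have bF : bnd (Num.max h k) s (A * W s I (Num.min c e) d x) (F t) x.
    apply: bnd_le (HA t x); rewrite ?(ltW h0) ?mulr_ge0 ?W_ge0 // ?le_max ?lexx //.
    by rewrite ler_wpM2l //; apply: le_W => j; rewrite lerB // ler_wpM2r ?ler0n.
  have bG : bnd (Num.max h k) s (B * W s I (Num.min c e) d x) (G t) x.
    apply: bnd_le (HB t x); rewrite ?(ltW k0) ?mulr_ge0 ?W_ge0 // ?le_max ?lexx ?orbT //.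
    by rewrite ler_wpM2l //; apply: le_W => j; rewrite lerB // ler_wpM2r ?ler0n.
  have -> := partialsD l (sF t) (sG t).
  by rewrite (le_trans (cabsD _ _)) // !mulrDl lerD.
Qed.

Lemma clsZ n (I : {set 'I_n}) T (k : T -> C) (M : R) (F : T -> 'rV[R]_n -> C) :
  (forall t, cabs (k t) <= M) -> cls I F -> cls I (fun t x => k t * F t x).
Proof.
move=> kM [sF [h [c [h0 c0 H]]]]; split=> [t|]; first exact: smoothZ.
exists h, c; split=> // d d0; have [A A0 HA] := H d d0.
exists (`|M| * A) => [|t x l]; first by rewrite mulr_ge0.
have -> := partialsZ l (k t) (sF t).
rewrite cabsM -!mulrA ler_pM ?cabs_ge0 //; last by rewrite mulrA; exact: HA.
exact: le_trans (kM t) (ler_norm _).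
Qed.

(** One more derivative replaces k!^s by (k+1)!^s, which is at most (2^s)^(k+1) k!^s; this is
    absorbed by enlarging h. *)
Lemma cls_partial n (I : {set 'I_n}) T (i : T -> 'I_n) (F : T -> 'rV[R]_n -> C) :
  cls I F -> cls I (fun t => partial (i t) (F t)).
Proof.
move=> [sF [h [c [h0 c0 H]]]]; split=> [t|]; first exact: smooth_partial.
exists (2 `^ s * h), c; split=> //; first by rewrite mulr_gt0 ?powR_gt0.
move=> d d0; have [A A0 HA] := H d d0.
exists (A * (2 `^ s * h)) => [|t x l]; first by rewrite !mulr_ge0 ?powR_ge0 // ltW.
rewrite -(partials_rcons l (i t) (F t)); apply: le_trans (HA t x _) _.
rewrite size_rcons; have := fs_add (size l) 1 s_ge0; rewrite addn1.
have -> : fs s 1 = 1 by rewrite /fs powR1.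
rewrite mulr1 => F1.
apply: (@le_trans _ _ (A * W s I c d x * (h ^+ (size l).+1 *
    ((2 `^ s) ^+ (size l).+1 * fs s (size l))))).
  by rewrite ler_wpM2l ?mulr_ge0 ?W_ge0 // ler_wpM2l // exprn_ge0 // ltW.
by rewrite exprMn !exprS; apply: eqW; ring.
Qed.

Lemma cls_pull m n (I : {set 'I_m}) (J : {set 'I_n}) T (L : T -> 'M[R]_(m, n))
    (B k : R) (F : T -> 'rV[R]_n -> C) :
  (forall t i j, `|L t i j| <= B) -> 0 < k ->
  (forall t (x : 'rV[R]_m), \sum_(i in I) `|x 0 i| `^ s^-1 <=
     k * \sum_(j in J) `|(x *m L t) 0 j| `^ s^-1) ->
  cls J F -> cls I (fun t x => F t (x *m L t)).
Proof.
move=> LB k0 HIJ [sF [h [c [h0 c0 H]]]]; split=> [t|]; first exact: smooth_comp.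
exists ((n%:R * `|B| + 1) * h), (c / k); split.
- by rewrite mulr_gt0 // ltr_wpDl // mulr_ge0.
- by rewrite divr_gt0.
move=> d d0; pose Q := n%:R * (m%:R * `|B|) `^ s^-1 + 1.
have Q0 : 0 < Q by rewrite ltr_wpDl // mulr_ge0 ?powR_ge0.
have dQ : 0 < d / Q by rewrite divr_gt0.
have [A A0 HA] := H _ dQ; exists A => // t x.
have Wle : W s J c (d / Q) (x *m L t) <= W s I (c / k) d x.
  rewrite ler_expR.
  have E p (K : {set 'I_p}) (y : 'rV[R]_p) a b :
      \sum_j (a - b * (j \in K)%:R) * `|y 0 j| `^ s^-1 =
      a * Sp s y - b * \sum_(j in K) `|y 0 j| `^ s^-1.
    rewrite /Sp !mulr_sumr [X in _ - X]big_mkcond -sumrB; apply: eq_bigr => j _.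
    by rewrite mulrBl; case: (j \in K); rewrite ?mulr1 // mulr0 mul0r.
  rewrite !E; apply: lerB.
    rewrite mulrAC -mulrA ler_wpM2l ?(ltW d0) // ler_pdivrMr // mulrC.
    apply: le_trans (Sp_mulmx hs x (normr_ge0 B) _) _.
      by move=> i j; exact: le_trans (LB t i j) (ler_norm _).
    by rewrite ler_wpM2r ?Sp_ge0 // lerDl.
  by rewrite -mulrA ler_wpM2l ?(ltW c0) // ler_pdivrMl.
have K0 : 0 <= n%:R * `|B| + 1 :> R by rewrite addr_ge0 // mulr_ge0.
have := bnd_comp s_ge0 (ltW h0) _ K0 _ (sF t) (HA t (x *m L t)).
rewrite mulr_ge0 ?W_ge0 // => /(_ isT) bc.
apply: bnd_le (bc _); rewrite ?mulr_ge0 ?W_ge0 ?(ltW h0) // ?ler_wpM2l //.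
move=> i; apply: (@le_trans _ _ (\sum_(j < n) `|B|)).
  by apply: ler_sum => j _; exact: le_trans (LB t i j) (ler_norm _).
by rewrite sumr_const card_ord -[leLHS]mulr_natl lerDl.
Qed.

End Classes.

(** * From the Gelfand-Shilov norms and the symbol class to the weighted classes, and back *)

Section Conversions.
Context {R : realType}.
Local Notation C := R[i].

Definition full n : {set 'I_n} := [set i | true]%SET.

Lemma in_full n (i : 'I_n) : i \in full n.
Proof. by rewrite inE. Qed.

Lemma sub_full n (I : {set 'I_n}) : I \subset full n.
Proof. by apply/fintype.subsetP => i _; exact: in_full. Qed.

Lemma cabs0 : cabs (0 : C) = 0.
Proof. by rewrite /cabs ComplexField.Normc.normc0. Qed.

Lemma cabsR (r : R) : cabs r%:C = `|r|.
Proof. by rewrite /cabs /= expr0n addr0 sqrtr_sqr. Qed.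

Lemma cabs1 : cabs (1 : C) = 1.
Proof. by rewrite -[1 : C]/(1%:C) cabsR normr1. Qed.

Lemma cabsN (z : C) : cabs (- z) = cabs z.
Proof. by rewrite -mulN1r cabsM /cabs /= !(oppr0, sqrrN, expr1n, expr0n) addr0 sqrtr1 mul1r. Qed.

Lemma cabsX (z : C) k : cabs (z ^+ k) = cabs z ^+ k.
Proof. by elim: k => [|k IH]; rewrite ?expr0 ?cabs1 // !exprS cabsM IH. Qed.

Lemma partials_cst n (l : seq 'I_n) (k : C) :
  partials l (fun _ : 'rV[R]_n => k) = fun=> if l is [::] then k else 0.
Proof.
case/lastP: l => [|l i]; first exact: erefl.
rewrite partials_rcons.
have -> : partial i (fun _ : 'rV[R]_n => k) = fun=> 0.
  by apply/funext => x; apply: partialE; exact: cder_cst.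
rewrite partials0; apply/funext => x.
by case: l.
Qed.

Lemma smooth_cst n (k : C) : smooth (fun _ : 'rV[R]_n => k).
Proof.
apply: (@smooth_coind R n [set f | exists k, f = fun=> k]); last by exists k.
move=> _ [c ->]; split; first by split; exact: cst_continuous.
move=> i; have [d E] := @cderivable_partial R n i (fun=> c) (fun=> 0)
  (fun x => cder_cst c x (delta_mx 0 i)).
by split=> //; exists 0.
Qed.

Lemma cder_coord n (i : 'I_n) (x v : 'rV[R]_n) :
  cder (fun y : 'rV[R]_n => (y 0 i)%:C) x v (v 0 i)%:C.
Proof.
split=> /=; last exact: is_derive_cst.
have E : (fun h : R => h^-1 *: ((h *: v + x) 0 i - x 0 i : R^o)) @ 0^' --> (v 0 i : R^o).
  apply: cvg_near_cst; near=> h.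
  have h0 : h != 0 by near: h; exact: nbhs_dnbhs_neq.
  by rewrite !mxE addrK /GRing.scale /= mulKf.
by split; [apply/cvg_ex; exists (v 0 i)|apply/cvg_lim].
Unshelve. all: by end_near. Qed.

Lemma partial_coord n (i j : 'I_n) :
  cderivable j (fun x : 'rV[R]_n => (x 0 i)%:C) /\
  partial j (fun x : 'rV[R]_n => (x 0 i)%:C) = fun=> (i == j)%:R%:C.
Proof.
apply: cderivable_partial => x; have := cder_coord i x (delta_mx 0 j).
by rewrite mxE eqxx.
Qed.

Lemma smooth_coord n (i : 'I_n) : smooth (fun x : 'rV[R]_n => (x 0 i)%:C).
Proof.
pose X : 'rV[R]_n -> C := fun x => (x 0 i)%:C; rewrite -/X.
apply: (@smooth_coind R n [set f | f = X \/ exists k, f = fun=> k]); last by left.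
move=> f [->|[c ->]].
  split; first by split; [exact: coord_continuous|exact: cst_continuous].
  move=> j; have [d ->] := partial_coord i j; split=> //.
  by right; exists (i == j)%:R%:C.
split; first by split; exact: cst_continuous.
move=> j; have [d E] := @cderivable_partial R n j (fun=> c) (fun=> 0)
  (fun x => cder_cst c x (delta_mx 0 j)).
by split=> //; right; exists 0.
Qed.

Variables (s : R) (hs : 2^-1 <= s).
Let s0 : 0 < s := s_gt0 hs.
Let s_ge0 : 0 <= s := ltW s0.

Lemma W_set0_ge1 n (c d : R) (x : 'rV[R]_n) : 0 <= d -> 1 <= W s finset.set0 c d x.
Proof.
move=> d0; rewrite -expR0 ler_expR sumr_ge0 // => j _.
by rewrite inE mulr0 subr0 mulr_ge0 ?powR_ge0.
Qed.

(** Linear growth is below every exp(d |x_i|^(1/s)) up to a constant, by [pow_le_exp] for k = 1, and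
    derivatives of order above 1 vanish. *)
Lemma cls_coord n (i : 'I_n) :
  cls s finset.set0 (fun (_ : unit) (x : 'rV[R]_n) => (x 0 i)%:C).
Proof.
split=> [t|]; first exact: smooth_coord.
exists 1, 1; split=> // d d0.
have [K K0 KE] := kap_surj s0 d0.
exists (K + 1) => [|_ x l]; first by rewrite addr_ge0 // ltW.
have W1 := W_set0_ge1 1 x (ltW d0).
have K1 : 0 <= K + 1 by rewrite addr_ge0 // ltW.
case/lastP: l => [|l j].
  rewrite [X in cabs X](_ : _ = (x 0 i)%:C) // cabsR [size _]/= expr0 fs0 !mulr1.
  have := pow_le_exp s0 1 K0 (normr_ge0 (x 0 i)).
  rewrite !expr1 KE /fs powR1 mulr1 => H; apply: (le_trans H).
  rewrite ler_pM ?(ltW K0) ?expR_ge0 ?lerDl // ler_expR (bigD1 i) //= inE mulr0 subr0.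
  by rewrite lerDl sumr_ge0 // => k _; rewrite inE mulr0 subr0 mulr_ge0 ?powR_ge0 ?ltW.
rewrite partials_rcons (partial_coord i j).2 partials_cst.
have Q : 0 <= 1 ^+ size (rcons l j) * fs s (size (rcons l j)).
  by rewrite mulr_ge0 ?exprn_ge0 ?fs_ge0.
case: l Q => [|k l] Q; last by rewrite cabs0 mulr_ge0 ?Q // mulr_ge0 ?W_ge0.
rewrite cabsR [size _]/= expr1 mul1r /fs powR1 mulr1.
apply: (@le_trans _ _ 1).
  by case: (i == j); rewrite ?normr1 ?normr0.
by rewrite -[leLHS]mulr1 ler_pM // lerDr ltW.
Qed.

Lemma mfact_le n (al : 'I_n -> nat) : (mfact al <= (msize al)`!)%N.
Proof.
rewrite /mfact /msize; elim: (index_enum _) => [|i r IH]; first by rewrite !big_nil.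
rewrite !big_cons; apply: (leq_trans (leq_mul (leqnn _) IH)).
set m := al i; set k := (\sum_(j <- r) al j)%N.
rewrite -(@bin_fact (m + k) m) ?leq_addr // addKn.
by rewrite leq_pmull // bin_gt0 leq_addr.
Qed.

Lemma fs_mfact_le n (al : 'I_n -> nat) : (mfact al)%:R `^ s <= fs s (msize al).
Proof. by rewrite /fs ge0_ler_powR ?nnegrE ?ler0n // ler_nat mfact_le. Qed.

Lemma prod_fs n (al : 'I_n -> nat) : \prod_i fs s (al i) = (mfact al)%:R `^ s.
Proof.
rewrite /mfact; elim: (index_enum _) => [|i r IH]; first by rewrite !big_nil powR1.
by rewrite !big_cons IH natrM powRM ?ler0n.
Qed.

Lemma fs_msize_le n (al : 'I_n -> nat) :
  fs s (msize al) <= ((2 `^ s) ^+ n) ^+ msize al * \prod_i fs s (al i).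
Proof.
have c1 : 1 <= 2 `^ s by rewrite -[leLHS](powRr0 2) ler_powR // ler1n.
suff H (r : seq 'I_n) : fs s (\sum_(i <- r) al i) <=
    ((2 `^ s) ^+ size r) ^+ (\sum_(i <- r) al i) * \prod_(i <- r) fs s (al i).
  have := H (index_enum _); rewrite /msize.
  by rewrite [index_enum _]unlock -enumT size_enum_ord.
elim: r => [|i r IH]; first by rewrite !big_nil fs0 expr0 mulr1.
rewrite !big_cons; set m := al i; set k := (\sum_(j <- r) al j)%N.
apply: (le_trans (fs_add m k s_ge0)).
apply: (@le_trans _ _ ((2 `^ s) ^+ (m + k) * (fs s m *
   (((2 `^ s) ^+ size r) ^+ k * \prod_(i <- r) fs s (al i))))).
  by rewrite ler_wpM2l ?exprn_ge0 ?powR_ge0 // ler_wpM2l ?fs_ge0.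
have P0 : 0 <= \prod_(j <- r) fs s (al j) by apply: prodr_ge0 => j _; exact: fs_ge0.
rewrite (mulrCA (fs s m)) [leLHS]mulrA; apply: ler_wpM2r; first by rewrite mulr_ge0 ?fs_ge0.
rewrite /= exprS exprMn ler_wpM2l ?exprn_ge0 ?powR_ge0 //.
by rewrite -!exprM ler_weXn2l // leq_mul // leq_addl.
Qed.

Lemma mpow_norm n (x : 'rV[R]_n) be : `|mpow x be| = \prod_i `|x 0 i| ^+ be i.
Proof. by rewrite /mpow normr_prod; apply: eq_bigr => i _; rewrite normrX. Qed.

Lemma prod_expn n (K : R) (be : 'I_n -> nat) : \prod_i K ^+ be i = K ^+ msize be.
Proof. by rewrite prodrXr. Qed.

Lemma W_full n (c d : R) (x : 'rV[R]_n) :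
  W s (full n) c d x = \prod_i expR ((d - c) * `|x 0 i| `^ s^-1).
Proof.
rewrite /W expR_sum; apply: eq_bigr => i _.
by rewrite in_full mulr1.
Qed.

(** The exponents [be j] are chosen by [exp_le_pow] for the point x at hand, so that x^be dominates
    the product of the exponentials; the norm then bounds the derivatives multiplied by that
    product. *)
Lemma cls_full_of_gs n T (F : T -> 'rV[R]_n -> C) (h M : R) : 0 < h ->
  (forall t, smooth (F t)) -> (forall t, (gs_norm s h (F t) <= M%:E)%E) ->
  cls s (full n) F.
Proof.
move=> h0 sF HM; split=> //.
(* The factor e^s offsets the loss in [exp_le_pow]: the powers of e^s cancel against K^|be| and
   leave the h^|be| of the norm. *)
pose K := expR s * h; have K0 : 0 < K by rewrite mulr_gt0 ?expR_gt0.
exists h, (kap s K); split=> //; first exact: kap_gt0.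
move=> d d0; exists (expR s ^+ n * `|M|) => [|t x l].
  by rewrite mulr_ge0 ?exprn_ge0 ?expR_ge0.
have H j := exp_le_pow s0 K0 (normr_ge0 (x 0 j)).
pose be j := projT1 (cid (H j)).
have Hbe j : expR (kap s K * `|x 0 j| `^ s^-1) * (K ^+ be j * fs s (be j)) <=
   expR s * (expR s * `|x 0 j|) ^+ be j by exact: projT2 (cid (H j)).
rewrite (partials_mderiv l (sF t)); set al := fun i => count_mem i l.
have al_l : msize al = size l by rewrite -size_mseq (perm_size (perm_mseq l)).
have := (gs_norm_leP s (F t) M h0).1 (HM t) al be x.
rewrite cabsM cabsR mpow_norm; set D := cabs _ => HD.
have prodH : \prod_j expR (kap s K * `|x 0 j| `^ s^-1) * (K ^+ msize be * (mfact be)%:R `^ s)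
   <= expR s ^+ n * (expR s ^+ msize be * \prod_j `|x 0 j| ^+ be j).
  have -> : expR s ^+ n = \prod_(i < n) expR s by rewrite prodr_const card_ord.
  rewrite -prod_fs -!prod_expn -!big_split /=.
  apply: ler_prod => j _; rewrite !mulr_ge0 ?expR_ge0 ?exprn_ge0 ?fs_ge0 ?(ltW K0) //=.
  by rewrite -exprMn; exact: Hbe.
have W0 : 0 < \prod_j expR (kap s K * `|x 0 j| `^ s^-1).
  by apply: prodr_gt0 => j _; exact: expR_gt0.
have Q0 : 0 < K ^+ msize be * (mfact be)%:R `^ s.
  by rewrite mulr_gt0 ?exprn_gt0 // -prod_fs prodr_gt0 // => j _; exact: fs_gt0.
have Wle : (\prod_j expR (kap s K * `|x 0 j| `^ s^-1))^-1 <= W s (full n) (kap s K) d x.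
  rewrite W_full -prodfV; apply: ler_prod => j _; rewrite invr_ge0 expR_ge0 /=.
  by rewrite -expRN ler_expR -mulNr ler_wpM2r ?powR_ge0 // lerDr ltW.
apply: (@le_trans _ _ (expR s ^+ n * `|M| * (\prod_j expR (kap s K * `|x 0 j| `^ s^-1))^-1
    * (h ^+ size l * fs s (size l)))); last first.
  rewrite ler_wpM2r ?mulr_ge0 ?exprn_ge0 ?(ltW h0) ?fs_ge0 // ler_wpM2l //.
rewrite mulrAC ler_pdivlMr // -(ler_pM2r Q0) -[leLHS]mulrA.
have D0 : 0 <= D by exact: cabs_ge0.
apply: (le_trans (ler_wpM2l D0 prodH)).
have r1 (a b c e : R) : a * (b * (c * e)) = b * c * (e * a) by clear; ring.
have r2 (a b c e f g k : R) : a * b * (c * e) * (f * g * k) = a * f * (b * (c * g * (e * k))).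
  by clear; ring.
rewrite r1 /K exprMn r2.
rewrite ler_wpM2l ?mulr_ge0 ?exprn_ge0 ?expR_ge0 //; apply: (le_trans HD).
rewrite al_l exprD natrM powRM ?ler0n //.
have Q1 : 0 <= h ^+ size l * h ^+ msize be by rewrite mulr_ge0 // exprn_ge0 // ltW.
apply: (@le_trans _ _ (`|M| * (h ^+ size l * h ^+ msize be *
   ((mfact al)%:R `^ s * (mfact be)%:R `^ s)))).
  by rewrite ler_wpM2r ?ler_norm // mulr_ge0 // mulr_ge0 ?powR_ge0.
rewrite ler_wpM2l // ler_wpM2l // ler_wpM2r ?powR_ge0 //.
by rewrite -al_l fs_mfact_le.
Qed.

(** With the allowance d = c/2 the weight is exp(-(c/2) |x_j|^(1/s)) in each coordinate, which is
    exactly what cancels the exponentials that [pow_le_exp] spends on the monomials. *)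
Lemma gs_of_cls_full n T (F : T -> 'rV[R]_n -> C) : cls s (full n) F ->
  exists2 h : R, 0 < h & exists M, forall t, (gs_norm s h (F t) <= M%:E)%E.
Proof.
move=> [sF [h [c [h0 c0 H]]]]; have c2 : 0 < c / 2 by rewrite divr_gt0.
have [A A0 HA] := H _ c2; have [K K0 KE] := kap_surj s0 c2.
pose H0 := Num.max K (h * (2 `^ s) ^+ n).
have H00 : 0 < H0 by rewrite lt_max K0.
exists H0 => //; exists A => t; apply/gs_norm_leP => // al be x.
rewrite cabsM cabsR mpow_norm.
have P0 (f : 'I_n -> R) : (forall i, 0 <= f i) -> 0 <= \prod_i f i.
  by move=> f0; apply: prodr_ge0 => i _.
have h1 : \prod_i `|x 0 i| ^+ be i <=
    K ^+ msize be * (mfact be)%:R `^ s * \prod_i expR (c / 2 * `|x 0 i| `^ s^-1).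
  rewrite -prod_fs -prod_expn -!big_split /=; apply: ler_prod => i _.
  by rewrite exprn_ge0 //= -KE; exact: pow_le_exp.
have := HA t x (mseq al); rewrite -/(mderiv al (F t)) size_mseq => h2.
have h3 := fs_msize_le al.
apply: (le_trans (ler_pM _ (cabs_ge0 _) h1 h2)).
  by apply: P0 => i; rewrite exprn_ge0.
rewrite W_full.
have E1 : (\prod_i expR (c / 2 * `|x 0 i| `^ s^-1)) *
    (\prod_i expR ((c / 2 - c) * `|x 0 i| `^ s^-1)) = 1.
  rewrite -big_split big1 //= => i _; rewrite -expRD -mulrDl.
  rewrite (_ : _ + _ = 0) ?mul0r ?expR0 //.
  by rewrite addrA -splitr subrr.
rewrite [leLHS](_ : _ = A * (K ^+ msize be * (mfact be)%:R `^ s *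
    (h ^+ msize al * fs s (msize al)))); last first.
  have r (a b q e f g k : R) : a * b * q * (e * f * (g * k)) = e * (a * b * (g * k)) * (q * f).
    by clear; ring.
  by rewrite r E1 mulr1.
rewrite ler_wpM2l // natrM powRM ?ler0n // exprD.
have a1 : K ^+ msize be <= H0 ^+ msize be.
  by rewrite lerXn2r ?nnegrE ?(ltW K0) ?(ltW H00) // /H0 le_max lexx.
have hc0 : 0 <= h * (2 `^ s) ^+ n by rewrite mulr_ge0 ?exprn_ge0 ?powR_ge0 // ltW.
have a2 : h ^+ msize al * ((2 `^ s) ^+ n) ^+ msize al <= H0 ^+ msize al.
  by rewrite -exprMn lerXn2r ?nnegrE ?(ltW H00) // /H0 le_max lexx orbT.
rewrite prod_fs in h3.
have a3 : h ^+ msize al * fs s (msize al) <= H0 ^+ msize al * (mfact al)%:R `^ s.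
  apply: (le_trans (ler_wpM2l (exprn_ge0 _ (ltW h0)) h3)).
  by rewrite mulrA ler_wpM2r ?powR_ge0.
rewrite mulrC (mulrACA (H0 ^+ _)); apply: ler_pM => //.
- by rewrite mulr_ge0 ?fs_ge0 // exprn_ge0 // ltW.
- by rewrite mulr_ge0 ?powR_ge0 // exprn_ge0 // ltW.
by rewrite ler_wpM2r ?powR_ge0.
Qed.

Lemma enorm_le n (x : 'rV[R]_n) : enorm x <= (n%:R + 1) * `|x|.
Proof.
have Q : 0 <= (n%:R + 1) * `|x| by rewrite mulr_ge0 // addr_ge0.
rewrite -(ger0_norm Q) -sqrtr_sqr /enorm ler_sqrt ?sqr_ge0 // /dotp.
apply: (@le_trans _ _ (\sum_(i < n) `|x| ^+ 2)).
  apply: ler_sum => i _; rewrite -expr2 -real_normK ?num_real //.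
  by rewrite lerXn2r ?nnegrE ?rV_norm_coord.
rewrite sumr_const card_ord -[leLHS]mulr_natl exprMn ler_wpM2r ?sqr_ge0 //.
by rewrite expr2 -[leLHS]mulr1 ler_pM ?lerDl ?lerDr.
Qed.

Lemma cls_of_Gamma n (a : 'rV[R]_n -> C) : Gamma_infty s a ->
  cls s finset.set0 (fun _ : unit => a).
Proof.
move=> [sa [eps eps0 H]]; split=> //; exists eps, 1; split=> // d d0.
(* [Q] compares the Euclidean norm with the max norm after raising to the power 1/s; dividing by it
   is allowed because the symbol estimate holds for every h > 0. *)
pose Q : R := (n%:R + 1) `^ s^-1; have Q0 : 0 < Q by rewrite powR_gt0 // ltr_wpDl.
have [A A0 HA] := H (d / Q) (divr_gt0 d0 Q0); exists A; first exact: ltW.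
move=> _ x l; rewrite (partials_mderiv l sa); set al := fun i => count_mem i l.
have al_l : msize al = size l by rewrite -size_mseq (perm_size (perm_mseq l)).
apply: (le_trans (HA al x)); rewrite al_l -[leRHS]mulrA ler_wpM2l ?(ltW A0) // mulrC.
apply: ler_pM; rewrite ?expR_ge0 ?mulr_ge0 ?exprn_ge0 ?powR_ge0 ?(ltW eps0) //.
  rewrite ler_expR (_ : \sum_j _ = d * Sp s x); last first.
    by rewrite /Sp mulr_sumr; apply: eq_bigr => j _; rewrite inE mulr0 subr0.
  rewrite -mulrA ler_wpM2l ?(ltW d0) // ler_pdivrMl //.
  have p0 : 0 <= s^-1 by rewrite invr_ge0.
  apply: le_trans (ler_wpM2l (ltW Q0) (norm_Sp hs x)).
  rewrite /Q -powRM ?addr_ge0 // ge0_ler_powR ?nnegrE ?sqrtr_ge0 ?enorm_le //.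
by rewrite ler_wpM2l ?exprn_ge0 ?(ltW eps0) // -al_l fs_mfact_le.
Qed.

End Conversions.

(** * Integration in one variable *)

Section RealIntegral.
Context {R : realType}.
Local Notation mu := (@lebesgue_measure R).
Local Notation C := R[i].

Lemma integrable_oneDsqrV :
  mu.-integrable [set: R] (EFin \o (fun t : R => (oneDsqr t)^-1)).
Proof.
have c : continuous (fun t : R => (oneDsqr t)^-1) by exact: continuous_oneDsqrV.
have nn (t : R) : 0 <= (oneDsqr t)^-1 by rewrite invr_ge0.
apply/integrableP; split.
  by apply/measurable_EFinP; exact: continuous_measurable_fun.
under eq_integral do rewrite /= ger0_norm //.
rewrite ge0_symfun_integralT //; last first.
  by move=> t; rewrite /oneDsqr /= sqrrN.
have -> : [set x : R | 0 <= x] = `[0, +oo[%classic.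
  by apply/seteqP; split=> x /=; rewrite in_itv /= andbT.
by rewrite integral0y_oneDsqr -EFinM ltry.
Qed.

Variables (s : R) (hs : 2^-1 <= s).
Let s0 : 0 < s := s_gt0 hs.
Local Notation p := s^-1.

Definition kern (k t : R) : R := expR (- (k * `|t| `^ p)).

Lemma kern_ge0 k t : 0 <= kern k t. Proof. exact: expR_ge0. Qed.

Lemma measurable_kern k : measurable_fun [set: R] (kern k).
Proof.
apply: measurableT_comp; first exact: measurable_expR.
apply: measurableT_comp; first exact: oppr_measurable.
apply: measurable_funM; first exact: measurable_cst.
apply: (@measurableT_comp _ _ _ _ _ _ (fun y : R => y `^ p) _ (fun t : R => `|t|)).
  exact: measurable_powR.
by apply: continuous_measurable_fun; exact: norm_continuous.
Qed.

(** Comparison with 1 / (1 + t^2), by [pow_le_exp] for k = 2. *)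
Lemma kern_le k : 0 < k -> exists2 A, 0 <= A & forall t, kern k t <= A * (oneDsqr t)^-1.
Proof.
move=> k0; have [K K0 KE] := kap_surj s0 k0.
exists (1 + K ^+ 2 * fs s 2) => [|t].
  by rewrite addr_ge0 // mulr_ge0 ?fs_ge0 // exprn_ge0 // ltW.
have o0 : 0 < oneDsqr t by rewrite (lt_le_trans ltr01) ?oneDsqr_ge1.
rewrite ler_pdivlMr // /kern expRN mulrC ler_pdivrMr ?expR_gt0 //.
rewrite /oneDsqr mulrDl mul1r lerD //.
  by rewrite -[leLHS]expR0 ler_expR mulr_ge0 ?powR_ge0 // ltW.
rewrite -real_normK ?num_real // -KE; exact: pow_le_exp.
Qed.

Lemma integrable_kern k : 0 < k -> mu.-integrable [set: R] (EFin \o kern k).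
Proof.
move=> k0; have [A A0 H] := kern_le k0.
apply: (@le_integrable _ _ _ mu [set: R] measurableT _ (fun t => (A%:E * ((oneDsqr t)^-1)%:E)%E)).
- by apply/measurable_EFinP; exact: measurable_kern.
- move=> t _ /=; rewrite lee_fin ger0_norm ?kern_ge0 // ger0_norm ?H //.
  by rewrite mulr_ge0 // invr_ge0.
- by apply: integrableZl => //; exact: integrable_oneDsqrV.
Qed.

Definition ikern (k : R) : R := \int[mu]_(t in [set: R]) kern k t.

Lemma ikern_ge0 k : 0 <= ikern k.
Proof. by apply: Rintegral_ge0 => t _; exact: kern_ge0. Qed.

Lemma integrable_dom (f : R -> R) A k : 0 < k -> measurable_fun [set: R] f ->
  (forall t, `|f t| <= A * kern k t) -> mu.-integrable [set: R] (EFin \o f).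
Proof.
move=> k0 mf H.
apply: (@le_integrable _ _ _ mu [set: R] measurableT _ (fun t => (A%:E * (kern k t)%:E)%E)).
- exact/measurable_EFinP.
- by move=> t _ /=; rewrite lee_fin (le_trans (H t)) // ler_norm.
- by apply: integrableZl => //; exact: integrable_kern.
Qed.

Lemma Rintegral_dom (f : R -> R) A k : 0 < k -> measurable_fun [set: R] f ->
  (forall t, `|f t| <= A * kern k t) ->
  `|\int[mu]_(t in [set: R]) f t| <= A * ikern k.
Proof.
move=> k0 mf H; have If := integrable_dom k0 mf H.
apply: (le_trans (le_normr_Rintegral measurableT If)).
rewrite /ikern -RintegralZl //; last exact: integrable_kern.
apply: le_Rintegral => //.
- exact: (integrable_norm If).
- have -> : EFin \o (fun t : R => A * kern k t) = (fun t => A%:E * (kern k t)%:E)%E.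
    by apply/funext.
  by apply: integrableZl => //; exact: integrable_kern.
Qed.

Section Affine.
Variables (a b : R) (a0 : 0 < a).
Let phi : measurableTypeR R -> measurableTypeR R := fun t => a * t + b.

Let mphi : measurable_fun [set: R] phi.
Proof.
apply: measurable_funD; last exact: measurable_cst.
by apply: measurable_funM; [exact: measurable_cst|exact: measurable_id].
Qed.

Let img : {measure set (measurableTypeR R) -> \bar R} :=
  @measure_function_pushforward__canonical__measure_function_Measure
    _ _ _ _ _ mu phi mphi.

(** Lebesgue measure is determined by its values on half-open intervals, where the rescaled image
    measure is computed directly. *)
Lemma lebesgue_measure_affine (A : set R) : measurable A ->
  mu A = mscale (NngNum (ltW a0)) img A.
Proof.
move=> mA; apply: lebesgue_measure_unique => //= _ [[x y]] _ <-.
rewrite /mscale /img /pushforward /=.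
rewrite -[pushforward _ _ _]/(mu (phi @^-1` `]x, y]%classic)).
have -> : phi @^-1` `]x, y]%classic = `](x - b) / a, (y - b) / a]%classic.
  apply/seteqP; split=> t /=; rewrite !in_itv /= ltr_pdivrMr // ler_pdivlMr //;
  by rewrite ltrBlDr lerBrDr (mulrC t).
rewrite !lebesgue_measure_itv /= !lte_fin ltr_pM2r ?invr_gt0 // ltrD2r.
case: ifP => xy; last by rewrite mule0.
rewrite -!EFinB -EFinM; congr EFin.
by field; rewrite gt_eqF.
Qed.

Lemma ge0_integral_affine (f : R -> \bar R) : measurable_fun [set: R] f ->
  (forall t, 0 <= f t)%E ->
  (\int[mu]_t f t = a%:E * \int[mu]_t f (a * t + b)%R)%E.
Proof.
move=> mf f0.
rewrite (eq_measure_integral (mscale (NngNum (ltW a0)) img)); last first.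
  by move=> A mA _; exact: lebesgue_measure_affine.
rewrite ge0_integral_mscale //=.
by rewrite ge0_integral_pushforward.
Qed.

Let fin1 (X : \bar R) : (a%:E * X)%E \is a fin_num -> X \is a fin_num.
Proof.
have a0' : (0 < a%:E)%E by rewrite lte_fin.
case: X => [r _|H|H]; first exact: fin_numE.
  by move: H; rewrite gt0_muley.
by move: H; rewrite gt0_muleNy.
Qed.

Lemma Rintegral_affine (f : R -> R) : mu.-integrable [set: R] (EFin \o f) ->
  \int[mu]_(t in [set: R]) f (a * t + b) = a^-1 * \int[mu]_(t in [set: R]) f t.
Proof.
move=> If; have mfe := measurable_int mu If.
have Ep : (\int[mu]_t (EFin \o f)^\+ t =
    a%:E * \int[mu]_t (fun t => (f (a * t + b))%:E)^\+ t)%E.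
  rewrite (ge0_integral_affine (measurable_funepos mfe) (funepos_ge0 _)); congr (_ * _)%E.
  by apply: eq_integral => t _; rewrite !funeposE.
have En : (\int[mu]_t (EFin \o f)^\- t =
    a%:E * \int[mu]_t (fun t => (f (a * t + b))%:E)^\- t)%E.
  rewrite (ge0_integral_affine (measurable_funeneg mfe) (funeneg_ge0 _)); congr (_ * _)%E.
  by apply: eq_integral => t _; rewrite !funenegE.
have fin : (\int[mu]_t (fun t => (f (a * t + b))%:E)^\- t)%E \is a fin_num.
  apply: fin1; rewrite -En ge0_fin_numE ?integral_ge0 //.
  exact: (integral_funeneg_lt_pinfty measurableT If).
have E : (\int[mu]_t (f t)%:E = a%:E * \int[mu]_t (f (a * t + b)%R)%:E)%E.
  rewrite [LHS]integralE [in RHS]integralE muleBr //; last by rewrite fin_num_adde_defl // fin_numN.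
  by rewrite -Ep -En.
rewrite /Rintegral E fineM //; last first.
  apply: fin1; rewrite -E; exact: (integrable_fin_num measurableT If).
by rewrite mulKf // gt_eqF.
Qed.

End Affine.

Lemma Rintegral_opp (f : R -> R) : mu.-integrable [set: R] (EFin \o f) ->
  \int[mu]_(t in [set: R]) f (- t) = \int[mu]_(t in [set: R]) f t.
Proof.
move=> If; have mfe := measurable_int mu If.
have mo : measurable_fun [set: R] (-%R : measurableTypeR R -> measurableTypeR R).
  exact: oppr_measurable.
have G (g : R -> \bar R) : measurable_fun [set: R] g -> (forall t, 0 <= g t)%E ->
    (\int[mu]_t g (- t)%R = \int[mu]_t g t)%E.
  move=> mg g0.
  rewrite [RHS](eq_measure_integral
    (@measure_function_pushforward__canonical__measure_function_Measure _ _ _ _ _ mu _ mo)).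
    by rewrite ge0_integral_pushforward.
  by move=> A mA _; exact: esym (lebesgue_measureN mA).
have Ep := G _ (measurable_funepos mfe) (fun t => funepos_ge0 _ t).
have En := G _ (measurable_funeneg mfe) (fun t => funeneg_ge0 _ t).
rewrite /Rintegral [in LHS]integralE [in RHS]integralE; congr fine.
rewrite -Ep -En; congr (_ - _)%E; apply: eq_integral => t _.
  by rewrite !funeposE.
by rewrite !funenegE.
Qed.

Definition grid (n : nat) (y : R) : R := (Num.floor (y * n.+1%:R))%:~R / n.+1%:R.

Lemma grid_cvg y : grid n y @[n --> \oo] --> y.
Proof.
apply/cvgrPdist_le => e e0.
have [N _ HN] : \forall n \near \oo, n.+1%:R^-1 <= e.
  by near=> n; apply/ltW; near: n; exact: near_infty_natSinv_lt (PosNum e0).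
exists N => // n Nn; apply: le_trans (HN n Nn).
have n0 : 0 < n.+1%:R :> R by rewrite ltr0n.
have nN0 : n.+1%:R != 0 :> R by rewrite gt_eqF.
rewrite /grid -{1}(mulfK nN0 y) -mulrBl normrM.
rewrite [X in _ * X]ger0_norm ?invr_ge0 // ler_piMl ?invr_ge0 //.
have := floor_itv (y * n.+1%:R); rewrite /= => /andP[f1 f2].
rewrite ger0_norm ?subr_ge0 // lerBlDr addrC -[X in _ + X]/(1%:~R) -intrD ltW //.
Unshelve. all: by end_near. Qed.

(* f(x, y) is the limit of f(x, grid k y), where grid k takes countably many values. *)
Lemma measurable_caratheodory (f : R -> R -> R) :
  (forall y, measurable_fun [set: R] (f^~ y)) -> (forall x, continuous (f x)) ->
  measurable_fun [set: R * R] (fun z : R * R => f z.1 z.2).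
Proof.
move=> mf cf.
apply: (@measurable_fun_cvg _ _ _ _ (fun n (z : R * R) => f z.1 (grid n z.2))).
  move=> n.
  pose E j : set (R * R) :=
    [set z | choice.pickle (Num.floor (z.2 * n.+1%:R)) = j].
  have n0 : 0 < n.+1%:R :> R by rewrite ltr0n.
  have Ek j : (exists k : int, E j = [set: R] `*` `[k%:~R / n.+1%:R, (k + 1)%:~R / n.+1%:R[)
      \/ E j = set0.
    have [[k kj]|nk] := pselect (exists k : int, choice.pickle k = j).
      left; exists k; apply/seteqP; split=> [[x y]|[x y]] /=.
        rewrite -kj => /(pcan_inj choice.pickleK) <-; split=> //; rewrite in_itv /=.
        rewrite ler_pdivrMr // ltr_pdivlMr //.
        by have := floor_itv (y * n.+1%:R).
      rewrite in_itv /= ler_pdivrMr // ltr_pdivlMr // => -[_ yk].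
      by rewrite /E /= -kj; congr choice.pickle; exact: floor_def.
    right; apply/seteqP; split=> [[x y]|//] /= Exy; apply: nk.
    by exists (Num.floor (y * n.+1%:R)).
  have mE j : measurable (E j).
    by have [[k ->]|->] := Ek j; [exact: measurableX|exact: measurable0].
  have <- : \bigcup_j E j = [set: R * R].
    apply/seteqP; split=> // -[x y] _.
    by exists (choice.pickle (Num.floor (y * n.+1%:R))).
  apply/measurable_fun_bigcup => // j.
  have [[k kE]|E0] := Ek j; last by rewrite E0; exact: measurable_fun_set0.
  apply: (@eq_measurable_fun _ _ _ _ _ (fun z : R * R => f z.1 (k%:~R / n.+1%:R))).
    move=> z; rewrite inE kE => -[_] /=; rewrite in_itv /= ler_pdivrMr // ltr_pdivlMr // => yk.
    by rewrite /grid (floor_def yk).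
  apply: measurable_funTS.
  by apply: (measurableT_comp (mf (k%:~R / n.+1%:R))); exact: measurable_fst.
have H (x y : R) : f x (grid n y) @[n --> \oo] --> f x y.
  exact: ((@cvg_nbhsP R R^o (f x) y (f x y)).1 (cf x y) (fun n => grid n y) (@grid_cvg y)).
by move=> [x y] _; exact: H.
Qed.

(** Joint measurability comes from [measurable_caratheodory]; a product of kernels dominates f, so
    Tonelli gives integrability on the plane. *)
Lemma Fubini_dom (f : R -> R -> R) A k : 0 < k ->
  (forall y, measurable_fun [set: R] (f^~ y)) -> (forall x, continuous (f x)) ->
  (forall x y, `|f x y| <= A * (kern k x * kern k y)) ->
  \int[mu]_(x in [set: R]) (\int[mu]_(y in [set: R]) f x y) =
  \int[mu]_(y in [set: R]) (\int[mu]_(x in [set: R]) f x y).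
Proof.
move=> k0 mf cf H.
have mF := measurable_caratheodory mf cf.
have I1 x : mu.-integrable [set: R] (EFin \o f x).
  apply: (@integrable_dom _ (A * kern k x) k k0) => [|y].
    exact: continuous_measurable_fun.
  by rewrite -mulrA.
have I2 y : mu.-integrable [set: R] (EFin \o f^~ y).
  apply: (@integrable_dom _ (A * kern k y) k k0) => [|x]; first exact: mf.
  by rewrite -mulrA (mulrC (kern k y)).
have IF : (mu \x mu)%E.-integrable [set: R * R] (fun z => (f z.1 z.2)%:E).
  apply/integrable12ltyP; first exact/measurable_EFinP.
  apply: (@le_lt_trans _ _ (\int[mu]_x (`|A| * kern k x * ikern k)%:E)%E).
    apply: ge0_le_integral => //.
    - by move=> x _; apply: integral_ge0.
    - have mG : measurable_fun [set: R * R] (fun z : R * R => `|(f z.1 z.2)%:E|%E).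
        by apply: measurableT_comp => //; exact/measurable_EFinP.
      exact: (@measurable_fun_fubini_tonelli_F _ _ _ _ R mu _ mG (fun z => abse_ge0 _)).
    - apply/measurable_EFinP; apply: measurable_funM; last exact: measurable_cst.
      by apply: measurable_funM; [exact: measurable_cst|exact: measurable_kern].
    - move=> x _.
      have -> : (\int[mu]_y `|(f x y)%:E| = (\int[mu]_(y in [set: R]) `|f x y|)%:E)%E.
        rewrite /Rintegral fineK //; apply: integrable_fin_num => //.
        exact: (integrable_norm (I1 x)).
      rewrite lee_fin; have := @Rintegral_dom (fun y => `|f x y|) (`|A| * kern k x) k k0.
      rewrite ger0_norm; last by apply: Rintegral_ge0.
      apply; first by apply: measurableT_comp => //; exact: continuous_measurable_fun.
      move=> y; rewrite normr_id (le_trans (H x y)) // -mulrA ler_wpM2r ?ler_norm //.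
      by rewrite mulr_ge0 ?kern_ge0.
  apply: integrable_lty => //.
  have -> : (fun x : R => (`|A| * kern k x * ikern k)%:E) =
      (fun x => ((`|A| * ikern k)%:E * (kern k x)%:E)%E).
    by apply/funext => x; rewrite -EFinM mulrAC.
  by apply: integrableZl => //; exact: integrable_kern.
have := Fubini IF => /= E; rewrite /Rintegral; congr fine.
transitivity (\int[mu]_x \int[mu]_y (f x y)%:E)%E.
  by apply: eq_integral => x _; rewrite fineK //; exact: (integrable_fin_num _ (I1 x)).
rewrite E; apply: eq_integral => y _.
by rewrite fineK //; exact: (integrable_fin_num _ (I2 y)).
Qed.

End RealIntegral.

(** * Complex integrals and their dependence on parameters *)

Section ComplexIntegral.
Context {R : realType}.
Local Notation mu := (@lebesgue_measure R).
Local Notation C := R[i].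

Lemma Re_le (z : C) : `|complex.Re z| <= cabs z.
Proof.
case: z => a b; rewrite /cabs /= -sqrtr_sqr ler_sqrt ?addr_ge0 ?sqr_ge0 //.
by rewrite lerDl sqr_ge0.
Qed.

Lemma Im_le (z : C) : `|complex.Im z| <= cabs z.
Proof.
case: z => a b; rewrite /cabs /= -sqrtr_sqr ler_sqrt ?addr_ge0 ?sqr_ge0 //.
by rewrite lerDr sqr_ge0.
Qed.

Lemma cabs_le (z : C) : cabs z <= `|complex.Re z| + `|complex.Im z|.
Proof.
case: z => a b; rewrite /cabs /= -[leRHS]ger0_norm ?addr_ge0 // -sqrtr_sqr.
rewrite ler_sqrt ?sqr_ge0 // sqrrD !real_normK ?num_real // addrAC lerDl.
by rewrite mulrn_wge0 // mulr_ge0.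
Qed.

Definition mC (f : R -> C) : Prop :=
  measurable_fun [set: R] (fun t => complex.Re (f t)) /\
  measurable_fun [set: R] (fun t => complex.Im (f t)).

Definition Jint (f : R -> C) : C :=
  (\int[mu]_(t in [set: R]) complex.Re (f t)) +i*
  (\int[mu]_(t in [set: R]) complex.Im (f t)).

Lemma mC_M (f g : R -> C) : mC f -> mC g -> mC (fun t => f t * g t).
Proof.
move=> [fr fi] [gr gi]; split.
  have -> : (fun t => complex.Re (f t * g t)) =
    (fun t => complex.Re (f t) * complex.Re (g t) - complex.Im (f t) * complex.Im (g t)).
    by apply/funext => y; case: (f y) (g y) => [? ?] [].
  by apply: measurable_funB; exact: measurable_funM.
have -> : (fun t => complex.Im (f t * g t)) =
  (fun t => complex.Re (f t) * complex.Im (g t) + complex.Im (f t) * complex.Re (g t)).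
  by apply/funext => y; case: (f y) (g y) => [? ?] [].
by apply: measurable_funD; exact: measurable_funM.
Qed.

Lemma mC_cst (k : C) : mC (fun _ => k).
Proof. by split; exact: measurable_cst. Qed.

Definition contC (f : R -> C) : Prop :=
  continuous (fun t => complex.Re (f t)) /\ continuous (fun t => complex.Im (f t)).

Lemma contC_mC (f : R -> C) : contC f -> mC f.
Proof. by move=> [fr fi]; split; exact: continuous_measurable_fun. Qed.

Lemma contC_comp n (g : R -> 'rV[R]_n) (F : 'rV[R]_n -> C) :
  continuous g -> ccontinuous F -> contC (fun t => F (g t)).
Proof.
move=> cg [cr ci]; split=> x.
  by apply: (@continuous_comp _ _ _ g (fun y => complex.Re (F y))); [exact: cg|exact: cr].
by apply: (@continuous_comp _ _ _ g (fun y => complex.Im (F y))); [exact: cg|exact: ci].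
Qed.

Lemma cabs_cis (t : R) : cabs (cis t) = 1.
Proof. by rewrite /cabs /= cos2Dsin2 sqrtr1. Qed.

Lemma cisD (a b : R) : cis (a + b) = cis a * cis b.
Proof.
rewrite /cis cosD sinD; apply/eqP; rewrite eq_complex /=.
by rewrite eqxx /= addrC.
Qed.

Lemma cis0 : cis (0 : R) = 1.
Proof. by rewrite /cis cos0 sin0. Qed.

Variables (s : R) (hs : 2^-1 <= s).
Let s0 : 0 < s := s_gt0 hs.
Local Notation p := s^-1.
Local Notation kern := (kern s).
Local Notation ikern := (ikern s).

(** Domination by a kernel stands for integrability; without it the integrals could take default
    values and linearity would fail. *)
Definition nice1 (A k : R) (f : R -> C) : Prop :=
  [/\ 0 < k, mC f & forall t, cabs (f t) <= A * kern k t].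

Lemma nice1_int A k f : nice1 A k f ->
  mu.-integrable [set: R] (EFin \o (fun t => complex.Re (f t))) /\
  mu.-integrable [set: R] (EFin \o (fun t => complex.Im (f t))).
Proof.
move=> [k0 [fr fi] H]; split; apply: (integrable_dom hs k0) => // t.
  exact: le_trans (Re_le _) (H t).
exact: le_trans (Im_le _) (H t).
Qed.

Lemma Jint_bound A k f : nice1 A k f -> cabs (Jint f) <= 2 * A * ikern k.
Proof.
move=> [k0 [fr fi] H]; apply: (le_trans (cabs_le _)).
rewrite -mulrA mulr_natl mulr2n; apply: lerD; apply: (Rintegral_dom hs k0) => // t.
  exact: le_trans (Re_le _) (H t).
exact: le_trans (Im_le _) (H t).
Qed.

Lemma JintD A k f B l g : nice1 A k f -> nice1 B l g ->
  Jint (fun t => f t + g t) = Jint f + Jint g.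
Proof.
move=> /nice1_int[fr fi] /nice1_int[gr gi].
apply/eqP; rewrite eq_complex /=; apply/andP; split; apply/eqP.
  rewrite -RintegralD //; apply: eq_Rintegral => t _.
  by case: (f t) (g t) => [? ?] [].
rewrite -RintegralD //; apply: eq_Rintegral => t _.
by case: (f t) (g t) => [? ?] [].
Qed.

Lemma JintZ A k (c : C) f : nice1 A k f -> Jint (fun t => c * f t) = c * Jint f.
Proof.
move=> /nice1_int[fr fi]; case: c => a b.
have I1 (r : R) (u : R -> R) : mu.-integrable [set: R] (EFin \o u) ->
    mu.-integrable [set: R] (EFin \o (fun t => r * u t)).
  move=> Iu; have -> : EFin \o (fun t => r * u t) = (fun t => r%:E * (u t)%:E)%E.
    by apply/funext.
  exact: integrableZl.
apply/eqP; rewrite eq_complex /=; apply/andP; split; apply/eqP.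
  rewrite -!RintegralZl // -RintegralB //; try exact: I1.
  by apply: eq_Rintegral => t _; case: (f t).
rewrite -!RintegralZl // -RintegralD //; try exact: I1.
by apply: eq_Rintegral => t _; case: (f t).
Qed.

Lemma eq_Jint f g : f =1 g -> Jint f = Jint g.
Proof. by move=> fg; congr Jint; apply/funext. Qed.

Lemma Jint_affine A k f (a b : R) : 0 < a -> nice1 A k f ->
  Jint (fun t => f (a * t + b)) = (a^-1)%:C * Jint f.
Proof.
move=> a0 /nice1_int[fr fi].
apply/eqP; rewrite eq_complex /= !mul0r subr0 addr0; apply/andP; split; apply/eqP.
  exact: (@Rintegral_affine R a b a0 _ fr).
exact: (@Rintegral_affine R a b a0 _ fi).
Qed.

Lemma Jint_shift A k f (b : R) : nice1 A k f -> Jint (fun t => f (t + b)) = Jint f.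
Proof.
move=> nf; have := Jint_affine b ltr01 nf; rewrite invr1 mul1r => <-.
by apply: eq_Jint => t; rewrite mul1r.
Qed.

Lemma Jint_opp A k f : nice1 A k f -> Jint (fun t => f (- t)) = Jint f.
Proof.
move=> /nice1_int[fr fi]; apply/eqP; rewrite eq_complex /=; apply/andP; split; apply/eqP.
  exact: (Rintegral_opp fr).
exact: (Rintegral_opp fi).
Qed.

Lemma Jint_Fubini (f : R -> R -> C) A k : 0 < k ->
  (forall y, mC (f^~ y)) -> (forall x, contC (f x)) ->
  (forall x y, cabs (f x y) <= A * (kern k x * kern k y)) ->
  Jint (fun x => Jint (f x)) = Jint (fun y => Jint (f^~ y)).
Proof.
move=> k0 mf cf H; apply/eqP; rewrite eq_complex /=; apply/andP; split; apply/eqP.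
  apply: (Fubini_dom hs k0).
  - by move=> y; exact: (mf y).1.
  - by move=> x; exact: (cf x).1.
  - by move=> x y; exact: le_trans (Re_le _) (H x y).
apply: (Fubini_dom hs k0).
- by move=> y; exact: (mf y).2.
- by move=> x; exact: (cf x).2.
- by move=> x y; exact: le_trans (Im_le _) (H x y).
Qed.

(** The derivative is taken at 0 only, with the open unit interval as neighbourhood, so domination
    is needed only near the base point. *)
Lemma Rint_DUI (f df : R -> R -> R) (A k : R) : 0 < k ->
  (forall r t : R, `|r| < 1 -> is_derive r 1 (f^~ t) (df r t)) ->
  (forall r, measurable_fun [set: R] (f r)) ->
  (forall r t : R, `|r| < 1 -> `|f r t| <= A * kern k t) ->
  (forall r t : R, `|r| < 1 -> `|df r t| <= A * kern k t) ->
  is_derive (0 : R) 1 (fun r => \int[mu]_(t in [set: R]) f r t)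
    (\int[mu]_(t in [set: R]) df 0 t).
Proof.
move=> k0 dfH mf Hf Hdf.
have I0 : `]-1, 1[%classic (0 : R) by rewrite /= in_itv /= ltrN10 ltr01.
have I1 (r : R) : `]-1, 1[%classic r -> `|r| < 1.
  by rewrite /= in_itv /= ltr_norml.
have Intf r : `]-1, 1[%classic r -> mu.-integrable [set: R] (EFin \o f r).
  by move=> /I1 r1; apply: (@integrable_dom R s hs (f r) A k k0) => // t; exact: Hf.
have Der r (t : R) : `]-1, 1[%classic r -> [set: R] t -> derivable (f^~ t) r 1.
  by move=> /I1 r1 _; have [] := dfH r t r1.
have G0 (t : R) : 0 <= `|A| * kern k t by rewrite mulr_ge0 ?kern_ge0.
have IG : mu.-integrable [set: R] (EFin \o (fun t => `|A| * kern k t)).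
  apply: (@integrable_dom R s hs _ `|A| k k0).
    by apply: measurable_funM; [exact: measurable_cst|exact: measurable_kern].
  by move=> t; rewrite ger0_norm.
have Gub r (t : R) : `]-1, 1[%classic r -> [set: R] t ->
    `|partial1of2 f r t| <= `|A| * kern k t.
  move=> /I1 r1 _; rewrite partial1of2E (@derive_val _ _ _ _ _ _ _ (dfH r t r1)).
  by rewrite (le_trans (Hdf r t r1)) // ler_wpM2r ?kern_ge0 // ler_norm.
have D0 := derivable_under_integral measurableT I0 Intf Der G0 IG Gub.
split=> //; rewrite -derive1E.
rewrite (differentiation_under_integral measurableT I0 Intf Der G0 IG Gub).
apply: eq_Rintegral => t _.
by rewrite partial1of2E (@derive_val _ _ _ _ _ _ _ (dfH 0 t _)) // normr0.
Qed.

Lemma Jint_DUI (f df : R -> R -> C) (A k : R) : 0 < k ->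
  (forall r t : R, `|r| < 1 -> @cder R R^o (f^~ t) r 1 (df r t)) ->
  (forall r, mC (f r)) ->
  (forall r t : R, `|r| < 1 -> cabs (f r t) <= A * kern k t) ->
  (forall r t : R, `|r| < 1 -> cabs (df r t) <= A * kern k t) ->
  @cder R R^o (fun r => Jint (f r)) 0 1 (Jint (df 0)).
Proof.
move=> k0 dfH mf Hf Hdf; split=> /=.
  apply: (@Rint_DUI (fun r t => complex.Re (f r t)) (fun r t => complex.Re (df r t)) A k k0).
  - by move=> r t r1; have [] := dfH r t r1.
  - by move=> r; exact: (mf r).1.
  - by move=> r t r1; exact: le_trans (Re_le _) (Hf r t r1).
  - by move=> r t r1; exact: le_trans (Re_le _) (Hdf r t r1).
apply: (@Rint_DUI (fun r t => complex.Im (f r t)) (fun r t => complex.Im (df r t)) A k k0).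
- by move=> r t r1; have [] := dfH r t r1.
- by move=> r; exact: (mf r).2.
- by move=> r t r1; exact: le_trans (Im_le _) (Hf r t r1).
- by move=> r t r1; exact: le_trans (Im_le _) (Hdf r t r1).
Qed.

Lemma is_derive_of_line n (f : 'rV[R]_n -> R) (x v : 'rV[R]_n) (c : R) :
  is_derive (0 : R) 1 (fun r : R => f (x + r *: v)) c -> is_derive x v f c.
Proof.
have E : (fun h : R => h^-1 *: (f (x + (h *: 1 + 0) *: v) - f (x + 0 *: v)))
  = (fun h : R => h^-1 *: (f (h *: v + x) - f x)).
  apply/funext => h; congr (_ *: (f _ - f _)).
    by rewrite addr0 /GRing.scale /= mulr1 addrC.
  by rewrite scale0r addr0.
move=> [d1 d2]; split; first by move: d1; rewrite /derivable E.
by rewrite -d2 /derive E.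
Qed.

Lemma cder_line n (f : 'rV[R]_n -> C) (x v : 'rV[R]_n) (r : R) d :
  cder f (x + r *: v) v d -> @cder R R^o (fun r => f (x + r *: v)) r 1 d.
Proof.
move=> [[r1 r2] [i1 i2]]; split; [rewrite -r2|rewrite -i2].
  exact: (@is_derive_line R n (fun y => complex.Re (f y)) x v r r1).
exact: (@is_derive_line R n (fun y => complex.Im (f y)) x v r i1).
Qed.

Lemma cder_of_line n (f : 'rV[R]_n -> C) (x v : 'rV[R]_n) d :
  @cder R R^o (fun r => f (x + r *: v)) 0 1 d -> cder f x v d.
Proof.
move=> [r1 i1]; split.
  exact: (@is_derive_of_line n (fun y => complex.Re (f y)) x v _ r1).
exact: (@is_derive_of_line n (fun y => complex.Im (f y)) x v _ i1).
Qed.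

Lemma norm_delta_le n (j : 'I_n) (r : R) : `|r *: (delta_mx 0 j : 'rV[R]_n)| <= `|r|.
Proof.
apply: (rV_norm_le _ (normr_ge0 r)).2 => m; rewrite !mxE eqxx /=.
by case: eqP => _; rewrite ?mulr1 ?mulr0 ?normr0.
Qed.

Lemma cder_Jint n (j : 'I_n) (f df : 'rV[R]_n -> R -> C) x A k : 0 < k ->
  (forall y (t : R), cder (f^~ t) y (delta_mx 0 j) (df y t)) ->
  (forall y, mC (f y)) ->
  (forall y (t : R), `|y - x| <= 1 -> cabs (f y t) <= A * kern k t) ->
  (forall y (t : R), `|y - x| <= 1 -> cabs (df y t) <= A * kern k t) ->
  cder (fun y => Jint (f y)) x (delta_mx 0 j) (Jint (df x)).
Proof.
move=> k0 dH mf Hf Hdf; apply: cder_of_line.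
set v : 'rV[R]_n := delta_mx 0 j.
have xr (r : R) : `|r| < 1 -> `|x + r *: v - x| <= 1.
  by move=> r1; rewrite addrAC subrr add0r (le_trans (norm_delta_le _ _)) // ltW.
have := @Jint_DUI (fun r t => f (x + r *: v) t) (fun r t => df (x + r *: v) t) A k k0.
rewrite scale0r addr0; apply.
- move=> r t r1; exact: (@cder_line n (f^~ t) x v r _ (dH _ t)).
- by move=> r; exact: mf.
- by move=> r t /xr; exact: Hf.
- by move=> r t /xr; exact: Hdf.
Qed.

Lemma Rint_continuous n (f : 'rV[R]_n -> R -> R) (x : 'rV[R]_n) A k : 0 < k ->
  (forall t, continuous (f^~ t)) -> (forall y, measurable_fun [set: R] (f y)) ->
  (forall y (t : R), `|y - x| <= 1 -> `|f y t| <= A * kern k t) ->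
  {for x, continuous (fun y => \int[mu]_(t in [set: R]) f y t)}.
Proof.
move=> k0 cf mf Hf; apply/(@cvgrPdist_lt R R^o _ (nbhs (x : 'rV[R]_n))) => e e0.
apply: contrapT => nH.
(* If continuity failed, there would be points y_m -> x along which the integrals stay at distance
   e; dominated convergence for sequences contradicts this. *)
have H n' : exists y : 'rV[R]_n, `|x - y| < n'.+1%:R^-1 /\
   e <= `|(\int[mu]_(t in [set: R]) f x t) - (\int[mu]_(t in [set: R]) f y t)|.
  apply: contrapT => nex; apply: nH; apply/nbhs_ballP; exists n'.+1%:R^-1 => [|y].
    by rewrite /= invr_gt0.
  rewrite -ball_normE /= => xy; rewrite ltNge; apply/negP => le; apply: nex.
  by exists y.
have [y Hy] := choice H.
have cy : y m @[m --> \oo] --> x.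
  apply/(@cvgrPdist_lt R 'rV[R]_n _ (nbhs \oo)) => r r0.
  have [N _ HN] : \forall m \near \oo, m.+1%:R^-1 < r.
    exact: (near_infty_natSinv_lt (PosNum r0)).
  by exists N => // m Nm; apply: lt_trans (Hy m).1 (HN m Nm).
have y1 m : `|y m - x| <= 1.
  rewrite distrC (le_trans (ltW (Hy m).1)) // invf_le1 // ler1n //.
have AK : mu.-integrable [set: R] (fun t => (A * kern k t)%:E).
  apply: (@integrable_dom R s hs (fun t => A * kern k t) `|A| k k0).
    by apply: measurable_funM; [exact: measurable_cst|exact: measurable_kern].
  by move=> t; rewrite normrM [X in _ * X]ger0_norm ?kern_ge0.
have Ix : mu.-integrable [set: R] (EFin \o f x).
  apply: (@integrable_dom R s hs (f x) A k k0) => // t.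
  by apply: Hf; rewrite subrr normr0.
have C1 : (\int[mu]_(t in [set: R]) f (y m) t) @[m --> \oo] -->
    (\int[mu]_(t in [set: R]) f x t).
  apply: fine_cvg; rewrite fineK; last exact: integrable_fin_num.
  apply: (@dominated_cvg _ _ _ mu [set: R] measurableT (fun m t => (f (y m) t)%:E)
    (fun t => (f x t)%:E) (fun t => (A * kern k t)%:E)) => //.
  - by move=> m; apply/measurable_EFinP; exact: mf.
  - move=> t _; apply: cvg_EFin; first exact: nearW.
    exact: (cvg_comp _ _ cy (cf t x)).
  - by move=> m t _; rewrite lee_fin; exact: Hf.
have [N _ HN] := (@cvgrPdist_lt R R^o _ (nbhs \oo) _ _ _).1 C1 e e0.
have := HN N (leqnn N) => /=; rewrite ltNge => /negP; apply.
exact: (Hy N).2.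
Qed.

Lemma Jint_continuous n (f : 'rV[R]_n -> R -> C) :
  (forall t, ccontinuous (f^~ t)) -> (forall y, mC (f y)) ->
  (forall x : 'rV[R]_n, exists A k : R, 0 < k /\
    forall y (t : R), `|y - x| <= 1 -> cabs (f y t) <= A * kern k t) ->
  ccontinuous (fun y => Jint (f y)).
Proof.
move=> cf mf H; split=> x; have [A [k [k0 Hx]]] := H x.
  apply: (@Rint_continuous n (fun y t => complex.Re (f y t)) x A k k0).
  - by move=> t; exact: (cf t).1.
  - by move=> y; exact: (mf y).1.
  - by move=> y t yx; exact: le_trans (Re_le _) (Hx y t yx).
apply: (@Rint_continuous n (fun y t => complex.Im (f y t)) x A k k0).
- by move=> t; exact: (cf t).2.
- by move=> y; exact: (mf y).2.
- by move=> y t yx; exact: le_trans (Im_le _) (Hx y t yx).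
Qed.

End ComplexIntegral.

(** * Integration and Fourier transforms in one coordinate *)

Section Slices.
Context {R : realType}.
Local Notation C := R[i].

Definition upd n (x : 'rV[R]_n) (i : 'I_n) (t : R) : 'rV[R]_n :=
  \row_j (if j == i then t else x 0 j).

Lemma upd_same n (x : 'rV[R]_n) i t : upd x i t 0 i = t.
Proof. by rewrite mxE eqxx. Qed.

Lemma upd_other n (x : 'rV[R]_n) i j t : j != i -> upd x i t 0 j = x 0 j.
Proof. by rewrite mxE => /negbTE ->. Qed.

Lemma updC n (x : 'rV[R]_n) i j t u : i != j ->
  upd (upd x i t) j u = upd (upd x j u) i t.
Proof.
move=> ij; apply/rowP => k; rewrite !mxE.
have [->|] := eqVneq k j; first by rewrite eq_sym (negbTE ij).
by [].
Qed.

Lemma updE n (x : 'rV[R]_n) i t : upd x i t = x + (t - x 0 i) *: delta_mx 0 i.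
Proof.
apply/rowP => j; rewrite !mxE eqxx /=; have [->|_] := eqVneq j i.
  by rewrite mulr1 addrC subrK.
by rewrite mulr0 addr0.
Qed.

Lemma upd_addr n (x : 'rV[R]_n) i t r :
  upd x i (t + r) = upd x i t + r *: delta_mx 0 i.
Proof. by rewrite !updE -[RHS]addrA -scalerDl addrAC. Qed.

Lemma upd_move n (x : 'rV[R]_n) i j t (r : R) : j != i ->
  upd (x + r *: delta_mx 0 j) i t = upd x i t + r *: delta_mx 0 j.
Proof.
move=> ji; apply/rowP => k; rewrite !mxE eqxx /=.
by have [->|] := eqVneq k i; rewrite // eq_sym (negbTE ji) mulr0 addr0.
Qed.

Lemma upd_move_same n (x : 'rV[R]_n) i t (r : R) :
  upd (x + r *: delta_mx 0 i) i t = upd x i t.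
Proof.
apply/rowP => k; rewrite !mxE eqxx /=.
by have [//|] := eqVneq k i; rewrite mulr0 addr0.
Qed.

Lemma continuous_upd_t n (x : 'rV[R]_n) i : continuous (upd x i).
Proof.
move=> t; apply/(@cvgrPdist_le R 'rV[R]_n _ (nbhs (t : R))) => e e0.
apply/nbhs_ballP; exists e => // u; rewrite -ball_normE /= => /ltW tu.
rewrite !updE opprD addrACA subrr add0r -scalerBl opprB addrA subrK.
exact: le_trans (norm_delta_le _ _) tu.
Qed.

Lemma continuous_upd_x n i t : continuous (fun x : 'rV[R]_n => upd x i t).
Proof.
move=> x; apply/(@cvgrPdist_le R 'rV[R]_n _ (nbhs (x : 'rV[R]_n))) => e e0.
apply/nbhs_ballP; exists e => // y; rewrite -ball_normE /= => /ltW xy.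
apply: (rV_norm_le _ (ltW e0)).2 => j; rewrite !mxE.
case: eqP => _; first by rewrite subrr normr0 ltW.
by apply: le_trans xy; have := rV_norm_coord (x - y) j; rewrite !mxE.
Qed.

Variables (s : R) (hs : 2^-1 <= s).
Let s0 : 0 < s := s_gt0 hs.
Let s_ge0 : 0 <= s := ltW s0.
Local Notation p := s^-1.
Local Notation kern := (kern s).
Local Notation ikern := (ikern s).
Local Notation W := (@W R s _).

(** In the unit ball around x the weight is bounded by a constant depending on x, which makes the
    dominations in t uniform near x. *)
Lemma W_loc n (I : {set 'I_n}) (c d : R) (x y : 'rV[R]_n) : 0 <= c -> 0 <= d ->
  `|y - x| <= 1 -> W I c d y <= expR (d * (n%:R * (`|x| + 1) `^ p)).
Proof.
move=> c0 d0 yx; rewrite ler_expR.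
apply: (@le_trans _ _ (\sum_(j < n) d * (`|x| + 1) `^ p)); last first.
  by rewrite sumr_const card_ord -[leLHS]mulr_natl mulrCA.
apply: ler_sum => j _.
apply: (@le_trans _ _ (d * `|y 0 j| `^ p)).
  by rewrite ler_wpM2r ?powR_ge0 // lerBlDr lerDl mulr_ge0.
rewrite ler_wpM2l // ge0_ler_powR ?nnegrE ?invr_ge0 ?addr_ge0 //.
have -> : y 0 j = x 0 j + (y - x) 0 j by rewrite !mxE [RHS]addrC subrK.
rewrite (le_trans (ler_normD _ _)) // lerD ?rV_norm_coord //.
exact: le_trans (rV_norm_coord _ _) yx.
Qed.

(** The weight factorises over the coordinates: setting coordinate i to t splits off a kernel in t
    of rate c - d and takes i out of the decaying set. *)
Lemma W_upd n (I : {set 'I_n}) (c d : R) (x : 'rV[R]_n) i t : i \in I -> 0 <= d ->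
  W I c d (upd x i t) <= W (I :\ i) c d x * kern (c - d) t.
Proof.
move=> iI d0; rewrite -expRD ler_expR.
rewrite (bigD1 i) //= [in leRHS](bigD1 i) //= upd_same iI !inE eqxx /= mulr1 mulr0 subr0.
rewrite -[- ((c - d) * _)]mulNr opprB [leRHS]addrC lerD2l.
rewrite addrC; apply: ler_wpDr; first by rewrite mulr_ge0 ?powR_ge0.
by apply: ler_sum => j ji; rewrite upd_other // !inE ji.
Qed.

Lemma kern_mono (k k' t : R) : k' <= k -> kern k t <= kern k' t.
Proof. by move=> kk; rewrite ler_expR lerN2 ler_wpM2r ?powR_ge0. Qed.

(* The analogue of [cls] for a single continuous function, without derivatives. *)
Definition nb n (I : {set 'I_n}) (F : 'rV[R]_n -> C) : Prop :=
  ccontinuous F /\ exists2 c : R, 0 < c & forall d : R, 0 < d ->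
    exists2 A : R, 0 <= A & forall x, cabs (F x) <= A * W I c d x.

Lemma nb_of_cls n (I : {set 'I_n}) T (F : T -> 'rV[R]_n -> C) t :
  cls s I F -> nb I (F t).
Proof.
move=> [sF [h [c [h0 c0 H]]]]; split; first exact: smooth_cont.
exists c => // d d0; have [A A0 HA] := H d d0; exists A => // x.
by have := HA t x [::]; rewrite expr0 fs0 !mulr1.
Qed.

(** For d <= c/2 the rate c - d stays at least c/2, so the kernel that is integrated does not depend
    on d. *)
Lemma nb_slice n (I : {set 'I_n}) F i : nb I F -> i \in I ->
  exists2 c : R, 0 < c & forall d : R, 0 < d -> d <= c / 2 ->
    exists2 A : R, 0 <= A & forall x t,
      cabs (F (upd x i t)) <= A * W (I :\ i) c d x * kern (c / 2) t.
Proof.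
move=> [cF [c c0 H]] iI; exists c => // d d0 dc.
have [A A0 HA] := H d d0; exists A => // x t; apply: (le_trans (HA _)).
rewrite -mulrA ler_wpM2l //; apply: (le_trans (W_upd c x t iI (ltW d0))).
rewrite ler_wpM2l ?W_ge0 // kern_mono //.
by rewrite lerBrDr (le_trans (lerD (lexx _) dc)) // -splitr.
Qed.

Lemma nb_slice_contC n (F : 'rV[R]_n -> C) (x : 'rV[R]_n) i : ccontinuous F ->
  contC (fun t => F (upd x i t)).
Proof. by move=> cF; apply: contC_comp => //; exact: continuous_upd_t. Qed.

Lemma nb_nice1 n (I : {set 'I_n}) F i x : nb I F -> i \in I ->
  exists A k, nice1 s A k (fun t => F (upd x i t)).
Proof.
move=> nF iI; have [c c0 H] := nb_slice nF iI.
have c2 : 0 < c / 2 by rewrite divr_gt0.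
have [A A0 HA] := H _ c2 (lexx _); exists (A * W (I :\ i) c (c / 2) x), (c / 2).
by split=> //; apply: contC_mC; apply: nb_slice_contC; case: nF.
Qed.

Definition J n (i : 'I_n) (F : 'rV[R]_n -> C) : 'rV[R]_n -> C :=
  fun x => Jint (fun t => F (upd x i t)).

(** The unimodular factor u covers both the plain integral, u = 1, and the Fourier phase. *)
Lemma nb_Jint_continuous n (I : {set 'I_n}) F (u : R -> 'rV[R]_n -> C) i :
  nb I F -> i \in I -> (forall t x, cabs (u t x) = 1) ->
  (forall t, ccontinuous (u t)) -> (forall x, mC (u^~ x)) ->
  ccontinuous (fun x => Jint (fun t => F (upd x i t) * u t x)).
Proof.
move=> nF iI u1 cu mu; have [c c0 H] := nb_slice nF iI.
have c2 : 0 < c / 2 by rewrite divr_gt0.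
have [A A0 HA] := H _ c2 (lexx _); have [cF _] := nF.
apply: (@Jint_continuous R s hs).
- move=> t; apply: ccontinuousM => //.
  by apply: ccontinuous_comp => //; exact: continuous_upd_x.
- by move=> x; apply: mC_M => //; apply: contC_mC; exact: nb_slice_contC.
- move=> x; exists (A * expR (c / 2 * (n%:R * (`|x| + 1) `^ p))), (c / 2).
  split=> // y t yx; rewrite cabsM u1 mulr1 (le_trans (HA y t)) //.
  by rewrite ler_wpM2r ?kern_ge0 // ler_wpM2l // W_loc // ltW.
Qed.

Lemma nb_J n (I : {set 'I_n}) F i : nb I F -> i \in I -> nb (I :\ i) (J i F).
Proof.
move=> nF iI; split.
  have -> : J i F = (fun x => Jint (fun t => F (upd x i t) * 1)).
    by apply/funext => x; apply: eq_Jint => t; rewrite mulr1.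
  apply: (@nb_Jint_continuous n I F (fun _ _ => 1) i nF iI).
  - by move=> _ _; exact: cabs1.
  - by move=> t; split; exact: cst_continuous.
  - by move=> x; exact: mC_cst.
have [c c0 H] := nb_slice nF iI; have c2 : 0 < c / 2 by rewrite divr_gt0.
(* The slice bound needs an allowance of at most c/2; a smaller allowance gives a stronger bound. *)
exists c => // d d0; pose e := Num.min d (c / 2).
have e0 : 0 < e by rewrite lt_min d0.
have ed : e <= d by rewrite ge_min lexx.
have ec : e <= c / 2 by rewrite ge_min lexx orbT.
have [A A0 HA] := H e e0 ec; exists (2 * A * ikern (c / 2)) => [|x].
  by rewrite !mulr_ge0 ?ikern_ge0.
have nn : nice1 s (A * W (I :\ i) c e x) (c / 2) (fun t => F (upd x i t)).
  by split=> //; apply: contC_mC; apply: nb_slice_contC; case: nF.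
apply: (le_trans (Jint_bound hs nn)).
have r (a b w k : R) : a * (b * w) * k = a * b * k * w by clear; ring.
rewrite r ler_wpM2l ?mulr_ge0 ?ikern_ge0 //.
by apply: le_W => j; rewrite lerD2r.
Qed.

Lemma J_swap n (I : {set 'I_n}) F i j : nb I F -> i \in I -> j \in I -> i != j ->
  J i (J j F) = J j (J i F).
Proof.
move=> [cF [c c0 H]] iI jI ij; apply/funext => x; rewrite /J.
have c2 : 0 < c / 2 by rewrite divr_gt0.
have [A A0 HA] := H _ c2.
transitivity (Jint (fun t => Jint (fun u => F (upd (upd x i t) j u)))); first by [].
rewrite (@Jint_Fubini R s hs (fun t u => F (upd (upd x i t) j u))
  (A * W (I :\ j :\ i) c (c / 2) x) (c / 2) c2).
- by apply: eq_Jint => u; apply: eq_Jint => t; rewrite updC.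
- move=> u; apply: contC_mC.
  have -> : (fun t => F (upd (upd x i t) j u)) = (fun t => F (upd (upd x j u) i t)).
    by apply/funext => t; rewrite updC.
  exact: nb_slice_contC.
- by move=> t; exact: nb_slice_contC.
- move=> t u; apply: (le_trans (HA _)); rewrite -mulrA ler_wpM2l //.
  have ck : c - c / 2 = c / 2 by rewrite {1}(splitr c) addrK.
  apply: (le_trans (W_upd c _ _ jI (ltW c2))); rewrite ck mulrA ler_wpM2r ?kern_ge0 //.
  have ij' : i \in I :\ j by rewrite !inE ij.
  by apply: (le_trans (W_upd c _ _ ij' (ltW c2))); rewrite ck.
Qed.

Lemma JZ n (I : {set 'I_n}) F (k : 'rV[R]_n -> C) i : nb I F -> i \in I ->
  (forall x t, k (upd x i t) = k x) ->
  J i (fun x => k x * F x) = (fun x => k x * J i F x).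
Proof.
move=> nF iI kk; apply/funext => x; have [A [l nn]] := nb_nice1 x nF iI.
rewrite /J -(JintZ hs (k x) nn); apply: eq_Jint => t.
by rewrite kk.
Qed.

End Slices.

(** * The Fourier transform in one coordinate exchanges derivatives and multiplications *)

Section CoordinateFourier.
Context {R : realType}.
Local Notation C := R[i].

Definition iC : C := 0 +i* 1.

Lemma cabs_iC (r : R) : cabs (iC * r%:C) = `|r|.
Proof. by rewrite cabsM cabsR /cabs /= expr0n expr1n add0r sqrtr1 mul1r. Qed.

Lemma cder_cis_line (a b r : R) :
  @cder R R^o (fun r => cis (a + r * b)) r 1 (iC * b%:C * cis (a + r * b)).
Proof.
have dl : is_derive r 1 (fun r : R => a + r * b) b.
  have := is_deriveD (is_derive_cst a r 1) (is_deriveM (is_derive_id r 1) (is_derive_cst b r 1)).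
  move=> H; apply: is_derive_eq.
  by rewrite scaler0 !add0r /GRing.scale /= mulr1.
split=> /=.
  have H := @is_derive1_comp R cos (fun r : R => a + r * b) r _ _ (is_derive_cos _) dl.
  apply: is_derive_eq; ring.
have H := @is_derive1_comp R sin (fun r : R => a + r * b) r _ _ (is_derive_sin _) dl.
apply: is_derive_eq; ring.
Qed.

Variables (s : R) (hs : 2^-1 <= s).
Let s0 : 0 < s := s_gt0 hs.
Let s_ge0 : 0 <= s := ltW s0.
Local Notation p := s^-1.
Local Notation kern := (kern s).
Local Notation ikern := (ikern s).
Local Notation W := (@W R s _).
Local Notation cls := (@cls R s).
Local Notation nb := (@nb R s _).

(** From |t|^(1/s) <= 4 (|t + r|^(1/s) + 1), by [powR_leD]; this explains the rate k/4. It dominates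
    translates uniformly in r. *)
Lemma kern_shift (k t r : R) : 0 <= k -> `|r| <= 1 ->
  kern k (t + r) <= expR k * kern (k / 4) t.
Proof.
move=> k0 r1; rewrite -expRD ler_expR.
have H : `|t| `^ p <= 4 * (`|t + r| `^ p + 1).
  have := powR_leD hs (t + r) (- r); rewrite addrK normrN => H; apply: (le_trans H).
  have E1 : 1 `^ p = 1 :> R by rewrite powR1.
  rewrite ler_wpM2l // lerD2l -[leRHS]E1.
  by rewrite ge0_ler_powR ?nnegrE ?invr_ge0.
have := ler_wpM2l k0 H; move: (`|t| `^ p) (`|t + r| `^ p) => a b; lra.
Qed.

Section Phase.
Variables (n : nat) (sg : R) (sg1 : `|sg| = 1) (i : 'I_n).

Let phase (t : R) (x : 'rV[R]_n) : C := cis (sg * t * x 0 i).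

(** The integrated variable and the frequency share coordinate i, so that the transform acts on
    functions on one space and can be iterated. The sign sg makes it the transform or, up to a
    constant, its inverse. *)
Definition FT (F : 'rV[R]_n -> C) : 'rV[R]_n -> C :=
  fun x => Jint (fun t => F (upd x i t) * cis (sg * t * x 0 i)).

Let phase1 t x : cabs (phase t x) = 1. Proof. exact: cabs_cis. Qed.

Let cphase t : ccontinuous (phase t).
Proof.
have c1 : continuous (fun x : 'rV[R]_n => sg * t * x 0 i).
  move=> x; apply: (@cvgM R _ (nbhs (x : 'rV[R]_n)) _ (fun=> sg * t) (fun x => x 0 i)).
    exact: cvg_cst.
  exact: coord_continuous.
split=> x; rewrite /phase /cis /=.
  apply: (@continuous_comp _ _ _ (fun x : 'rV[R]_n => sg * t * x 0 i) (@cos R)).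
    exact: c1.
  exact: continuous_cos.
apply: (@continuous_comp _ _ _ (fun x : 'rV[R]_n => sg * t * x 0 i) (@sin R)).
  exact: c1.
exact: continuous_sin.
Qed.

Let phase_t x : contC (phase^~ x).
Proof.
have c1 : continuous (fun t : R => sg * t * x 0 i).
  move=> t; apply: (@cvgM R _ (nbhs (t : R)) _ (fun t => sg * t) (fun=> x 0 i)).
    by apply: (@cvgM R _ (nbhs (t : R)) _ (fun=> sg) id); [exact: cvg_cst|exact: cvg_id].
  exact: cvg_cst.
split=> t; rewrite /phase /cis /=.
  apply: (@continuous_comp _ _ _ (fun t : R => sg * t * x 0 i) (@cos R)).
    exact: c1.
  exact: continuous_cos.
apply: (@continuous_comp _ _ _ (fun t : R => sg * t * x 0 i) (@sin R)).
  exact: c1.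
exact: continuous_sin.
Qed.

(** [None] stands for multiplication by x_i and [Some j] for a derivative; a list of options is thus
    a word in these non-commuting operators. *)
Definition op (o : option 'I_n) (G : 'rV[R]_n -> C) : 'rV[R]_n -> C :=
  if o is Some j then partial j G else fun x => (x 0 i)%:C * G x.

(* Up to a factor of modulus 1, [op o] after the Fourier transform is the transform
   after [op (dual o)]. *)
Definition dual (o : option 'I_n) : option 'I_n :=
  if o is Some j then (if j == i then None else Some j) else Some i.

Lemma cls1_op I (G : 'rV[R]_n -> C) o : cls I (fun _ : unit => G) ->
  cls I (fun _ : unit => op o G).
Proof.
case: o => [j|] cG; first exact: (cls_partial hs (fun _ => j) cG).
exact: (clsM0 hs (cls_coord hs i) cG).
Qed.

Lemma smooth_op (G : 'rV[R]_n -> C) o : smooth G -> smooth (op o G).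
Proof.
case: o => [j|] sG; first exact: smooth_partial.
exact: (smoothM (smooth_coord i) sG).
Qed.

Lemma smooth_ops (G : 'rV[R]_n -> C) w : smooth G -> smooth (foldr op G w).
Proof. by move=> sG; elim: w => [|o w IH]; [exact: sG|exact: (smooth_op o IH)]. Qed.

Lemma op_lin (k : C) (f g : 'rV[R]_n -> C) o : smooth f -> smooth g ->
  op o (fun x => k * f x + g x) = (fun x => k * op o f x + op o g x).
Proof.
case: o => [j|] sf sg'.
  have := partials_lin [:: j] k sf sg'; exact.
by apply/funext => x /=; rewrite mulrDr mulrCA.
Qed.

Lemma ops_lin (k : C) (f g : 'rV[R]_n -> C) w : smooth f -> smooth g ->
  foldr op (fun x => k * f x + g x) w = (fun x => k * foldr op f w x + foldr op g w x).
Proof.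
move=> sf sg'; elim: w => [|o w IH]; first exact: erefl.
have -> : foldr op (fun x => k * f x + g x) (o :: w) =
  op o (foldr op (fun x => k * f x + g x) w) by exact: erefl.
by rewrite IH (op_lin k o (smooth_ops w sf) (smooth_ops w sg')).
Qed.

Lemma local_dom I (G : 'rV[R]_n -> C) x : nb I G -> i \in I ->
  exists A k, 0 < k /\ 0 <= A /\ forall y t, `|y - x| <= 1 -> cabs (G (upd y i t)) <= A * kern k t.
Proof.
move=> nG iI; have [c c0 H] := nb_slice nG iI.
have c2 : 0 < c / 2 by rewrite divr_gt0.
have [A A0 HA] := H _ c2 (lexx _).
exists (A * expR (c / 2 * (n%:R * (`|x| + 1) `^ p))), (c / 2); split=> //.
split=> [|y t yx]; first by rewrite mulr_ge0 ?expR_ge0.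
rewrite (le_trans (HA y t)) // ler_wpM2r ?kern_ge0 // ler_wpM2l //.
by apply: (W_loc hs) => //; exact: ltW.
Qed.

Lemma FT_continuous I (G : 'rV[R]_n -> C) : nb I G -> i \in I -> ccontinuous (FT G).
Proof.
move=> nG iI; apply: (@nb_Jint_continuous R s hs n I G phase i nG iI) => // x.
exact: contC_mC.
Qed.

Lemma slice_phase_mC (G : 'rV[R]_n -> C) x : ccontinuous G ->
  mC (fun t => G (upd x i t) * phase t x).
Proof.
move=> cG; apply: mC_M; first by apply: contC_mC; exact: nb_slice_contC.
exact: contC_mC.
Qed.

Lemma FT_nice1 I (G : 'rV[R]_n -> C) x : nb I G -> i \in I ->
  exists A k, nice1 s A k (fun t => G (upd x i t) * phase t x).
Proof.
move=> nG iI; have [A [k [k0 [A0 H]]]] := local_dom x nG iI.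
exists A, k; split=> //; first by apply: slice_phase_mC; case: nG.
by move=> t; rewrite cabsM phase1 mulr1; apply: H; rewrite subrr normr0.
Qed.

(** The phase does not involve x_j, so the whole derivative falls on G. *)
Lemma FT_partial_other I (G : 'rV[R]_n -> C) j x : cls I (fun _ : unit => G) -> i \in I ->
  j != i -> cder (FT G) x (delta_mx 0 j) (FT (partial j G) x).
Proof.
move=> cG iI ji; have cG' := cls_partial hs (fun _ => j) cG.
have nG := nb_of_cls tt cG; have nG' := nb_of_cls tt cG'.
have sG := cls_smooth tt cG.
have [A [k [k0 [A0 HA]]]] := local_dom x nG iI.
have [B [l [l0 [B0 HB]]]] := local_dom x nG' iI.
pose m := Num.min k l; have m0 : 0 < m by rewrite lt_min k0.
have mk t : kern k t <= kern m t by apply: kern_mono; rewrite ge_min lexx.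
have ml t : kern l t <= kern m t by apply: kern_mono; rewrite ge_min lexx orbT.
apply: (@cder_Jint R s hs n j (fun x t => G (upd x i t) * phase t x)
  (fun x t => partial j G (upd x i t) * phase t x) x (A + B) m m0).
- move=> y t.
  have d1 : cder (fun y => G (upd y i t)) y (delta_mx 0 j) (partial j G (upd y i t)).
    apply: cder_of_line.
    have -> : (fun r : R => G (upd (y + r *: delta_mx 0 j) i t)) =
        (fun r => G (upd y i t + r *: delta_mx 0 j)).
      by apply/funext => r; rewrite upd_move.
    apply: cder_line; rewrite scale0r addr0; exact: smooth_cder.
  have d2 : cder (phase t) y (delta_mx 0 j) 0.
    apply: cder_of_line.
    have -> : (fun r : R => phase t (y + r *: delta_mx 0 j)) = (fun=> phase t y).
      apply/funext => r; rewrite /phase !mxE eqxx /= eq_sym (negbTE ji).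
      by rewrite mulr0 addr0.
    exact: cder_cst.
  by have := cderM d1 d2; rewrite mulr0 addr0.
- by move=> y; apply: slice_phase_mC; case: nG.
- move=> y t yx; rewrite cabsM phase1 mulr1 (le_trans (HA y t yx)) //.
  by rewrite mulrDl ler_wpDr ?mulr_ge0 ?kern_ge0 // ler_wpM2l.
- move=> y t yx; rewrite cabsM phase1 mulr1 (le_trans (HB y t yx)) //.
  by rewrite mulrDl ler_wpDl ?mulr_ge0 ?kern_ge0 // ler_wpM2l.
Qed.

(** [upd] overwrites x_i, so the integrand depends on x_i through the phase only, whose derivative
    brings down the integration variable. *)
Lemma FT_partial_same I (G : 'rV[R]_n -> C) x : cls I (fun _ : unit => G) -> i \in I ->
  cder (FT G) x (delta_mx 0 i) (iC * sg%:C * FT (op None G) x).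
Proof.
move=> cG iI; have cG' := cls1_op None cG.
have nG := nb_of_cls tt cG; have nG' := nb_of_cls tt cG'.
have [A [k [k0 [A0 HA]]]] := local_dom x nG iI.
have [B [l [l0 [B0 HB]]]] := local_dom x nG' iI.
pose m := Num.min k l; have m0 : 0 < m by rewrite lt_min k0.
have mk t : kern k t <= kern m t by apply: kern_mono; rewrite ge_min lexx.
have ml t : kern l t <= kern m t by apply: kern_mono; rewrite ge_min lexx orbT.
have [D [e nn]] := FT_nice1 x nG' iI.
rewrite /FT -(JintZ hs _ nn).
apply: (@cder_Jint R s hs n i (fun x t => G (upd x i t) * phase t x)
  (fun x t => iC * sg%:C * (op None G (upd x i t) * phase t x)) x (A + B) m m0).
- move=> y t.
  have d1 : cder (fun y => G (upd y i t)) y (delta_mx 0 i) 0.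
    apply: cder_of_line.
    have -> : (fun r : R => G (upd (y + r *: delta_mx 0 i) i t)) = (fun=> G (upd y i t)).
      by apply/funext => r; rewrite upd_move_same.
    exact: cder_cst.
  have d2 : cder (phase t) y (delta_mx 0 i) (iC * (sg * t)%:C * phase t y).
    apply: cder_of_line.
    have -> : (fun r : R => phase t (y + r *: delta_mx 0 i)) =
       (fun r => cis (sg * t * y 0 i + r * (sg * t))).
      apply/funext => r; rewrite /phase !mxE !eqxx /= mulr1 mulrDr.
      by rewrite (mulrC r).
    by have := cder_cis_line (sg * t * y 0 i) (sg * t) 0; rewrite mul0r addr0.
  have := cderM d1 d2; rewrite mul0r add0r.
  suff -> : G (upd y i t) * (iC * (sg * t)%:C * phase t y) =
    iC * sg%:C * (op None G (upd y i t) * phase t y) by [].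
  rewrite /op upd_same.
  have -> : (sg * t)%:C = sg%:C * t%:C :> C by rewrite -rmorphM.
  move: (phase t y) (G _) (sg%:C) (t%:C) iC => a b c d f; clear; ring.
- by move=> y; apply: slice_phase_mC; case: nG.
- move=> y t yx; rewrite cabsM phase1 mulr1 (le_trans (HA y t yx)) //.
  by rewrite mulrDl ler_wpDr ?mulr_ge0 ?kern_ge0 // ler_wpM2l.
- move=> y t yx; rewrite cabsM cabs_iC sg1 mul1r cabsM phase1 mulr1 (le_trans (HB y t yx)) //.
  by rewrite mulrDl ler_wpDl ?mulr_ge0 ?kern_ge0 // ler_wpM2l.
Qed.

(* The integral of G(x[i := t + r]) e^{i sg (t + r) x_i} over t does not depend on r,
   so the integral of its r-derivative vanishes. *)
Lemma FT_mul_coord I (G : 'rV[R]_n -> C) (x : 'rV[R]_n) : cls I (fun _ : unit => G) -> i \in I ->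
  iC * sg%:C * ((x 0 i)%:C * FT G x) = - FT (partial i G) x.
Proof.
move=> cG iI; have cG' := cls_partial hs (fun _ => i) cG.
have nG := nb_of_cls tt cG; have nG' := nb_of_cls tt cG'.
have sG := cls_smooth tt cG.
have x1 : `|x - x| <= 1 by rewrite subrr normr0.
have [A [k [k0 [A0 HA]]]] := local_dom x nG iI.
have [B [l [l0 [B0 HB]]]] := local_dom x nG' iI.
pose m := Num.min k l; have m0 : 0 < m by rewrite lt_min k0.
have mk t : kern k t <= kern m t by apply: kern_mono; rewrite ge_min lexx.
have ml t : kern l t <= kern m t by apply: kern_mono; rewrite ge_min lexx orbT.
have [K KE] : exists K : C, K = iC * (sg * x 0 i)%:C by exists (iC * (sg * x 0 i)%:C).
pose f (r t : R) := G (upd x i (t + r)) * phase (t + r) x.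
pose df (r t : R) := partial i G (upd x i (t + r)) * phase (t + r) x +
  K * (G (upd x i (t + r)) * phase (t + r) x).
have [a [k1 nn]] := FT_nice1 x nG iI.
have [b [l1 nn']] := FT_nice1 x nG' iI.
have fE r : Jint (f r) = FT G x by exact: (Jint_shift hs r nn).
have D : @cder R R^o (fun r => Jint (f r)) 0 1 (Jint (df 0)).
  apply: (@Jint_DUI R s hs f df ((A + B + cabs K * A) * expR m) (m / 4)).
  - by rewrite divr_gt0.
  - move=> r t _.
    have d1 : @cder R R^o (fun r => G (upd x i (t + r))) r 1 (partial i G (upd x i (t + r))).
      have -> : (fun r : R => G (upd x i (t + r))) = (fun r => G (upd x i t + r *: delta_mx 0 i)).
        by apply/funext => u; rewrite upd_addr.
      by rewrite upd_addr; apply: cder_line; exact: smooth_cder.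
    have d2 : @cder R R^o (fun r => phase (t + r) x) r 1 (K * phase (t + r) x).
      have E u : phase (t + u) x = cis (sg * t * x 0 i + u * (sg * x 0 i)).
        by rewrite /phase; congr cis; move: (x 0 i) => z; clear; ring.
      rewrite E KE; under eq_fun do rewrite E.
      exact: cder_cis_line.
    have := cderM d1 d2.
    suff -> : G (upd x i (t + r)) * (K * phase (t + r) x) =
      K * (G (upd x i (t + r)) * phase (t + r) x) by [].
    by rewrite mulrCA.
  - move=> r; apply: contC_mC.
    have [cG1 _] := nG.
    have sh (g : R -> C) : contC g -> contC (fun t => g (t + r)).
      have cs : continuous (fun t : R => t + r).
        by move=> t; apply: cvgD; [exact: cvg_id|exact: cvg_cst].
      move=> [g1 g2]; split=> t.
        exact: (@continuous_comp R R R (fun t => t + r) (fun t => complex.Re (g t)) t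
          (cs t) (g1 (t + r))).
      exact: (@continuous_comp R R R (fun t => t + r) (fun t => complex.Im (g t)) t
        (cs t) (g2 (t + r))).
    apply: (sh (fun t => G (upd x i t) * phase t x)).
    have [g1 g2] := nb_slice_contC x i cG1; have [p1 p2] := phase_t x.
    split.
      have -> : (fun t => complex.Re (G (upd x i t) * phase t x)) = (fun t =>
        complex.Re (G (upd x i t)) * complex.Re (phase t x) -
        complex.Im (G (upd x i t)) * complex.Im (phase t x)).
        by apply/funext => t; case: (G _) (phase _ _) => [? ?] [].
      by move=> t; apply: cvgB; apply: cvgM; [exact: g1|exact: p1|exact: g2|exact: p2].
    have -> : (fun t => complex.Im (G (upd x i t) * phase t x)) = (fun t =>
      complex.Re (G (upd x i t)) * complex.Im (phase t x) +
      complex.Im (G (upd x i t)) * complex.Re (phase t x)).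
      by apply/funext => t; case: (G _) (phase _ _) => [? ?] [].
    by move=> t; apply: cvgD; apply: cvgM; [exact: g1|exact: p2|exact: g2|exact: p1].
  - move=> r t r1; rewrite cabsM phase1 mulr1 (le_trans (HA x _ x1)) //.
    apply: (le_trans (ler_wpM2l A0 (mk _))).
    apply: (le_trans (ler_wpM2l A0 (kern_shift t (ltW m0) (ltW r1)))).
    rewrite mulrA ler_wpM2r ?kern_ge0 // ler_wpM2r ?expR_ge0 //.
    by rewrite -addrA lerDl addr_ge0 // mulr_ge0 ?cabs_ge0.
  - move=> r t r1; apply: (le_trans (cabsD _ _)).
    rewrite !cabsM phase1 !mulr1.
    apply: (@le_trans _ _ (B * kern m (t + r) + cabs K * (A * kern m (t + r)))).
      apply: lerD; first exact: (le_trans (HB x _ x1) (ler_wpM2l B0 (ml _))).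
      apply: ler_wpM2l; first exact: cabs_ge0.
      exact: (le_trans (HA x _ x1) (ler_wpM2l A0 (mk _))).
    rewrite mulrA -mulrDl -mulrA.
    apply: (@le_trans _ _ ((B + cabs K * A) * (expR m * kern (m / 4) t))).
      rewrite ler_wpM2l ?addr_ge0 ?mulr_ge0 ?cabs_ge0 //.
      exact: (kern_shift t (ltW m0) (ltW r1)).
    rewrite ler_wpM2r ?mulr_ge0 ?expR_ge0 ?kern_ge0 //.
    by rewrite lerD2r lerDr.
have D0 : @cder R R^o (fun r => Jint (f r)) 0 1 0.
  have -> : (fun r => Jint (f r)) = (fun=> FT G x) by apply/funext.
  exact: cder_cst.
have := cder_unique D D0.
have -> : Jint (df 0) = FT (partial i G) x + K * FT G x.
  have nK : nice1 s (cabs K * a) k1 (fun t => K * (G (upd x i t) * phase t x)).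
    have [k10 m1 H1] := nn; split=> //.
      by apply: (mC_M (mC_cst K)).
    by move=> t; rewrite cabsM -mulrA ler_wpM2l ?cabs_ge0.
  rewrite /FT -(JintZ hs K nn) -(JintD hs nn' nK); apply: eq_Jint => t.
  by rewrite /df addr0.
move=> /eqP; rewrite addrC addr_eq0 => /eqP <-.
have -> : K = iC * sg%:C * (x 0 i)%:C by rewrite KE -mulrA -rmorphM.
by rewrite !mulrA.
Qed.

End Phase.
End CoordinateFourier.

(** * Stability of the weighted classes under the transform in one coordinate *)

Section FourierClass.
Context {R : realType}.
Local Notation C := R[i].
Variables (s : R) (hs : 2^-1 <= s).
Let s0 : 0 < s := s_gt0 hs.
Let s_ge0 : 0 <= s := ltW s0.
Local Notation p := s^-1.
Local Notation kern := (kern s).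
Local Notation ikern := (ikern s).
Local Notation W := (@W R s _).
Local Notation cls := (@cls R s).
Local Notation nb := (@nb R s _).

Lemma half_split (a b : R) : a / 2 + (b - a) = b - a / 2.
Proof. by field. Qed.

Section Coordinate.
Variables (n : nat) (sg : R) (sg1 : `|sg| = 1) (i : 'I_n).
Local Notation FT := (@FT R n sg i).
Local Notation op := (@op R n i).

Lemma cder_scale (V : normedModType R) (f : V -> C) x v d (k : C) :
  cder f x v d -> cder (fun y => k * f y) x v (k * d).
Proof. by move=> H; have := cderM (cder_cst k x v) H; rewrite mul0r add0r. Qed.

Lemma FT_op I (G : 'rV[R]_n -> C) o : cls I (fun _ : unit => G) -> i \in I ->
  exists2 k : C, cabs k = 1 & op o (FT G) = (fun x => k * FT (op (dual i o) G) x).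
Proof.
move=> cG iI; case: o => [j|].
  rewrite /dual; have [->|ji] := eqVneq j i.
    exists (iC * sg%:C); first by rewrite cabs_iC sg1.
    apply/funext => x; apply: partialE.
    exact: (FT_partial_same hs sg1 x cG iI).
  exists 1; first exact: cabs1.
  apply/funext => x; rewrite mul1r; apply: partialE.
  exact: (FT_partial_other hs sg x cG iI ji).
have k0 : iC * sg%:C != 0 :> C.
  apply/eqP => E; have := cabs_iC sg; rewrite E cabs0 sg1 => /eqP.
  by rewrite eq_sym oner_eq0.
exists (- (iC * sg%:C)^-1).
  have : cabs (iC * sg%:C * (iC * sg%:C)^-1) = 1 by rewrite mulfV // cabs1.
  by rewrite cabsM cabs_iC sg1 mul1r cabsN.
apply/funext => x; apply: (mulfI k0).
rewrite [RHS]mulrA mulrN mulfV // mulN1r.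
exact: (FT_mul_coord hs sg x cG iI).
Qed.

Lemma FT_cderivable I (G : 'rV[R]_n -> C) j : cls I (fun _ : unit => G) -> i \in I ->
  cderivable j (FT G).
Proof.
move=> cG iI; have [->|ji] := eqVneq j i.
  apply: (cderivable_partial (fun x => FT_partial_same hs sg1 x cG iI)).1.
exact: (cderivable_partial (fun x => FT_partial_other hs sg x cG iI ji)).1.
Qed.

Lemma cls1_ops I (G : 'rV[R]_n -> C) w : cls I (fun _ : unit => G) ->
  cls I (fun _ : unit => foldr op G w).
Proof.
move=> cG; elim: w => [|o w IH]; first exact: cG.
exact: (cls1_op hs i o IH).
Qed.

Lemma FT_ops I (G : 'rV[R]_n -> C) w : cls I (fun _ : unit => G) -> i \in I ->
  exists2 k : C, cabs k = 1 &
    foldr op (FT G) w = (fun x => k * FT (foldr op G (map (dual i) w)) x).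
Proof.
move=> cG iI; elim: w => [|o w [k k1 E]].
  by exists 1; [exact: cabs1|apply/funext => x; rewrite mul1r].
have cG' := cls1_ops (map (dual i) w) cG.
have [l l1 E'] := FT_op o cG' iI.
exists (k * l); first by rewrite cabsM k1 l1 mulr1.
have -> : foldr op (FT G) (o :: w) = op o (foldr op (FT G) w) by exact: erefl.
rewrite E; set H := FT _ in E' *.
have -> : op o (fun x => k * H x) = (fun x => k * op o H x).
  case: o {E'} => [j|]; last by apply/funext => x /=; rewrite mulrCA.
  apply/funext => x; apply: partialE; apply: cder_scale.
  by have /cderivableP := FT_cderivable j cG' iI; apply.
by rewrite E'; apply/funext => x; rewrite mulrA.
Qed.

Lemma ops_partials (G : 'rV[R]_n -> C) l : foldr op G (map Some l) = partials l G.
Proof. by elim: l => [|j l IH]; [exact: erefl|rewrite /= IH]. Qed.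

Lemma FT_smooth I (G : 'rV[R]_n -> C) : cls I (fun _ : unit => G) -> i \in I ->
  smooth (FT G).
Proof.
move=> cG iI l; have [k k1] := FT_ops (map Some l) cG iI.
rewrite ops_partials => ->; have cG' := cls1_ops (map (dual i) (map Some l)) cG.
set H := foldr _ _ _ in cG' *.
have E : (fun x => k * FT H x) = (fun x => k * FT H x + (fun=> 0) x).
  by apply/funext => x; rewrite addr0.
have cH := FT_continuous hs sg (nb_of_cls tt cG') iI.
split=> [|j].
  by rewrite E; apply: ccontinuous_lin cH (smooth_cont (@smooth0 R n)).
have d := FT_cderivable j cG' iI.
apply: (cderivable_partial (df := fun x => k * partial j (FT H) x) _).1 => x.
by apply: cder_scale; move: x; apply/cderivableP.
Qed.

Lemma op_monomial (P : 'rV[R]_n -> C) o m l : smooth P ->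
  op o (fun x => (x 0 i)%:C ^+ m * partials l P x) =
  if o is Some j then
    fun x => (m%:R * (i == j)%:R) * ((x 0 i)%:C ^+ m.-1 * partials l P x) +
             (x 0 i)%:C ^+ m * partials (j :: l) P x
  else fun x => (x 0 i)%:C ^+ m.+1 * partials l P x.
Proof.
move=> sP; case: o => [j|]; last by apply/funext => x; rewrite /= mulrA -exprS.
apply/funext => x; apply: partialE.
have d1 : cder (fun x : 'rV[R]_n => (x 0 i)%:C ^+ m) x (delta_mx 0 j)
    (m%:R * (i == j)%:R * (x 0 i)%:C ^+ m.-1).
  elim: m => [|m IH].
    by rewrite mul0r mul0r; apply: cder_cst.
  under eq_fun do rewrite exprS.
  have d0 : cder (fun x : 'rV[R]_n => (x 0 i)%:C) x (delta_mx 0 j) (i == j)%:R.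
    have := cder_coord i x (delta_mx 0 j).
    by rewrite mxE eqxx /=; case: (i == j).
  have := cderM d0 IH.
  suff -> : (i == j)%:R * (x 0 i)%:C ^+ m +
     (x 0 i)%:C * (m%:R * (i == j)%:R * (x 0 i)%:C ^+ m.-1) =
     m.+1%:R * (i == j)%:R * (x 0 i)%:C ^+ m.+1.-1 by [].
  rewrite /= -natr1; case: m {IH} => [|m] /=; first by rewrite !mul0r mulr0 addr0 add0r mul1r.
  rewrite (mulrCA (x 0 i)%:C) -exprS !mulrDl mul1r addrC; congr (_ + _).
have d2 := smooth_cder j x (smooth_partials l sP).
have := cderM d1 d2.
by rewrite -!mulrA.
Qed.

(** A letter applied to x_i^m times a derivative raises m or the order of the derivative, and in the
    commutator term lowers m at the cost of a factor m. Each letter at most doubles the number of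
    terms, and [fs_step] absorbs the factor m, since in that term the total count is two below the
    one in the bound. Half of the decay in x_i pays for the monomials. *)
Lemma ops_bound (I : {set 'I_n}) (F : 'rV[R]_n -> C) (h c d A K H : R) : H = 1 + h + K ->
  i \in I -> 0 < h -> 0 < c -> 0 <= A -> 0 < K -> kap s K = c / 2 -> smooth F ->
  (forall x, bnd h s (A * W I c d x) F x) ->
  forall w m l x,
    cabs (foldr op (fun x => (x 0 i)%:C ^+ m * partials l F x) w x) <=
    A * W I (c / 2) d x * (2 ^+ size w * (H ^+ (size w + m + size l) *
      fs s (size w + m + size l))).
Proof.
move=> HE iI h0 c0 A0 K0 KE sF HF w m l x.
have H1 : 1 <= H by rewrite HE -addrA lerDl addr_ge0 ?ltW.
have Hh : h <= H by rewrite HE addrAC lerDr addr_ge0 ?ltW.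
have HK : K <= H by rewrite HE lerDr addr_ge0 ?ltW.
have H0 : 0 <= H by rewrite (le_trans _ H1).
have AW : 0 <= A * W I (c / 2) d x by rewrite mulr_ge0 ?W_ge0.
have smon m' l' : smooth (fun x : 'rV[R]_n => (x 0 i)%:C ^+ m' * partials l' F x).
  apply: smoothM; last exact: smooth_partials.
  elim: m' => [|m' IH]; first exact: smooth_cst.
  by under eq_fun do rewrite exprS; exact: (smoothM (smooth_coord i) IH).
have fHmono a b : (a <= b)%N -> H ^+ a * fs s a <= H ^+ b * fs s b.
  move=> ab; apply: ler_pM; rewrite ?exprn_ge0 ?fs_ge0 ?le_fs //.
  by rewrite ler_weXn2l.
elim/last_ind: w m l => [|w o IH] m l.
  rewrite /= expr0 mul1r add0n cabsM cabsX cabsR.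
  have P := pow_le_exp s0 m K0 (normr_ge0 (x 0 i)).
  apply: (le_trans (ler_pM _ (cabs_ge0 _) P (HF x l))); first by rewrite exprn_ge0.
  have EW : expR (kap s K * `|x 0 i| `^ p) * W I c d x <= W I (c / 2) d x.
    rewrite KE -expRD ler_expR (bigD1 i) //= [in leRHS](bigD1 i) //= iI !mulr1 addrA.
    apply: lerD; first by rewrite -mulrDl half_split.
    apply: ler_sum => j ji; rewrite ler_wpM2r ?powR_ge0 // lerB // ler_wpM2r //.
    by rewrite ler_pdivrMr // ler_peMr ?(ltW c0) ?ler1n.
  rewrite [leLHS](_ : _ = A * (expR (kap s K * `|x 0 i| `^ p) * W I c d x) *
     ((K ^+ m * h ^+ size l) * (fs s m * fs s (size l)))); last first.
    move: (K ^+ m) (h ^+ _) (fs s m) (fs s _) (expR _) (W I c d x) => a b e f g k.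
    clear; ring.
  apply: ler_pM.
  - by rewrite mulr_ge0 // mulr_ge0 ?expR_ge0 ?W_ge0.
  - by rewrite !mulr_ge0 ?exprn_ge0 ?fs_ge0 ?ltW.
  - by rewrite ler_wpM2l.
  apply: ler_pM; rewrite ?mulr_ge0 ?exprn_ge0 ?fs_ge0 ?(ltW h0) ?(ltW K0) //; last exact: fs_mul.
  rewrite exprD; apply: ler_pM; rewrite ?exprn_ge0 ?(ltW h0) ?(ltW K0) //.
    by rewrite lerXn2r ?nnegrE // ltW.
  by rewrite lerXn2r ?nnegrE // ltW.
rewrite foldr_rcons (op_monomial o m l sF) size_rcons.
case: o => [j|].
  rewrite (ops_lin i _ w (smon m.-1 l) (smon m (j :: l))).
  apply: (le_trans (cabsD _ _)).
  set N := (size w + m + size l)%N.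
  have B2 := IH m (j :: l); rewrite [size (j :: l)]/= addnS -/N in B2.
  have B1 : cabs (m%:R * (i == j)%:R * foldr op (fun x => (x 0 i)%:C ^+ m.-1 * partials l F x) w x)
     <= A * W I (c / 2) d x * (2 ^+ size w * (H ^+ N.+1 * fs s N.+1)).
    rewrite cabsM; case: m @N B2 => [|m'] N _.
      by rewrite mul0r cabs0 mul0r !mulr_ge0 ?exprn_ge0 ?fs_ge0 ?W_ge0.
    have Q := IH m' l; rewrite /=; set M := (size w + m' + size l)%N in Q.
    have NM : N = M.+1 by rewrite /N /M addnS addSn.
    have c1 : cabs (m'.+1%:R * (i == j)%:R : C) <= m'.+1%:R.
      rewrite -[m'.+1%:R : C](rmorph_nat (real_complex R)) -[(i == j)%:R : C](rmorph_nat (real_complex R)).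
      rewrite -rmorphM cabsR ger0_norm ?mulr_ge0 // ler_piMr //.
      by case: (i == j).
    apply: (le_trans (ler_pM (cabs_ge0 _) (cabs_ge0 _) c1 Q)).
    rewrite NM mulrCA ler_wpM2l // mulrCA ler_wpM2l ?exprn_ge0 //.
    rewrite mulrCA; apply: ler_pM; rewrite ?exprn_ge0 ?mulr_ge0 ?fs_ge0 //.
      by rewrite ler_weXn2l // leqW.
    apply: (fs_step hs); rewrite /M ltnS.
    by rewrite -addnA addnCA leq_addr.
  apply: (le_trans (lerD B1 B2)).
  rewrite -mulr2n -[leLHS]mulr_natl (exprS (2 : R)) !addSn -/N.
  by rewrite mulrCA [2 * (_ * _)]mulrA.
apply: (le_trans (IH m.+1 l)).
rewrite addnS !addSn ler_wpM2l // (exprS (2 : R)) -[leRHS]mulrA ler_peMl ?mulr_ge0 ?exprn_ge0 ?fs_ge0 //.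
by rewrite ler1n.
Qed.

(** To bound a derivative of the transform at x, it is multiplied by x_i^k with k adapted to x_i
    through [exp_le_pow]. The word for x_i^k times the derivative passes to the dual word on F,
    where [ops_bound] applies. The factorial of k + |l| then splits by [fs_add] into a part that
    yields the new decay and a part that yields the new Gevrey bound. *)
Lemma cls_FT (I : {set 'I_n}) T (F : T -> 'rV[R]_n -> C) : cls I F -> i \in I ->
  cls I (fun t => FT (F t)).
Proof.
move=> cF iI; have cF1 t : cls I (fun _ : unit => F t) := cls_sub (fun _ => t) cF.
split=> [t|]; first exact: FT_smooth (cF1 t) iI.
have [sF [h [c [h0 c0 HF]]]] := cF.
have c2 : 0 < c / 2 by rewrite divr_gt0.
have c4 : 0 < c / 4 by rewrite divr_gt0.
have [K K0 KE] := kap_surj s0 c2.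
pose H := 1 + h + K; have H0 : 0 < H by rewrite !addr_gt0.
(* The factor 2 H comes from [ops_bound] and 2^s from splitting the factorial; [K2] adds the e^s
   lost in [exp_le_pow]. *)
pose h' := 2 * H * 2 `^ s; have h'0 : 0 < h' by rewrite !mulr_gt0 ?powR_gt0.
pose K2 := expR s * h'; have K20 : 0 < K2 by rewrite mulr_gt0 ?expR_gt0.
(* In coordinate i the decay is the newly gained one; in the others c/2 is what [ops_bound] leaves
   of the old one. *)
pose c' := Num.min (c / 2) (kap s K2).
have c'0 : 0 < c' by rewrite lt_min c2 kap_gt0.
(* With e <= c/4 the slices of the integrand keep the rate c/2 - e >= c/4. *)
exists h', c'; split=> // d d0; pose e := Num.min d (c / 4).
have e0 : 0 < e by rewrite lt_min d0.
have ed : e <= d by rewrite ge_min lexx.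
have ec : e <= c / 4 by rewrite ge_min lexx orbT.
have [A A0 HA] := HF e e0.
pose B := 2 * A * ikern (c / 4); have B0 : 0 <= B by rewrite !mulr_ge0 ?ikern_ge0.
exists (B * expR s) => [|t x l]; first by rewrite mulr_ge0 ?expR_ge0.
have [k Hk] := exp_le_pow s0 K20 (normr_ge0 (x 0 i)).
set D := cabs (partials l (FT (F t)) x).
have D0 : 0 <= D by exact: cabs_ge0.
pose w := nseq k None ++ map Some l.
have wD : foldr op (FT (F t)) w x = (x 0 i)%:C ^+ k * partials l (FT (F t)) x.
  rewrite /w foldr_cat ops_partials; elim: k {Hk w} => [|k IH]; first by rewrite /= expr0 mul1r.
  by rewrite /= IH mulrA -exprS.
have [u u1 Eu] := FT_ops w (cF1 t) iI.
pose w' := map (dual i) w.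
have sw' : size w' = (k + size l)%N by rewrite size_map size_cat size_nseq size_map.
have Q y : cabs (foldr op (F t) w' y) <= A * W I (c / 2) e y *
    ((2 * H) ^+ (k + size l) * fs s (k + size l)).
  have := @ops_bound I (F t) h c e A K H erefl iI h0 c0 A0 K0 KE (sF t) (HA t) w' 0 [::] y.
  rewrite sw' !addn0 exprMn -!mulrA.
  suff -> : (fun x : 'rV[R]_n => (x 0 i)%:C ^+ 0 * partials [::] (F t) x) = F t by [].
  by apply/funext => z; rewrite expr0 mul1r.
pose Z := (2 * H) ^+ (k + size l) * fs s (k + size l).
have Z0 : 0 <= Z by rewrite mulr_ge0 ?fs_ge0 // exprn_ge0 // mulr_ge0 // ltW.
have nn : nice1 s (A * W (I :\ i) (c / 2) e x * Z) (c / 4)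
    (fun r => foldr op (F t) w' (upd x i r) * cis (sg * r * x 0 i)).
  split=> //.
    apply: (slice_phase_mC sg i x (smooth_cont _)).
    exact: smooth_ops (sF t).
  move=> r; rewrite cabsM cabs_cis mulr1; apply: (le_trans (Q _)); rewrite -/Z.
  rewrite [leRHS]mulrAC ler_wpM2r // -mulrA ler_wpM2l //.
  apply: (le_trans (W_upd s (c / 2) x r iI (ltW e0))); rewrite ler_wpM2l ?W_ge0 //.
  apply: kern_mono; rewrite lerBrDr (le_trans (lerD (lexx _) ec)) //.
  by rewrite -mulrDl -mulr2n -[c *+ 2]mulr_natr -mulrA ler_wpM2l ?(ltW c0) //; lra.
have HD : `|x 0 i| ^+ k * D <= B * W (I :\ i) (c / 2) e x * Z.
  rewrite /D -cabsR -cabsX -cabsM -wD Eu cabsM u1 mul1r.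
  apply: (le_trans (Jint_bound hs nn)).
  rewrite /B; move: (ikern _) (W (I :\ i) _ _ _) => a b.
  by rewrite le_eqVlt; apply/orP; left; apply/eqP; clear; ring.
have Zle : Z <= (h' ^+ k * fs s k) * (h' ^+ size l * fs s (size l)).
  rewrite /Z /h' mulrACA -exprD [in leRHS]exprMn -mulrA.
  rewrite ler_wpM2l ?exprn_ge0 ?mulr_ge0 ?(ltW H0) //; exact: fs_add.
pose E := expR (kap s K2 * `|x 0 i| `^ p).
have E0 : 0 < E by exact: expR_gt0.
have step : E * (K2 ^+ k * fs s k) * D <=
    expR s * (expR s ^+ k * (B * W (I :\ i) (c / 2) e x * Z)).
  apply: (le_trans (ler_wpM2r D0 Hk)).
  by rewrite -[leLHS]mulrA ler_wpM2l ?expR_ge0 // exprMn -[leLHS]mulrA ler_wpM2l ?exprn_ge0 ?expR_ge0.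
have {}step : E * D <= expR s * (B * W (I :\ i) (c / 2) e x * (h' ^+ size l * fs s (size l))).
  have q0 : 0 < K2 ^+ k * fs s k by rewrite mulr_gt0 ?exprn_gt0 ?fs_gt0.
  rewrite -(ler_pM2r q0) mulrAC; apply: (le_trans step).
  rewrite -[leRHS]mulrA ler_wpM2l ?expR_ge0 //.
  have -> : K2 ^+ k = expR s ^+ k * h' ^+ k by rewrite /K2 exprMn.
  apply: (@le_trans _ _ (expR s ^+ k * (B * W (I :\ i) (c / 2) e x *
     ((h' ^+ k * fs s k) * (h' ^+ size l * fs s (size l)))))).
    by rewrite ler_wpM2l ?exprn_ge0 ?expR_ge0 // ler_wpM2l // mulr_ge0 ?W_ge0.
  have r (a b g f x' : R) : a * (b * ((g * f) * x')) = b * x' * (a * g * f) by clear; ring.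
  by rewrite r.
have {}step : D <= E^-1 * (expR s * (B * W (I :\ i) (c / 2) e x * (h' ^+ size l * fs s (size l)))).
  by rewrite ler_pdivlMl.
apply: (le_trans step).
have WE : E^-1 * W (I :\ i) (c / 2) e x <= W I c' d x.
  rewrite /E -expRN -expRD ler_expR (bigD1 i) //= [in leRHS](bigD1 i) //= iI !inE eqxx /=.
  rewrite mulr0 subr0 mulr1 addrA; apply: lerD.
    rewrite -mulNr -mulrDl ler_wpM2r ?powR_ge0 // addrC lerB //.
    by rewrite ge_min lexx orbT.
  apply: ler_sum => j ji; rewrite !inE ji /= ler_wpM2r ?powR_ge0 // lerB //.
  by rewrite ler_wpM2r // ge_min lexx.
have Y0 : 0 <= B * expR s * (h' ^+ size l * fs s (size l)).
  by rewrite mulr_ge0 ?[B * _]mulr_ge0 ?expR_ge0 // mulr_ge0 ?fs_ge0 ?exprn_ge0 // ltW.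
have r (a b g f y : R) : a * (b * (g * f * y)) = g * b * y * (a * f) by clear; ring.
by rewrite r [leRHS]mulrAC ler_wpM2l.
Qed.

End Coordinate.
End FourierClass.

(** * Integration and Fourier transforms in a block of coordinates *)

Section Blocks.
Context {R : realType}.
Local Notation C := R[i].

Definition Jl n (l : seq 'I_n) (F : 'rV[R]_n -> C) : 'rV[R]_n -> C :=
  foldr (fun i G => J i G) F l.

Definition FTl (sg : R) n (l : seq 'I_n) (F : 'rV[R]_n -> C) : 'rV[R]_n -> C :=
  foldr (fun i G => FT sg i G) F l.

(* [put sig x y] is x with its coordinates sig i replaced by those of y. *)
Definition put m n (sig : 'I_m -> 'I_n) (x : 'rV[R]_n) (y : 'rV[R]_m) : 'rV[R]_n :=
  \row_j (if [pick i | sig i == j] is Some i then y 0 i else x 0 j).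

Lemma put_in m n (sig : 'I_m -> 'I_n) (x : 'rV[R]_n) (y : 'rV[R]_m) i :
  injective sig -> put sig x y 0 (sig i) = y 0 i.
Proof.
move=> inj; rewrite mxE; case: pickP => [k /eqP/inj -> //|/(_ i)].
by rewrite eqxx.
Qed.

Lemma put_out m n (sig : 'I_m -> 'I_n) (x : 'rV[R]_n) (y : 'rV[R]_m) j :
  (forall i, sig i != j) -> put sig x y 0 j = x 0 j.
Proof. by move=> H; rewrite mxE; case: pickP => // k; rewrite (negbTE (H k)). Qed.

Lemma put_caseP m n (sig : 'I_m -> 'I_n) (j : 'I_n) :
  (exists i, j = sig i) \/ (forall i, sig i != j).
Proof.
case: (pickP (fun i => sig i == j)) => [i /eqP <-|H]; first by left; exists i.
by right=> i; rewrite H.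
Qed.

Lemma put_cons m n (sig : 'I_m.+1 -> 'I_n) (x : 'rV[R]_n) (t : R) (y : 'rV[R]_m) :
  injective sig -> put sig x (row_mx (t%:M : 'rV[R]_1) y) =
  put (sig \o lift ord0) (upd x (sig ord0) t) y.
Proof.
move=> inj; have inj' : injective (sig \o lift ord0).
  by move=> a b /inj /lift_inj.
apply/rowP => j; have [[i ->]|H] := put_caseP sig j.
  rewrite (put_in _ (row_mx (t%:M : 'rV[R]_1) y) i inj).
  case: (unliftP ord0 i) => [k ->|->].
    rewrite (put_in _ y k inj') (_ : lift ord0 k = rshift 1 k); last by rewrite rshift1.
    by rewrite row_mxEr.
  rewrite put_out => [|k]; last by rewrite /= (inj_eq inj) eq_sym neq_lift.
  have E : row_mx (t%:M : 'rV[R]_1) y 0 (lshift m ord0) = t.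
    by rewrite row_mxEl mxE eqxx mulr1n.
  by rewrite upd_same -[RHS]E; congr (row_mx _ _ _ _); exact: val_inj.
rewrite !put_out // => [|k /=]; last exact: H.
by rewrite upd_other // eq_sym H.
Qed.

Lemma cintS n (F : 'rV[R]_n.+1 -> C) :
  cint F = Jint (fun t : R => cint (fun y : 'rV[R]_n => F (row_mx (t%:M : 'rV[R]_1) y))).
Proof. by []. Qed.

Lemma eq_cint n (F G : 'rV[R]_n -> C) : F =1 G -> cint F = cint G.
Proof. by move=> /funext ->. Qed.

(** The iterated integral becomes a composition of coordinate integrals, whose order [J_swap] allows
    to change; the coordinates outside the range of sig are frozen at those of x. *)
Lemma cint_put m n (sig : 'I_m -> 'I_n) (F : 'rV[R]_n -> C) (x : 'rV[R]_n) :
  injective sig -> cint (fun y => F (put sig x y)) = Jl (map sig (enum 'I_m)) F x.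
Proof.
elim: m sig x => [|m IH] sig x inj.
  rewrite (size0nil (size_enum_ord 0)) /= /cint /=.
  have -> : put sig x 0 = x by apply/rowP => j; rewrite put_out // => -[].
  by case: (F x).
rewrite cintS enum_ordSl /= /J; apply: eq_Jint => t.
rewrite -map_comp -IH; last by move=> a b /inj /lift_inj.
by apply: eq_cint => y; rewrite put_cons.
Qed.

Lemma cint_J n (F : 'rV[R]_n -> C) (x : 'rV[R]_n) : cint F = Jl (enum 'I_n) F x.
Proof.
rewrite -[enum _]map_id -cint_put //; apply: eq_cint => y; congr F.
by apply/rowP => j; rewrite (@put_in _ _ (fun i => i)).
Qed.

Lemma put_rshift m n (u : 'rV[R]_m) (v y : 'rV[R]_n) :
  put (@rshift m n) (row_mx u v) y = row_mx u y.
Proof.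
apply/rowP => j; have [[i ->]|H] := put_caseP (@rshift m n) j.
  by rewrite put_in ?row_mxEr //; exact: rshift_inj.
rewrite put_out //; case: (split_ordP j) => k E; first by rewrite E !row_mxEl.
by have := H k; rewrite E eqxx.
Qed.

Lemma put_lshift m n (u y : 'rV[R]_m) (v : 'rV[R]_n) :
  put (@lshift m n) (row_mx u v) y = row_mx y v.
Proof.
apply/rowP => j; have [[i ->]|H] := put_caseP (@lshift m n) j.
  by rewrite put_in ?row_mxEl //; exact: lshift_inj.
rewrite put_out //; case: (split_ordP j) => k E; last by rewrite E !row_mxEr.
by have := H k; rewrite E eqxx.
Qed.

Context {s : R}.
Hypothesis hs : 2^-1 <= s.
Let s0 : 0 < s := s_gt0 hs.
Let s_ge0 : 0 <= s := ltW s0.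
Local Notation p := s^-1.
Local Notation W := (@W R s _).
Local Notation cls := (@cls R s).
Local Notation nb := (@nb R s _).

Lemma nb_sub n (I K : {set 'I_n}) (F : 'rV[R]_n -> C) : I \subset K -> nb K F -> nb I F.
Proof.
move=> IK [cF [c c0 H]]; split=> //; exists c => // d /H [A A0 B]; exists A => // x.
apply: (le_trans (B x)); rewrite ler_wpM2l //; apply: le_W => j.
rewrite lerD2l lerN2 ler_wpM2l ?(ltW c0) // ler_nat.
by case E : (j \in I) => //; rewrite (fintype.subsetP IK j E).
Qed.

Lemma nb_Jl n (I : {set 'I_n}) F l : nb I F -> uniq l -> {subset l <= I} ->
  nb (I :\: [set i in l]) (Jl l F).
Proof.
move=> nF; elim: l => [|i l IH] /= => [_ _|/andP[il ul] sl].
  by apply: nb_sub nF; rewrite subDset finset.setUC subsetU // subxx.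
have {}IH : nb (I :\: [set i in l]) (Jl l F).
  by apply: IH => // j jl; apply: sl; rewrite inE jl orbT.
have iI : i \in I :\: [set j in l] by rewrite !inE il sl ?mem_head.
have := nb_J hs IH iI.
congr (nb _ _); apply/setP => j; rewrite !inE negb_or -andbA.
by rewrite (andbC (j \notin l)) !andbA.
Qed.

Lemma nb_Jl_in n (I : {set 'I_n}) F l i : nb I F -> uniq (i :: l) -> {subset i :: l <= I} ->
  nb [set i] (Jl l F).
Proof.
move=> nF /= /andP[il ul] sl; apply: nb_sub (nb_Jl nF ul _); last first.
  by move=> j jl; apply: sl; rewrite inE jl orbT.
by rewrite finset.sub1set !inE il sl ?mem_head.
Qed.

Lemma Jl_move n (I : {set 'I_n}) F l1 l2 i : nb I F -> uniq (l1 ++ i :: l2) ->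
  {subset l1 ++ i :: l2 <= I} -> Jl (l1 ++ i :: l2) F = J i (Jl (l1 ++ l2) F).
Proof.
move=> nF; elim: l1 => [//|a l1 IH] u sl.
have sl' : {subset l1 ++ i :: l2 <= I} by move=> j jl; apply: sl; rewrite inE jl orbT.
have u' : uniq (l1 ++ i :: l2) by case/andP: u.
have -> : Jl ((a :: l1) ++ i :: l2) F = J a (J i (Jl (l1 ++ l2) F)) by rewrite -(IH u' sl').
have P : perm_eq (a :: l1 ++ i :: l2) (i :: a :: l1 ++ l2).
  by rewrite -cat_cons perm_sym -(cat1s i) -(cat1s i l2) -cat_cons perm_catCA.
move: u; rewrite (perm_uniq P) /= inE negb_or => /andP[/andP[ia il] /andP[al ul]].
have ai : a != i by rewrite eq_sym.
rewrite (J_swap hs (nb_Jl nF ul _)) //.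
- by move=> j jl; apply: sl'; move: jl; rewrite !mem_cat inE => /orP[]->; rewrite ?orbT.
- by rewrite !inE al sl ?mem_head.
- by rewrite !inE il sl // inE mem_cat mem_head !orbT.
Qed.

Lemma Jl_perm n (I : {set 'I_n}) F l l' : nb I F -> uniq l -> {subset l <= I} ->
  perm_eq l l' -> Jl l F = Jl l' F.
Proof.
move=> nF; elim: l l' => [|i l IH] l' u sl pl.
  by move: (perm_size pl) => /esym/eqP/nilP ->.
have il' : i \in l' by rewrite -(perm_mem pl) mem_head.
have [l1 [l2 E]] : exists l1 l2, l' = l1 ++ i :: l2.
  by case/splitPr: il' => l1 l2; exists l1, l2.
move: pl; rewrite E => pl.
rewrite (Jl_move nF); last first.
- by move=> j; rewrite -(perm_mem pl); exact: sl.
- by rewrite -(perm_uniq pl).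
rewrite /= -(IH (l1 ++ l2)) //; first by case/andP: u.
  by move=> j jl; apply: sl; rewrite inE jl orbT.
by rewrite -(perm_cons i) (perm_trans pl) // -cat1s perm_catCA.
Qed.

Lemma enum_split_perm m n : perm_eq (enum 'I_(m + n))
  (map (@lshift m n) (enum 'I_m) ++ map (@rshift m n) (enum 'I_n)).
Proof.
apply: uniq_perm; rewrite ?enum_uniq //.
  rewrite cat_uniq (map_inj_uniq (@lshift_inj _ _)) (map_inj_uniq (@rshift_inj _ _)).
  rewrite !enum_uniq /= andbT; apply/hasPn => _ /mapP[j _ ->]; apply/mapP => -[k _].
  by move/eqP; rewrite eq_rlshift.
move=> j; rewrite mem_enum mem_cat; case: (split_ordP j) => k ->.
  by rewrite (mem_map (@lshift_inj _ _)) mem_enum.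
by rewrite (mem_map (@rshift_inj _ _)) mem_enum orbT.
Qed.

(** Fubini by blocks: the list of coordinates is permuted into the left block followed by the right
    one, and the innermost integrals are those at the end of the list. *)
Lemma cint_block m n (F : 'rV[R]_(m + n) -> C) : nb (full _) F ->
  cint F = cint (fun u : 'rV[R]_m => cint (fun v : 'rV[R]_n => F (row_mx u v))).
Proof.
move=> nF; pose x : 'rV[R]_(m + n) := row_mx 0 0.
rewrite (cint_J F x) (Jl_perm nF (enum_uniq _) _ (enum_split_perm _ _)); last by move=> j _; exact: in_full.
rewrite /Jl foldr_cat -/(Jl _ F) -/(Jl _ _) -cint_put; last exact: lshift_inj.
apply: eq_cint => u; rewrite put_lshift -cint_put; last exact: rshift_inj.
by apply: eq_cint => v; rewrite put_rshift.
Qed.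

Lemma cint_block_swap m n (F : 'rV[R]_(m + n) -> C) : nb (full _) F ->
  cint F = cint (fun v : 'rV[R]_n => cint (fun u : 'rV[R]_m => F (row_mx u v))).
Proof.
move=> nF; pose x : 'rV[R]_(m + n) := row_mx 0 0.
have P := perm_trans (enum_split_perm m n) (permEl (perm_catC _ _)).
rewrite (cint_J F x) (Jl_perm nF (enum_uniq _) _ P); last by move=> j _; exact: in_full.
rewrite /Jl foldr_cat -/(Jl _ F) -/(Jl _ _) -cint_put; last exact: rshift_inj.
apply: eq_cint => u; rewrite put_rshift -cint_put; last exact: lshift_inj.
by apply: eq_cint => v; rewrite put_lshift.
Qed.

Lemma nb_put m n (sig : 'I_m -> 'I_n) (x : 'rV[R]_n) (I : {set 'I_n}) (F : 'rV[R]_n -> C) :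
  injective sig -> (forall i, sig i \in I) -> nb I F ->
  nb (full m) (fun y => F (put sig x y)).
Proof.
move=> inj sI [cF [c c0 H]]; pose P : 'M[R]_(m, n) := \matrix_(i, j) (sig i == j)%:R.
have E y : put sig x y = y *m P + put sig x 0.
  apply/rowP => j; rewrite !mxE; have [[i ->]|N] := put_caseP sig j.
    case: pickP => [k /eqP/inj ->|/(_ i)]; last by rewrite eqxx.
    rewrite [(0 : 'rV_m) 0 i]mxE addr0 (bigD1 i) //= [P _ _]mxE eqxx mulr1.
    by rewrite big1 ?addr0 // => j' ji; rewrite [P _ _]mxE (inj_eq inj) (negbTE ji) mulr0.
  case: pickP => [k|_]; first by rewrite (negbTE (N k)).
  by rewrite big1 ?add0r // => i _; rewrite [P _ _]mxE (negbTE (N i)) mulr0.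
split.
  apply: (@ccontinuous_comp R m n (put sig x)) cF.
  have -> : put sig x = fun y => y *m P + put sig x 0 by apply/funext => y; exact: E.
  move=> y; have K := @continuous_mulmx R m n P y.
  exact: (cvgD K (cvg_cst (put sig x 0))).
exists c => // d d0; have [A A0 B] := H d d0.
pose J := [set sig i | i in full m]%SET.
have WE y : W I c d (put sig x y) <= W (full m) c d y * expR (\sum_(j | j \notin J) d * `|x 0 j| `^ p).
  rewrite -expRD ler_expR (bigID (mem J)) /=; apply: lerD.
    rewrite (big_imset _ (in2W inj)) /=; apply: eqW.
    rewrite (eq_bigl xpredT) => [|i]; last by rewrite in_full.
    by apply: eq_bigr => i _; rewrite in_full sI put_in.
  apply: ler_sum => j jJ; rewrite put_out => [|i]; last first.
    by apply: contra jJ => /eqP <-; apply: imset_f; exact: in_full.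
  rewrite ler_wpM2r ?powR_ge0 // lerBlDr lerDl mulr_ge0 ?ler0n // ltW //.
exists (A * expR (\sum_(j | j \notin J) d * `|x 0 j| `^ p)) => [|y].
  by rewrite mulr_ge0 ?expR_ge0.
by apply: (le_trans (B _)); rewrite -mulrA ler_wpM2l // mulrC.
Qed.

Lemma nb_right m n (u : 'rV[R]_m) (I : {set 'I_(m + n)}) (F : 'rV[R]_(m + n) -> C) :
  (forall i, rshift m i \in I) -> nb I F -> nb (full n) (fun v => F (row_mx u v)).
Proof.
move=> sI nF; rewrite (_ : (fun v => _) = fun v => F (put (@rshift m n) (row_mx u 0) v)).
  by apply: nb_put nF => //; exact: rshift_inj.
by apply/funext => v; rewrite put_rshift.
Qed.

Lemma nb_left m n (v : 'rV[R]_n) (I : {set 'I_(m + n)}) (F : 'rV[R]_(m + n) -> C) :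
  (forall i, lshift n i \in I) -> nb I F -> nb (full m) (fun u => F (row_mx u v)).
Proof.
move=> sI nF; rewrite (_ : (fun v => _) = fun u => F (put (@lshift m n) (row_mx 0 v) u)).
  by apply: nb_put nF => //; exact: lshift_inj.
by apply/funext => u; rewrite put_lshift.
Qed.

Lemma nbM n (I : {set 'I_n}) (F : 'rV[R]_n -> C) (k : 'rV[R]_n -> C) (M : R) :
  0 <= M -> ccontinuous k -> (forall x, cabs (k x) <= M) -> nb I F ->
  nb I (fun x => k x * F x).
Proof.
move=> M0 ck kM [cF [c c0 H]]; split; first exact: ccontinuousM.
exists c => // d /H [A A0 B]; exists (M * A) => [|x]; first by rewrite mulr_ge0.
by rewrite cabsM -mulrA ler_pM ?cabs_ge0.
Qed.

(** Carried out one coordinate at a time, so that only the one-dimensional substitution is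
    needed. *)
Lemma cint_affine n (F : 'rV[R]_n -> C) (a : R) (c : 'rV[R]_n) : 0 < a -> nb (full n) F ->
  cint (fun x => F (a *: x + c)) = (a^-1)%:C ^+ n * cint F.
Proof.
move=> a0 nF; pose tau x := a *: x + c.
suff H l : uniq l -> Jl l (fun x => F (tau x)) = fun x => (a^-1)%:C ^+ size l * Jl l F (tau x).
  by rewrite (cint_J _ 0) (H _ (enum_uniq _)) size_enum_ord -cint_J.
elim: l => [_|i l IH u]; first by apply/funext => x; rewrite /= mul1r.
have nG := nb_Jl_in nF u (fun j _ => in_full j).
rewrite [LHS]/= -/(Jl _ _) IH; last by case/andP: u.
apply/funext => x; rewrite /= -/(Jl _ _) /J.
have [B [k Hk]] := nb_nice1 (tau x) nG (set11 i).
have E t : tau (upd x i t) = upd (tau x) i (a * t + c 0 i).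
  by apply/rowP => j; rewrite !mxE; case: eqP => // ->.
set k0 := (a^-1)%:C ^+ size l.
have nG' : nb [set i] (fun y => k0 * Jl l F y).
  apply: (@nbM _ _ _ (fun=> k0) (cabs k0)) nG => //; first exact: cabs_ge0.
  exact/smooth_cont/smooth_cst.
have [B' [k' Hk']] := nb_nice1 (tau x) nG' (set11 i).
rewrite exprS -mulrA -/k0 -(JintZ hs k0 Hk) -(Jint_affine hs (c 0 i) a0 Hk').
by apply: eq_Jint => t; rewrite E.
Qed.

Lemma cint_opp n (F : 'rV[R]_n -> C) : nb (full n) F ->
  cint (fun x => F (- x)) = cint F.
Proof.
move=> nF.
suff H l : uniq l -> Jl l (fun x => F (- x)) = fun x => Jl l F (- x).
  by rewrite (cint_J _ 0) (H _ (enum_uniq _)) -cint_J.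
elim: l => [//|i l IH u].
have nG := nb_Jl_in nF u (fun j _ => in_full j).
rewrite [LHS]/= -/(Jl _ _) IH; last by case/andP: u.
apply/funext => x; rewrite /= -/(Jl _ _) /J.
have [B [k Hk]] := nb_nice1 (- x) nG (set11 i).
rewrite -(Jint_opp hs Hk); apply: eq_Jint => t; congr (Jl _ _ _).
by apply/rowP => j; rewrite !mxE; case: eqP.
Qed.

Lemma cintZ n (F : 'rV[R]_n -> C) (k : C) : nb (full n) F ->
  cint (fun x => k * F x) = k * cint F.
Proof.
move=> nF; rewrite !(cint_J _ 0).
suff -> : forall l, uniq l -> Jl l (fun x => k * F x) = (fun x => k * Jl l F x) by rewrite ?enum_uniq.
elim=> [//|i l IH u].
have nG := nb_Jl_in nF u (fun j _ => in_full j).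
rewrite [LHS]/= -/(Jl _ _) IH; last by case/andP: u.
exact: (JZ hs (k := fun=> k) nG (set11 i)).
Qed.

End Blocks.

(** * Fourier transforms in a block of coordinates, and linear substitutions *)

Section BlockFourier.
Context {R : realType}.
Local Notation C := R[i].
Context {s : R}.
Hypothesis hs : 2^-1 <= s.
Let s0 : 0 < s := s_gt0 hs.
Let s_ge0 : 0 <= s := ltW s0.
Local Notation p := s^-1.
Local Notation W := (@W R s _).
Local Notation cls := (@cls R s).
Local Notation nb := (@nb R s _).

Lemma continuous_dotp (U : topologicalType) n (f g : U -> 'rV[R]_n) :
  continuous f -> continuous g -> continuous (fun x => dotp (f x) (g x)).
Proof.
move=> cf cg; rewrite /dotp; elim: (index_enum _) => [|i r IH].
  rewrite (_ : (fun x => _) = cst 0); first exact: cst_continuous.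
  by apply/funext => x; rewrite big_nil.
rewrite (_ : (fun x => _) = fun x => f x 0 i * g x 0 i + \sum_(j <- r) f x 0 j * g x 0 j).
  move=> x; apply: cvgD; last exact: IH.
  have H (h : U -> 'rV[R]_n) : continuous h -> h y 0 i @[y --> x] --> h x 0 i.
    move=> ch; exact: (@continuous_cvg _ _ _ (nbhs x) _ h (fun y : 'rV[R]_n => y 0 i : R) (h x) (@coord_continuous R 1 n 0 i (h x)) (ch x)).
  by apply: cvgM; exact: H.
by apply/funext => x; rewrite big_cons.
Qed.

Lemma continuous_dotpl n (k : R) (c : 'rV[R]_n) :
  continuous (fun y : 'rV[R]_n => k * dotp y c).
Proof.
have H : continuous (fun y : 'rV[R]_n => dotp y c).
  have c1 : continuous (fun _ : 'rV[R]_n => c) by exact: (@cst_continuous 'rV[R]_n 'rV[R]_n c).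
  have c2 : continuous (fun x : 'rV[R]_n => x) by move=> x; exact: cvg_id.
  exact: (continuous_dotp c2 c1).
by move=> y; exact: (cvgM (cvg_cst k) (H y)).
Qed.

Lemma ccontinuous_cis n (q : 'rV[R]_n -> R) : continuous q -> ccontinuous (fun x => cis (q x)).
Proof.
move=> cq; split=> x.
  exact: (continuous_cvg _ (@continuous_cos R _) (cq x)).
exact: (continuous_cvg _ (@continuous_sin R _) (cq x)).
Qed.

Lemma nb_phase n (I : {set 'I_n}) (F : 'rV[R]_n -> C) (q : 'rV[R]_n -> R) :
  continuous q -> nb I F -> nb I (fun x => F x * cis (q x)).
Proof.
move=> cq nF; rewrite (_ : (fun x => _) = fun x => cis (q x) * F x); last first.
  by apply/funext => x; rewrite mulrC.
apply: (nbM ler01 (ccontinuous_cis cq)) nF => x; by rewrite cabs_cis.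
Qed.

Lemma cintD n (F G : 'rV[R]_n -> C) : nb (full n) F -> nb (full n) G ->
  cint (fun x => F x + G x) = cint F + cint G.
Proof.
move=> nF nG; rewrite !(cint_J _ 0).
suff -> : forall l, uniq l -> Jl l (fun x => F x + G x) = (fun x => Jl l F x + Jl l G x) by rewrite ?enum_uniq.
elim=> [//|i l IH u].
have nF' := nb_Jl_in hs nF u (fun j _ => in_full j).
have nG' := nb_Jl_in hs nG u (fun j _ => in_full j).
rewrite [LHS]/= -/(Jl _ _) IH; last by case/andP: u.
apply/funext => x; have [? [? H1]] := nb_nice1 x nF' (finset.set11 i).
have [? [? H2]] := nb_nice1 x nG' (finset.set11 i).
exact: (JintD hs H1 H2).
Qed.

Lemma row_cons0 m (t : R) (y : 'rV[R]_m) : row_mx (t%:M : 'rV[R]_1) y 0 ord0 = t.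
Proof.
have E : row_mx (t%:M : 'rV[R]_1) y 0 (lshift m ord0) = t by rewrite row_mxEl mxE eqxx mulr1n.
by rewrite -[RHS]E; congr (row_mx _ _ _ _); exact: val_inj.
Qed.

Lemma row_consS m (t : R) (y : 'rV[R]_m) i :
  row_mx (t%:M : 'rV[R]_1) y 0 (lift ord0 i) = y 0 i.
Proof.
by rewrite -[RHS](row_mxEr (t%:M : 'rV[R]_1)); congr (row_mx _ _ _ _); rewrite rshift1.
Qed.

(** The coordinate transforms are nested: the inner ones see x with one coordinate overwritten,
    which is none of their frequencies, so the phases multiply to a single exponential of the inner
    product. *)
Lemma FTl_put sg m n (sig : 'I_m -> 'I_n) (I : {set 'I_n}) (F : 'rV[R]_n -> C)
    (x : 'rV[R]_n) : injective sig -> (forall i, sig i \in I) -> nb I F ->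
  FTl sg (map sig (enum 'I_m)) F x =
  cint (fun y => F (put sig x y) * cis (sg * dotp y (\row_i x 0 (sig i)))).
Proof.
elim: m sig x => [|m IH] sig x inj sI nF.
  rewrite (size0nil (size_enum_ord 0)) /= /cint /=.
  have -> : put sig x 0 = x by apply/rowP => j; rewrite put_out // => -[].
  by rewrite /dotp big_ord0 mulr0 cis0 mulr1; case: (F x).
rewrite cintS enum_ordSl /= /FT; apply: eq_Jint => t.
have inj' : injective (sig \o lift ord0) by move=> a b /inj /lift_inj.
rewrite -map_comp -/(FTl _ _ _) IH //; last by move=> i; exact: sI.
have nP := nb_put (upd x (sig ord0) t) inj' (fun i => sI (lift ord0 i)) nF.
pose c : 'rV[R]_m := \row_i upd x (sig ord0) t 0 ((sig \o lift ord0) i).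
have cc := @continuous_dotpl m sg c.
rewrite -/c mulrC -(cintZ hs _ (nb_phase cc nP)); apply: eq_cint => y.
rewrite -(put_cons _ _ _ inj) mulrCA -cisD; congr (_ * cis _).
rewrite -mulrA -mulrDr; congr (_ * _); rewrite /dotp [RHS]big_ord_recl row_cons0 [in RHS]mxE.
congr (_ + _); apply: eq_bigr => i _; rewrite row_consS /c !mxE /=.
by rewrite (inj_eq inj) eq_sym (negbTE (neq_lift _ _)).
Qed.

Lemma cls_FTl sg n (l : seq 'I_n) (I : {set 'I_n}) T (F : T -> 'rV[R]_n -> C) :
  `|sg| = 1 -> cls I F -> {subset l <= I} -> cls I (fun t => FTl sg l (F t)).
Proof.
move=> sg1 cF; elim: l => [//|i l IH] sl.
have {}IH : cls I (fun t => FTl sg l (F t)) by apply: IH => j jl; apply: sl; rewrite inE jl orbT.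
by apply: (cls_FT hs sg1 IH); apply: sl; rewrite mem_head.
Qed.

Definition rset m n : {set 'I_(m + n)} := [set rshift m i | i in full n]%SET.

Lemma rset_in m n (i : 'I_n) : rshift m i \in rset m n.
Proof. by apply: imset_f; exact: in_full. Qed.

(** The frequency of the output occupies the block that has been integrated, as in [FT]. *)
Definition bFT (sg : R) m n (F : 'rV[R]_(m + n) -> C) (z : 'rV[R]_(m + n)) : C :=
  cint (fun y : 'rV[R]_n => F (row_mx (lsubmx z) y) * cis (sg * dotp y (rsubmx z))).

Lemma cls_bFT sg m n (I : {set 'I_(m + n)}) T (F : T -> 'rV[R]_(m + n) -> C) :
  `|sg| = 1 -> cls I F -> rset m n \subset I -> cls I (fun t => bFT sg (F t)).
Proof.
move=> sg1 cF /fintype.subsetP sI.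
have sI' i : rshift m i \in I by apply: sI; exact: rset_in.
rewrite (_ : (fun t => _) = fun t => FTl sg (map (@rshift m n) (enum 'I_n)) (F t)).
  by apply: cls_FTl sg1 cF _ => _ /mapP[i _ ->].
apply/funext => t; apply/funext => z.
rewrite (FTl_put sg z (@rshift_inj m n) sI' (nb_of_cls t cF)); apply: eq_cint => y.
have -> : put (@rshift m n) z y = row_mx (lsubmx z) y by rewrite -{1}(hsubmxK z) put_rshift.
congr (_ * cis (_ * dotp _ _)).
by apply/rowP => i; rewrite !mxE.
Qed.

Lemma nb_bFT_arg sg m n (I : {set 'I_(m + n)}) (F : 'rV[R]_(m + n) -> C) u eta :
  nb I F -> rset m n \subset I ->
  nb (full n) (fun y : 'rV[R]_n => F (row_mx u y) * cis (sg * dotp y eta)).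
Proof.
move=> nF /fintype.subsetP sI; apply: nb_phase; first exact: continuous_dotpl.
by apply: nb_right nF => i; apply: sI; exact: rset_in.
Qed.

(** A form of [cls_pull] with a linear hypothesis: [y] keeps the J-part of the image, and [norm_Sp]
    passes from its max norm to the sum of powers. *)
Lemma cls_lin m n (I : {set 'I_m}) (J : {set 'I_n}) T (L : T -> 'M[R]_(m, n))
    (B B' : R) (F : T -> 'rV[R]_n -> C) :
  (forall t i j, `|L t i j| <= B) -> 0 <= B' ->
  (forall t (x : 'rV[R]_m) i, i \in I -> `|x 0 i| <= B' * \sum_(j in J) `|(x *m L t) 0 j|) ->
  cls J F -> cls I (fun t x => F t (x *m L t)).
Proof.
move=> LB B'0 H; pose k := m%:R * (B' * n%:R) `^ p + 1.
have k0 : 0 < k by rewrite ltr_wpDl // mulr_ge0 // powR_ge0.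
apply: (cls_pull hs LB k0) => t x.
pose y : 'rV[R]_n := \row_j (if j \in J then (x *m L t) 0 j else 0).
have p_ge0 : 0 <= p by rewrite invr_ge0.
have p0 : p != 0 by rewrite invr_eq0 gt_eqF.
have SE : Sp s y = \sum_(j in J) `|(x *m L t) 0 j| `^ p.
  rewrite [RHS]big_mkcond; apply: eq_bigr => j _; rewrite mxE.
  by case: ifP => // _; rewrite normr0 powR0.
have S0 : 0 <= Sp s y by exact: Sp_ge0.
have E i : i \in I -> `|x 0 i| `^ p <= (B' * n%:R) `^ p * Sp s y.
  move=> iI; apply: (@le_trans _ _ ((B' * n%:R * `|y|) `^ p)).
    rewrite ge0_ler_powR ?nnegrE ?normr_ge0 ?mulr_ge0 //.
    apply: (le_trans (H t x i iI)); rewrite -mulrA ler_wpM2l //.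
    have -> : n%:R * `|y| = \sum_(j < n) `|y| by rewrite sumr_const card_ord mulr_natl.
    rewrite big_mkcond; apply: ler_sum => j _.
    by case: ifP => // jJ; apply: le_trans (rV_norm_coord y j); rewrite [y 0 j]mxE jJ.
  by rewrite powRM ?mulr_ge0 // ler_wpM2l ?powR_ge0 // norm_Sp.
rewrite -SE; apply: (@le_trans _ _ (\sum_(i < m) (B' * n%:R) `^ p * Sp s y)).
  rewrite big_mkcond; apply: ler_sum => i _; case: ifP => [/E//|_].
  by rewrite mulr_ge0 ?powR_ge0.
rewrite [leLHS](_ : _ = (m%:R * (B' * n%:R) `^ p) * Sp s y); last first.
  by rewrite sumr_const card_ord -[in RHS]mulrA mulr_natl.
by apply: ler_wpM2r => //; rewrite /k lerDl ler01.
Qed.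

Lemma mx_bounded m n (L : 'M[R]_(m, n)) : exists B : R, forall i j, `|L i j| <= B.
Proof.
exists (\sum_i \sum_j `|L i j|) => i j.
rewrite (bigD1 i) //= (bigD1 j) //= -addrA lerDl addr_ge0 // ?sumr_ge0 // => k _.
exact: sumr_ge0.
Qed.

Lemma cls_lin1 m n (I : {set 'I_m}) (J : {set 'I_n}) T (L : 'M[R]_(m, n))
    (F : T -> 'rV[R]_n -> C) :
  (forall i, i \in I -> exists2 j, j \in J & forall x : 'rV[R]_m, (x *m L) 0 j = x 0 i) ->
  cls J F -> cls I (fun t x => F t (x *m L)).
Proof.
move=> H; have [B LB] := mx_bounded L.
apply: (@cls_lin _ _ I J T (fun=> L) B 1) => // _ x i /H[j jJ E].
by rewrite mul1r (bigD1 j) //= E lerDl sumr_ge0.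
Qed.

Lemma cls_lin_inv n T (L N : T -> 'M[R]_n) (B : R) (F : T -> 'rV[R]_n -> C) :
  (forall t i j, `|L t i j| <= B) -> (forall t i j, `|N t i j| <= B) ->
  (forall t, L t *m N t = 1%:M) ->
  cls (full n) F -> cls (full n) (fun t x => F t (x *m L t)).
Proof.
(* That B >= 0 is read off from a matrix entry, which needs n > 0 and a member of the family; the
   two degenerate cases come first. *)
case: n L N F => [|n] L N F LB NB LN; first by apply: (cls_lin LB ler01) => t x [].
have [t|nT] := pselect (inhabited T); last first.
  by apply: (cls_lin LB ler01) => t; case: nT.
have B0 : 0 <= B by case: t => t; apply: le_trans (LB t ord0 ord0).
apply: (cls_lin LB B0) => {}t x i _.
have E : x = x *m L t *m N t by rewrite -mulmxA LN mulmx1.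
rewrite {1}E mxE (le_trans (ler_norm_sum _ _ _)) // mulr_sumr.
rewrite [leRHS](eq_bigl xpredT); last by move=> j; rewrite in_full.
by apply: ler_sum => j _; rewrite normrM mulrC ler_wpM2r.
Qed.

Definition PL m n : 'M[R]_(m + n, m) := col_mx 1%:M 0.
Definition PR m n : 'M[R]_(m + n, n) := col_mx 0 1%:M.

Lemma mul_PL m n (w : 'rV[R]_(m + n)) : w *m PL m n = lsubmx w.
Proof. by rewrite -{1}(hsubmxK w) mul_row_col mulmx1 mulmx0 addr0. Qed.

Lemma mul_PR m n (w : 'rV[R]_(m + n)) : w *m PR m n = rsubmx w.
Proof. by rewrite -{1}(hsubmxK w) mul_row_col mulmx1 mulmx0 add0r. Qed.

End BlockFourier.

(** * The operator and its transpose *)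

Section Operator.
Context {R : realType}.
Local Notation C := R[i].
Context {s : R}.
Hypothesis hs : 2^-1 <= s.
Let s0 : 0 < s := s_gt0 hs.
Let s_ge0 : 0 <= s := ltW s0.
Local Notation p := s^-1.
Local Notation cls := (@cls R s).
Local Notation nb := (@nb R s _).

Lemma cls_lin0 m n T (L : 'M[R]_(m, n)) (F : T -> 'rV[R]_n -> C) :
  cls finset.set0 F -> cls finset.set0 (fun t x => F t (x *m L)).
Proof. by apply: (cls_lin1 hs) => i; rewrite inE. Qed.

Lemma nbZ n (I : {set 'I_n}) (k : C) (F : 'rV[R]_n -> C) :
  nb I F -> nb I (fun x => k * F x).
Proof.
by apply: (nbM (cabs_ge0 k)) => //; exact/smooth_cont/smooth_cst.
Qed.

Lemma nb_opp n (I : {set 'I_n}) (F : 'rV[R]_n -> C) :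
  nb I F -> nb I (fun x => F (- x)).
Proof.
move=> [cF [c c0 H]]; split.
  by apply: (@ccontinuous_comp R n n -%R) cF => x; exact: opp_continuous.
have WE c' d x : W s I c' d (- x) = W s I c' d x.
  by congr expR; apply: eq_bigr => j _; rewrite mxE normrN.
by exists c => // d /H [A A0 B]; exists A => // x; rewrite -WE; exact: B.
Qed.

Lemma lset_rset m n : [set lshift n i | i in full m]%SET :|: rset m n = full (m + n).
Proof.
apply/setP => j; rewrite in_full inE; case: (split_ordP j) => k ->.
  by rewrite imset_f // in_full.
by rewrite rset_in orbT.
Qed.

Lemma cls_tensor m n T (F : T -> 'rV[R]_m -> C) (G : T -> 'rV[R]_n -> C) :
  cls (full m) F -> cls (full n) G ->
  cls (full (m + n)) (fun t z => F t (lsubmx z) * G t (rsubmx z)).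
Proof.
move=> cF cG; pose lset := [set lshift n i | i in full m]%SET.
have cF' : cls lset (fun t z => F t (z *m PL m n)).
  apply: (cls_lin1 hs) cF => _ /imsetP[i _ ->]; exists i; [exact: in_full|move=> x].
  by rewrite mul_PL mxE.
have cG' : cls (rset m n) (fun t z => G t (z *m PR m n)).
  apply: (cls_lin1 hs) cG => _ /imsetP[i _ ->]; exists i; [exact: in_full|move=> x].
  by rewrite mul_PR mxE.
have := clsM hs cF' cG'.
rewrite lset_rset; congr (cls _ _); apply/funext => t; apply/funext => z.
by rewrite mul_PL mul_PR.
Qed.

Variables (d : nat) (A : 'M[R]_d) (a : 'rV[R]_(d + d) -> C).
Hypothesis ca : cls finset.set0 (fun _ : unit => a).

(** The factor e^{i <x-y, xi>} is split: its part in y makes the inner integral a Fourier transform,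
    whose decay in xi lets the outer integral converge although a may grow. *)
Definition amp (f : 'rV[R]_d -> C) (z : 'rV[R]_(d + d)) : C :=
  cint (fun y => a (row_mx (lsubmx z - (lsubmx z - y) *m A^T) (rsubmx z)) * f y *
                 cis (-1 * dotp y (rsubmx z))).

Definition psido (f : 'rV[R]_d -> C) (x : 'rV[R]_d) : C :=
  twopi_pow d ^+ 2 * cint (fun xi => amp f (row_mx x xi) * cis (1 * dotp xi x)).

Let P1 : 'M[R]_(d + d, d) := PL d d.
Let P2 : 'M[R]_(d + d, d) := PR d d.
Let Q1 : 'M[R]_(d + d + d, d + d) := PL (d + d) d.
Let Q2 : 'M[R]_(d + d + d, d) := PR (d + d) d.
(** The matrix of ((x, xi), y) |-> (x - A(x - y), xi). *)
Let aL : 'M[R]_(d + d + d, d + d) :=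
  row_mx (Q1 *m P1 - (Q1 *m P1 - Q2) *m A^T) (Q1 *m P2).
Let F0 (f : 'rV[R]_d -> C) w := a (w *m aL) * f (w *m Q2).

Let aLE (z : 'rV[R]_(d + d)) (y : 'rV[R]_d) : row_mx z y *m aL = row_mx (lsubmx z - (lsubmx z - y) *m A^T) (rsubmx z).
Proof.
rewrite mul_mx_row mulmxBr !mulmxA mulmxBr !mulmxA /Q1 /Q2 mul_PL mul_PR.
by rewrite row_mxKl row_mxKr /P1 /P2 mul_PL mul_PR.
Qed.

Let cF0 T (f : T -> 'rV[R]_d -> C) : cls (full d) f ->
  cls (rset (d + d) d) (fun t => F0 (f t)).
Proof.
move=> cf; apply: (clsM0 hs).
  exact: (cls_lin0 aL (cls_sub (fun _ : T => tt) ca)).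
apply: (cls_lin1 hs) cf => _ /imsetP[i _ ->]; exists i; [exact: in_full|move=> x].
by rewrite mul_PR mxE.
Qed.

Lemma nb_amp (f : 'rV[R]_d -> C) z : cls (full d) (fun _ : unit => f) ->
  nb (full d) (fun y => a (row_mx (lsubmx z - (lsubmx z - y) *m A^T) (rsubmx z)) * f y *
                 cis (-1 * dotp y (rsubmx z))).
Proof.
move=> cf; have n0 := nb_of_cls tt (cF0 cf).
have := nb_bFT_arg (-1) z (rsubmx z) n0 (subxx _).
congr (nb _ _); apply/funext => y; rewrite /F0 aLE mul_PR row_mxKr //.
Qed.

Lemma cls_amp T (f : T -> 'rV[R]_d -> C) : cls (full d) f ->
  cls (rset d d) (fun t => amp (f t)).
Proof.
move=> cf; have N1 : `|-1 : R| = 1 by rewrite normrN1.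
have c1 := cls_bFT hs N1 (cF0 cf) (subxx _).
(* The transform has an independent frequency eta; the linear substitution eta = xi turns its decay
   in eta into decay in xi. *)
have : cls (rset d d) (fun t z => bFT (-1) (F0 (f t)) (z *m row_mx 1%:M P2)).
  apply: (cls_lin1 hs) c1 => _ /imsetP[i _ ->].
  exists (rshift (d + d) i); first exact: rset_in.
  by move=> x; rewrite mul_mx_row mulmx1 /P2 mul_PR row_mxEr mxE.
congr (cls _ _); apply/funext => t; apply/funext => z.
rewrite mul_mx_row mulmx1 /P2 mul_PR /bFT row_mxKl row_mxKr; apply: eq_cint => y.
by rewrite /F0 aLE mul_PR row_mxKr.
Qed.

Lemma nb_psido (f : 'rV[R]_d -> C) x : cls (full d) (fun _ : unit => f) ->
  nb (full d) (fun xi => amp f (row_mx x xi) * cis (1 * dotp xi x)).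
Proof. by move=> cf; exact: (nb_bFT_arg 1 x x (nb_of_cls tt (cls_amp cf)) (subxx _)). Qed.

Let cls_psido0 T (f : T -> 'rV[R]_d -> C) : cls (full d) f ->
  cls (full d) (fun t x => cint (fun xi => amp (f t) (row_mx x xi) * cis (1 * dotp xi x))).
Proof.
move=> cf; have c1 := cls_bFT hs (normr1 R) (cls_amp cf) (subxx _).
(* Likewise the frequency is set equal to x, and its decay becomes decay in x. *)
have : cls (full d) (fun t x => bFT 1 (amp (f t)) (x *m row_mx 1%:M 1%:M)).
  apply: (cls_lin1 hs) c1 => i _; exists (rshift d i); first exact: rset_in.
  by move=> x; rewrite mul_mx_row mulmx1 row_mxEr.
congr (cls _ _); apply/funext => t; apply/funext => x.
by rewrite mul_mx_row mulmx1 /bFT row_mxKl row_mxKr.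
Qed.

Lemma cls_psido T (f : T -> 'rV[R]_d -> C) : cls (full d) f ->
  cls (full d) (fun t => psido (f t)).
Proof.
move=> /cls_psido0 c2.
have kM (t : T) : cabs (twopi_pow d ^+ 2 : C) <= cabs (twopi_pow d ^+ 2 : C) by [].
exact: (clsZ (k := fun=> twopi_pow d ^+ 2) kM c2).
Qed.

Lemma psido_lin (k : C) (f g : 'rV[R]_d -> C) :
  cls (full d) (fun _ : unit => f) -> cls (full d) (fun _ : unit => g) ->
  psido (fun x => k * f x + g x) = (fun x => k * psido f x + psido g x).
Proof.
move=> cf cg; apply/funext => x.
have E z : amp (fun x => k * f x + g x) z = k * amp f z + amp g z.
  have nf := nb_amp z cf; have ng := nb_amp z cg.
  have nkf := nbZ k nf.
  rewrite /amp -(cintZ hs k nf) -(cintD hs nkf ng); apply: eq_cint => y.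
  by rewrite mulrDr mulrDl; congr (_ + _); rewrite !mulrA; congr (_ * _ * _); rewrite mulrC.
have nf := nb_psido x cf; have ng := nb_psido x cg.
have nkf := nbZ k nf.
rewrite /psido mulrCA -mulrDr -(cintZ hs k nf) -(cintD hs nkf ng); congr (_ * _).
by apply: eq_cint => y; rewrite E mulrDl mulrA.
Qed.

(** Up to normalisation, the pairing of a with a cross-Wigner distribution of f and g adapted to A,
    in the variables u = x - A(x - y), v = x - y. The kernel definition and the integral formula are
    both reduced to it. *)
Definition pairing (f g : 'rV[R]_d -> C) : C := twopi_pow d ^+ 2 *
  cint (fun z => a z * cint (fun v =>
    g (lsubmx z + v *m A^T) * f (lsubmx z + v *m A^T - v) * cis (1 * dotp v (rsubmx z)))).

(** A unipotent column operation makes the matrix block triangular with diagonal blocks 1 and -1. *)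
Lemma det_kernel_mx : `|\det (kernel_mx A)| = 1.
Proof.
have E : kernel_mx A *m block_mx 1%:M 0 A^T 1%:M = block_mx 1%:M 1%:M 0 (- 1%:M).
  rewrite mulmx_block !mulmx1 !mul1mx !mulNmx !mul1mx !mulmx0 subrK subrr add0r.
  by rewrite add0r.
have := congr1 (fun M => `|\det M|) E.
rewrite det_mulmx det_lblock !det1 !mulr1 det_ublock det1 mul1r => ->.
by rewrite -scaleN1r detZ det1 mulr1 normrX normrN1 expr1n.
Qed.

Let M := kernel_mx A.
Let Psi (f g : 'rV[R]_d -> C) z := tensor g f (z *m invmx M).

Let PsiE f g u v : Psi f g (row_mx u v) = g (u + v *m A^T) * f (u + v *m A^T - v).
Proof.
rewrite /Psi.
have -> : row_mx u v = row_mx (u + v *m A^T) (u + v *m A^T - v) *m M.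
  by rewrite kernel_mxE; have -> : u + v *m A^T - (u + v *m A^T - v) = v; rewrite ?addrK // opprB addrC subrK.
by rewrite mulmxK ?kernel_mx_unit // /tensor row_mxKl row_mxKr.
Qed.

Let cPsi f g : cls (full d) (fun _ : unit => f) -> cls (full d) (fun _ : unit => g) ->
  cls (full (d + d)) (fun _ : unit => Psi f g).
Proof.
move=> cf cg; have ct := cls_tensor cg cf.
have [B1 HB1] := mx_bounded (invmx M); have [B2 HB2] := mx_bounded M.
apply: (cls_lin_inv hs (L := fun=> invmx M) (N := fun=> M) (B := Num.max B1 B2)) ct.
- by move=> _ i j; rewrite le_max HB1.
- by move=> _ i j; rewrite le_max HB2 orbT.
- by move=> _; rewrite mulVmx // kernel_mx_unit.
Qed.

Lemma cls_pairing f g : cls (full d) (fun _ : unit => f) -> cls (full d) (fun _ : unit => g) ->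
  cls (full (d + d)) (fun (_ : unit) z => a z * cint (fun v =>
    g (lsubmx z + v *m A^T) * f (lsubmx z + v *m A^T - v) * cis (1 * dotp v (rsubmx z)))) /\
  forall z, nb (full d) (fun v =>
    g (lsubmx z + v *m A^T) * f (lsubmx z + v *m A^T - v) * cis (1 * dotp v (rsubmx z))).
Proof.
move=> cf cg; split=> [|z].
  have := clsM0 hs ca (cls_bFT hs (normr1 R) (cPsi cf cg) (sub_full _)).
  congr (cls _ _); apply/funext => _; apply/funext => z; congr (_ * _).
  by apply: eq_cint => v; rewrite PsiE.
have := nb_bFT_arg 1 (lsubmx z) (rsubmx z) (nb_of_cls tt (cPsi cf cg)) (sub_full _).
by congr (nb _ _); apply/funext => v; rewrite PsiE.
Qed.

Lemma Op_pairing f g : cls (full d) (fun _ : unit => f) -> cls (full d) (fun _ : unit => g) ->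
  Op A (of_fun a) f g = pairing f g.
Proof.
move=> cf cg; rewrite /Op /op_kernel /comp_lin det_kernel_mx invr1 mul1r.
rewrite /F2inv_dual /of_fun /F2inv /pairing expr2 -mulrA; congr (_ * _).
have nG := nb_of_cls tt (cls_bFT hs (normr1 R) (cPsi cf cg) (sub_full _)).
have naG := nb_of_cls tt (clsM0 hs ca (cls_bFT hs (normr1 R) (cPsi cf cg) (sub_full _))).
transitivity (cint (fun z => twopi_pow d * (a z * bFT 1 (Psi f g) z))).
  apply: eq_cint => z; rewrite mulrCA; congr (_ * (_ * _)).
  by apply: eq_cint => v; rewrite mul1r.
rewrite (cintZ hs _ naG); congr (_ * _); apply: eq_cint => z; congr (_ * _).
by apply: eq_cint => v; rewrite PsiE.
Qed.

Lemma dotp_row m n (x y : 'rV[R]_m) (u v : 'rV[R]_n) :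
  dotp (row_mx x u) (row_mx y v) = dotp x y + dotp u v.
Proof.
rewrite /dotp big_split_ord; congr (_ + _); apply: eq_bigr => i _.
  by rewrite !row_mxEl.
by rewrite !row_mxEr.
Qed.

Lemma dotpDl n (x y z : 'rV[R]_n) : dotp (x + y) z = dotp x z + dotp y z.
Proof. by rewrite /dotp -big_split; apply: eq_bigr => i _; rewrite mxE mulrDl. Qed.

Lemma dotpNl n (x z : 'rV[R]_n) : dotp (- x) z = - dotp x z.
Proof. by rewrite /dotp -sumrN; apply: eq_bigr => i _; rewrite mxE mulNr. Qed.

Lemma dotpC n (x y : 'rV[R]_n) : dotp x y = dotp y x.
Proof. by apply: eq_bigr => i _; rewrite mulrC. Qed.

(** The decay comes from Phi alone. The fixed xi is first adjoined as a variable, because the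
    classes are stable under linear, not affine, substitutions, and is frozen afterwards. *)
Let nb_section (L : 'M[R]_(d + d, d)) (Phi : 'rV[R]_(d + d) -> C) (xi : 'rV[R]_d) :
  cls (full (d + d)) (fun _ : unit => Phi) ->
  nb (full (d + d)) (fun w => a (row_mx (w *m L) xi) * Phi w * cis (1 * dotp (rsubmx w) xi)).
Proof.
move=> cPhi; pose L' := PL d (d + d) : 'M[R]_(d + (d + d), d).
pose R' := PR d (d + d) : 'M[R]_(d + (d + d), d + d).
have c1 : cls (rset d (d + d)) (fun (_ : unit) w => Phi (w *m R')).
  apply: (cls_lin1 hs) cPhi => _ /imsetP[i _ ->]; exists i; [exact: in_full|move=> x].
  by rewrite mul_PR mxE.
have c2 := clsM0 hs (cls_lin0 (row_mx (R' *m L) L') ca) c1.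
have c3 := nb_right xi (@rset_in d (d + d)) (nb_of_cls tt c2).
have := nb_phase (@continuous_dotpl R (d + d) 1 (row_mx 0 xi)) c3.
congr (nb _ _); apply/funext => w; congr (_ * cis (1 * _)).
  by rewrite mul_mx_row mulmxA /R' /L' mul_PR mul_PL row_mxKr row_mxKl.
by rewrite -{1}(hsubmxK w) dotp_row dotpC /dotp big1 ?add0r // => i _; rewrite mxE mul0r.
Qed.

(** For fixed xi, (u, v) is carried to (x, y) by a translation of u for each fixed v, giving the
    integrand [H2] in (x, v), and then by a reflection and a translation of v for each fixed x. No
    general linear change of variables in the integral is needed. *)
Let inner f g (xi : 'rV[R]_d) : cls (full d) (fun _ : unit => f) ->
  cls (full d) (fun _ : unit => g) ->
  cint (fun u => a (row_mx u xi) * bFT 1 (Psi f g) (row_mx u xi)) =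
  cint (fun x => g x * (amp f (row_mx x xi) * cis (1 * dotp xi x))).
Proof.
move=> cf cg; have cP := cPsi cf cg.
pose H w := a (row_mx (w *m P1) xi) * Psi f g w * cis (1 * dotp (rsubmx w) xi).
have nH : nb (full (d + d)) H := nb_section P1 xi cP.
transitivity (cint H).
  rewrite (cint_block hs nH); apply: eq_cint => u.
  rewrite /bFT row_mxKl row_mxKr -(cintZ hs); last exact: (nb_bFT_arg 1 u xi (nb_of_cls tt cP) (sub_full _)).
  by apply: eq_cint => v; rewrite /H mulrA /P1 mul_PL row_mxKl row_mxKr.
pose S : 'M[R]_(d + d) := block_mx 1%:M 1%:M 0 (- 1%:M).
have SE (x v : 'rV[R]_d) : row_mx x v *m S = row_mx x (x - v).
  by rewrite mul_row_block !mulmx1 mulmx0 mulmxN mulmx1 addr0.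
have S2 : S *m S = 1%:M.
  rewrite mulmx_block !mulmx1 !mul1mx !mulNmx !mul1mx ?mulmx0 ?mul0mx ?oppr0 ?addr0 ?subrr ?add0r ?opprK.
  by rewrite -scalar_mx_block.
pose Phi2 w := tensor g f (w *m S).
have cPhi2 : cls (full (d + d)) (fun _ : unit => Phi2).
  have [B HB] := mx_bounded S.
  exact: (@cls_lin_inv R s hs _ unit (fun=> S) (fun=> S) B _ (fun=> HB) (fun=> HB) (fun=> S2) (cls_tensor cg cf)).
pose L2 : 'M[R]_(d + d, d) := P1 - P2 *m A^T.
pose H2 w := a (row_mx (w *m L2) xi) * Phi2 w * cis (1 * dotp (rsubmx w) xi).
have nH2 : nb (full (d + d)) H2 := nb_section L2 xi cPhi2.
have L2E (x v : 'rV[R]_d) : row_mx x v *m L2 = x - v *m A^T.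
  by rewrite mulmxBr mulmxA /P1 /P2 mul_PL mul_PR row_mxKl row_mxKr.
transitivity (cint H2).
  rewrite (cint_block_swap hs nH) (cint_block_swap hs nH2); apply: eq_cint => v.
  have n2 := nb_left v (fun i => in_full (lshift d i)) nH2.
  have := cint_affine hs (v *m A^T) ltr01 n2.
  rewrite invr1 expr1n mul1r => <-; apply: eq_cint => u.
  rewrite scale1r /H /H2 L2E addrK /P1 mul_PL row_mxKl row_mxKr.
  by rewrite [Psi _ _ _]PsiE /Phi2 SE /tensor row_mxKl !row_mxKr.
rewrite (cint_block hs nH2); apply: eq_cint => x.
have n3 := nb_right x (fun i => in_full (rshift d i)) nH2.
have -> : g x * (amp f (row_mx x xi) * cis (1 * dotp xi x)) =
    (g x * cis (1 * dotp xi x)) * amp f (row_mx x xi) by rewrite mulrCA mulrC.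
rewrite {1}/amp -(cintZ hs _ (nb_amp (row_mx x xi) cf)) -(cint_opp hs n3).
have := cint_affine hs (- x) ltr01 (nb_opp n3); rewrite invr1 expr1n mul1r => <-.
apply: eq_cint => y; rewrite /H2 scale1r opprB L2E row_mxKr row_mxKl /Phi2 SE /tensor row_mxKl row_mxKr.
have -> : x - (x - y) = y by rewrite opprB addrC subrK.
rewrite dotpDl dotpNl mulrDr cisD mulrN mulN1r (dotpC x) mul1r mul1r.
have r (q1 q2 q3 q4 q5 : C) : q1 * (q2 * q3) * (q4 * q5) = q2 * q4 * (q1 * q3 * q5) by clear; ring.
by rewrite r !row_mxKr.
Qed.

Lemma psido_pairing f g : cls (full d) (fun _ : unit => f) ->
  cls (full d) (fun _ : unit => g) ->
  of_fun (psido f) g = pairing f g.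
Proof.
move=> cf cg.
have nG := nb_of_cls tt (cls_bFT hs (normr1 R) (cPsi cf cg) (sub_full _)).
have naG := nb_of_cls tt (clsM0 hs ca (cls_bFT hs (normr1 R) (cPsi cf cg) (sub_full _))).
have -> : pairing f g = twopi_pow d ^+ 2 * cint (fun z => a z * bFT 1 (Psi f g) z).
  rewrite /pairing; congr (_ * _); apply: eq_cint => z; congr (_ * _).
  by apply: eq_cint => v; rewrite PsiE.
(* The frequency xi is taken outermost because the changes of variables are made for fixed xi; [H]
   restores the order of [psido], with x outermost. *)
rewrite (cint_block_swap hs naG).
rewrite (eq_cint (fun xi => inner xi cf cg)).
pose H z := g (lsubmx z) * amp f z * cis (1 * dotp (rsubmx z) (lsubmx z)).
have nH : nb (full (d + d)) H.
  apply: nb_phase.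
    have q1 : (fun z : 'rV[R]_(d + d) => 1 * dotp (rsubmx z) (lsubmx z)) =
        fun z => dotp (z *m PR d d) (z *m PL d d).
      by apply/funext => z; rewrite mul1r mul_PL mul_PR.
    rewrite q1; apply: continuous_dotp; exact: continuous_mulmx.
  have c1 : cls [set lshift d i | i in full d]%SET (fun (_ : unit) z => g (z *m P1)).
    apply: (cls_lin1 hs) cg => _ /imsetP[i _ ->]; exists i; [exact: in_full|move=> x].
    by rewrite mul_PL mxE.
  have := nb_of_cls tt (clsM hs c1 (cls_amp cf)).
  rewrite lset_rset; congr (nb _ _); apply/funext => z.
  by rewrite /P1 mul_PL.
transitivity (twopi_pow d ^+ 2 * cint H); last first.
  congr (_ * _); rewrite (cint_block_swap hs nH); apply: eq_cint => xi; apply: eq_cint => x.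
  by rewrite /H row_mxKl row_mxKr mulrA.
rewrite (cint_block hs nH).
have E x : cint (fun xi => H (row_mx x xi)) =
    g x * cint (fun xi => amp f (row_mx x xi) * cis (1 * dotp xi x)).
  rewrite -(cintZ hs _ (nb_psido x cf)); apply: eq_cint => xi.
  by rewrite /H row_mxKl row_mxKr mulrA.
have cN := clsM hs cg (cls_psido0 cf); rewrite finset.setUid in cN.
rewrite (eq_cint E) -(cintZ hs _ (nb_of_cls tt cN)); apply: eq_cint => x.
by rewrite /psido mulrCA mulrC -mulrA mulrC.
Qed.

End Operator.

(** * The symbol of the transposed operator *)

Section Transpose.
Context {R : realType}.
Local Notation C := R[i].
Context {s : R}.
Hypothesis hs : 2^-1 <= s.
Local Notation cls := (@cls R s).
Local Notation nb := (@nb R s _).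
Variables (d : nat) (A : 'M[R]_d) (a : 'rV[R]_(d + d) -> C).
Hypothesis ca : cls finset.set0 (fun _ : unit => a).

Definition flip_mx : 'M[R]_(d + d) := block_mx 1%:M 0 0 (- 1%:M).

Lemma flip_mxE (x xi : 'rV[R]_d) : row_mx x xi *m flip_mx = row_mx x (- xi).
Proof. by rewrite mul_row_block !mulmx1 !mulmx0 mulmxN mulmx1 addr0 add0r. Qed.

Definition flip z : C := a (z *m flip_mx).

Lemma cls_flip : cls finset.set0 (fun _ : unit => flip).
Proof. exact: (cls_lin0 hs flip_mx ca). Qed.

(** The substitution v |-> -v carries the arguments u + (1 - A)v and u - A v of f and g to u + A v -
    v and u + A v. It also reverses the sign of the frequency, which xi |-> -xi undoes. *)
Lemma pairing_flip f g : cls (full d) (fun _ : unit => f) -> cls (full d) (fun _ : unit => g) ->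
  pairing (1%:M - A) flip g f = pairing A a f g.
Proof.
move=> cf cg; have [caG nG] := cls_pairing hs A ca cf cg.
rewrite /pairing; congr (_ * _).
pose G z := cint (fun v : 'rV[R]_d =>
  g (lsubmx z + v *m A^T) * f (lsubmx z + v *m A^T - v) * cis (1 * dotp v (rsubmx z))).
have naG : nb (full (d + d)) (fun z => a z * G z) := nb_of_cls tt caG.
have E z : cint (fun v : 'rV[R]_d => f (lsubmx z + v *m (1%:M - A)^T) *
    g (lsubmx z + v *m (1%:M - A)^T - v) * cis (1 * dotp v (rsubmx z))) = G (z *m flip_mx).
  rewrite /G -(cint_opp hs (nG (z *m flip_mx))); apply: eq_cint => v.
  rewrite -[z in RHS]hsubmxK flip_mxE row_mxKl row_mxKr.
  have -> : (1%:M - A)^T = 1%:M - A^T by rewrite linearB /= trmx1.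
  have -> : dotp (- v) (- rsubmx z) = dotp v (rsubmx z) by rewrite dotpNl dotpC dotpNl opprK dotpC.
  rewrite mulmxBr mulmx1 mulNmx opprK [g _ * _]mulrC; congr (f _ * g _ * _).
    by rewrite addrA addrAC.
  by rewrite addrA addrAC addrK.
transitivity (cint (fun z => a (z *m flip_mx) * G (z *m flip_mx))).
  by apply: eq_cint => z; rewrite E.
have naG' : nb (full (d + d)) (fun z => a (z *m flip_mx) * G (z *m flip_mx)).
  have F2 : flip_mx *m flip_mx = 1%:M.
    rewrite mulmx_block !mulmx1 !mul1mx !mulNmx ?mul1mx ?mulmx0 ?mul0mx ?oppr0 ?addr0 ?add0r ?opprK.
    by rewrite -scalar_mx_block.
  have [B HB] := mx_bounded flip_mx.
  exact: (nb_of_cls tt (@cls_lin_inv R s hs _ unit (fun=> flip_mx) (fun=> flip_mx) B _ (fun=> HB) (fun=> HB) (fun=> F2) caG)).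
rewrite (cint_block hs naG) (cint_block hs naG'); apply: eq_cint => x.
rewrite -(cint_opp hs (nb_right x (fun i => in_full (rshift d i)) naG)).
by apply: eq_cint => xi; rewrite flip_mxE.
Qed.

End Transpose.

(** * Gaussian regularisation *)

Section Path.
Context {R : realType}.
Local Notation C := R[i].

Lemma mvt_nonneg (f df : R -> R) (c : R) : 0 <= c ->
  (forall r : R, is_derive r 1 f (df r)) ->
  exists2 t : R, 0 <= t <= c & f c - f 0 = c * df t.
Proof.
move=> c0 dfE.
have cf : {within `[0, c], continuous f}.
  apply: continuous_subspaceT => r; apply/differentiable_continuous.
  by apply/derivable1_diffP; have [] := dfE r.
have [t tc E] := @MVT_segment R f df 0 c c0 (fun r _ => dfE r) cf.
by exists t; [move: tc; rewrite in_itv|rewrite E subr0 mulrC].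
Qed.

Lemma cder_R_cst_lin (a b r : R) :
  @cder R R^o (fun r => (a + r * b)%:C) r 1 b%:C.
Proof.
split=> /=; last exact: is_derive_cst.
have H := @is_deriveD _ _ _ _ _ _ _ _ _ (is_derive_cst a r 1) (is_deriveM (is_derive_id r (1 : R^o)) (is_derive_cst b r 1)).
by apply: is_derive_eq; rewrite scaler0 !add0r; exact: mulr1.
Qed.

Variables (n m : nat) (L0 N : 'M[R]_(n, m)).
Let L (r : R) := L0 + r *: N.

(* The derivative of k (z *m (L0 + r *: N)) in r. *)
Definition path_d (r : R) (k : 'rV[R]_m -> C) (z : 'rV[R]_n) : C :=
  \sum_j ((z *m N) 0 j)%:C * partial j k (z *m L r).

Let smooth_lin_coord j : smooth (fun z : 'rV[R]_n => ((z *m N) 0 j)%:C : C).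
Proof. exact: (@smooth_comp _ _ _ N (fun x => (x 0 j)%:C) (smooth_coord j)). Qed.

Let path_dE r k i : smooth k -> partial i (path_d r k) =
  fun z => \sum_j ((N i j)%:C * partial j k (z *m L r) +
    ((z *m N) 0 j)%:C * \sum_q (L r i q)%:C * partial q (partial j k) (z *m L r)).
Proof.
move=> sk; have sp j : smooth (fun z : 'rV[R]_n => partial j k (z *m L r)).
  exact: (smooth_comp (L r) (smooth_partial j sk)).
have := @partials_sum _ _ [:: i] _ (index_enum 'I_m) _
  (fun j => smoothM (smooth_lin_coord j) (sp j)); rewrite /= => ->.
apply/funext => z; apply: eq_bigr => j _.
rewrite (partialM i (smooth_lin_coord j) (sp j)).2.
rewrite (partial_comp (L r) i (smooth_partial j sk)).2; congr (_ * _ + _).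
rewrite (partial_comp N i (smooth_coord j)).2 (bigD1 j) //= (partial_coord j j).2.
rewrite eqxx mulr1 big1 ?addr0 // => q qj.
by rewrite (partial_coord j q).2 eq_sym (negbTE qj) mulr0.
Qed.

(** Induction on l with k general: the innermost derivative gives a combination of pullbacks of
    derivatives of k whose coefficients are affine in r. Differentiating these coefficients matches
    the terms in which that derivative falls on (z N)_j in [path_d]. *)
Lemma cder_path l (k : 'rV[R]_m -> C) z (r : R) : smooth k ->
  @cder R R^o (fun r => partials l (fun z => k (z *m L r)) z) r 1
    (partials l (path_d r k) z).
Proof.
elim/last_ind: l k => [|l i IH] k sk.
  have E : (fun r : R => k (z *m L r)) = fun r => k (z *m L0 + r *: (z *m N)).
    by apply/funext => t; rewrite /L mulmxDr scalemxAr.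
  rewrite [X in cder X](E) /=; apply: cder_line.
  have -> : path_d r k z = \sum_j ((z *m N) 0 j)%:C * partial j k (z *m L0 + r *: (z *m N)).
    by apply: eq_bigr => j _; rewrite /L mulmxDr scalemxAr.
  exact: cder_dir.
rewrite partials_rcons path_dE //.
have sc j r' : smooth (fun z : 'rV[R]_n => partial j k (z *m L r')).
  exact: (smooth_comp (L r') (smooth_partial j sk)).
have E : (fun r => partials (rcons l i) (fun z => k (z *m L r)) z) =
   fun r => \sum_j (L0 i j + r * N i j)%:C * partials l (fun z => partial j k (z *m L r)) z.
  apply/funext => t; rewrite partials_rcons (partial_comp (L t) i sk).2.
  rewrite (partials_sum l _ (fun j => smoothZ (L t i j)%:C (sc j t))).
  by apply: eq_bigr => j _; rewrite partialsZ // /L !mxE.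
rewrite [X in cder X](E).
have sd j : smooth (fun z : 'rV[R]_n => ((z *m N) 0 j)%:C *
    \sum_q (L r i q)%:C * partial q (partial j k) (z *m L r)).
  apply: smoothM => //; apply: smooth_sum => q; apply: smoothZ.
  exact: (smooth_comp (L r) (smooth_partial q (smooth_partial j sk))).
rewrite (partials_sum l _ (fun j => smoothD (smoothZ (N i j)%:C (sc j r)) (sd j))).
have -> : \sum_j partials l (fun z => (N i j)%:C * partial j k (z *m L r) +
    ((z *m N) 0 j)%:C * \sum_q (L r i q)%:C * partial q (partial j k) (z *m L r)) z =
  \sum_j ((N i j)%:C * partials l (fun z => partial j k (z *m L r)) z +
    (L r i j)%:C * partials l (path_d r (partial j k)) z).
  pose G j q z : C := ((z *m N) 0 j)%:C * partial q (partial j k) (z *m L r).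
  have sG j q : smooth (G j q).
    by apply: smoothM => //; exact: (smooth_comp (L r) (smooth_partial q (smooth_partial j sk))).
  have e1 j : partials l (fun z => (N i j)%:C * partial j k (z *m L r) +
      ((z *m N) 0 j)%:C * \sum_q (L r i q)%:C * partial q (partial j k) (z *m L r)) z =
    (N i j)%:C * partials l (fun z => partial j k (z *m L r)) z +
    \sum_q (L r i q)%:C * partials l (G j q) z.
    rewrite (partialsD l (smoothZ (N i j)%:C (sc j r)) (sd j)) (partialsZ l _ (sc j r)).
    congr (_ + _).
    have -> : (fun z => ((z *m N) 0 j)%:C * \sum_q (L r i q)%:C * partial q (partial j k) (z *m L r)) =
        fun z => \sum_q (L r i q)%:C * G j q z.
      by apply/funext => w; rewrite mulr_sumr; apply: eq_bigr => q _; rewrite mulrCA.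
    rewrite (partials_sum l _ (fun q => smoothZ (L r i q)%:C (sG j q))).
    by apply: eq_bigr => q _; rewrite (partialsZ l _ (sG j q)).
  (* Symmetry of second derivatives allows the two sums to be exchanged. *)
  have e2 j : partials l (path_d r (partial j k)) z = \sum_q partials l (G q j) z.
    have -> : path_d r (partial j k) = fun z => \sum_q G q j z.
      by apply/funext => w; apply: eq_bigr => q _; rewrite /G (partialC q j sk).
    by rewrite (partials_sum l _ (fun q => sG q j)).
  rewrite (eq_bigr _ (fun j _ => e1 j)) !big_split /=; congr (_ + _).
  rewrite exchange_big /=; apply: eq_bigr => q _.
  by rewrite e2 mulr_sumr.
apply: cder_sum => j; have := cderM (cder_R_cst_lin (L0 i j) (N i j) r) (IH (partial j k) (smooth_partial j sk)).
by rewrite /L !mxE.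
Qed.

Context {s : R}.
Hypothesis hs : 2^-1 <= s.
Local Notation cls := (@cls R s).
Local Notation W := (@W R s _).

Lemma cls_zero p (I : {set 'I_p}) T : cls I (fun (_ : T) (_ : 'rV[R]_p) => 0 : C).
Proof.
split=> [t|]; first exact: smooth0.
exists 1, 1; split=> // d d0; exists 0 => // t x l.
by rewrite partials0 cabs0 !mul0r.
Qed.

Lemma cls_sum p (I : {set 'I_p}) T (J : Type) (r : seq J) (F : J -> T -> 'rV[R]_p -> C) :
  (forall j, cls I (F j)) -> cls I (fun t x => \sum_(j <- r) F j t x).
Proof.
move=> cF; elim: r => [|j r IH].
  have := @cls_zero p I T; congr (cls _ _); apply/funext => t; apply/funext => x.
  by rewrite big_nil.
have := clsD (cF j) IH; congr (cls _ _); apply/funext => t; apply/funext => x.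
by rewrite big_cons.
Qed.

(* By the mean value theorem in r, applied to all derivatives. *)
Lemma cls_path T (k : T -> 'rV[R]_m -> C) (B : R) : cls (full m) k -> 0 <= B ->
  (forall r, 0 <= r <= 1 -> forall (x : 'rV[R]_n) i,
    `|x 0 i| <= B * \sum_j `|(x *m L r) 0 j|) ->
  cls (full n) (fun (te : T * {e : R | 0 < e <= 1}) x =>
    ((val te.2)^-1)%:C * (k te.1 (x *m L (val te.2)) + -1 * k te.1 (x *m L 0))).
Proof.
move=> ck B0 HB.
have [b0 Hb0] := mx_bounded L0; have [b1 Hb1] := mx_bounded N.
(* The r-derivatives form one family with r in [0, 1] as an index; the factor (z N)_j belongs to the
   class without decay, and [HB] gives decay uniformly in r. *)
have cD : cls (full n) (fun tr : T * {r : R | 0 <= r <= 1} => path_d (val tr.2) (k tr.1)).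
  apply: cls_sum => j; apply: (clsM0 hs).
    apply: (@cls_lin0 R s hs n m (T * {r : R | 0 <= r <= 1})%type N (fun _ x => (x 0 j)%:C)).
    exact: (cls_sub (fun=> tt) (cls_coord hs j)).
  apply: (@cls_lin R s hs _ _ (full n) (full m) (T * {r : R | 0 <= r <= 1})%type
    (fun tr => L (val tr.2)) (`|b0| + `|b1|) B (fun tr => partial j (k tr.1))) => //.
  - move=> [t [r /andP[r0 r1]]] i q /=; rewrite !mxE (le_trans (ler_normD _ _)) // lerD //.
      exact: le_trans (Hb0 _ _) (ler_norm _).
    rewrite normrM ger0_norm // -[leRHS]mul1r ler_pM //.
    exact: le_trans (Hb1 _ _) (ler_norm _).
  - move=> [t [r Hr]] x i _ /=; rewrite (eq_bigl xpredT); first exact: HB.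
    by move=> q; rewrite in_full.
  - exact: (cls_partial hs (fun=> j) (cls_sub (fun tr : T * {r : R | 0 <= r <= 1} => tr.1) ck)).
have sk t : smooth (k t) := cls_smooth t ck.
have skL t r : smooth (fun x => k t (x *m L r)) := smooth_comp (L r) (sk t).
have [_ [h [c [h0 c0 H]]]] := cD; split=> [[t e]|].
  by apply: smoothZ; apply: smoothD => //; exact: smoothZ.
exists h, c; split=> // d d0; have [A A0 HA] := H d d0.
exists (2 * A) => [|[t [e He]] x l]; first by rewrite mulr_ge0.
have [e0 e1] := andP He; rewrite /=.
set Q := h ^+ _ * _; set w := W (full n) c d x.
rewrite (partialsZ l _ (smoothD (skL t e) (smoothZ (-1) (skL t 0)))).
rewrite (partialsD l (skL t e) (smoothZ (-1) (skL t 0))) (partialsZ l _ (skL t 0)) /=.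
have dl r := cder_path l x r (sk t).
have bd r : 0 <= r <= e -> cabs (partials l (path_d r (k t)) x) <= A * w * Q.
  move=> /andP[r0 re]; have r01 : 0 <= r <= 1 by rewrite r0 (le_trans re).
  exact: (HA (t, exist _ r r01) x l).
(* The mean value theorem yields different intermediate points for the real and imaginary parts,
   hence the constant 2 A. *)
have [r1 /bd b1' E1] := mvt_nonneg (ltW e0) (fun r => (dl r).1).
have [r2 /bd b2' E2] := mvt_nonneg (ltW e0) (fun r => (dl r).2).
rewrite cabsM cabsR gtr0_norm ?invr_gt0 // ler_pdivrMl //.
apply: (le_trans (cabs_le _)).
have -> : complex.Re (partials l (fun z => k t (z *m L e)) x + -1 * partials l (fun z => k t (z *m L 0)) x) =
  e * complex.Re (partials l (path_d r1 (k t)) x) by rewrite -E1 mulN1r raddfB.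
have -> : complex.Im (partials l (fun z => k t (z *m L e)) x + -1 * partials l (fun z => k t (z *m L 0)) x) =
  e * complex.Im (partials l (path_d r2 (k t)) x) by rewrite -E2 mulN1r raddfB.
rewrite !normrM (gtr0_norm e0) -mulrDr ler_wpM2l ?(ltW e0) //.
have -> : 2 * A * w * Q = A * w * Q + A * w * Q by rewrite -!mulrA mulr_natl mulr2n.
by apply: lerD; [exact: le_trans (Re_le _) b1'|exact: le_trans (Im_le _) b2'].
Qed.

End Path.

(** * Families of Gaussian type *)

Section GaussianType.
Context {R : realType}.
Local Notation C := R[i].

Lemma is_derive_comp1 n (q : 'rV[R]_n -> R) (phi : R -> R) (x v : 'rV[R]_n) (dq dphi : R) :
  is_derive x v q dq -> is_derive (q x) (1 : R) phi dphi ->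
  is_derive x v (fun y => phi (q y)) (dphi * dq).
Proof.
move=> hq hphi; apply: is_derive_of_line.
have hq' : is_derive (0 : R) 1 (fun r : R => q (x + r *: v)) dq.
  have [d1 d2] := hq.
  have := @is_derive_line R n q x v 0; rewrite scale0r addr0 => H.
  by have := H d1; rewrite d2.
have hphi' : is_derive (q (x + 0 *: v)) (1 : R) phi dphi by rewrite scale0r addr0.
have := @is_derive1_comp R phi (fun r : R => q (x + r *: v)) 0 dphi dq hphi' hq'.
by rewrite mulrC.
Qed.

Definition mono n (l : seq 'I_n) (x : 'rV[R]_n) : C := \prod_(j <- l) (x 0 j)%:C.

(** The monomials of the derivative are listed with repetition, at most one for each entry of l, so
    that counting terms replaces integer coefficients. *)
Fixpoint dmono n (i : 'I_n) (l : seq 'I_n) : seq (seq 'I_n) :=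
  if l is j :: l' then
    (if i == j then [:: l'] else [::]) ++ map (cons j) (dmono i l')
  else [::].

Lemma dmono_size n (i : 'I_n) l :
  (size (dmono i l) <= size l)%N /\ forall l', l' \in dmono i l -> size l = (size l').+1.
Proof.
elim: l => [//|j l [IH1 IH2]] /=; split.
  rewrite size_cat size_map; case: ifP => _ /=; first by rewrite add1n.
  exact: leq_trans IH1 _.
move=> l'; rewrite mem_cat => /orP[|/mapP[l0 /IH2 -> -> //]].
by case: ifP => // _; rewrite inE => /eqP ->.
Qed.

Lemma mono_cons n (j : 'I_n) l x : mono (j :: l) x = (x 0 j)%:C * mono l x.
Proof. by rewrite /mono big_cons. Qed.

Lemma smooth_mono n (l : seq 'I_n) : smooth (mono l).
Proof.
elim: l => [|j l IH].
  have -> : mono [::] = (fun=> 1 : C) :> ('rV[R]_n -> C) by apply/funext => x; rewrite /mono big_nil.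
  exact: smooth_cst.
have -> : mono (j :: l) = fun x => (x 0 j)%:C * mono l x by apply/funext => x; exact: mono_cons.
exact: (smoothM (smooth_coord j) IH).
Qed.

Lemma partial_mono n (i : 'I_n) l :
  partial i (mono l) = fun x => \sum_(l' <- dmono i l) mono l' x.
Proof.
elim: l => [|j l IH].
  have -> : mono [::] = (fun=> 1 : C) :> ('rV[R]_n -> C) by apply/funext => x; rewrite /mono big_nil.
  have := @partials_cst R n [:: i] 1; rewrite /= => ->.
  by apply/funext => x; rewrite big_nil.
have -> : mono (j :: l) = fun x => (x 0 j)%:C * mono l x by apply/funext => x; exact: mono_cons.
rewrite (partialM i (smooth_coord j) (smooth_mono l)).2 (partial_coord j i).2 IH.
apply/funext => x; rewrite big_cat big_map mulr_sumr; congr (_ + _).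
  rewrite eq_sym; case: eqP => _; first by rewrite big_seq1 mul1r.
  by rewrite big_nil mul0r.
by apply: eq_bigr => l' _; rewrite mono_cons.
Qed.

Variables (n : nat) (T : Type) (H : T -> 'rV[R]_n -> C).
Variables (kappa : T -> 'I_n -> 'I_n -> C) (sig : T -> 'I_n -> 'I_n -> T).
Hypothesis cH : forall t, ccontinuous (H t).
Hypothesis dH : forall t x i, cder (H t) x (delta_mx 0 i)
  (\sum_j kappa t i j * ((x 0 j)%:C * H (sig t i j) x)).

(** An invariant set for [smooth_coind]: by [dH] a derivative of p H_t is again a sum of such
    products. *)
Inductive gspan : ('rV[R]_n -> C) -> Prop :=
| gspan_term p t : smooth p -> gspan (fun x => p x * H t x)
| gspan_add F G : gspan F -> gspan G -> gspan (fun x => F x + G x)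
| gspan0 : gspan (fun=> 0).

Lemma gspan_sum (J : Type) (r : seq J) (F : J -> 'rV[R]_n -> C) :
  (forall j, gspan (F j)) -> gspan (fun x => \sum_(j <- r) F j x).
Proof.
move=> gF; elim: r => [|j r IH].
  by have := gspan0; congr gspan; apply/funext => x; rewrite big_nil.
by have := gspan_add (gF j) IH; congr gspan; apply/funext => x; rewrite big_cons.
Qed.

Lemma smooth_gauss t : smooth (H t).
Proof.
suff H0 F : gspan F -> smooth F.
  have -> : H t = fun x => (fun=> 1) x * H t x by apply/funext => x; rewrite mul1r.
  by apply: H0; apply: gspan_term; exact: smooth_cst.
apply: smooth_coind F => F; elim=> {F} [p {}t sp|F G _ [cF IF] _ [cG IG]|].
- split; first by apply: ccontinuousM => //; exact: smooth_cont.
  move=> i; have D x : cder (fun x => p x * H t x) x (delta_mx 0 i)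
     (partial i p x * H t x + p x * \sum_j kappa t i j * ((x 0 j)%:C * H (sig t i j) x)).
    exact: cderM (smooth_cder i x sp) (dH t x i).
  have [c1 c2] := cderivable_partial D; split=> //; rewrite c2.
  apply: gspan_add; first by apply: gspan_term; exact: smooth_partial.
  have -> : (fun x => p x * \sum_j kappa t i j * ((x 0 j)%:C * H (sig t i j) x)) =
     fun x => \sum_j (kappa t i j * (p x * (x 0 j)%:C)) * H (sig t i j) x.
    apply/funext => x; rewrite mulr_sumr; apply: eq_bigr => j _.
    by rewrite mulrCA !mulrA.
  apply: gspan_sum => j; apply: gspan_term; apply: smoothZ.
  exact: (smoothM sp (smooth_coord j)).
- split.
    have := ccontinuous_lin 1 cF cG; congr ccontinuous; apply/funext => x.
    by rewrite mul1r.
  move=> i; have [dF gF] := IF i; have [dG gG] := IG i.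
  have D x := cderD ((cderivableP i F).1 dF x) ((cderivableP i G).1 dG x).
  have [c1 c2] := cderivable_partial D; split=> //; rewrite c2.
  exact: gspan_add.
- split; first exact/smooth_cont/smooth0.
  move=> i; split; first exact: ((@smooth0 R n [::]).2 i).
  have := @partials0 R n [:: i]; rewrite /= => ->; exact: gspan0.
Qed.

Definition S2 m (x : 'rV[R]_m) : R := \sum_j (x 0 j) ^+ 2.

Lemma S2_ge0 m (x : 'rV[R]_m) : 0 <= S2 x.
Proof. by apply: sumr_ge0 => j _; exact: sqr_ge0. Qed.

Context {s : R}.
Hypothesis hs : 2^-1 <= s.
Let s0 : 0 < s := s_gt0 hs.
Local Notation p := s^-1.
Local Notation cls := (@cls R s).

Lemma powR_le_sqr (t : R) : `|t| `^ p <= 1 + t ^+ 2.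
Proof.
have p2 : p <= 2 by rewrite -[leRHS]invrK lef_pV2 ?posrE ?invr_gt0.
have p0 : 0 <= p by rewrite invr_ge0 ltW.
have [t1|t1] := leP `|t| 1.
  rewrite (@le_trans _ _ 1) //; last by rewrite lerDl sqr_ge0.
  have -> : 1 = 1 `^ p :> R by rewrite powR1.
  by rewrite ge0_ler_powR ?nnegrE.
rewrite (@le_trans _ _ (t ^+ 2)) //; last by rewrite lerDr.
rewrite -[t ^+ 2]ger0_norm ?sqr_ge0 // normrX -powR_mulrn ?normr_ge0 //.
by rewrite ler_powR // ltW.
Qed.

Lemma Sp_le_S2 m (x : 'rV[R]_m) : Sp s x <= m%:R + S2 x.
Proof.
apply: (@le_trans _ _ (\sum_(j < m) (1 + x 0 j ^+ 2))).
  by apply: ler_sum => j _; exact: powR_le_sqr.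
by rewrite big_split /= sumr_const card_ord.
Qed.

Lemma cabs_mono m (l : seq 'I_m) (x : 'rV[R]_m) : cabs (mono l x) <= `|x| ^+ size l.
Proof.
elim: l => [|j l IH]; first by rewrite /mono big_nil cabs1.
rewrite mono_cons cabsM exprS ler_pM ?cabs_ge0 // cabsR; exact: rV_norm_coord.
Qed.

(** Half of the Gaussian absorbs the monomial: |x|^k <= K^k k!^s exp((c/2) |x|^(1/s)), and |x|^(1/s)
    is at most a constant plus the squared Euclidean norm. *)
Lemma mono_gauss_bound m (c : R) : 0 < c -> exists2 P : R, 1 <= P &
  exists2 A0 : R, 0 <= A0 & forall (l : seq 'I_m) (x : 'rV[R]_m),
    cabs (mono l x) * expR (- (c * S2 x)) <=
    A0 * (P ^+ size l * fs s (size l)) * expR (- (c / 2 * S2 x)).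
Proof.
move=> c0; have c20 : 0 < c / 2 by rewrite divr_gt0.
have [K K0 Kc] := kap_surj s0 c20.
exists (Num.max 1 K); first by rewrite le_max lexx.
exists (expR (c / 2 * m%:R)) => [|l x]; first exact: expR_ge0.
have := pow_le_exp s0 (size l) K0 (normr_ge0 x); rewrite Kc => H1.
have H2 : expR (c / 2 * `|x| `^ p) <= expR (c / 2 * m%:R) * expR (c / 2 * S2 x).
  rewrite -expRD ler_expR -mulrDr ler_wpM2l ?(ltW c20) //.
  exact: le_trans (norm_Sp hs x) (Sp_le_S2 x).
have H3 : K ^+ size l <= Num.max 1 K ^+ size l.
  by rewrite lerXn2r ?nnegrE ?(ltW K0) ?le_max ?lexx ?orbT ?ler01.
have E : expR (- (c * S2 x)) = expR (- (c / 2 * S2 x)) * expR (- (c / 2 * S2 x)).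
  rewrite -expRD -opprD; congr (expR (- _)); rewrite -mulrDl; congr (_ * _).
  by rewrite -mulrDl -mulr2n -[c *+ 2]mulr_natr mulfK.
rewrite E mulrA ler_wpM2r ?expR_ge0 // expRN ler_pdivrMr ?expR_gt0 //.
apply: (le_trans (cabs_mono l x)); apply: (le_trans H1).
have r (a b e g : R) : a * (b * e) * g = b * e * (a * g) by clear; ring.
rewrite r; apply: ler_pM => //; rewrite ?expR_ge0 ?mulr_ge0 ?fs_ge0 ?exprn_ge0 ?(ltW K0) //.
by rewrite ler_wpM2r ?fs_ge0.
Qed.

(* [kappa] and [sig] describe dH: each derivative of the family is a combination of
   members of the family with linear coefficients, so derivatives trade for monomials,
   which the Gaussian absorbs at the cost of square roots of factorials. *)
Lemma gauss_cls (A c K : R) : 0 < c -> 0 <= K -> 0 <= A ->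
  (forall t i j, cabs (kappa t i j) <= K) ->
  (forall t x, cabs (H t x) <= A * expR (- (c * S2 x))) ->
  cls (full n) H.
Proof.
move=> c0 K0 A0 kK HA; have [P P1 [B B0 HB]] := mono_gauss_bound n c0.
have P0 : 0 <= P by apply: le_trans P1.
pose Q := 1 + n%:R * K; have Q1 : 1 <= Q by rewrite lerDl mulr_ge0.
have Q0 : 0 <= Q by apply: le_trans Q1.
have sH := smooth_gauss.
(* What is controlled is order plus degree. A derivative on the monomial lowers the degree and
   yields at most as many terms as the degree, absorbed by [fs_step]; one on H_t raises the degree
   and yields n terms with coefficients of size K. Together they cost the factor Q = 1 + n K. *)
have main L : forall l m t x, size l = L -> cabs (partials l (fun x => mono m x * H t x) x) <=
    A * B * expR (- (c / 2 * S2 x)) *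
      (Q ^+ L * (P ^+ (L + size m) * fs s (L + size m))).
  elim: L => [|L IH] l m t x.
    move/size0nil => -> /=; rewrite expr0 mul1r add0n cabsM.
    apply: (@le_trans _ _ (A * (cabs (mono m x) * expR (- (c * S2 x))))).
      by rewrite mulrCA ler_wpM2l ?cabs_ge0.
    have r (a b e g : R) : a * b * e * g = a * (b * g * e) by clear; ring.
    by rewrite r ler_wpM2l.
  case/lastP: l => [//|l i]; rewrite size_rcons => -[sl].
  rewrite partials_rcons (partialM i (smooth_mono m) (sH t)).2 partial_mono.
  rewrite ((cderivable_partial (fun x => dH t x i)).2).
  set w := A * B * _.
  have w0 : 0 <= w by rewrite !mulr_ge0 ?expR_ge0.
  have -> : (fun x => (\sum_(l' <- dmono i m) mono l' x) * H t x +
      mono m x * \sum_j kappa t i j * ((x 0 j)%:C * H (sig t i j) x)) =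
    (fun x => \sum_(l' <- dmono i m) (mono l' x * H t x) +
      \sum_j kappa t i j * (mono (j :: m) x * H (sig t i j) x)).
    apply/funext => y; rewrite mulr_suml mulr_sumr; congr (_ + _).
    apply: eq_bigr => j _; rewrite mulrCA mono_cons; congr (_ * _).
    by rewrite mulrA [mono m y * _]mulrC.
  have sm l' t' : smooth (fun x => mono l' x * H t' x) := smoothM (smooth_mono l') (sH t').
  rewrite (partialsD l (smooth_sum _ (fun l' => sm l' t))
    (smooth_sum _ (fun j => smoothZ (kappa t i j) (sm (j :: m) (sig t i j))))).
  rewrite (partials_sum l _ (fun l' => sm l' t)).
  rewrite (partials_sum l _ (fun j => smoothZ (kappa t i j) (sm (j :: m) (sig t i j)))).
  have [sz1 sz2] := dmono_size i m.
  pose Z := Q ^+ L * (P ^+ (L.+1 + size m) * fs s (L.+1 + size m)).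
  have Z0 : 0 <= Z by rewrite !mulr_ge0 ?exprn_ge0 ?fs_ge0.
  have cabs_sum (I : eqType) (r : seq I) (F : I -> C) (M : R) :
      (forall k, k \in r -> cabs (F k) <= M) -> cabs (\sum_(k <- r) F k) <= (size r)%:R * M.
    elim: r => [|k r IHr] FM; first by rewrite big_nil cabs0 mul0r.
    rewrite big_cons (le_trans (cabsD _ _)) //= -addn1 natrD mulrDl mul1r addrC.
    rewrite lerD ?FM ?mem_head ?IHr // => k' kr; by rewrite FM // inE kr orbT.
  have b1 : cabs (\sum_(l' <- dmono i m) partials l (fun x => mono l' x * H t x) x) <= w * Z.
    (* Every l' has one entry less than m; if m is empty there are no terms, so the predecessor is
       never truncated where it counts. *)
    pose N := (L + size m).-1.
    apply: (@le_trans _ _ ((size (dmono i m))%:R * (w * (Q ^+ L * (P ^+ (L.+1 + size m) * fs s N))))).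
      apply: cabs_sum => l' l'm; apply: (le_trans (IH _ l' t x sl)); rewrite -/w.
      rewrite ler_wpM2l // ler_wpM2l ?exprn_ge0 //.
      have -> : (L + size l')%N = N by rewrite /N (sz2 _ l'm) addnS.
      by rewrite ler_wpM2r ?fs_ge0 // ler_weXn2l // /N addSn (leq_trans (leq_pred _)).
    rewrite mulrCA ler_wpM2l // mulrCA ler_wpM2l ?exprn_ge0 // mulrCA ler_wpM2l ?exprn_ge0 //.
    case E : (size m) sz1 sz2 => [|M] sz1 sz2.
      by move: sz1; rewrite leqn0 => /eqP ->; rewrite mul0r fs_ge0.
    have -> : (L.+1 + M.+1 = (L + M).+2)%N by rewrite addSn addnS.
    have -> : N = (L + M)%N by rewrite /N E addnS.
    by apply: fs_step => //; apply: (leq_trans sz1); rewrite ltnS leq_addl.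
  have b2 : cabs (\sum_j partials l (fun x => kappa t i j * (mono (j :: m) x * H (sig t i j) x)) x) <= n%:R * K * (w * Z).
    have sz : size (index_enum 'I_n) = n.
      rewrite -[RHS](size_enum_ord n); apply/perm_size/uniq_perm; rewrite ?index_enum_uniq ?enum_uniq //.
      by move=> j; rewrite mem_index_enum mem_enum.
    rewrite -mulrA; have := cabs_sum _ (index_enum 'I_n) (fun j => partials l (fun x => kappa t i j * (mono (j :: m) x * H (sig t i j) x)) x) (K * (w * Z)).
    rewrite sz; apply => j _.
    rewrite (partialsZ l _ (sm (j :: m) (sig t i j))) cabsM ler_pM ?cabs_ge0 //.
    by apply: (le_trans (IH _ _ _ x sl)); rewrite -/w /= addnS.
  apply: (le_trans (cabsD _ _)); apply: (le_trans (lerD b1 b2)).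
  by rewrite -[X in X + _]mul1r -mulrDl exprS -mulrA -/Z mulrCA.
split=> [t|]; first exact: sH.
exists (Q * P), (c / 2); split; [|exact: divr_gt0|].
  by rewrite mulr_gt0 ?(lt_le_trans ltr01).
move=> d d0; exists (A * B * expR (c / 2 * n%:R)) => [|t x l]; first by rewrite !mulr_ge0 ?expR_ge0.
have := main (size l) l [::] t x erefl.
have -> : (fun x => mono [::] x * H t x) = H t by apply/funext => y; rewrite /mono big_nil mul1r.
rewrite addn0 => /le_trans; apply.
rewrite exprMn -[in leRHS](mulrA (Q ^+ _)) ler_wpM2r ?mulr_ge0 ?exprn_ge0 ?fs_ge0 //.
rewrite -[leRHS]mulrA ler_wpM2l ?mulr_ge0 //.
rewrite /W -expRD ler_expR.
have -> : \sum_j (d - c / 2 * (j \in full n)%:R) * `|x 0 j| `^ p = (d - c / 2) * Sp s x.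
  by rewrite mulr_sumr; apply: eq_bigr => j _; rewrite in_full mulr1.
have h1 := Sp_le_S2 x; have h2 := Sp_ge0 s x.
have h3 : c / 2 * Sp s x <= c / 2 * (n%:R + S2 x) by rewrite ler_wpM2l // divr_ge0 // ltW.
rewrite mulrBl; have h4 : 0 <= d * Sp s x by rewrite mulr_ge0 // ltW.
by move: h3; rewrite mulrDr; lra.
Qed.

End GaussianType.

(** * Gaussians and the Taylor remainders of a Gaussian kernel *)

Section GaussianKernel.
Context {R : realType}.
Local Notation C := R[i].

Lemma is_derive_coord n (i : 'I_n) (x v : 'rV[R]_n) :
  is_derive x v (fun y : 'rV[R]_n => y 0 i : R) (v 0 i).
Proof. exact: (cder_coord i x v).1. Qed.

Lemma continuous_coord n (i : 'I_n) : continuous (fun y : 'rV[R]_n => y 0 i : R).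
Proof. exact: coord_continuous. Qed.

Definition bil n m (u w : 'I_m -> 'I_n) (x : 'rV[R]_n) : R := \sum_k x 0 (u k) * x 0 (w k).

Lemma is_derive_bil n m (u w : 'I_m -> 'I_n) (x v : 'rV[R]_n) :
  is_derive x v (bil u w) (\sum_k (x 0 (u k) * v 0 (w k) + v 0 (u k) * x 0 (w k))).
Proof.
have H k : is_derive x v (fun y : 'rV[R]_n => y 0 (u k) * y 0 (w k) : R)
   (x 0 (u k) * v 0 (w k) + v 0 (u k) * x 0 (w k)).
  have := is_deriveM (is_derive_coord (u k) x v) (is_derive_coord (w k) x v).
  by rewrite /GRing.scale /= [X in _ + X]mulrC.
have -> : bil u w = \sum_k (fun y : 'rV[R]_n => y 0 (u k) * y 0 (w k)).
  by apply/funext => y; rewrite /bil fct_sumE.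
exact: is_derive_sum.
Qed.

Lemma continuous_bil n m (u w : 'I_m -> 'I_n) : continuous (bil u w).
Proof.
rewrite /bil; elim: (index_enum _) => [|i r IH].
  rewrite (_ : (fun x => _) = cst 0); first exact: cst_continuous.
  by apply/funext => x; rewrite big_nil.
rewrite (_ : (fun x => _) = fun x : 'rV[R]_n => x 0 (u i) * x 0 (w i) + \sum_(j <- r) x 0 (u j) * x 0 (w j)).
  move=> x; exact: (cvgD (cvgM (@continuous_coord n (u i) x) (@continuous_coord n (w i) x)) (IH x)).
by apply/funext => x; rewrite big_cons.
Qed.

Definition texp (N : nat) (z : R) : R := expR z - \sum_(k < N) z ^+ k / k`!%:R.

Lemma texpS N z : texp N.+1 z = texp N z - z ^+ N / N`!%:R.
Proof. by rewrite /texp big_ord_recr /= opprD addrA. Qed.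

(** With the convention 0.-1 = 0 the case N = 0 reads exp' = exp. *)
Lemma is_derive_texp N (z : R) : is_derive z (1 : R) (texp N) (texp N.-1 z).
Proof.
elim: N => [|N IH].
  have -> : texp 0 = expR by apply/funext => y; rewrite /texp big_ord0 subr0.
  exact: is_derive_expR.
have -> : texp N.+1 = texp N - (N`!%:R^-1 *: (fun y : R => y ^+ N)).
  by apply/funext => y; rewrite texpS /= mulrC.
have dX : is_derive z (1 : R) (fun y : R => y ^+ N) (N%:R * z ^+ N.-1).
  have := @is_deriveX R R^o (fun y => y) N z 1 1 (is_derive_id z (1 : R^o)).
  rewrite exprfctE => H; apply: (@is_derive_eq _ _ _ _ _ _ _ _ H).
  by rewrite /GRing.scale /= mulr1.
have H := is_deriveB IH (is_deriveZ (N`!%:R^-1) dX).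
apply: is_derive_eq H _; rewrite /GRing.scale /=.
case: N {IH dX} => [|N] /=; first by rewrite mul0r mulr0 subr0.
rewrite texpS; congr (_ - _); rewrite factS natrM invfM mulrCA mulrA mulrC.
by rewrite mulVKf // pnatr_eq0.
Qed.

Lemma texp0 N : texp N.+1 0 = 0.
Proof.
rewrite /texp expR0 big_ord_recl expr0 fact0 divr1 big1 ?addr0 ?subrr // => i _.
by rewrite expr0n mul0r.
Qed.

(** A remainder of order N gains the geometric factor rho^N at the price of a faster exponential.
    Induction on N: as a function of |z|, the right side plus or minus the remainder is non-negative
    at 0, and its derivative is the same expression for N - 1, up to the sign. *)
Lemma texp_bound (rho : R) N z : 0 < rho -> rho <= 1 ->
  `|texp N z| <= rho ^+ N * expR (`|z| / rho).
Proof.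
move=> r0 r1; elim: N z => [|N IH] z.
  rewrite /texp big_ord0 subr0 expr0 mul1r ger0_norm ?expR_ge0 // ler_expR.
  apply: (le_trans (ler_norm z)); rewrite ler_pdivlMr // -[leRHS]mulr1.
  by rewrite ler_wpM2l.
(* Here e selects the side of the absolute value and f the sign of z, so that the monotonicity
   argument is made for r >= 0 only. *)
have key (e f r : R) : `|e| = 1 -> `|f| = 1 -> 0 <= r ->
    0 <= rho ^+ N.+1 * expR (r / rho) + e * texp N.+1 (f * r).
  move=> e1 f1 rr0.
  pose phi (r : R) := rho ^+ N.+1 * expR (r * rho^-1) + e * texp N.+1 (r * f).
  pose dphi (r : R) := rho ^+ N * expR (r * rho^-1) + e * (texp N (r * f) * f).
  have lin (a y : R) : is_derive y (1 : R) (fun y : R => y * a) a.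
    have := is_deriveM (is_derive_id y (1 : R^o)) (is_derive_cst a y (1 : R^o)).
    by rewrite /GRing.scale /= mulr0 add0r mulr1.
  have dp (y : R) : is_derive y 1 phi (dphi y).
    have h1 := @is_derive1_comp R expR (fun y => y * rho^-1) y _ _ (is_derive_expR _) (lin rho^-1 y).
    have h2 := @is_derive1_comp R (texp N.+1) (fun y => y * f) y _ _ (is_derive_texp _ _) (lin f y).
    have := is_deriveD (is_deriveZ (rho ^+ N.+1) h1) (is_deriveZ e h2).
    move=> H; apply: (@is_derive_eq _ _ _ _ _ _ _ _ H); rewrite /GRing.scale /= /dphi; congr (_ + _).
    rewrite exprSr -mulrA; congr (_ * _).
    by rewrite [expR _ * _]mulrC mulVKf // gt_eqF.
  have [t /andP[t0 tr] E] := mvt_nonneg rr0 dp.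
  have -> : rho ^+ N.+1 * expR (r / rho) + e * texp N.+1 (f * r) = phi r by rewrite /phi [f * r]mulrC.
  have d0 : 0 <= dphi t.
    have := IH (t * f); rewrite normrM f1 mulr1 (ger0_norm t0) => H.
    have : `|e * (texp N (t * f) * f)| <= rho ^+ N * expR (t * rho^-1) by rewrite !normrM e1 f1 mul1r mulr1.
    by rewrite ler_norml => /andP[H' _]; rewrite /dphi -lerBlDl sub0r.
  have p0 : phi 0 = rho ^+ N.+1 by rewrite /phi !mul0r expR0 mulr1 texp0 mulr0 addr0.
  rewrite -[phi r](subrK (phi 0)) E p0 addr_ge0 ?exprn_ge0 ?(ltW r0) //.
  exact: mulr_ge0.
have N1 : `|-1 : R| = 1 by rewrite normrN1.
pose f : R := if 0 <= z then 1 else -1.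
have f1 : `|f| = 1 by rewrite /f; case: ifP; rewrite ?normr1.
have fz : f * `|z| = z.
  rewrite /f; case: (leP 0 z) => z0; first by rewrite ger0_norm // mul1r.
  by rewrite ltr0_norm // mulN1r opprK.
have k1 := key 1 f _ (normr1 _) f1 (normr_ge0 z); have k2 := key (-1) f _ N1 f1 (normr_ge0 z).
move: k1 k2; rewrite fz mul1r mulN1r => k1 k2.
by rewrite ler_norml -subr_ge0 opprK addrC k1 -subr_ge0.
Qed.

Lemma ccontinuousR n (f : 'rV[R]_n -> R) : continuous f -> ccontinuous (fun x => (f x)%:C).
Proof. by move=> cf; split=> //; exact: cst_continuous. Qed.

Lemma cderR n (f : 'rV[R]_n -> R) x v d : is_derive x v f d -> cder (fun x => (f x)%:C) x v d%:C.
Proof. by move=> df; split=> //=; exact: is_derive_cst. Qed.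

Context {s : R}.
Hypothesis hs : 2^-1 <= s.
Local Notation cls := (@cls R s).

Lemma S2_bil n (x : 'rV[R]_n) : S2 x = bil id id x.
Proof. by apply: eq_bigr => j _; rewrite expr2. Qed.

Lemma cls_gauss n (c : R) : 0 < c -> cls (full n) (fun (_ : unit) x => (expR (- (c * S2 x)))%:C).
Proof.
move=> c0; pose kp (_ : unit) (i j : 'I_n) : C := ((- 2 * c) * (i == j)%:R)%:C.
have cS : continuous (fun x : 'rV[R]_n => - (c * S2 x)).
  have -> : (fun x : 'rV[R]_n => - (c * S2 x)) = fun x => - (c * bil id id x).
    by apply/funext => y; rewrite S2_bil.
  move=> x; exact: (cvgN (cvgM (cvg_cst c) (@continuous_bil n n id id x))).
apply: (@gauss_cls R n unit _ kp (fun t _ _ => t) _ _ s hs 1 c (2 * c)) => //.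
- move=> _; apply: ccontinuousR => x; exact: (continuous_cvg _ (@continuous_expR R _) (cS x)).
- move=> [] x i.
  have -> : \sum_j kp tt i j * ((x 0 j)%:C * (expR (- (c * S2 x)))%:C) =
     (expR (- (c * S2 x)) * (- (c * (\sum_k (x 0 k * (delta_mx 0 i : 'rV[R]_n) 0 k + (delta_mx 0 i : 'rV[R]_n) 0 k * x 0 k)))))%:C.
    rewrite (bigD1 i) //= big1 ?addr0 => [|j ji]; last first.
      by rewrite /kp eq_sym (negbTE ji) mulr0 mul0r.
    rewrite [in RHS](bigD1 i) //= [X in _ + X]big1 ?addr0 => [|j ji]; last first.
      by rewrite mxE (negbTE ji) andbF mulr0 mul0r addr0.
    rewrite mxE !eqxx /kp eqxx /= -!rmorphM /=; congr (_%:C); rewrite !mulr1 mul1r.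
    by clear; ring.
  apply: cderR; apply: is_derive_comp1 (is_derive_expR _).
  have := is_deriveN (is_deriveZ c (is_derive_bil id id x (delta_mx 0 i))).
  have -> // : - (c *: bil id id) = fun x : 'rV[R]_n => - (c * S2 x).
  by apply/funext => y; rewrite S2_bil.
- by rewrite mulr_ge0 // ltW.
- move=> [] i j; rewrite cabsR normrM normrM normrN (gtr0_norm c0) ger0_norm // normr_nat.
  by case: (i == j); rewrite ?mulr1 ?lexx // mulr0 mulr_ge0 // ltW.
- by move=> _ x; rewrite cabsR mul1r ger0_norm ?expR_ge0.
Qed.

Section TaylorKernel.
Variables (n : nat) (b e : R).
Hypotheses (b0 : 0 < b) (e0 : 0 < e) (eb : e <= 4 * b).
Let l := @lshift n n.
Let r := @rshift n n.
Let Q (z : 'rV[R]_(n + n)) : R := - ((b + e) * bil l l z + b * bil r r z).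
Let B : 'rV[R]_(n + n) -> R := bil l r.

(** With z = (x, t), the N-th Taylor remainder in <x, t> of the kernel exp(-e |x|^2 - b |x - t|^2),
    divided by rho^N so that a suitable rho keeps the family bounded in N. For N = 0 it is the
    kernel itself. *)
Definition taylor_kernel (rho : R) (N : nat) (z : 'rV[R]_(n + n)) : C :=
  (rho ^- N * (expR (Q z) * texp N (2 * b * B z)))%:C.

(** The gradient of [B] exchanges the two blocks: the derivative along i is the coordinate
    [sw i]. *)
Let sw (i : 'I_(n + n)) : 'I_(n + n) := if fintype.split i is inl k then r k else
  if fintype.split i is inr k then l k else i.
Let ci (i : 'I_(n + n)) : R := if fintype.split i is inl k then b + e else b.

Let swl k : sw (l k) = r k. Proof. by rewrite /sw (unsplitK (inl k)). Qed.
Let swr k : sw (r k) = l k. Proof. by rewrite /sw (unsplitK (inr k)). Qed.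
Let cil k : ci (l k) = b + e. Proof. by rewrite /ci (unsplitK (inl k)). Qed.
Let cir k : ci (r k) = b. Proof. by rewrite /ci (unsplitK (inr k)). Qed.

Let sw_neq i : sw i != i.
Proof.
by case: (split_ordP i) => k ->; rewrite ?swl ?swr ?eq_lrshift ?eq_rlshift.
Qed.

Let dsum (F : 'I_n -> R) (u : 'I_n -> 'I_(n + n)) k0 : injective u ->
  \sum_k F k * (delta_mx 0 (u k0) : 'rV[R]_(n + n)) 0 (u k) = F k0.
Proof.
move=> iu; rewrite (bigD1 k0) //= big1 ?addr0 => [|k kk]; first by rewrite mxE !eqxx mulr1.
by rewrite mxE (inj_eq iu) (negbTE kk) andbF mulr0.
Qed.

Let dsum0 (F : 'I_n -> R) (u : 'I_n -> 'I_(n + n)) i : (forall k, (u k == i) = false) ->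
  \sum_k F k * (delta_mx 0 i : 'rV[R]_(n + n)) 0 (u k) = 0.
Proof. by move=> ui; rewrite big1 // => k _; rewrite mxE ui andbF mulr0. Qed.

Let dbil (u w : 'I_n -> 'I_(n + n)) (z : 'rV[R]_(n + n)) i :
  is_derive z (delta_mx 0 i : 'rV[R]_(n + n)) (bil u w)
    (\sum_k z 0 (u k) * (delta_mx 0 i : 'rV[R]_(n + n)) 0 (w k) +
     \sum_k z 0 (w k) * (delta_mx 0 i : 'rV[R]_(n + n)) 0 (u k)).
Proof.
have H := is_derive_bil u w z (delta_mx 0 i).
apply: (@is_derive_eq _ _ _ _ _ _ _ _ H); rewrite big_split /=; congr (_ + _).
by apply: eq_bigr => k _; rewrite mulrC.
Qed.

Let li := @lshift_inj n n.
Let ri := @rshift_inj n n.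

Let dQ z i : is_derive z (delta_mx 0 i : 'rV[R]_(n + n)) Q (- (2 * ci i * z 0 i)).
Proof.
have H := is_deriveN (is_deriveD (is_deriveZ (b + e) (dbil l l z i)) (is_deriveZ b (dbil r r z i))).
apply: (@is_derive_eq _ _ _ _ _ _ _ _ H); congr (- _); rewrite /GRing.scale /=.
case: (split_ordP i) => k ->.
  rewrite !(dsum _ _ li) !dsum0; last by move=> k'; exact: eq_rlshift.
  by rewrite -/l cil addr0 mulr0 addr0 -mulr2n -[in LHS]mulr_natl mulrCA mulrA.
rewrite !(dsum _ _ ri) !dsum0; last by move=> k'; exact: eq_lrshift.
by rewrite -/r cir addr0 mulr0 add0r -mulr2n -[in LHS]mulr_natl mulrCA mulrA.
Qed.

Let dB z i : is_derive z (delta_mx 0 i : 'rV[R]_(n + n)) B (z 0 (sw i)).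
Proof.
apply: (@is_derive_eq _ _ _ _ _ _ _ _ (dbil l r z i)).
case: (split_ordP i) => k ->.
  by rewrite (dsum _ _ li) dsum0 => [|k']; [rewrite add0r swl|exact: eq_rlshift].
by rewrite (dsum _ _ ri) dsum0 => [|k']; [rewrite addr0 swr|exact: eq_lrshift].
Qed.

(** The weight tau allows the two blocks to be charged unequally: only the first has the extra e to
    spend. *)
Let B_young (tau : R) z : 0 < tau -> 2 * `|B z| <= tau * bil l l z + tau^-1 * bil r r z.
Proof.
move=> t0; rewrite /B /bil !mulr_sumr -big_split /=.
apply: (@le_trans _ _ (2 * \sum_k `|z 0 (l k) * z 0 (r k)|)).
  by rewrite ler_wpM2l // ler_norm_sum.
rewrite mulr_sumr; apply: ler_sum => k _; rewrite normrM.
set x := `|_|; set y := `|z 0 (r k)|.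
have -> : z 0 (l k) * z 0 (l k) = x * x by rewrite -!expr2 /x real_normK ?num_real.
have -> : z 0 (r k) * z 0 (r k) = y * y by rewrite -!expr2 /y real_normK ?num_real.
have -> : tau * (x * x) + tau^-1 * (y * y) = 2 * (x * y) + tau^-1 * (tau * x - y) ^+ 2.
  by rewrite expr2; field; rewrite gt_eqF.
by rewrite lerDl mulr_ge0 ?invr_ge0 ?(ltW t0) ?sqr_ge0.
Qed.

(* With 1/rho = 1 + mu and tau = 1 + 2 mu in [B_young], a multiple of -|z|^2 is left
   over in the exponent. *)
Let mu := e / (8 * b).
Let mu0 : 0 < mu. Proof. by rewrite divr_gt0 // mulr_gt0. Qed.
Let muE : e = 8 * b * mu. Proof. by rewrite /mu mulrC divfK // gt_eqF // mulr_gt0. Qed.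
Let mu_half : 2 * mu <= 1.
Proof. by move: eb; rewrite muE => H; rewrite -(ler_pM2l b0); move: H; lra. Qed.

Let rho := (1 + mu)^-1.

Let cc := Num.min (e / 2) (b * mu / (1 + 2 * mu)).

Let cc0 : 0 < cc.
Proof.
have m1 : 0 < 1 + 2 * mu by rewrite addr_gt0 // mulr_gt0.
by rewrite lt_min (divr_gt0 e0) // (divr_gt0 (mulr_gt0 b0 mu0) m1).
Qed.

Let exponent z : Q z + `|2 * b * B z| / rho <= - (cc * S2 z).
Proof.
have m1 : 0 < 1 + 2 * mu by rewrite addr_gt0 // mulr_gt0.
have H := B_young z m1; have b0' := ltW b0.
have SE : S2 z = bil l l z + bil r r z.
  rewrite /S2 big_split_ord; congr (_ + _); apply: eq_bigr => k _; exact: expr2.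
have Sl : 0 <= bil l l z by apply: sumr_ge0 => k _; rewrite -expr2 sqr_ge0.
have Sr : 0 <= bil r r z by apply: sumr_ge0 => k _; rewrite -expr2 sqr_ge0.
have c1 : cc * bil l l z <= e / 2 * bil l l z by rewrite ler_wpM2r // ge_min lexx.
have c2 : cc * bil r r z <= b * mu / (1 + 2 * mu) * bil r r z by rewrite ler_wpM2r // ge_min lexx orbT.
have -> : `|2 * b * B z| / rho = b * (1 + mu) * (2 * `|B z|).
  rewrite /rho invrK normrM normrM normr_nat (gtr0_norm b0); move: (`|B z|) => t; clear; ring.
have H2 : b * (1 + mu) * (2 * `|B z|) <=
   b * (1 + mu) * ((1 + 2 * mu) * bil l l z + (1 + 2 * mu)^-1 * bil r r z).
  by rewrite ler_wpM2l // mulr_ge0 // addr_ge0 // ltW.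
apply: (le_trans (lerD (lexx _) H2)).
(* Since e = 8 b mu, this is (1 + mu)(1 + 2 mu) <= 1 + 4 mu, which follows from 2 mu <= 1. It leaves
   e/2 in the first block, [c4] leaves b mu / (1 + 2 mu) in the second, and [cc] is the smaller of
   the two. *)
have c3 : b * (1 + mu) * (1 + 2 * mu) <= b + e / 2.
  have -> : b + e / 2 = b * (1 + 4 * mu) by rewrite [in LHS]muE; move: (b) (mu) => u v; field.
  rewrite -mulrA ler_wpM2l //; have := ler_wpM2l (ltW mu0) mu_half; rewrite mulr1 => h.
  by move: h; move: (mu) => v; lra.
have c4 : b * (1 + mu) * (1 + 2 * mu)^-1 = b - b * mu / (1 + 2 * mu).
  have ne : 1 + 2 * mu != 0 by rewrite gt_eqF.
  by move: (b) (mu) ne => u v ne; field.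
have c5 := ler_wpM2r Sl c3.
have rr (u v m m' X Y : R) : u * v * (m * X + m' * Y) = u * v * m * X + u * v * m' * Y by clear; ring.
rewrite rr c4 SE /Q; move: c1 c2 c5 Sl Sr.
move: (bil l l z) (bil r r z) (b * (1 + mu) * (1 + 2 * mu)) (b * mu / (1 + 2 * mu)) (cc) (b) (e).
by move=> X Y u v w b1 e1 c1 c2 c5 _ _; lra.
Qed.

(** Differentiating the exponential multiplies by -2 c_i z_i at the same N. Differentiating the
    remainder lowers N by one and changes the normalisation by 1/rho, except at N = 0, where N is
    unchanged. *)
Let kp (N : nat) (i j : 'I_(n + n)) : C :=
  (if j == i then - (2 * ci i) else if j == sw i then 2 * b * (if N is 0%N then 1 else rho^-1) else 0)%:C.
Let sg (N : nat) (i j : 'I_(n + n)) : nat := if j == i then N else N.-1.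

Lemma cls_taylor_kernel : exists2 rho : R, 0 < rho < 1 &
  cls (full (n + n)) (fun N => taylor_kernel rho N).
Proof.
have r0 : 0 < rho by rewrite invr_gt0 addr_gt0.
have r1 : rho < 1 by rewrite invf_lt1 ?addr_gt0 // ltrDl.
exists rho; first by rewrite r0.
have cT N : continuous (texp N : R -> R).
  by move=> x; apply/differentiable_continuous/derivable1_diffP; have [] := is_derive_texp N x.
have cQ : continuous Q.
  move=> x; exact: (cvgN (cvgD (cvgM (cvg_cst (b + e)) (@continuous_bil (n + n) n l l x)) (cvgM (cvg_cst b) (@continuous_bil (n + n) n r r x)))).
have cB : continuous (fun z => 2 * b * B z).
  move=> x; exact: (cvgM (cvg_cst (2 * b)) (@continuous_bil (n + n) n l r x)).
have ci0 i : 0 <= ci i <= b + e.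
  by case: (split_ordP i) => k ->; rewrite ?cil ?cir ?lerDl ?lexx ?addr_ge0 ?ltW.
pose K := 2 * (b + e) + 2 * b * (1 + rho^-1).
have bp := ltW b0; have rp := ltW r0.
have K1 : 0 <= 2 * (b + e) by rewrite mulr_ge0 // addr_ge0 // ltW.
have K2 : 0 <= 2 * b * (1 + rho^-1) by rewrite mulr_ge0 ?mulr_ge0 // addr_ge0 // invr_ge0.
apply: (@gauss_cls R (n + n) nat _ kp sg _ _ s hs 1 cc K) => //.
- move=> N; apply: ccontinuousR => x.
  have h3 : {for x, continuous (fun z => expR (Q z))}.
    by apply: (@continuous_comp _ _ _ Q expR); [exact: cQ|exact: continuous_expR].
  have h4 : {for x, continuous (fun z => texp N (2 * b * B z))}.
    by apply: (@continuous_comp _ _ _ (fun z => 2 * b * B z) (texp N)); [exact: cB|exact: cT].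
  exact: (cvgM (cvg_cst _) (cvgM h3 h4)).
- move=> N z i; rewrite (bigD1 i) //= (bigD1 (sw i)) ?sw_neq //= big1 ?addr0; last first.
    by move=> j /andP[ji js]; rewrite /kp (negbTE ji) (negbTE js) mul0r.
  rewrite /kp /sg eqxx (negbTE (sw_neq i)) eqxx /taylor_kernel -!rmorphM -rmorphD /=.
  have h1 := is_derive_comp1 (dQ z i) (is_derive_expR _).
  have h2 := is_derive_comp1 (is_deriveZ (2 * b) (dB z i)) (is_derive_texp N _).
  have H := is_deriveZ (rho ^- N) (is_deriveM h1 h2).
  apply: cderR; apply: (@is_derive_eq _ _ _ _ _ _ _ _ H); rewrite /GRing.scale /=.
  have rE : rho ^- N = (if N is 0%N then 1 else rho^-1) * rho ^- N.-1.
    by case: N {h1 h2 H} => [|N] /=; rewrite ?mul1r // exprS invfM.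
  rewrite mulrDr addrC; congr (_ + _); last first.
    rewrite {1}rE; move: (rho ^- N.-1) (expR _) (texp _ _) (z 0 _) (if _ is 0%N then _ else _) => u1 u2 u3 u4 u5.
    by clear; ring.
  move: (rho ^- N) (expR _) (texp _ _) (z 0 _) (ci i) => u1 u2 u3 u4 u5.
  by clear; ring.
- exact: addr_ge0.
- move=> N i j; rewrite cabsR /kp; have [_ c2] := andP (ci0 i); have [c1 _] := andP (ci0 i).
  case: ifP => _.
    rewrite normrN ger0_norm ?mulr_ge0 // (le_trans (ler_wpM2l _ c2)) // lerDl //.
  case: ifP => _; last by rewrite normr0 addr_ge0.
  set q := (if _ is 0%N then _ else _).
  have ri0 : 0 <= rho^-1 by rewrite invr_ge0.
  have q0 : 0 <= q by rewrite /q; case: (N) => [|_]; [exact: ler01|].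
  have q1 : q <= 1 + rho^-1 by rewrite /q; case: (N) => [|_]; rewrite ?lerDl ?lerDr ?ler01.
  have b2 : 0 <= 2 * b by rewrite mulr_ge0.
  rewrite ger0_norm ?(mulr_ge0 b2 q0) //; apply: (@le_trans _ _ (2 * b * (1 + rho^-1))).
    exact: ler_wpM2l.
  by rewrite lerDr.
- move=> N z; rewrite mul1r cabsR normrM normrM ger0_norm ?invr_ge0 ?exprn_ge0 //.
  rewrite ler_pdivrMl ?exprn_gt0 // ger0_norm ?expR_ge0 //.
  apply: (le_trans (ler_wpM2l (expR_ge0 _) (texp_bound N _ r0 (ltW r1)))).
  rewrite mulrCA ler_wpM2l ?exprn_ge0 // -expRD ler_expR; exact: exponent.
Qed.

End TaylorKernel.

End GaussianKernel.

(** * Approximation of the identity by operators of finite rank *)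

Section FiniteRank.
Context {R : realType}.
Local Notation C := R[i].
Context {s : R}.
Hypothesis hs : 2^-1 <= s.
Local Notation cls := (@cls R s).
Local Notation nb := (@nb R s _).
Local Notation half_le := (lexx (2^-1 : R)).

Lemma gs_pred_of_cls n (f : 'rV[R]_n -> C) : cls (full n) (fun _ : unit => f) ->
  (f : 'rV[R]_n -> R[i]^o) \in gs_pred s.
Proof.
move=> cf; apply/asboolP; split; first exact: (cls_smooth tt cf).
have [h h0 [M HM]] := gs_of_cls_full hs cf.
by exists h => //; apply/gs_norm_ltyP; exists M; exact: HM tt.
Qed.

Definition gs_of_cls n (f : 'rV[R]_n -> C) (cf : cls (full n) (fun _ : unit => f)) : gs n s :=
  GS (gs_pred_of_cls cf).

Lemma cls_gs n (g : gs n s) : cls (full n) (fun _ : unit => g : 'rV[R]_n -> C).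
Proof.
have [sg [h h0 /gs_norm_ltyP[M HM]]] := asboolW (gs_funP g).
exact: (cls_full_of_gs hs h0 (fun=> sg) (fun=> HM)).
Qed.

(** A bounded set as an index type: class statements over it are uniform on the ball. *)
Definition gs_ball n (h M : R) := {g : gs n s | (gs_norm s h g <= M%:E)%E}.

Lemma cls_gs_ball n (h M : R) : 0 < h ->
  cls (full n) (fun g : gs_ball n h M => val g : 'rV[R]_n -> C).
Proof.
move=> h0; apply: (cls_full_of_gs hs h0); last by move=> g; exact: (valP g).
by move=> g; have [] := asboolW (gs_funP (val g)).
Qed.

(** wait: see the bounded family below. *)
Lemma cls_gs_base n T (F : T -> 'rV[R]_n -> C) (D : set (gs n s)) :
  cls (full n) F -> gs_base D ->
  exists2 eps : R, 0 < eps & forall (c : C), cabs c <= eps -> forall t (f : gs n s),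
    (forall x, f x = c * F t x) -> D f.
Proof.
move=> cF [dD bD]; have [h h0 [M HM]] := gs_of_cls_full hs cF.
have [r r0 Hr] := bD h h0; exists (r / (`|M| + 1)) => [|c cc t f fE].
  by rewrite divr_gt0 // ltr_wpDl.
have ct : cls (full n) (fun _ : unit => F t) := cls_sub (fun _ : unit => t) cF.
have -> : f = c *: gs_of_cls ct by apply/val_inj/funext => x; exact: fE.
apply: Hr; apply: (@le_trans _ _ (cabs c * M)%:E).
  apply: gs_norm_scale => //; exact: HM.
rewrite lee_fin; apply: (@le_trans _ _ (r / (`|M| + 1) * (`|M| + 1))).
  apply: (@le_trans _ _ (cabs c * (`|M| + 1))).
    by rewrite ler_wpM2l ?cabs_ge0 // (le_trans (ler_norm M)) // lerDl.
  by rewrite ler_wpM2r // addr_ge0.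
by rewrite divfK // gt_eqF // ltr_wpDl.
Qed.

(** The integral over a block is the Fourier transform at frequency 0, and restriction to frequency
    0 is a linear substitution. *)
Lemma cls_cint m n T (F : T -> 'rV[R]_(m + n) -> C) : cls (full (m + n)) F ->
  cls (full m) (fun t x => cint (fun y => F t (row_mx x y))).
Proof.
move=> cF; have c1 := cls_bFT hs (normr1 R) cF (sub_full _).
have : cls (full m) (fun t x => bFT 1 (F t) (x *m row_mx 1%:M 0)).
  apply: (cls_lin1 hs) c1 => i _; exists (lshift n i); first exact: in_full.
  by move=> x; rewrite mul_mx_row mulmx1 row_mxEl.
congr (cls _ _); apply/funext => t; apply/funext => x.
rewrite mul_mx_row mulmx1 mulmx0 /bFT row_mxKl row_mxKr; apply: eq_cint => y.
rewrite /dotp big1 ?mulr0 ?cis0 ?mulr1 // => i _; by rewrite mxE mulr0.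
Qed.

(** The factor 1 makes this literally an instance of [cls_gauss]. *)
Definition gam n (x : 'rV[R]_n) : C := (expR (- (1 * S2 x)))%:C.

Lemma cls_gam n : cls (full n) (fun _ : unit => @gam n).
Proof. exact: cls_gauss. Qed.

Lemma cint_gam n : cint (@gam n) = (Num.sqrt pi)%:C ^+ n.
Proof.
elim: n => [|n IH].
  rewrite /cint /= /gam /S2 big_ord0 mulr0 oppr0 expR0 expr0 //.
have E (t : R) (y : 'rV[R]_n) : gam (row_mx (t%:M : 'rV[R]_1) y) = (expR (- t ^+ 2))%:C * gam y.
  rewrite /gam -rmorphM -expRD; congr (expR _)%:C.
  rewrite !mul1r -opprD; congr (- _); rewrite /S2 big_ord_recl row_cons0; congr (_ + _).
  by apply: eq_bigr => i _; rewrite row_consS.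
have nG : nice1 s (expR 1) 1 (fun t : R => (expR (- t ^+ 2))%:C).
  split=> // [|t].
    by split; [exact: measurable_gauss_fun|exact: measurable_cst].
  rewrite cabsR ger0_norm ?expR_ge0 // -expRD ler_expR mul1r.
  by have := powR_le_sqr hs t; lra.
rewrite cintS; transitivity (Jint (fun t : R => (Num.sqrt pi)%:C ^+ n * (expR (- t ^+ 2))%:C)).
  apply: eq_Jint => t; rewrite mulrC -IH -(cintZ hs _ (nb_of_cls tt (cls_gam n))).
  by apply: eq_cint => y; rewrite E.
rewrite (JintZ hs _ nG) exprSr; congr (_ * _); rewrite /Jint /=.
have -> : \int[lebesgue_measure]_(t in [set: R]) (0 : R) = 0.
  by rewrite /Rintegral integral0.
have -> // : \int[lebesgue_measure]_(t in [set: R]) expR (- t ^+ 2) = Num.sqrt pi.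
by rewrite /Rintegral integralT_gauss.
Qed.

Lemma sqrt_pi_neq0 n : (Num.sqrt pi : R)%:C ^+ n != 0 :> C.
Proof.
apply/expf_neq0/eqP => /(@complexI R)/eqP.
by rewrite gt_eqF // sqrtr_gt0 pi_gt0.
Qed.

Lemma nbD n (I : {set 'I_n}) (F G : 'rV[R]_n -> C) : nb I F -> nb I G ->
  nb I (fun x => F x + G x).
Proof.
move=> [cF [c c0 HF]] [cG [c' c'0 HG]]; split.
  have := ccontinuous_lin 1 cF cG; congr ccontinuous; apply/funext => x.
  by rewrite mul1r.
exists (Num.min c c') => [|d d0]; first by rewrite lt_min c0.
have [A A0 HA] := HF d d0; have [B B0 HB] := HG d d0.
have mono (a : R) x : Num.min c c' <= a -> W s I a d x <= W s I (Num.min c c') d x.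
  by move=> ca; apply: le_W => j; rewrite lerD2l lerN2 ler_wpM2r.
exists (A + B) => [|x]; first exact: addr_ge0.
rewrite mulrDl (le_trans (cabsD _ _)) // lerD //.
  by apply: (le_trans (HA x)); rewrite ler_wpM2l // mono // ge_min lexx.
by apply: (le_trans (HB x)); rewrite ler_wpM2l // mono // ge_min lexx orbT.
Qed.

Section Mollifier.
Variable n : nat.
Local Notation NN := (n + (n + n))%N.
Let c0 : C := ((Num.sqrt pi : R)%:C ^+ n)^-1.

(* The regularisation x |-> gam (eta x) int c0 gam(u) g(x + eta u) du. *)
Definition moll (eta : R) (g : 'rV[R]_n -> C) (x : 'rV[R]_n) : C :=
  cint (fun u => gam (eta *: x) * (g (x + eta *: u) * (c0 * gam u))).

Lemma gam0 m : gam (0 : 'rV[R]_m) = 1.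
Proof.
by rewrite /gam /S2 big1 ?mulr0 ?oppr0 ?expR0 // => i _; rewrite mxE expr0n.
Qed.

Lemma moll0 g x : moll 0 g x = g x.
Proof.
rewrite /moll scale0r gam0; transitivity (cint (fun u => (g x * c0) * @gam n u)).
  by apply: eq_cint => u; rewrite scale0r addr0 mul1r mulrA.
rewrite (cintZ hs _ (nb_of_cls tt (cls_gam n))) cint_gam /c0 -mulrA mulVf ?mulr1 //.
exact: sqrt_pi_neq0.
Qed.

(** The integrand of [moll] is one fixed function evaluated at (eta x, x + eta u, u), the image of
    (x, u) under [L0 + eta *: N]; this is affine in eta, as [cls_path] requires. *)
Let L0 : 'M[R]_(n + n, NN) := row_mx 0 1%:M.
Let N : 'M[R]_(n + n, NN) := row_mx (PL n n) (row_mx (PR n n) 0).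

Let LE (e : R) (x u : 'rV[R]_n) :
  row_mx x u *m (L0 + e *: N) = row_mx (e *: x) (row_mx (x + e *: u) u).
Proof.
rewrite mulmxDr -scalemxAr !mul_mx_row !mulmx0 mulmx1 mul_PL mul_PR.
by rewrite row_mxKl row_mxKr !scale_row_mx scaler0 !add_row_mx add0r addr0.
Qed.

(** Divided by eta, the error is the integral over u of the difference quotient in [cls_path], hence
    bounded uniformly over the ball and in eta. *)
Lemma cls_moll_error (h M : R) : 0 < h ->
  cls (full n) (fun (te : gs_ball n h M * {e : R | 0 < e <= 1}) x =>
    ((val te.2)^-1)%:C * (moll (val te.2) (val te.1) x + -1 * val te.1 x)).
Proof.
move=> h0; pose gT := gs_ball n h M.
have cg := cls_gs_ball n M h0.
have ck : cls (full NN) (fun (g : gT) w => @gam n (lsubmx w) *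
    ((val g : 'rV[R]_n -> C) (lsubmx (rsubmx w)) * (c0 * gam (rsubmx (rsubmx w))))).
  have kM (t : gT) : cabs c0 <= cabs c0 by [].
  have c1 := cls_sub (fun _ : gT => tt) (cls_gam n).
  have c2 := clsZ (k := fun=> c0) kM c1.
  exact: (cls_tensor hs c1 (cls_tensor hs cg c2)).
have B2 : (0 : R) <= 2 by [].
(* Since x = (x + r u) - r u with r <= 1, the last two blocks recover x and u; the constant 2 holds
   down to r = 0. *)
have HB (r : R) : 0 <= r <= 1 -> forall (z : 'rV[R]_(n + n)) i,
    `|z 0 i| <= 2 * \sum_j `|(z *m (L0 + r *: N)) 0 j|.
  move=> /andP[r0 r1] z i.
  have -> : z *m (L0 + r *: N) = row_mx (r *: lsubmx z) (row_mx (lsubmx z + r *: rsubmx z) (rsubmx z)).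
    by rewrite -LE hsubmxK.
  set w := row_mx (r *: _) _; have S0 : 0 <= \sum_j `|w 0 j| by apply: sumr_ge0.
  have Sj j : `|w 0 j| <= \sum_j `|w 0 j|.
    by rewrite (bigD1 j) //= lerDl sumr_ge0.
  have u1 k : `|rsubmx z 0 k| <= \sum_j `|w 0 j|.
    by have := Sj (rshift n (rshift n k)); rewrite /w !row_mxEr.
  case: (split_ordP i) => k ->.
    have -> : z 0 (lshift n k) = (lsubmx z + r *: rsubmx z) 0 k - r * rsubmx z 0 k.
      by rewrite [X in X - _]mxE [X in _ + X - _]mxE addrK mxE.
    rewrite (le_trans (ler_normB _ _)) // mulr_natl mulr2n lerD //.
      by have := Sj (rshift n (lshift n k)); rewrite /w row_mxEr row_mxEl.
    rewrite normrM (ger0_norm r0) -[leRHS]mul1r ler_pM //.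
  have -> : z 0 (rshift n k) = rsubmx z 0 k by rewrite mxE.
  by rewrite (le_trans (u1 k)) // mulr_natl mulr2n lerDl.
have cp := cls_path hs ck B2 HB.
have := cls_cint cp; congr (cls _ _); apply/funext => -[g [e He]]; apply/funext => x /=.
have nk (e' : R) : 0 <= e' <= 1 -> nb (full n) (fun u : 'rV[R]_n =>
    @gam n (e' *: x) * ((val g : 'rV[R]_n -> C) (x + e' *: u) * (c0 * gam u))).
  move=> He'; have [b0 Hb0] := mx_bounded L0; have [b1 Hb1] := mx_bounded N.
  have c1 : cls (full (n + n)) (fun (_ : unit) z => @gam n (lsubmx (z *m (L0 + e' *: N))) *
    ((val g : 'rV[R]_n -> C) (lsubmx (rsubmx (z *m (L0 + e' *: N)))) * (c0 * gam (rsubmx (rsubmx (z *m (L0 + e' *: N))))))).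
    have [b Hb] := mx_bounded (L0 + e' *: N).
    apply: (@cls_lin R s hs _ _ (full (n + n)) (full NN) unit (fun=> L0 + e' *: N) b 2
      (fun _ w => @gam n (lsubmx w) * ((val g : 'rV[R]_n -> C) (lsubmx (rsubmx w)) * (c0 * gam (rsubmx (rsubmx w)))))) => //.
    - move=> _ z i _; rewrite [X in _ <= 2 * X](eq_bigl xpredT); first exact: HB.
      by move=> j; rewrite in_full.
    - exact: (cls_sub (fun _ : unit => g) ck).
  have := nb_right x (fun i => in_full (rshift n i)) (nb_of_cls tt c1).
  congr (nb _ _); apply/funext => u.
  by rewrite LE row_mxKl row_mxKr row_mxKl row_mxKr.
have [e0 e1] := andP He.
have e01 : 0 <= e <= 1 by rewrite (ltW e0) e1.
have n1 := nk e e01.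
have n0 := nk 0 (introT andP (conj (lexx 0) ler01)).
rewrite -(moll0 (val g) x) /moll.
rewrite -(cintZ hs (-1) n0) -(cintD hs n1 (nbZ (-1) n0)) -(cintZ hs); last by apply: nbD n1 (nbZ (-1) n0).
by apply: eq_cint => u; rewrite !LE !(row_mxKl, row_mxKr).
Qed.

Let kern_factor (eta : R) (x t : 'rV[R]_n) : C := gam (eta *: x) * (c0 * gam (eta^-1 *: (t - x))).

Let nb_kern (eta : R) x (g : 'rV[R]_n -> C) : nb (full n) g ->
  nb (full n) (fun t => kern_factor eta x t * g t).
Proof.
apply: (@nbM R s n (full n) g (kern_factor eta x) (cabs c0)); first exact: cabs_ge0.
  have cg : ccontinuous (fun t => @gam n (eta^-1 *: (t - x))).
    apply: (@ccontinuous_comp R n n (fun t => eta^-1 *: (t - x))); last exact: smooth_cont (cls_smooth tt (cls_gam n)).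
    have -> : (fun t : 'rV[R]_n => eta^-1 *: (t - x)) = fun t => t *m (eta^-1)%:M + - (eta^-1 *: x).
      by apply/funext => t; rewrite mul_mx_scalar scalerBr.
    move=> t; have K := @continuous_mulmx R n n (eta^-1)%:M t.
    exact: (cvgD K (cvg_cst (- (eta^-1 *: x)))).
  apply: ccontinuousM; first exact/smooth_cont/smooth_cst.
  by apply: ccontinuousM => //; exact/smooth_cont/smooth_cst.
move=> t; have le1 (y : 'rV[R]_n) : cabs (gam y) <= 1.
  rewrite cabsR ger0_norm ?expR_ge0 // -[leRHS]expR0 ler_expR mul1r oppr_le0.
  exact: S2_ge0.
rewrite /kern_factor !cabsM mulrCA -[leRHS]mulr1 ler_wpM2l ?cabs_ge0 //.
by rewrite -[leRHS]mulr1 ler_pM ?cabs_ge0.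
Qed.

(** The substitution t = x + eta u gives the kernel exp(-eta^2 |x|^2 - eta^-2 |x - t|^2), which
    fixes b = eta^-2 and e = eta^2. *)
Lemma moll_kernel (eta : R) (g : 'rV[R]_n -> C) x : 0 < eta -> nb (full n) g ->
  moll eta g x = (eta^-1)%:C ^+ n * c0 * cint (fun t =>
    taylor_kernel (eta ^- 2) (eta ^+ 2) 1 0 (row_mx x t) * g t) /\
  nb (full n) (fun t => taylor_kernel (eta ^- 2) (eta ^+ 2) 1 0 (row_mx x t) * g t).
Proof.
move=> e0 ng; have nk := nb_kern eta x ng.
have c0n : c0 != 0 by rewrite invr_neq0 // sqrt_pi_neq0.
suff E t : taylor_kernel (eta ^- 2) (eta ^+ 2) 1 0 (row_mx x t) = c0^-1 * kern_factor eta x t.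
  have Eg : (fun t => taylor_kernel (eta ^- 2) (eta ^+ 2) 1 0 (row_mx x t) * g t) =
      fun t => c0^-1 * (kern_factor eta x t * g t).
    by apply/funext => t; rewrite E -mulrA.
  rewrite Eg; split; last exact: nbZ nk.
  rewrite (cintZ hs _ nk) mulrA mulfK // -(cint_affine hs x e0 nk); apply: eq_cint => u.
  rewrite /kern_factor addrK scalerA mulVf ?gt_eqF // scale1r.
  by rewrite [x + _]addrC -!mulrA; congr (_ * _); rewrite mulrC -!mulrA.
rewrite /kern_factor mulrCA mulKf //.
rewrite /gam /taylor_kernel -rmorphM; congr (_%:C).
rewrite expr0 invr1 mul1r /texp big_ord0 subr0 -!expRD; congr expR.
have bE (u w : 'I_n -> 'I_(n + n)) : bil u w (row_mx x t) = \sum_k row_mx x t 0 (u k) * row_mx x t 0 (w k) by [].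
rewrite /S2 !mul1r !bE !mulr_sumr -!sumrN -!big_split /= -sumrN -big_split /=.
apply: eq_bigr => k _; rewrite !row_mxEl !row_mxEr !mxE.
have e1 : eta != 0 by rewrite gt_eqF.
by move: (x 0 k) (t 0 k) => u v; field.
Qed.

End Mollifier.

End FiniteRank.

(** * Finite-rank approximation of the identity, uniform on bounded sets *)

Section Density.
Context {R : realType}.
Local Notation C := R[i].
Local Notation half := (2^-1 : R).

Definition gs_coord n (i : 'I_n) (g : gs n half) : gs n half :=
  gs_of_cls (lexx half) (clsM0 (lexx half) (cls_coord (lexx half) i) (cls_gs (lexx half) g)).

Definition finite_rank n (k : 'rV[R]_n -> 'rV[R]_n -> C) : Prop :=
  exists r : seq (gs n half * gs n half),
    forall x t, k x t = \sum_(pq <- r) (pq.1 x : C) * pq.2 t.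

Lemma finite_rank_scale n (c : C) (k : 'rV[R]_n -> 'rV[R]_n -> C) :
  finite_rank k -> finite_rank (fun x t => c * k x t).
Proof.
move=> [r rE]; exists [seq (c *: pq.1, pq.2) | pq <- r] => x t.
rewrite rE mulr_sumr big_map; apply: eq_bigr => pq _ /=.
by rewrite mulrA.
Qed.

Lemma finite_rank_coord n i (k : 'rV[R]_n -> 'rV[R]_n -> C) :
  finite_rank k -> finite_rank (fun x t => ((x 0 i)%:C * (t 0 i)%:C) * k x t).
Proof.
move=> [r rE]; exists [seq (gs_coord i pq.1, gs_coord i pq.2) | pq <- r] => x t.
rewrite rE mulr_sumr big_map; apply: eq_bigr => pq _ /=.
by rewrite mulrACA.
Qed.

Lemma finite_rank_sum n (I : Type) (r : seq I) (k : I -> 'rV[R]_n -> 'rV[R]_n -> C) :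
  (forall i, finite_rank (k i)) -> finite_rank (fun x t => \sum_(i <- r) k i x t).
Proof.
move=> fk; elim: r => [|i r [q qE]]; first by exists [::] => x t; rewrite !big_nil.
have [q' qE'] := fk i; exists (q' ++ q) => x t.
by rewrite big_cons qE qE' big_cat.
Qed.

Section Taylor.
Variables (n : nat) (b e : R).
Hypotheses (b0 : 0 < b) (e0 : 0 < e).

Let BB (x t : 'rV[R]_n) : R := bil (@lshift n n) (@rshift n n) (row_mx x t).
Let QQ (x t : 'rV[R]_n) : R :=
  - ((b + e) * bil (@lshift n n) (@lshift n n) (row_mx x t) +
     b * bil (@rshift n n) (@rshift n n) (row_mx x t)).

(** Each factor <x, t> = sum_i x_i t_i is distributed over the two tensor factors, which stay in
    S_{1/2}. *)
Lemma finite_rank_monomial k : finite_rank (fun x t => ((BB x t) ^+ k)%:C * (expR (QQ x t))%:C).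
Proof.
elim: k => [|k IH].
  have be0 : 0 < b + e by rewrite addr_gt0.
  exists [:: (gs_of_cls (lexx half) (cls_gauss (lexx half) n be0),
              gs_of_cls (lexx half) (cls_gauss (lexx half) n b0))] => x t.
  rewrite big_seq1 /= expr0 mul1r -rmorphM -expRD; congr (expR _)%:C.
  rewrite /QQ opprD; congr (- (_ * _) + - (_ * _)); apply: eq_bigr => i _.
    by rewrite !row_mxEl expr2.
  by rewrite !row_mxEr expr2.
have H := finite_rank_sum (index_enum 'I_n) (fun i => finite_rank_coord i IH).
have [r rE] := H; exists r => x t; rewrite -rE -mulr_suml mulrA exprS rmorphM.
congr (_ * _ * _); rewrite /BB /bil raddf_sum; apply: eq_bigr => i _.
by rewrite row_mxEl row_mxEr; exact: (rmorphM (real_complex R)).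
Qed.

(** The Taylor terms below order N have finite rank; the rest is rho^N times the normalised
    remainder. *)
Lemma taylor_split (rho : R) N : 0 < rho -> exists2 k : 'rV[R]_n -> 'rV[R]_n -> C, finite_rank k &
  forall x t, taylor_kernel b e 1 0 (row_mx x t) =
    (rho ^+ N)%:C * taylor_kernel b e rho N (row_mx x t) + k x t.
Proof.
move=> r0; exists (fun x t => \sum_(k < N) ((2 * b) ^+ k / k`!%:R)%:C * (((BB x t) ^+ k)%:C * (expR (QQ x t))%:C)).
  exact: (finite_rank_sum _ (fun k : 'I_N => finite_rank_scale _ (finite_rank_monomial k))).
move=> x t; rewrite /taylor_kernel.
have rE (X : R) : (rho ^+ N)%:C * (rho ^- N * X)%:C = X%:C.
  by rewrite -rmorphM mulrA mulfV ?expf_neq0 ?gt_eqF // mul1r.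
rewrite rE.
have -> : \sum_(k < N) ((2 * b) ^+ k / k`!%:R)%:C * (((BB x t) ^+ k)%:C * (expR (QQ x t))%:C) =
   (\sum_(k < N) (2 * b) ^+ k / k`!%:R * ((BB x t) ^+ k * expR (QQ x t)))%:C.
  rewrite (raddf_sum (real_complex R)); apply: eq_bigr => k _ /=.
  by rewrite -!(rmorphM (real_complex R)).
rewrite -rmorphD; congr (_%:C); rewrite expr0 invr1 mul1r /texp big_ord0 subr0.
rewrite -/(QQ x t) -/(BB x t).
rewrite [X in _ = _ + X](_ : _ = expR (QQ x t) * \sum_(k < N) (2 * b * BB x t) ^+ k / k`!%:R).
  by rewrite mulrBr subrK.
rewrite mulr_sumr; apply: eq_bigr => k _; rewrite [(2 * b * BB x t) ^+ _]exprMn.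
have r (u v w z : R) : v * z * (w * u) = u * (v * w * z) by clear; ring.
exact: r.
Qed.

End Taylor.

Lemma pow_small (rho eps : R) : 0 < rho < 1 -> 0 < eps -> exists N, rho ^+ N <= eps.
Proof.
move=> /andP[r0 r1] e0.
have /cvgrPdist_le/(_ _ e0)[N _ HN] : (fun k => rho ^+ k) @ \oo --> (0 : R).
  by apply: cvg_expr; rewrite ger0_norm // ltW.
exists N; have := HN N (leqnn N); rewrite /= sub0r normrN.
by apply: le_trans; exact: ler_norm.
Qed.

Context {s : R}.
Hypothesis hs : half <= s.
Local Notation cls := (@cls R s).
Local Notation nb := (@nb R s _).

Definition rank_op n (r : seq (gs n half * gs n half)) (g : gs n s) : gs n s :=
  \sum_(pq <- r) (cint (fun t => pq.2 t * (g t : C)) : C) *: gs_incl hs pq.1.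

Lemma rank_opE n r (g : gs n s) x :
  rank_op r g x = \sum_(pq <- r) (pq.1 x : C) * cint (fun t => pq.2 t * (g t : C)).
Proof.
rewrite /rank_op; elim: r => [|pq r IH]; first by rewrite !big_nil.
by rewrite !big_cons -IH [in RHS]mulrC.
Qed.

Lemma nb_gsM n (f g : gs n s) : nb (full n) (fun t => (f t : C) * g t).
Proof.
have := nb_of_cls tt (clsM hs (cls_gs hs f) (cls_gs hs g)).
by rewrite finset.setUid.
Qed.

Lemma rank_op_cint n (r : seq (gs n half * gs n half)) (k : 'rV[R]_n -> 'rV[R]_n -> C) (g : gs n s) x :
  (forall x t, k x t = \sum_(pq <- r) (pq.1 x : C) * pq.2 t) ->
  rank_op r g x = cint (fun t => k x t * g t) /\ nb (full n) (fun t => k x t * (g t : C)).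
Proof.
move=> kE; have -> : (fun t => k x t * (g t : C)) =
    fun t => \sum_(pq <- r) (pq.1 x : C) * ((gs_incl hs pq.2 t : C) * g t).
  by apply/funext => t; rewrite kE mulr_suml; apply: eq_bigr => pq _; rewrite mulrA.
rewrite rank_opE; elim: r {kE} => [|pq r [IH1 IH2]].
  split.
    rewrite big_nil (_ : (fun t => _) = fun t => 0 * ((g t : C) * g t)).
      by rewrite (cintZ hs 0 (nb_gsM g g)) mul0r.
    by apply/funext => t; rewrite big_nil mul0r.
  have := nbZ 0 (nb_gsM g g); congr (nb _ _); apply/funext => t.
  by rewrite big_nil mul0r.
have n1 := nbZ (pq.1 x) (nb_gsM (gs_incl hs pq.2) g).
rewrite (_ : (fun t => \sum_(i <- _ :: _) _) = fun t => (pq.1 x : C) * ((gs_incl hs pq.2 t : C) * g t) +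
  \sum_(pq <- r) (pq.1 x : C) * ((gs_incl hs pq.2 t : C) * g t)); last first.
  by apply/funext => t; rewrite big_cons.
split; last exact: nbD n1 IH2.
by rewrite (cintD hs n1 IH2) big_cons IH1 (cintZ hs _ (nb_gsM (gs_incl hs pq.2) g)).
Qed.

(** Two errors are made: that of the regularisation, small with eta, and that of truncating the
    Taylor series, small with rho^N. The second comes after eta is fixed, since rho and the bounds
    depend on eta. Each error is placed in half of D. *)
Lemma rank_op_approx n (D : set (gs n s)) (h M : R) : gs_base D -> 0 < h ->
  exists r : seq (gs n half * gs n half),
    forall g : gs n s, (gs_norm s h g <= M%:E)%E -> D (g - rank_op r g).
Proof.
move=> bD h0; have bD1 := gs_base_double bD.
have [eps1 eps10 H1] := cls_gs_base hs (cls_moll_error hs n M h0) bD1.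
pose eta := Num.min 1 eps1.
have eta0 : 0 < eta by rewrite lt_min ltr01.
have eta1 : eta <= 1 by rewrite ge_min lexx.
have b0 : 0 < eta ^- 2 by rewrite invr_gt0 exprn_gt0.
have e0 : 0 < eta ^+ 2 by rewrite exprn_gt0.
(* The condition e <= 4 b of the kernel estimate holds because eta <= 1. *)
have eb : eta ^+ 2 <= 4 * eta ^- 2.
  have h1 : eta ^+ 2 <= 1 by rewrite exprn_ile1 // ltW.
  have h2 : 1 <= eta ^- 2 by rewrite invf_ge1.
  by lra.
have [rho rho01 ctk] := cls_taylor_kernel hs n b0 e0 eb.
have [rho0 rho1] := andP rho01.
pose BT := @gs_ball R s n h M.
(* The index is a pair (g, N), so the remainder operators are bounded uniformly in both. *)
pose F3 (gN : BT * nat) (z : 'rV[R]_(n + n)) : C :=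
  taylor_kernel (eta ^- 2) (eta ^+ 2) rho gN.2 z * (val gN.1 : 'rV[R]_n -> C) (z *m PR n n).
have cF3 : cls (full (n + n)) F3.
  have c1 := cls_sub (fun gN : BT * nat => gN.2) ctk.
  have c2 := cls_sub (fun gN : BT * nat => gN.1) (cls_gs_ball hs n M h0).
  have c3 : cls (rset n n) (fun (gN : BT * nat) z => (val gN.1 : 'rV[R]_n -> C) (z *m PR n n)).
    apply: (cls_lin1 hs) c2 => _ /imsetP[i _ ->]; exists i; [exact: in_full|move=> x].
    by rewrite mul_PR mxE.
  by have := clsM hs c1 c3; apply: cls_mono; exact: finset.subsetUl.
have cE3 := cls_cint hs cF3.
have [eps2 eps20 H2] := cls_gs_base hs cE3 bD1.
pose c0 : C := ((Num.sqrt pi : R)%:C ^+ n)^-1.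
pose kap : C := (eta^-1)%:C ^+ n * c0.
have [N HN] := pow_small rho01 (divr_gt0 eps20 (ltr_wpDl (cabs_ge0 kap) ltr01)).
have [k fk kE] := @taylor_split n (eta ^- 2) (eta ^+ 2) b0 e0 rho N rho0.
have [r rE] := finite_rank_scale kap fk; exists r => g gM.
pose gb : BT := exist _ g gM.
have cE : cls (full n) (fun _ : unit => fun x => cint (fun y => F3 (gb, N) (row_mx x y))) :=
  cls_sub (fun _ : unit => (gb, N)) cE3.
pose c2 : C := kap * (rho ^+ N)%:C.
(* [f2] is the contribution of the Taylor remainder; what is left, [f1], is the regularisation error
   g - moll eta g. *)
pose f2 : gs n s := c2 *: gs_of_cls hs cE.
pose f1 : gs n s := g - rank_op r g - f2.
have D2 : D (2 *: f2).
  apply: (H2 c2 _ (gb, N) f2) => //; rewrite /c2 cabsM cabsR ger0_norm ?exprn_ge0 ?(ltW rho0) //.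
  apply: (le_trans (ler_wpM2l (cabs_ge0 _) HN)).
  rewrite mulrCA -[leRHS]mulr1 ler_wpM2l ?(ltW eps20) //.
  by rewrite ler_pdivrMr ?mul1r ?lerDl // ltr_wpDl ?cabs_ge0.
have He : 0 < eta <= 1 by rewrite eta0 eta1.
have D1 : D (2 *: f1).
  apply: (H1 (- eta%:C) _ (gb, exist _ eta He) f1).
    by rewrite cabsN cabsR gtr0_norm // ge_min lexx orbT.
  move=> x; have -> : f1 x = g x - rank_op r g x - c2 * cint (fun y => F3 (gb, N) (row_mx x y)) by [].
  have [-> nk] := rank_op_cint g x rE.
  have nF : nb (full n) (fun y => F3 (gb, N) (row_mx x y)).
    by apply: nb_right (nb_of_cls (gb, N) cF3) => i; exact: in_full.
  have mE : moll eta g x = cint (fun t => kap * k x t * g t) + c2 * cint (fun y => F3 (gb, N) (row_mx x y)).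
    have [-> nTK] := moll_kernel hs x eta0 (nb_of_cls tt (cls_gs hs g)).
    rewrite -/c0 -/kap -(cintZ hs _ nF).
    rewrite -(cintD hs nk (nbZ c2 nF)) -(cintZ hs _ nTK).
    apply: eq_cint => t; rewrite kE /F3 /= mul_PR row_mxKr /c2.
    have q (u v w z y : C) : u * ((v * w + z) * y) = u * z * y + u * v * (w * y) by clear; ring.
    by rewrite q.
  rewrite -addrA -opprD -mE.
  have q (u v : C) : u - v = - eta%:C * ((eta^-1)%:C * (v + -1 * u)).
    have h1 : eta%:C * (eta^-1)%:C = 1 :> C.
      by rewrite -(rmorphM (real_complex R)) mulfV ?gt_eqF //= rmorph1.
    have q (y z : C) : - y * (z * (v + -1 * u)) = y * z * (u - v) by clear; ring.
    by rewrite q h1 mul1r.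
  exact: q.
have -> : g - rank_op r g = 2^-1 *: (2 *: f1) + 2^-1 *: (2 *: f2).
  have q (u v : gs n s) : u = 2^-1 *: (2 *: (u - v)) + 2^-1 *: (2 *: v).
    by rewrite !scalerA mulVf ?pnatr_eq0 // !scale1r subrK.
  exact: q.
apply: bD.1 D1 D2.
by rewrite ger0_norm ?invr_ge0 // [leRHS](splitr 1) !mul1r.
Qed.

End Density.

(** * Topology of S_s and its strong dual *)

Section Topology.
Context {R : realType}.
Local Notation C := R[i].

Lemma complex_gt0 (e : C) : 0 < e -> 0 < complex.Re e /\ e = (complex.Re e)%:C.
Proof. by case: e => a b; rewrite ltcE /= => /andP[/eqP -> ->]. Qed.

Lemma nbhs_cabs (z : R[i]^o) (V : set R[i]^o) :
  nbhs z V <-> exists2 e : R, 0 < e & forall w, cabs (z - w) < e -> V w.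
Proof.
split=> [/nbhs_ballP[e e0 He]|[e e0 He]].
  have [e1 eE] := complex_gt0 e0; exists (complex.Re e) => // w zw; apply: He.
  by rewrite -ball_normE /= eE -cabsE ltcR.
apply/nbhs_ballP; exists e%:C; first by rewrite /= ltcR.
by move=> w; rewrite -ball_normE /= -cabsE ltcR; exact: He.
Qed.

Context {n : nat} {s : R}.
Local Notation gs := (gs n s).

Lemma gs_base_opp (D : set gs) f : gs_base D -> D f -> D (- f).
Proof.
move=> [dD _] Df; have := dD (-1) 0 f f; rewrite scaleN1r scale0r addr0; apply => //.
by rewrite normrN1 normr0 addr0.
Qed.

Lemma gs_base_add (D : set gs) f g : gs_base D -> D (2 *: f) -> D (2 *: g) -> D (f + g).
Proof.
move=> [dD _] Df Dg.
have q (v : gs) : v = 2^-1 *: (2 *: v) by rewrite scalerA mulVf ?pnatr_eq0 // scale1r.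
rewrite (q f) (q g); apply: dD => //.
by rewrite ger0_norm ?invr_ge0 // [leRHS](splitr 1) !mul1r.
Qed.

Lemma gs_dual_lin (u : gs_dual n s) : linear (u : gs -> R[i]^o).
Proof. by have [] := asboolW (gs_dual_funP u). Qed.

Lemma lin_scale (u : gs -> R[i]^o) : linear u -> forall (k : C) f, u (k *: f) = k * u f.
Proof.
move=> lu k f; have := lu k f 0.
have u0 : u 0 = 0 by have := lu 1 0 0; rewrite scaler0 addr0 scale1r => /eqP; rewrite -subr_eq0 opprD addrA subrr sub0r oppr_eq0 => /eqP.
by rewrite addr0 u0 addr0.
Qed.

Lemma lin_sub (u : gs -> R[i]^o) : linear u -> forall f g, u (f - g) = u f - u g.
Proof.
move=> lu f g; have -> : f - g = -1 *: g + f by rewrite scaleN1r addrC.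
by rewrite lu scaleN1r addrC.
Qed.

Lemma functional_base (u : gs -> R[i]^o) (r : R) : linear u ->
  (forall h, 0 < h -> exists2 M : R, 0 <= M & forall f : gs, (gs_norm s h f <= 1%:E)%E -> cabs (u f) <= M) ->
  0 < r -> gs_base [set f | cabs (u f) <= r].
Proof.
move=> lu Hu r0; split=> [k l f g kl /= uf ug|h h0].
  rewrite /= (lu k f) (lin_scale lu l g) (le_trans (cabsD _ _)) //.
  rewrite [cabs (k *: _)]cabsM cabsM (@le_trans _ _ (cabs k * r + cabs l * r)) //.
    by rewrite lerD // ler_wpM2l ?cabs_ge0.
  rewrite -mulrDl -[leRHS]mul1r ler_wpM2r ?(ltW r0) //.
  by move: kl; rewrite -!cabsE -rmorphD -[1]/(1%:C) lecR.
have [M M0 HM] := Hu h h0; pose k := r / (M + 1).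
have M1 : 0 < M + 1 by rewrite ltr_wpDl.
have k0 : 0 < k by rewrite divr_gt0.
exists k => // f fk /=.
have := gs_norm_scale (k^-1)%:C h0 fk; rewrite cabsR gtr0_norm ?invr_gt0 // mulVf ?gt_eqF //.
move/HM; rewrite (lin_scale lu) cabsM cabsR gtr0_norm ?invr_gt0 // ler_pdivrMl // => /le_trans; apply.
by rewrite /k mulrAC ler_pdivrMr // ler_wpM2l ?(ltW r0) // lerDl.
Qed.

Lemma functional_continuous (u : gs -> R[i]^o) : linear u ->
  (forall r : R, 0 < r -> gs_base [set f | cabs (u f) <= r]) -> continuous u.
Proof.
move=> lu bu f V /nbhs_cabs[e e0 He]; apply/gs_nbhsP.
exists [set f | cabs (u f) <= e / 2]; first by apply: bu; rewrite divr_gt0.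
move=> g /= H; apply: He; rewrite -cabsN opprB -lin_sub //.
by apply: le_lt_trans H _; rewrite ltr_pdivrMr // ltr_pMr // ltr1n.
Qed.

Lemma gs_dual_base (u : gs_dual n s) (r : R) : 0 < r -> gs_base [set f | cabs (u f) <= r].
Proof.
move=> r0; have lu := gs_dual_lin u; have [_ cu] := asboolW (gs_dual_funP u).
have u0 : u 0 = 0 by have := lin_scale lu 0 0; rewrite scale0r mul0r.
split=> [k l f g kl /= uf ug|h h0].
  rewrite /= (lu k f) (lin_scale lu l g) (le_trans (cabsD _ _)) //.
  rewrite [cabs (k *: _)]cabsM cabsM (@le_trans _ _ (cabs k * r + cabs l * r)) //.
    by rewrite lerD // ler_wpM2l ?cabs_ge0.
  rewrite -mulrDl -[leRHS]mul1r ler_wpM2r ?(ltW r0) //.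
  by move: kl; rewrite -!cabsE -rmorphD -[1]/(1%:C) lecR.
have /gs_nbhsP[D bD HD] : nbhs (0 : gs) [set f | cabs (u f) < r].
  have nV : nbhs (u 0 : R[i]^o) [set w : R[i]^o | cabs w < r].
    by apply/nbhs_cabs; exists r => // w; rewrite u0 sub0r cabsN.
  exact: (cu 0 _ nV).
have [k k0 Hk] := bD.2 h h0; exists k => // f /Hk Df /=.
by apply/ltW; apply: HD; rewrite subr0.
Qed.

Lemma gs_norm_eval (h M : R) (f : 'rV[R]_n -> C) x : 0 < h -> (gs_norm s h f <= M%:E)%E -> cabs (f x) <= M.
Proof.
move=> h0 /(gs_norm_leP _ _ _ h0)/(_ (fun=> 0%N) (fun=> 0%N) x).
have e1 : msize (fun _ : 'I_n => 0%N) = 0%N by rewrite /msize big1.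
have e2 : mfact (fun _ : 'I_n => 0%N) = 1%N by rewrite /mfact big1.
have e3 : mpow x (fun=> 0%N) = 1 by rewrite /mpow big1 // => i _; rewrite expr0.
rewrite e1 e2 e3 expr0 mul1r powR1 mulr1 mul1r.
have -> : mderiv (fun=> 0%N) f = f.
  rewrite /mderiv (_ : mseq _ = [::]) //; apply/size0nil.
  by rewrite size_mseq /msize big1.
by [].
Qed.

(** Evaluations at points are bounded on every S_{s,h} and separate functions. *)
Lemma gs_hausdorff (w : gs) : (forall D, gs_base D -> D w) -> w = 0.
Proof.
move=> H; apply/val_inj/funext => x.
have le0 (r : R) : 0 < r -> cabs (w x) <= r.
  move=> r0; have bD : gs_base [set f : gs | cabs (f x) <= r].
    have lx : linear ((fun f : gs => f x) : gs -> R[i]^o) by [].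
    apply: (functional_base lx _ r0) => h h0.
    by exists 1 => // f; exact: gs_norm_eval.
  exact: (H _ bD).
apply: ComplexField.Normc.eq0_normc; apply/eqP; rewrite eq_le cabs_ge0 andbT.
by apply/ler_addgt0Pr => r r0; rewrite add0r; exact: le0.
Qed.

Lemma mul_swap_div (a f q : R) : q != 0 -> a * f = q * f * (a / q).
Proof. by move=> q0; field. Qed.

(* If B is in no ball, functionals L_k f = x^be d^al f(x) / (k^|al+be| (al! be!)^s) with
   |L_k f_k| > k, f_k in B, define a neighbourhood of 0 that does not absorb B. *)
Lemma vn_bounded_ball (B : set gs) : @vn_bounded R (gs : preTopologicalLmodType R[i]) B ->
  exists h M : R, 0 < h /\ forall f : gs, B f -> (gs_norm s h f <= M%:E)%E.
Proof.
move=> bB; apply: contrapT => nH.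
have H k : exists z : gs * (('I_n -> nat) * ('I_n -> nat) * 'rV[R]_n), B z.1 /\
    k.+1%:R * (k.+1%:R ^+ (msize z.2.1.1 + msize z.2.1.2) * (mfact z.2.1.1 * mfact z.2.1.2)%:R `^ s)
    < cabs ((mpow z.2.2 z.2.1.2)%:C * mderiv z.2.1.1 z.1 z.2.2) :> R.
  apply: contrapT => nz; apply: nH; exists k.+1%:R, k.+1%:R; split=> // f Bf.
  apply/gs_norm_leP => // al be x; rewrite leNgt; apply/negP => lt.
  by apply: nz; exists (f, (al, be, x)).
have /choice[z Hz] := H.
pose L k (f : gs) : C := ((k.+1%:R ^+ (msize (z k).2.1.1 + msize (z k).2.1.2) *
    (mfact (z k).2.1.1 * mfact (z k).2.1.2)%:R `^ s)^-1 : R)%:C *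
  ((mpow (z k).2.2 (z k).2.1.2)%:C * mderiv (z k).2.1.1 f (z k).2.2).
have den0 k := @gs_den_gt0 R n s k.+1%:R (z k).2.1.1 (z k).2.1.2 (ltr0Sn _ _).
have Ll k : linear (L k : gs -> R[i]^o).
  move=> c f g; rewrite /L /mderiv.
  have [sf _] := asboolW (gs_funP f); have [sg _] := asboolW (gs_funP g).
  have -> : gs_fun (c *: f + g) = (fun x => c * f x + g x) by [].
  rewrite (partials_lin _ c sf sg); rewrite /GRing.scale /=.
  by move: (_%:C) (_%:C) (partials _ _ _) (partials _ _ _) => u v p q; clear; ring.
have LB k (h : R) (f : gs) : 0 < h -> (gs_norm s h f <= 1%:E)%E ->
    cabs (L k f) <= (h / k.+1%:R) ^+ (msize (z k).2.1.1 + msize (z k).2.1.2).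
  move=> h0 /(gs_norm_leP _ _ _ h0)/(_ (z k).2.1.1 (z k).2.1.2 (z k).2.2) H1.
  rewrite /L cabsM cabsR gtr0_norm ?invr_gt0 // ler_pdivrMl //; apply: (le_trans H1).
  by rewrite mul1r expr_div_n -mul_swap_div // expf_neq0 // pnatr_eq0.
pose D : set gs := [set f | forall k, cabs (L k f) <= 1].
have bD : gs_base D.
  split=> [c l f g cl Df Dg k|h h0].
    have bk : gs_base [set f | cabs (L k f) <= 1].
      apply: (functional_base (Ll k) _ ltr01) => h h0.
      exists ((h / k.+1%:R) ^+ (msize (z k).2.1.1 + msize (z k).2.1.2)).
        by rewrite exprn_ge0 // divr_ge0 // ltW.
      by move=> f'; exact: LB.
    exact: (bk.1 c l f g cl (Df k) (Dg k)).
  (* On the unit ball of S_{s,h} the powers of h / (k+1) are at most 1 for k >= N, so only finitely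
     many L_k need the larger constant [Mx]. *)
  pose N := (Num.truncn h).+1.
  pose Mx : R := 1 + \sum_(k < N) (h / k.+1%:R) ^+ (msize (z k).2.1.1 + msize (z k).2.1.2).
  have t0 k : 0 <= (h / k.+1%:R) ^+ (msize (z k).2.1.1 + msize (z k).2.1.2).
    by rewrite exprn_ge0 // divr_ge0 // ltW.
  have Mx1 : 1 <= Mx by rewrite lerDl sumr_ge0.
  have Mx0 : 0 < Mx by apply: lt_le_trans Mx1.
  have HM k (f : gs) : (gs_norm s h f <= 1%:E)%E -> cabs (L k f) <= Mx.
    move=> /(LB k h f h0) Lk; apply: (le_trans Lk); have [kN|Nk] := ltnP k N.
      by rewrite /Mx (bigD1 (Ordinal kN)) //= addrCA lerDl addr_ge0 // sumr_ge0.
    apply: le_trans Mx1; rewrite exprn_ile1 ?divr_ge0 ?(ltW h0) // ler_pdivrMr // mul1r.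
    apply: (le_trans (ltW (truncnS_gt h))); rewrite ler_nat; exact: leq_trans Nk _.
  exists Mx^-1; first by rewrite invr_gt0.
  move=> f fM k; have := gs_norm_scale Mx%:C h0 fM.
  rewrite cabsR gtr0_norm // mulfV ?gt_eqF // => /(HM k).
  by rewrite (lin_scale (Ll k)) cabsM cabsR gtr0_norm // -[leRHS]mulr1 ler_pM2l.
have n0 : nbhs (0 : gs) D by apply/gs_nbhsP; exists D => // g; rewrite subr0.
have /nbhs_cabs[e e0 He] := bB D n0.
(* This k satisfies (e/2)(k+1) > 1 while |L_k f_k| > k + 1, so the multiple of f_k by e/2 leaves D
   although e/2 is within the absorbing radius. *)
pose k := (Num.truncn (2 / e)).+1; pose c : R := e / 2.
have c0 : 0 < c by rewrite divr_gt0.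
have Dz : D (c%:C *: (z k).1).
  apply: He; last exact: (Hz k).1.
  by rewrite sub0r cabsN cabsR gtr0_norm // ltr_pdivrMr // ltr_pMr // ltr1n.
have := Dz k; rewrite (lin_scale (Ll k)) cabsM cabsR gtr0_norm //; apply/negP; rewrite -ltNge.
have Lz : k.+1%:R < cabs (L k (z k).1).
  rewrite /L cabsM cabsR gtr0_norm ?invr_gt0 // ltr_pdivlMl //.
  by rewrite mulrC; exact: (Hz k).2.
have ck : 1 < c * k.+1%:R.
  have := truncnS_gt (2 / e); rewrite -/k ltr_pdivrMr // => h1.
  have h2 : k%:R * e <= k.+1%:R * e :> R by rewrite ler_wpM2r ?(ltW e0) // ler_nat.
  by rewrite /c mulrAC ltr_pdivlMr // mul1r [e * _]mulrC (lt_le_trans h1).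
by apply: (lt_trans ck); rewrite ltr_pM2l.
Qed.

End Topology.

(** * Continuity from boundedness, density, and convergence in the strong dual *)

Section Duality.
Context {R : realType}.
Local Notation C := R[i].
Local Notation half := (2^-1 : R).

Section Maps.
Context {n m : nat} {s : R}.
Variable T : {linear gs n s -> gs m s}.
Hypothesis bT : forall h : R, 0 < h -> exists2 h' : R, 0 < h' & exists M : R,
  forall f : gs n s, (gs_norm s h f <= 1%:E)%E -> (gs_norm s h' (T f) <= M%:E)%E.

Lemma preimage_gs_base (D : set (gs m s)) : gs_base D -> gs_base [set f | D (T f)].
Proof.
move=> [dD bD]; split=> [k l f g kl Df Dg|h h0].
  by rewrite /= linearP linearZ; exact: dD.
have [h' h'0 [M HM]] := bT h0; have [r r0 Hr] := bD h' h'0.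
have M1 : 0 < `|M| + 1 by rewrite ltr_wpDl.
pose k := r / (`|M| + 1); have k0 : 0 < k by rewrite divr_gt0.
exists k => // f fk; apply: Hr.
have := gs_norm_scale (k^-1)%:C h0 fk; rewrite cabsR gtr0_norm ?invr_gt0 // mulVf ?gt_eqF //.
move=> /HM /(gs_norm_scale k%:C h'0); rewrite cabsR (gtr0_norm k0) linearZ /= scalerA.
rewrite -(rmorphM (real_complex R)) mulfV ?gt_eqF // rmorph1 scale1r => /le_trans; apply.
rewrite lee_fin /k mulrAC ler_pdivrMr // ler_wpM2l ?(ltW r0) //.
by rewrite (le_trans (ler_norm M)) // lerDl.
Qed.

Lemma bounded_continuous : continuous T.
Proof.
move=> f V /gs_nbhsP[D bD HD]; apply/gs_nbhsP.
exists [set g | D (T g)]; first exact: preimage_gs_base.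
by move=> g /=; rewrite linearB => /HD.
Qed.

End Maps.

Section Functionals.
Context {n : nat} {s : R}.
Hypothesis hs : half <= s.

(** Scalars are bounded through a family of functions: a Gaussian in one auxiliary variable is
    adjoined, [cls_cint] integrates t out, and the result is evaluated at 0, where the Gaussian
    equals 1. *)
Lemma cint_bounded (q : gs n s) (h : R) : 0 < h -> exists2 M : R, 0 <= M &
  forall f : gs n s, (gs_norm s h f <= 1%:E)%E -> cabs (cint (fun t => (q t : C) * f t)) <= M.
Proof.
move=> h0; pose BT := @gs_ball R s n h 1.
have c1 : cls s (full 1) (fun _ : BT => @gam R 1) := cls_sub (fun _ : BT => tt) (cls_gam hs 1).
have c2 : cls s (full n) (fun (t : BT) x => (q x : C) * (val t : 'rV[R]_n -> C) x).
  have := clsM hs (cls_sub (fun _ : BT => tt) (cls_gs hs q)) (cls_gs_ball hs n 1 h0).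
  by rewrite finset.setUid.
have [h' h'0 [M HM]] := gs_of_cls_full hs (cls_cint hs (cls_tensor hs c1 c2)).
exists `|M| => // f f1; have := gs_norm_eval 0 h'0 (HM (exist _ f f1)).
have -> : cint (fun y => gam (lsubmx (row_mx (0 : 'rV[R]_1) y)) *
    ((q (rsubmx (row_mx (0 : 'rV[R]_1) y)) : C) * f (rsubmx (row_mx (0 : 'rV[R]_1) y)))) =
    cint (fun t => (q t : C) * f t).
  by apply: eq_cint => y; rewrite row_mxKl row_mxKr gam0 mul1r.
by move/le_trans; apply; exact: ler_norm.
Qed.

Lemma of_fun_lin (q : gs n s) : linear ((fun f : gs n s => of_fun q f) : gs n s -> R[i]^o).
Proof.
move=> k f g; rewrite /of_fun.
rewrite -[RHS]/(k * cint _ + cint _) -(cintZ hs k (nb_gsM hs q f)) -(cintD hs (nbZ k (nb_gsM hs q f)) (nb_gsM hs q g)).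
by apply: eq_cint => x; rewrite -[(k *: f + g) x]/(k * f x + g x) mulrDr mulrCA.
Qed.

Lemma of_fun_dual_proof (q : gs n half) :
  ((fun f : gs n s => of_fun q f) : gs n s -> R[i]^o) \in @gs_dual_pred R n s.
Proof.
apply/asboolP; have lq := of_fun_lin (gs_incl hs q); split=> //.
apply: (functional_continuous lq) => r r0; apply: (functional_base lq _ r0) => h h0.
exact: cint_bounded.
Qed.

Definition of_fun_dual (q : gs n half) : gs_dual n s := GSDual (of_fun_dual_proof q).

Lemma of_fun_sym (f g : 'rV[R]_n -> C) : of_fun f g = of_fun g f.
Proof. by apply: eq_cint => x; rewrite mulrC. Qed.

(** If f - g pairs to 0 with S_{1/2}, every [rank_op] annihilates it, so the approximation puts f -
    g itself in every neighbourhood of 0. *)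
Lemma of_fun_separates (f g : gs n s) :
  (forall q : gs n half, of_fun f q = of_fun g q) -> f = g.
Proof.
move=> H; apply/eqP; rewrite -subr_eq0; apply/eqP/gs_hausdorff => D bD.
set w := f - g; have w0 (q : gs n half) : cint (fun t => (q t : C) * w t) = 0.
  have := lin_sub (of_fun_lin (gs_incl hs q)) f g; rewrite /of_fun => ->.
  by apply/eqP; rewrite subr_eq0; apply/eqP; have := H q; rewrite of_fun_sym [RHS]of_fun_sym.
have [sw [h h0 /gs_norm_ltyP[M HM]]] := asboolW (gs_funP w).
have [r Hr] := rank_op_approx hs M bD h0.
have := Hr w HM; rewrite /rank_op big1 ?subr0 // => pq _.
by rewrite w0 scale0r.
Qed.

Lemma gs_sumE k (s' : R) (I : Type) (r : seq I) (c : I -> C) (g : I -> gs k s') x :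
  (\sum_(i <- r) c i *: g i : gs k s') x = \sum_(i <- r) c i * (g i x : C).
Proof.
by elim: r => [|i r IH]; [rewrite !big_nil|rewrite !big_cons -IH].
Qed.

Lemma rank_op_incl r (f : gs n s) : exists q : gs n half, rank_op hs r f = gs_incl hs q.
Proof.
pose c (pq : gs n half * gs n half) : C := cint (fun t => pq.2 t * (f t : C)).
exists (\sum_(pq <- r) c pq *: pq.1); apply/val_inj/funext => x.
transitivity (\sum_(pq <- r) (pq.1 x : C) * c pq); first exact: rank_opE.
transitivity (\sum_(pq <- r) c pq * (pq.1 x : C)).
  by apply: eq_bigr => pq _; exact: mulrC.
by symmetry; exact: (gs_sumE r c (fun pq => pq.1) x).
Qed.

Lemma gs_incl_dense (f : gs n s) (V : set (gs n s)) : nbhs f V -> exists q : gs n half, V (gs_incl hs q).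
Proof.
move=> /gs_nbhsP[D bD HD].
have [sf [h h0 /gs_norm_ltyP[M HM]]] := asboolW (gs_funP f).
have [r Hr] := rank_op_approx hs M bD h0; have [q qE] := rank_op_incl r f.
exists q; apply: HD; rewrite -qE -opprB; apply: gs_base_opp => //; exact: Hr.
Qed.

Lemma eq_on_dense (T T' : gs n s -> gs n s) : continuous T -> continuous T' ->
  (forall q : gs n half, T' (gs_incl hs q) = T (gs_incl hs q)) -> T' =1 T.
Proof.
move=> cT cT' TT f; apply/eqP; rewrite -subr_eq0; apply/eqP/gs_hausdorff => D bD.
have bD1 := gs_base_double bD.
have n1 : nbhs (T f) [set g | D (2 *: (g - T f))] by apply/gs_nbhsP; exists [set g | D (2 *: g)].
have n2 : nbhs (T' f) [set g | D (2 *: (g - T' f))] by apply/gs_nbhsP; exists [set g | D (2 *: g)].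
have m1 : nbhs f [set g | D (2 *: (T g - T f))] := cT f _ n1.
have m2 : nbhs f [set g | D (2 *: (T' g - T' f))] := cT' f _ n2.
have [q [q1 q2]] := gs_incl_dense (filterI m1 m2).
have -> : T' f - T f = - (T' (gs_incl hs q) - T' f) + (T (gs_incl hs q) - T f).
  by rewrite TT opprB addrA subrK.
apply: gs_base_add bD _ q1; exact: (gs_base_opp bD1 q2).
Qed.

Lemma dual_eq (u v : gs_dual n s) :
  (forall q : gs n half, u (gs_incl hs q) = v (gs_incl hs q)) -> u = v.
Proof.
move=> H; apply/val_inj/funext => f /=; apply/eqP; rewrite -subr_eq0; apply/eqP.
apply: ComplexField.Normc.eq0_normc; apply/eqP; rewrite eq_le cabs_ge0 andbT.
apply/ler_addgt0Pr => r r0; rewrite add0r.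
have r20 : 0 < r / 2 by rewrite divr_gt0.
have n1 : nbhs f [set g : gs n s | cabs (u (g - f)) <= r / 2].
  by apply/gs_nbhsP; exists [set g | cabs (u g) <= r / 2] => //; exact: gs_dual_base.
have n2 : nbhs f [set g : gs n s | cabs (v (g - f)) <= r / 2].
  by apply/gs_nbhsP; exists [set g | cabs (v g) <= r / 2] => //; exact: gs_dual_base.
have [q [q1 q2]] := gs_incl_dense (filterI n1 n2).
move: q1 q2; rewrite /= !lin_sub; [|exact: gs_dual_lin|exact: gs_dual_lin]; rewrite H => q1 q2.
have -> : u f - v f = (v (gs_incl hs q) - v f) - (v (gs_incl hs q) - u f).
  have q' (x y z : C) : x - y = (z - y) - (z - x) by clear; ring.
  exact: q'.
apply: (le_trans (cabsD _ _)); rewrite cabsN (splitr r); exact: lerD.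
Qed.

Lemma ball_cabs (z w : R[i]^o) (e : C) : 0 < e -> cabs (z - w) < complex.Re e -> ball z e w.
Proof.
move=> e0 zw; have [_ eE] := complex_gt0 e0.
by rewrite -ball_normE /= eE -cabsE ltcR.
Qed.

(** Unfolds the initial topology and the uniform structures into the seminorms given by suprema over
    bounded sets. *)
Lemma gs_dual_cvgP (F : set_system (gs_dual n s)) (u : gs_dual n s) : Filter F ->
  F --> u <-> (forall B, @vn_bounded R (gs n s : preTopologicalLmodType R[i]) B -> forall e : R, 0 < e ->
    F [set v : gs_dual n s | forall f, B f -> cabs (u f - v f) < e]).
Proof.
move=> FF; pose fam := @vn_bounded R (gs n s : preTopologicalLmodType R[i]).
pose emb := @gs_dual_fun R n s : gs_dual n s -> {family fam, gs n s -> R[i]^o}.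
split=> [Fu B bB e e0|H].
  apply: Fu; have cu := @initial_continuous _ _ emb u.
  have nV : nbhs (emb u) [set v | forall f, B f -> cabs (u f - v f) < e].
    have := (@fam_cvgP (gs n s) R[i]^o fam (nbhs (emb u)) (emb u) (nbhs_filter (emb u))).1 cvg_id B bB.
    apply; apply/uniform_nbhs; exists [set xy : R[i]^o * R[i]^o | cabs (xy.1 - xy.2) < e]; split=> //.
    rewrite -entourage_ballE; exists e%:C; first by rewrite /= ltcR.
    by move=> [x y] /=; rewrite -ball_normE /= -cabsE ltcR.
  exact: (cu _ nV).
move=> V [_ [[B oB <-] Bu BV]].
apply: (filterS BV).
have nB : nbhs (emb u) B by apply: open_nbhs_nbhs.
have cF : (emb @ F) --> emb u.
  apply/fam_cvgP => A bA P /uniform_nbhs[E [/= entE EP]].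
  rewrite -entourage_ballE in entE; have [e e0 He] := entE.
  have [e1 eE] := complex_gt0 e0.
  apply: (@filterS _ F _ _ _ _ (H A bA _ e1)) => v Hv; apply: EP => f Af.
  have K : ball (u f : R[i]^o) e (v f : R[i]^o).
    exact: (ball_cabs e0 (Hv f Af)).
  exact: (He (u f, v f) K).
exact: cF _ nB.
Qed.

End Functionals.

End Duality.

(** * Transposition on the strong dual, and the conclusion *)

Section Main.
Context {R : realType}.
Local Notation C := R[i].
Local Notation half := (2^-1 : R).
Context {s : R}.
Hypothesis hs : half <= s.

Section Dual.
Variable n : nat.
Local Notation bounded := (@vn_bounded R (gs n s : preTopologicalLmodType R[i])).

Lemma lin_sum (u : gs n s -> R[i]^o) (I : Type) (r : seq I) (c : I -> C) (g : I -> gs n s) :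
  linear u -> u (\sum_(i <- r) c i *: g i) = \sum_(i <- r) c i * (u (g i) : C).
Proof.
move=> lu; elim: r => [|i r IH]; last by rewrite !big_cons lu IH.
by rewrite !big_nil; have := lin_scale lu 0 0; rewrite scale0r mul0r.
Qed.

Lemma gs_norm_mono (f : 'rV[R]_n -> C) (h h' M M' : R) : 0 < h -> h <= h' -> M <= M' -> 0 <= M' ->
  (gs_norm s h f <= M%:E)%E -> (gs_norm s h' f <= M'%:E)%E.
Proof.
move=> h0 hh MM M0 /(gs_norm_leP _ _ _ h0) H; have h'0 := lt_le_trans h0 hh.
apply/gs_norm_leP => // al be x; apply: (le_trans (H al be x)).
apply: (@le_trans _ _ (M' * (h ^+ (msize al + msize be) * (mfact al * mfact be)%:R `^ s))).
  by rewrite ler_wpM2r // ltW // gs_den_gt0.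
by rewrite ler_wpM2l // ler_wpM2r ?powR_ge0 // lerXn2r ?nnegrE ?(ltW h0) ?(ltW h'0).
Qed.

Lemma bounded1 (f : gs n s) : bounded [set f].
Proof.
move=> V /gs_nbhsP[D bD HD].
have [sf [h h0 /gs_norm_ltyP[M HM]]] := asboolW (gs_funP f).
have [r r0 Hr] := bD.2 h h0.
have M1 : 0 < `|M| + 1 by rewrite ltr_wpDl.
apply/nbhs_cabs; exists (r / (`|M| + 1)); first by rewrite divr_gt0.
move=> k; rewrite sub0r cabsN => kr _ ->; apply: HD; rewrite subr0; apply: Hr.
apply: (le_trans (gs_norm_scale k h0 HM)); rewrite lee_fin.
apply: (@le_trans _ _ (cabs k * (`|M| + 1))).
  by rewrite ler_wpM2l ?cabs_ge0 // (le_trans (ler_norm M)) // lerDl.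
by rewrite -ler_pdivlMr // ltW.
Qed.

Lemma bounded_image (T : {linear gs n s -> gs n s}) (B : set (gs n s)) :
  continuous T -> bounded B -> bounded (T @` B).
Proof.
move=> cT bB V nV; have nT : nbhs (0 : gs n s) (T @^-1` V).
  by apply: (cT 0); rewrite linear0.
have := bB _ nT; apply: filterS => k Hk _ [f Bf <-].
by rewrite -linearZ; exact: Hk.
Qed.

(** Transposed finite-rank operators send u into S_{1/2}. The k-th one is chosen so that u of the
    approximation error is at most 1/(k+1) on the ball with h = M = k+1; by [vn_bounded_ball] every
    bounded set lies in these balls eventually. *)
Lemma of_fun_dual_dense (u : gs_dual n s) : exists w : nat -> gs n half,
  (fun k => of_fun_dual hs (w k)) @ \oo --> u.
Proof.
have lu := gs_dual_lin u.
have H k : exists r : seq (gs n half * gs n half), forall g : gs n s,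
    (gs_norm s k.+1%:R g <= (k.+1%:R)%:E)%E -> cabs (u (g - rank_op hs r g)) <= k.+1%:R^-1.
  have b : gs_base [set f | cabs (u f) <= k.+1%:R^-1] by apply: gs_dual_base; rewrite invr_gt0.
  exact: (rank_op_approx hs k.+1%:R b (ltr0Sn _ _)).
have /choice[r Hr] := H.
pose w k : gs n half := \sum_(pq <- r k) (u (gs_incl hs pq.1) : C) *: pq.2.
exists w.
have wE k (f : gs n s) : of_fun (w k) f = u (rank_op hs (r k) f).
  have -> : u (rank_op hs (r k) f) = \sum_(pq <- r k)
     (cint (fun t => pq.2 t * (f t : C)) : C) * (u (gs_incl hs pq.1) : C).
    exact: (lin_sum (r k) (fun pq => cint (fun t => pq.2 t * (f t : C))) (fun pq => gs_incl hs pq.1) lu).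
  have -> : of_fun (w k) f = of_fun f (\sum_(pq <- r k) (u (gs_incl hs pq.1) : C) *: gs_incl hs pq.2 : gs n s).
    rewrite of_fun_sym; apply: eq_cint => x; congr (_ * _).
    by rewrite gs_sumE /w gs_sumE.
  rewrite (lin_sum _ _ _ (of_fun_lin hs f)); apply: eq_bigr => pq _.
  by rewrite mulrC; congr (_ * _); exact: of_fun_sym.
apply/gs_dual_cvgP => // B /vn_bounded_ball[h [M [h0 HM]]] e e0.
(* Beyond this N, each of h, |M| and 1/e is at most k + 1. *)
pose N := ((Num.truncn h).+1 + (Num.truncn `|M|).+1 + (Num.truncn e^-1).+1)%N.
exists N => // k /= Nk f Bf.
have leN (x : R) m : (m.+1 <= k.+1)%N -> Num.truncn x = m -> x <= k.+1%:R.
  move=> mk xm; apply: (le_trans (ltW (truncnS_gt x))); by rewrite xm ler_nat.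
have l1 := leqW (leq_trans (leq_trans (leq_addr _ _) (leq_addr _ _)) Nk).
have l2 := leqW (leq_trans (leq_trans (leq_addl _ _) (leq_addr _ _)) Nk).
have l3 := leqW (leq_trans (leq_addl _ _) Nk).
have hk : h <= k.+1%:R := leN _ _ l1 erefl.
have Mk : `|M| <= k.+1%:R := leN _ _ l2 erefl.
have ek : e^-1 < k.+1%:R by apply: lt_le_trans (truncnS_gt _) _; rewrite ler_nat.
have fk := gs_norm_mono h0 hk (le_trans (ler_norm M) Mk) (ler0n _ _) (HM f Bf).
rewrite /= wE -(lin_sub lu); apply: le_lt_trans (Hr k f fk) _.
by rewrite invf_plt ?posrE.
Qed.

Variable T : {linear gs n s -> gs n s}.
Hypothesis cT : continuous T.

Lemma transpose_proof (u : gs_dual n s) : (fun f => u (T f)) \in @gs_dual_pred R n s.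
Proof.
have [lu cu] := asboolW (gs_dual_funP u); apply/asboolP; split=> [k f g|f].
  by rewrite linearP lu.
by apply: (@continuous_comp (gs n s) (gs n s) R[i]^o T u f); [exact: cT|exact: cu].
Qed.

Definition transpose (u : gs_dual n s) : gs_dual n s := GSDual (transpose_proof u).

Lemma transpose_lin : linear transpose.
Proof. by move=> k u v; apply/val_inj. Qed.

HB.instance Definition _ :=
  GRing.isLinear.Build R[i] (gs_dual n s) (gs_dual n s) _ transpose transpose_lin.

(** Continuous linear maps preserve bounded sets, so the seminorm of B at the transpose of u is the
    seminorm of T(B) at u. *)
Lemma transpose_continuous : continuous transpose.
Proof.
move=> u; have F1 : Filter (nbhs u) := nbhs_filter u.
apply/(@gs_dual_cvgP R n s (transpose @ u) (transpose u) (fmap_filter transpose F1)) => B bB e e0.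
have H := (@gs_dual_cvgP R n s (nbhs u) u F1).1 cvg_id _ (bounded_image cT bB) e e0.
by apply: (@filterS _ _ F1 _ _ _ H) => v Hv f Bf; apply: Hv; exists f.
Qed.

(** One-point sets are bounded, so strong convergence implies convergence of values; this combines
    with the density of S_{1/2} in S_s' for the argument and in S_s for the test function. *)
Lemma dual_map_unique (S S' : gs_dual n s -> gs_dual n s) : continuous S -> continuous S' ->
  (forall f q : gs n half, S' (of_fun_dual hs f) (gs_incl hs q) = S (of_fun_dual hs f) (gs_incl hs q)) ->
  S' =1 S.
Proof.
move=> cS cS' SS u.
suff Hq q : S' u (gs_incl hs q) = S u (gs_incl hs q) by exact: (dual_eq Hq).
apply/eqP; rewrite -subr_eq0; apply/eqP.
apply: ComplexField.Normc.eq0_normc; apply/eqP; rewrite eq_le cabs_ge0 andbT.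
apply/ler_addgt0Pr => r r0; rewrite add0r.
have r20 : 0 < r / 2 by rewrite divr_gt0.
have [w wu] := of_fun_dual_dense u.
have H (P : gs_dual n s -> gs_dual n s) : continuous P -> \forall k \near \oo,
    cabs (P u (gs_incl hs q) - P (of_fun_dual hs (w k)) (gs_incl hs q)) < r / 2.
  move=> cP; have cw : (fun k => P (of_fun_dual hs (w k))) @ \oo --> P u.
    exact: (cvg_comp _ _ wu (cP u)).
  have F1 : Filter (\oo : set_system nat) by exact: _.
  have G := (@gs_dual_cvgP R n s _ (P u) (fmap_filter (fun k => P (of_fun_dual hs (w k))) F1)).1
    cw _ (bounded1 (gs_incl hs q)) _ r20.
  by apply: (@filterS _ _ F1 _ _ _ G) => k; apply.
have [k [h1 h2]] := @filter_ex _ _ _ _ (filterI (H S cS) (H S' cS')).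
move: h2; rewrite SS => h2.
set x := S' u _ in h2 *; set y := S u _ in h1 *; set z := S _ _ in h1 h2.
have -> : x - y = (x - z) - (y - z) by rewrite opprB addrA subrK.
by apply: (le_trans (cabsD _ _)); rewrite cabsN (splitr r) ltW // ltrD.
Qed.

End Dual.

Section Operator.
Variables (d : nat) (A : 'M[R]_d) (a : 'rV[R]_(d + d) -> C).
Hypothesis ca : cls s finset.set0 (fun _ : unit => a).

Definition psido_gs (f : gs d s) : gs d s := gs_of_cls hs (cls_psido hs A ca (cls_gs hs f)).

Lemma psido_gs_lin : linear psido_gs.
Proof.
move=> k f g; apply/val_inj.
exact: (psido_lin hs A ca k (cls_gs hs f) (cls_gs hs g)).
Qed.

HB.instance Definition _ :=
  GRing.isLinear.Build R[i] (gs d s) (gs d s) _ psido_gs psido_gs_lin.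

Lemma psido_gs_continuous : continuous psido_gs.
Proof.
apply: (@bounded_continuous R d d s psido_gs) => h h0.
have [h' h'0 [M HM]] := gs_of_cls_full hs (cls_psido hs A ca (cls_gs_ball hs d 1 h0)).
by exists h' => //; exists M => f f1; exact: (HM (exist _ f f1)).
Qed.

Lemma cls_gs_half (f : gs d half) : cls s (full d) (fun _ : unit => f : 'rV[R]_d -> C).
Proof. exact: (cls_gs hs (gs_incl hs f)). Qed.

Lemma psido_gs_extends : extends_gs hs (Op A (of_fun a)) psido_gs.
Proof.
move=> f g; rewrite (Op_pairing hs A ca (cls_gs_half f) (cls_gs_half g)).
exact: (psido_pairing hs A ca (cls_gs_half f) (cls_gs_half g)).
Qed.

End Operator.

End Main.

Theorem theorem4p11 (R : realType) (d : nat) (A : 'M[R]_d) (s : R)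
    (hs : 2^-1 <= s) (a : 'rV[R]_(d + d) -> R[i]) (ha : Gamma_infty s a) :
  continuous_on_gs hs (Op A (of_fun a)) /\
  continuous_on_gs_dual hs (Op A (of_fun a)).
Proof.
have ca := cls_of_Gamma hs ha; have cat := cls_flip hs ca.
split.
  exists (psido_gs hs A ca); split.
  - exact: psido_gs_continuous.
  - exact: psido_gs_extends.
  - move=> T' cT' eT'.
    (* On S_{1/2} the values of T' are given only through pairings with S_{1/2}, which determine
       them by [of_fun_separates]. *)
    apply: (@eq_on_dense R d s hs (psido_gs hs A ca) T' _ cT') => [|f].
      exact: psido_gs_continuous.
    have H (g : gs d 2^-1) : of_fun (T' (gs_incl hs f)) g = of_fun (psido_gs hs A ca (gs_incl hs f)) g.
      by rewrite eT' psido_gs_extends.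
    exact: (of_fun_separates hs H).
(* The map on S_s' is the transpose of the operator with matrix 1 - A and flipped symbol;
   [pairing_flip] identifies its values on S_{1/2}. *)
pose T := psido_gs hs (1%:M - A) cat : {linear gs d s -> gs d s}.
have cT : continuous T by exact: psido_gs_continuous.
have eT (f g : gs d 2^-1) : of_fun f (T (gs_incl hs g)) = Op A (of_fun a) f g.
  rewrite of_fun_sym.
  rewrite (psido_pairing hs (1%:M - A) cat (cls_gs_half hs g) (cls_gs_half hs f)).
  rewrite (pairing_flip hs A ca (cls_gs_half hs f) (cls_gs_half hs g)).
  by rewrite (Op_pairing hs A ca (cls_gs_half hs f) (cls_gs_half hs g)).
exists (transpose cT); split.
- exact: transpose_continuous.
- by move=> f u uf g; rewrite /= uf eT.
- move=> T' cT' eT'.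
  have H (f q : gs d 2^-1) : T' (of_fun_dual hs f) (gs_incl hs q) =
      transpose cT (of_fun_dual hs f) (gs_incl hs q).
    rewrite (eT' f); last by [].
    by rewrite -(eT f q).
  have Q := @dual_map_unique R s hs d (transpose cT) T' (@transpose_continuous R s d T cT) cT' H.
  exact: Q.
Qed.
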